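(* Let the sequence $\alpha:\mathbb N\to\mathbb H$ and the regular function $b(q)=\sum_{n=0}^\infty q^n\check b(n)$ on $\mathbb B$ be related via $\alpha(n)=\overline{\check b(n)}$ for $n\ge 0$. Set $\Lambda_b(h):=\langle h,b\rangle_{H^2(\mathbb B)}$ when $h$ is regular in $\mathbb B$. The following conditions are equivalent. (a) $\|\Gamma_\alpha\|_{\mathcal B(\ell^2(\mathbb N,\mathbb H))}<\infty$, where $(\Gamma_\alpha v)(j)=\sum_{k=0}^\infty\alpha(j+k)v(k)$. (b) $\displaystyle \sup_{f,g\neq 0}\frac{|\langle f\star g,b\rangle_{H^2(\mathbb B)}|}{\|f\|_{H^2(\mathbb B)}\cdot\|g\|_{H^2(\mathbb B)}}<\infty$. (c) $\|b\|_{BMO(\mathbb B)}:=\sup_{I\in\mathbb S}\|b\|_{BMO(\mathbb B_I)}<\infty$, where $\|b\|_{BMO(\mathbb B_I)}$ is the $BMO$-norm of the restriction of $b$ to the slice $\mathbb B_I$. (d) The measure $d\mu_b(q)=|\partial_c b(q)|^2(1-|q|^2)\,dVol_{\mathbb B}(q)$ on $\mathbb B$ is a Carleson measure for $H^2(\mathbb B)$: the inequality $\int_{\mathbb B}|f|^2\,d\mu_b\le C(\mu_b)\|f\|^2_{H^2(\mathbb B)}$ holds whenever $f$ is in $H^2(\mathbb B)$. (e) $\Lambda_b$ belongs to $[H^2(\mathbb B)\circledast H^2(\mathbb B)]^*$, the space dual to the weak $\star$-product of two copies of $H^2(\mathbb B)$, with respect to the inner product in $H^2(\mathbb B)$. Moreover,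 $$\|\Gamma_\alpha\|_{\mathcal B(\ell^2(\mathbb N,\mathbb H))}=\sup_{f,g\ne 0}\frac{|\langle f\star g,b\rangle_{H^2(\mathbb B)}|}{\|f\|_{H^2(\mathbb B)}\cdot\|g\|_{H^2(\mathbb B)}}\approx\|\Lambda_b\|_{(H^2(\mathbb B)\circledast H^2(\mathbb B))^*}\approx \|b\|_{BMO(\mathbb B)}\approx C(\mu_b)^{1/2}.$$
   Context: $\mathbb H$ is the skew-field of quaternions, $\mathbb B=\{q\in\mathbb H:|q|<1\}$, $\mathbb S=\{q\in\mathbb H:q^2=-1\}$; for $I\in\mathbb S$, $L_I=\mathbb R+\mathbb R I$ and $\mathbb B_I=\mathbb B\cap L_I$. Vector spaces over $\mathbb H$ have scalars on the right. For positive reals, $r\approx s$ means $\frac1C r\le s\le Cr$ for a positive constant $C$. $\mathcal B(\mathcal H)$ is the algebra of bounded operators on the quaternionic Hilbert space $\mathcal H$, with the sup-norm. Regular functions on $\mathbb B$ are the functions $f(q)=\sum_{n\ge0}q^na_n$, $a_n\in\mathbb H$, with power series converging in $\mathbb B$. The $\star$-product of $f=\sum q^na_n$ and $g=\sum q^nb_n$ is $f\star g(q)=\sum_{n\ge0}q^n\sum_{k=0}^n a_kb_{n-k}$. The slice (Cullen) derivative is $\partial_c f(q)=\sum_{n\ge1}q^{n-1}n\,a_n$. $H^2(\mathbb B)$ is the space of regular $f=\sum q^na_n$ with $\|f\|_{H^2(\mathbb B)}^2=\sum|a_n|^2<\infty$, with $\mathbb H$-valued inner product $\langle\sum q^na_n,\sum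 q^nb_n\rangle_{H^2(\mathbb B)}=\sum\overline{b_n}a_n$. In (b) the supremum is over nonzero $f,g\in H^2(\mathbb B)$. Weak $\star$-product: $H^2(\mathbb B)\circledast H^2(\mathbb B)$ is the space of regular $\varphi$ on $\mathbb B$ for which $\|\varphi\|_{H^2(\mathbb B)\circledast H^2(\mathbb B)}=\inf\{\sum_{j=1}^\infty\|f_j\|_{H^2(\mathbb B)}\|g_j\|_{H^2(\mathbb B)}:\varphi=\sum_{j=1}^\infty f_j\star g_j,\ f_j,g_j\in H^2(\mathbb B)\}$ is finite. The $BMO$ quantities are defined for functions in $H^1(\mathbb B)$, the space of regular $f$ on $\mathbb B$ with $\sup_{I\in\mathbb S}\sup_{0<r<1}\frac1{2\pi}\int_{-\pi}^{\pi}|f(re^{I\theta})|d\theta<\infty$, using their radial limits $f(e^{I\theta})$. For an interval $a\subset\mathbb R$ with length $|a|\le2\pi$, put $f_{I,a}=\frac1{|a|}\int_af(e^{\theta I})d\theta$. Then $\|f\|_{BMO(\mathbb B_I)}=\sup_{a}\frac1{|a|}\int_a|f(e^{\theta I})-f_{I,a}|d\theta$ (supremum over all such intervals); this and $\|f\|_{BMO(\mathbb B)}$ are only semi-norms, vanishing on constants. $dVol_{\mathbb B}$ is given by $dVol_{\mathbb B}(x+yI)=\frac14dA_{\mathbb S}(I)\,dx\,dy$, with $dA_{\mathbb S}$ the usual area element on the 2-sphere $\mathbb S$. $C(\mu_b)$ denotes the (best) constant in the Carleson inequality of (d).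
   Formalization: In the final chain, the norm of Λ_b is compared with |b(0)| + ‖b‖_BMO instead of ‖b‖_BMO alone, because for constant b the BMO seminorm and C(μ_b) vanish while ‖Γ_α‖ = |b(0)|; the original chain follows when b(0) = 0. *)

(* Defs.v *)
From HB Require Import structures.
From mathcomp Require Import all_boot all_order all_algebra ring lra.
From mathcomp Require Import all_classical all_reals all_analysis.

Set Implicit Arguments.
Unset Strict Implicit.
Unset Printing Implicit Defensive.

Import Order.TTheory GRing.Theory Num.Theory.
Import numFieldTopology.Exports numFieldNormedType.Exports.

Local Open Scope classical_set_scope.
Local Open Scope ring_scope.

(** * Quaternions *)

Record quat (R : realType) : Type :=
  Quat { qre : R; qi : R; qj : R; qk : R }.

Section Quaternions.
Variable R : realType.
Implicit Types p q : quat R.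

Definition quat_to_prod q : R * R * R * R := (qre q, qi q, qj q, qk q).
Definition prod_to_quat (u : R * R * R * R) : quat R :=
  let: (a, b, c, d) := u in Quat a b c d.
Lemma quat_to_prodK : cancel quat_to_prod prod_to_quat.
Proof. by case. Qed.

HB.instance Definition _ := Choice.copy (quat R) (can_type quat_to_prodK).

Definition qzero : quat R := Quat 0 0 0 0.
Definition qopp q : quat R := Quat (- qre q) (- qi q) (- qj q) (- qk q).
Definition qadd p q : quat R :=
  Quat (qre p + qre q) (qi p + qi q) (qj p + qj q) (qk p + qk q).
Definition qscale (a : R) q : quat R :=
  Quat (a * qre q) (a * qi q) (a * qj q) (a * qk q).
Definition qone : quat R := Quat 1 0 0 0.
Definition qmul p q : quat R :=
  Quat (qre p * qre q - qi p * qi q - qj p * qj q - qk p * qk q)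
       (qre p * qi q + qi p * qre q + qj p * qk q - qk p * qj q)
       (qre p * qj q - qi p * qk q + qj p * qre q + qk p * qi q)
       (qre p * qk q + qi p * qj q - qj p * qi q + qk p * qre q).
Definition qconj q : quat R := Quat (qre q) (- qi q) (- qj q) (- qk q).
Definition qabs q : R :=
  Num.sqrt (qre q ^+ 2 + qi q ^+ 2 + qj q ^+ 2 + qk q ^+ 2).

Lemma qaddA : associative qadd.
Proof. by move=> [????] [????] [????]; rewrite /qadd /= !addrA. Qed.
Lemma qaddC : commutative qadd.
Proof. by move=> [a b c d] [x y z t]; rewrite /qadd /=; congr Quat; ring. Qed.
Lemma qadd0 : left_id qzero qadd.
Proof. by move=> [????]; rewrite /qadd /= !add0r. Qed.
Lemma qaddN : left_inverse qzero qopp qadd.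
Proof. by move=> [????]; rewrite /qadd /= !addNr. Qed.
HB.instance Definition _ :=
  GRing.isZmodule.Build (quat R) qaddA qaddC qadd0 qaddN.

Lemma qscaleA (a b : R) q : qscale a (qscale b q) = qscale (a * b) q.
Proof. by case: q => *; rewrite /qscale /= !mulrA. Qed.
Lemma qscale1 : left_id 1 qscale.
Proof. by move=> [????]; rewrite /qscale /= !mul1r. Qed.
Lemma qscaleDr : right_distributive qscale qadd.
Proof. by move=> a [????] [????]; rewrite /qscale /qadd /=; congr Quat; ring. Qed.
Lemma qscaleDl q (a b : R) : qscale (a + b) q = qadd (qscale a q) (qscale b q).
Proof. by case: q => ????; rewrite /qscale /qadd /=; congr Quat; ring. Qed.
HB.instance Definition _ :=
  GRing.Zmodule_isLmodule.Build R (quat R) qscaleA qscale1 qscaleDr qscaleDl.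

Lemma qabsD p q : qabs (qadd p q) <= qabs p + qabs q.
Proof.
case: p q => [a b c d] [x y z t]; rewrite /qabs /qadd /=.
set A := a ^+ 2 + _ + _ + _; set X := x ^+ 2 + _ + _ + _.
have A0 : 0 <= A by rewrite !addr_ge0 // sqr_ge0.
have X0 : 0 <= X by rewrite !addr_ge0 // sqr_ge0.
rewrite -[leRHS]ger0_norm ?addr_ge0 ?sqrtr_ge0 // -sqrtr_sqr ler_wsqrtr //.
rewrite [leRHS]sqrrD !sqr_sqrtr // -sqrtrM //.
have le_sqrt : a * x + b * y + c * z + d * t <= Num.sqrt (A * X).
  rewrite (le_trans (ler_norm _)) // -sqrtr_sqr ler_wsqrtr // -subr_ge0.
  rewrite [leRHS](_ : _ = (a * y - b * x) ^+ 2 + (a * z - c * x) ^+ 2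
    + (a * t - d * x) ^+ 2 + (b * z - c * y) ^+ 2 + (b * t - d * y) ^+ 2
    + (c * t - d * z) ^+ 2); first by rewrite !addr_ge0 // sqr_ge0.
  by rewrite /A /X; ring.
rewrite [leLHS](_ : _ = A + (a * x + b * y + c * z + d * t) *+ 2 + X).
  by rewrite lerD2r lerD2l lerMn2r.
by rewrite /A /X; ring.
Qed.

Lemma qabsZ (a : R) q : qabs (qscale a q) = `|a| * qabs q.
Proof.
rewrite /qabs /= !exprMn -!mulrDr sqrtrM ?sqr_ge0 //.
by rewrite sqrtr_sqr.
Qed.

Lemma qabs0_eq0 q : qabs q = 0 -> q = 0.
Proof.
case: q => [a b c d] /eqP; rewrite /qabs /= sqrtr_eq0 => le0.
have := sqr_ge0 a; have := sqr_ge0 b; have := sqr_ge0 c; have := sqr_ge0 d.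
move=> d0 c0 b0 a0; congr Quat; apply/eqP; rewrite -sqrf_eq0; apply/eqP; lra.
Qed.

HB.instance Definition _ :=
  @Lmodule_isNormed.Build R (quat R) qabs qabsD qabsZ qabs0_eq0.

Lemma qmulA : associative qmul.
Proof.
by move=> [????] [????] [????]; rewrite /qmul /qadd /=; congr Quat; ring.
Qed.
Lemma qmul1r : left_id qone qmul.
Proof. by move=> [????]; rewrite /qmul /qadd /=; congr Quat; ring. Qed.
Lemma qmulr1 : right_id qone qmul.
Proof. by move=> [????]; rewrite /qmul /qadd /=; congr Quat; ring. Qed.
Lemma qmulDl : left_distributive qmul qadd.
Proof.
by move=> [????] [????] [????]; rewrite /qmul /qadd /=; congr Quat; ring.
Qed.
Lemma qmulDr : right_distributive qmul qadd.
Proof.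
by move=> [????] [????] [????]; rewrite /qmul /qadd /=; congr Quat; ring.
Qed.
Lemma qone_neq0 : qone != 0.
Proof. by apply/eqP => -[] /eqP; rewrite oner_eq0. Qed.
HB.instance Definition _ := GRing.Zmodule_isNzRing.Build (quat R)
  qmulA qmul1r qmulr1 qmulDl qmulDr qone_neq0.

Lemma qscaleAl (a : R) p q : qscale a (qmul p q) = qmul (qscale a p) q.
Proof. by case: p q => [????] [????]; rewrite /qscale /qmul /=; congr Quat; ring. Qed.
HB.instance Definition _ :=
  GRing.Lmodule_isLalgebra.Build R (quat R) qscaleAl.
Lemma qscaleAr (a : R) p q : qscale a (qmul p q) = qmul p (qscale a q).
Proof. by case: p q => [????] [????]; rewrite /qscale /qmul /=; congr Quat; ring. Qed.
HB.instance Definition _ :=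
  GRing.Lalgebra_isAlgebra.Build R (quat R) qscaleAr.

Lemma qnormE q : `|q| = qabs q. Proof. by []. Qed.

Definition qball : set (quat R) := [set q | `|q| < 1].
Definition qsphere : set (quat R) := [set I | I ^+ 2 = - 1].

Definition slice_pt (I : quat R) (x y : R) : quat R := x%:A + y *: I.
Definition qexp (I : quat R) (t : R) : quat R := slice_pt I (cos t) (sin t).

(* The integral of a quaternion-valued function is taken componentwise. *)
Definition qintegral (D : set R) (f : R -> quat R) : quat R :=
  let mu := @lebesgue_measure R in
  Quat (\int[mu]_(x in D) qre (f x)) (\int[mu]_(x in D) qi (f x))
       (\int[mu]_(x in D) qj (f x)) (\int[mu]_(x in D) qk (f x)).

End Quaternions.

(** * Regular functions on the unit ball *)

Section Regular.
Variable R : realType.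
Local Notation H := (quat R).

(* A regular function is represented by its sequence of coefficients, which it
   determines uniquely. *)
Definition regular (a : nat -> H) : Prop :=
  forall q, qball q -> cvgn (series (fun n => q ^+ n * a n)).
Definition reg_eval (a : nat -> H) (q : H) : H :=
  limn (series (fun n => q ^+ n * a n)).
Definition star (a c : nat -> H) : nat -> H :=
  fun n => \sum_(k < n.+1) a k * c (n - k)%N.
Definition cderiv (a : nat -> H) : nat -> H := fun n => a n.+1 *+ n.+1.

Definition l2norm (v : nat -> H) : \bar R :=
  sqrte (\sum_(0 <= n <oo) (`|v n| ^+ 2)%:E)%E.
Definition l2 : set (nat -> H) := [set v | (l2norm v < +oo)%E].
Definition H2 : set (nat -> H) := [set a | regular a /\ (l2norm a < +oo)%E].

End Regular.

(** * The Hankel operator *)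

Section Hankel.
Variable R : realType.
Local Notation H := (quat R).
Variable alpha : nat -> H.

Definition hankel_series (v : nat -> H) (j : nat) : nat -> H :=
  series (fun k => alpha (j + k)%N * v k).
Definition hankel (v : nat -> H) : nat -> H :=
  fun j => limn (hankel_series v j).

(* If one of the series defining the image of v diverges, the operator is not
   defined on the whole of l2 and its norm is infinite by convention. *)
Definition hankel_image_norm (v : nat -> H) : \bar R :=
  if `[< forall j, cvgn (hankel_series v j) >] then l2norm (hankel v)
  else +oo%E.
Definition hankel_norm : \bar R :=
  ereal_sup [set (hankel_image_norm v / l2norm v)%E
            | v in [set v | l2 v /\ v != (fun=> 0)]].

End Hankel.

(** * The pairing with b and the bilinear form *)

Section Pairing.
Variable R : realType.
Local Notation H := (quat R).
Implicit Types b h : nat -> H.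

Definition H2inner h b : H := limn (series (fun n => qconj (b n) * h n)).

(* <h, b> for regular h and b is the limit, as r tends to 1 from below, of
   <h_r, b> where h_r(q) = h(r q).  If the series defining H2inner h b
   converges, in particular if h and b are in H2, then by Abel's theorem this
   limit is H2inner h b.  The limit is needed because a product of two elements
   of H2 need not be in H2: for some f, g in H2 and some b with a bounded Hankel
   operator the partial sums of H2inner (star f g) b diverge. *)
Definition dilate (r : R) h : nat -> H := fun n => r ^+ n *: h n.
Definition Lambda_defined b h : Prop :=
  cvg (H2inner (dilate r h) b @[r --> 1^'-]).
Definition Lambda b h : H := lim (H2inner (dilate r h) b @[r --> 1^'-]).
Definition Lambda_abs b h : \bar R :=
  if `[< Lambda_defined b h >] then `|Lambda b h|%:E else +oo%E.

Definition form_norm b : \bar R :=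
  ereal_sup [set x | exists f g : nat -> H,
    [/\ H2 f, H2 g, f != (fun=> 0), g != (fun=> 0)
      & x = (Lambda_abs b (star f g) / (l2norm f * l2norm g))%E]].

End Pairing.

(** * The weak product *)

Section WeakProduct.
Variable R : realType.
Local Notation H := (quat R).
Implicit Types b phi : nat -> H.

Definition weak_norm phi : \bar R :=
  ereal_inf [set x | exists f g : nat -> nat -> H,
    [/\ forall j, H2 (f j), forall j, H2 (g j),
        forall q, qball q ->
          series (fun j => reg_eval (star (f j) (g j)) q) n
            @[n --> \oo] --> reg_eval phi q
      & x = (\sum_(0 <= j <oo) (l2norm (f j) * l2norm (g j)))%E]].
Definition weak_product : set (nat -> H) :=
  [set phi | regular phi /\ (weak_norm phi < +oo)%E].

Definition weak_dual_norm b : \bar R :=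
  ereal_sup [set (Lambda_abs b phi / weak_norm phi)%E
            | phi in [set phi | weak_product phi /\ phi != (fun=> 0)]].
Definition Lambda_in_weak_dual b : Prop :=
  [/\ forall phi, weak_product phi -> Lambda_defined b phi,
      forall phi psi, weak_product phi -> weak_product psi ->
        Lambda b (fun n => phi n + psi n) = Lambda b phi + Lambda b psi,
      forall phi (c : H), weak_product phi ->
        Lambda b (fun n => phi n * c) = Lambda b phi * c
    & (weak_dual_norm b < +oo)%E].

End WeakProduct.

(** * BMO *)

Section BMO.
Variable R : realType.
Local Notation H := (quat R).
Local Notation mu := (@lebesgue_measure R).
Implicit Types (a : nat -> H) (I : H).

Definition H1 : set (nat -> H) := [set a | regular a /\
  (ereal_sup [set x | exists (I : H) (r : R), [/\ qsphere I, (0 < r < 1)%R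
    & x = ((2 * pi)^-1)%R%:E * \int[mu]_(t in `[(- pi)%R, pi])
            `|reg_eval a (r *: qexp I t)|%:E]] < +oo)%E].

Definition radial_lim a I (t : R) : H :=
  lim (reg_eval a (r *: qexp I t) @[r --> 1^'-]).
Definition mean a I (s t : R) : H :=
  (t - s)^-1 *: qintegral `[s, t] (radial_lim a I).
Definition BMO_slice a I : \bar R :=
  ereal_sup [set x | exists s t : R, [/\ s < t, t <= s + 2 * pi
    & x = (((t - s)^-1)%:E * \int[mu]_(u in `[s, t])
            `|radial_lim a I u - mean a I s t|%:E)%E]].
(* Radial limits are only considered for functions in H1. *)
Definition BMO_seminorm a : \bar R :=
  if `[< H1 a >] then ereal_sup [set BMO_slice a I | I in @qsphere R]
  else +oo%E.

End BMO.

(** * Carleson measures *)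

Section Carleson.
Variable R : realType.
Local Notation H := (quat R).
Local Notation mu := (@lebesgue_measure R).

(* Integration over the sphere of imaginary units, in spherical coordinates. *)
Definition sphere_pt (t s : R) : H :=
  Quat 0 (sin t * cos s) (sin t * sin s) (cos t).
Definition sphere_integral (F : H -> \bar R) : \bar R :=
  (\int[mu]_(t in `[0%R, pi]) \int[mu]_(s in `[0%R, (2 * pi)%R])
     ((sin t)%:E * F (sphere_pt t s)))%E.

(* Integration over the ball for dVol (x + y I) = 1/4 dA(I) dx dy.  A non-real
   quaternion is x + y I with y > 0 for exactly one (x, y, I). *)
Definition ball_integral (F : H -> \bar R) : \bar R :=
  ((4^-1)%:E * sphere_integral (fun I =>
     \int[mu]_x \int[mu]_(y in [set y : R | 0 < y /\ x ^+ 2 + y ^+ 2 < 1]%R)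
       F (slice_pt I x y)))%E.

Definition mu_density (b : nat -> H) (q : H) : R :=
  `|reg_eval (cderiv b) q| ^+ 2 * (1 - `|q| ^+ 2).

Definition carleson_bound (w : H -> R) (C : R) : Prop :=
  0 <= C /\ forall f, H2 f ->
    (ball_integral (fun q => (`|reg_eval f q| ^+ 2 * w q)%:E)
       <= C%:E * l2norm f ^+ 2)%E.
Definition carleson (w : H -> R) : Prop := exists C, carleson_bound w C.
Definition carleson_const (w : H -> R) : \bar R :=
  ereal_inf [set C%:E | C in carleson_bound w].

End Carleson.

Definition approx_const (R : realType) (C : R) (x y : \bar R) : Prop :=
  ((C^-1)%:E * x <= y /\ y <= C%:E * x)%E.

(* Main.v *)
From HB Require Import structures.
Require Import Defs.
From mathcomp Require Import all_boot all_order all_algebra ring lra.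
From mathcomp Require Import all_classical all_reals all_analysis measurable_realfun.

Set Implicit Arguments.
Unset Strict Implicit.
Unset Printing Implicit Defensive.

Import Order.TTheory GRing.Theory Num.Theory.
Import numFieldTopology.Exports numFieldNormedType.Exports.

Local Open Scope classical_set_scope.
Local Open Scope ring_scope.

(** Everything is reduced to the four real coordinates of the coefficients of b.
    The Hankel form is bounded iff the four real Hankel forms of the coordinates
    are, and on the slice through I the function b is P + I Q, where P and Q
    collect the analytic functions u + i v attached to the coordinates; so (c) and
    (d) become statements on u and v, with constants independent of I.

    BMO => Carleson => Hankel => BMO is proved without the duality of H1 and BMO.
    For a polynomial with coefficients a, the Garsia seminorm
    sup_z int |a - a(z)|^2 P_z equals the supremum over the disc of
    S(z) = (1 - |z|^2) sum_j |sum_k a_(j+k+1) z^k|^2.  A mean oscillation bound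
    controls S by the John-Nirenberg inequality and a dyadic splitting of the
    Poisson kernel; a bound on the Hankel form controls S by testing on
    (z^k)_k, and S controls the mean oscillation on each arc.  Since
    Lap S = -4 |a'|^2, S is also a bounded potential of the Carleson measure:
    Green's formula applied to (1 + (1 - S/2G)^2) |f|^2 bounds
    int |f|^2 |a'|^2 (1 - |z|^2) by the supremum G of S.  Conversely the Carleson
    inequality and Cauchy-Schwarz bound int (f g)' conj(b') (1 - |z|^2), which is
    the Hankel form up to explicit coefficients.  Boundary values of b, for b in
    H1, come from a factorization b = g h with g and h square summable, obtained
    from approximate factorizations of polynomials, and from Fatou's theorem at
    Lebesgue points.  *)

(** The norms in (a), (b) and (e) are compared through one real inequality on finite sections,
    [QB b M]: each of them is at most a real [M >= 0] exactly when it holds, so they are equal and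
    not merely comparable. The BMO and Carleson quantities do not see the constant term, hence the
    passage through shifted coefficient sequences, with |b 0| added at the end.

    On the disc all estimates are made for polynomials in x and y, whose derivatives are algebraic.
    The only integration by parts is that the derivative of a multiple of rho^2 - |z|^2 integrates
    to zero, so boundary integrals never occur. The price is truncation and dilation, undone by a
    limit at the end of each estimate.

    Uniformity in I has two sources: upper bounds treat P and Q separately, using |I| = 1; lower
    bounds either average over the sphere, where the terms linear in I cancel, or combine the slices
    of I and -I, which together determine P and Q.

    The function 1 - S/2G is useful because it lies between 1/2 and 1 while its Laplacian is a
    positive multiple of |a'|^2. The constant of the theorem, 2^35, only collects numerical bounds
    rounded up to powers of two. *)

Lemma quad_CS (R : realFieldType) (A B C : R) : 0 <= C ->
  (forall l, 0 <= A - 2 * l * B + l ^+ 2 * C) -> B ^+ 2 <= A * C.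
Proof.
rewrite le_eqVlt => /predU1P[<- H|C0 H].
  have [->|B0] := eqVneq B 0; first by rewrite expr0n mulr0.
  (* For [C = 0] the hypothesis is affine in [l], and this value of [l] makes it equal to -1. *)
  have := H ((A + 1) / (2 * B)); rewrite mulr0 addr0.
  suff -> : A - 2 * ((A + 1) / (2 * B)) * B = - 1 by lra.
  by field.
(* The quadratic in [l] attains its minimum here. *)
have := H (B / C); have -> : A - 2 * (B / C) * B + (B / C) ^+ 2 * C = (A * C - B ^+ 2) / C.
  by field; rewrite gt_eqF.
by rewrite pmulr_lge0 ?invr_gt0// subr_ge0.
Qed.

Lemma cvg_sumr (K : numFieldType) (V : normedModType K) (T : Type) (F : set_system T)
  (FF : Filter F) (I : Type) (r : seq I) (P : pred I) (f : I -> T -> V) (l : I -> V) :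
  (forall i, P i -> f i x @[x --> F] --> l i) ->
  \sum_(i <- r | P i) f i x @[x --> F] --> \sum_(i <- r | P i) l i.
Proof.
move=> fl; elim: r => [|i r IH].
  rewrite big_nil; under eq_fun do rewrite big_nil; exact: cvg_cst.
rewrite big_cons; under eq_fun do rewrite big_cons.
by case: ifPn => // Pi; apply: cvgD => //; exact: fl.
Qed.

(** * Integrals of continuous functions over segments *)

Section SegmentIntegral.
Variable R : realType.
Local Notation mu := (@lebesgue_measure R).
Implicit Types (f g F : R -> R) (a c s t : R).

Definition rint s t f : R := \int[mu]_(x in `[s, t]) f x.

Lemma continuous_integrable f s t : continuous f ->
  mu.-integrable `[s, t] (EFin \o f).
Proof.
move=> cf; apply: continuous_compact_integrable; first exact: segment_compact.
exact: continuous_subspaceT.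
Qed.

Lemma rint_EFin f s t : continuous f ->
  (\int[mu]_(x in `[s, t]) (f x)%:E)%E = (rint s t f)%:E.
Proof.
move=> cf; rewrite /rint /Rintegral fineK //; apply: integrable_fin_num => //.
exact: continuous_integrable.
Qed.

Lemma rint_ext f g s t : (forall x, f x = g x) -> rint s t f = rint s t g.
Proof. by move=> fg; congr (rint _ _ _); apply/funext. Qed.

Lemma rintD f g s t : continuous f -> continuous g ->
  rint s t (fun x => f x + g x) = rint s t f + rint s t g.
Proof. by move=> cf cg; apply: RintegralD => //; exact: continuous_integrable. Qed.

Lemma rintB f g s t : continuous f -> continuous g ->
  rint s t (fun x => f x - g x) = rint s t f - rint s t g.
Proof. by move=> cf cg; apply: RintegralB => //; exact: continuous_integrable. Qed.

Lemma rintZ c f s t : continuous f ->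
  rint s t (fun x => c * f x) = c * rint s t f.
Proof. by move=> cf; apply: RintegralZl => //; exact: continuous_integrable. Qed.

Lemma rint_ge0 f s t : (forall x, s <= x <= t -> 0 <= f x) -> 0 <= rint s t f.
Proof.
by move=> f0; apply: Rintegral_ge0 => x /=; rewrite in_itv /=; exact: f0.
Qed.

Lemma le_rint f g s t : continuous f -> continuous g ->
  (forall x, s <= x <= t -> f x <= g x) -> rint s t f <= rint s t g.
Proof.
move=> cf cg fg; apply: le_Rintegral => //; exact: continuous_integrable.
Qed.

Lemma rint_cst c s t : s <= t -> rint s t (fun=> c) = c * (t - s).
Proof.
move=> st; rewrite /rint Rintegral_cst //= lebesgue_measure_itv /= lte_fin.
by case: ltP => // ts; rewrite (le_anti (introT andP (conj st ts))) subrr.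
Qed.

Lemma rint_norm f s t : continuous f -> 
  `|rint s t f| <= rint s t (fun x => `|f x|).
Proof. by move=> cf; apply: le_normr_Rintegral => //; exact: continuous_integrable. Qed.

Lemma rint_chasles f c s t : continuous f -> s <= c <= t ->
  rint s t f = rint s c f + rint c t f.
Proof.
move=> cf /andP[sc ct]; apply/eqP; rewrite addrC -subr_eq; apply/eqP.
rewrite /rint (@Rintegral_itvB R f (BLeft s) (BRight t) c) ?bnd_simp //.
  rewrite Rintegral_itv_obnd_cbnd //; apply: (@integrableS _ _ _ mu `[c, t]) => //.
    exact: subset_itv_oc_cc.
  exact: continuous_integrable.
exact: continuous_integrable.
Qed.

Lemma rint_FTC f F s t : s <= t -> continuous f ->
  (forall x : R, s <= x <= t -> is_derive x (1:R) F (f x)) -> rint s t f = F t - F s.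
Proof.
move=> st cf dF; have [->|neq] := eqVneq s t.
  by rewrite subrr /rint set_itv1 Rintegral_set1.
have {neq}st : s < t by rewrite lt_neqAle neq.
have dF' x : x \in `]s, t[ -> is_derive x (1:R) F (f x).
  by rewrite in_itv /= => /andP[sx xt]; apply: dF; rewrite !ltW.
have cF x : s <= x <= t -> {for x, continuous F}.
  move=> /dF dx; apply: differentiable_continuous; apply/derivable1_diffP.
  by have [] := dx.
apply: EFin_inj; rewrite -rint_EFin// (@continuous_FTC2 R f F s t)//.
- exact: continuous_subspaceT.
- split.
  + by move=> x /dF' [].
  + by apply/cvg_at_right_filter/cF; rewrite lexx ltW.
  + by apply/cvg_at_left_filter/cF; rewrite lexx ltW.
- by move=> x /dF' dx; rewrite derive1E; apply: derive_val.
Qed.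

(** [rint s t] is 0 when t < s, so a primitive on the whole line has to be glued at 0. Translation,
    reflection and periodicity of integrals then follow by comparing primitives. *)
Lemma continuous_antiderivative f : continuous f -> exists F,
  forall x : R, is_derive x (1:R) F (f x).
Proof.
move=> cf.
pose F x := if 0 <= x then rint 0 x f else - rint x 0 f.
have FE a x : a <= 0 -> a <= x -> F x = rint a x f - rint a 0 f.
  move=> a0 ax; rewrite /F; case: ifPn => [x0|]; last first.
    by rewrite -ltNge => x0; rewrite (@rint_chasles f x a 0)// ?ax ?ltW//; lra.
  by rewrite (@rint_chasles f 0 a x)// ?a0 ?x0//; lra.
exists F => x.
(* A base point to the left of both 0 and [x]: seen from there, the glued function is an ordinary
   integral minus a constant. *)
pose a := Num.min x 0 - 1.
have ax : a < x by rewrite /a ltrBlDr; rewrite gt_min ltrDl ltr01.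
have a0 : a <= 0 by rewrite /a lerBlDr ge_min; lra.
have [] := @continuous_FTC1_closed R f a x (x + 1).
- by rewrite ltrDl.
- exact: continuous_integrable.
- by [].
- exact: cf.
move=> d e; have dx : is_derive x (1:R) (fun y => rint a y f) (f x).
  by rewrite -e derive1E; apply: DeriveDef.
have dx2 : is_derive x (1:R) (fun y => rint a y f - rint a 0 f) (f x).
  by rewrite -[f x]subr0; apply: is_deriveB.
apply: near_eq_is_derive dx2.
near=> y; rewrite (FE a) // ltW //; near: y; exact: lt_nbhsr.
Unshelve. all: by end_near. Qed.

Lemma rint_shift f c s t : s <= t -> continuous f ->
  rint (s + c) (t + c) f = rint s t (fun x => f (x + c)).
Proof.
move=> st cf; have [F dF] := continuous_antiderivative cf.
have -> : rint (s + c) (t + c) f = F (t + c) - F (s + c).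
  by apply: rint_FTC => //; rewrite lerD2r.
symmetry; apply: (@rint_FTC _ (fun x => F (x + c))) => //.
  by move=> x; apply: continuous_comp; [apply: cvgD; [exact: cvg_id|exact: cvg_cst]|exact: cf].
move=> x _; rewrite -[f (x + c)]mulr1.
apply: (@is_derive1_comp _ F (fun x => x + c)).
by rewrite -[X in is_derive _ _ _ X](addr0 1); apply: is_deriveD.
Qed.

Lemma rint_opp f s t : s <= t -> continuous f ->
  rint (- t) (- s) f = rint s t (fun x => f (- x)).
Proof.
move=> st cf; have [F dF] := continuous_antiderivative cf.
have -> : rint (- t) (- s) f = F (- s) - F (- t).
  by apply: rint_FTC => //; rewrite lerN2.
symmetry; have -> : F (- s) - F (- t) = - F (- t) - (- F (- s)) by rewrite opprK addrC.
apply: (@rint_FTC _ (fun x => - F (- x))) => //.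
  by move=> x; apply: continuous_comp; [apply: continuousN; exact: cvg_id|exact: cf].
move=> x _; rewrite -[f (- x)]opprK; apply: is_deriveN; rewrite -mulrN1.
exact: (@is_derive1_comp _ F -%R).
Qed.

Lemma rint_period f p s t : 0 <= p -> continuous f -> (forall x, f (x + p) = f x) ->
  rint s (s + p) f = rint t (t + p) f.
Proof.
move=> p0 cf fp; have [F dF] := continuous_antiderivative cf.
have FTC u : rint u (u + p) f = F (u + p) - F u by apply: rint_FTC; rewrite ?lerDl.
rewrite !FTC.
(* F(x + p) - F(x) has derivative f(x + p) - f(x) = 0, so its values at [s] and [t] agree. *)
have := @is_derive_0_is_cst R (fun x => F (x + p) - F x).
apply=> x; rewrite -(subrr (f x)); apply: is_deriveB.
rewrite -[f x]mulr1 -fp; apply: (@is_derive1_comp _ F (fun x => x + p)).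
by rewrite -[X in is_derive _ _ _ X](addr0 1); apply: is_deriveD.
Qed.

Lemma rint_CS f g s t : continuous f -> continuous g -> s <= t ->
  rint s t (fun x => f x * g x) ^+ 2 <=
  rint s t (fun x => f x ^+ 2) * rint s t (fun x => g x ^+ 2).
Proof.
move=> cf cg st; apply: quad_CS => [|l].
  by apply: rint_ge0 => x _; exact: sqr_ge0.
have cM (h k : R -> R) : continuous h -> continuous k -> continuous (fun x => h x * k x).
  by move=> ch ck x; apply: cvgM; [exact: ch|exact: ck].
have -> : rint s t (fun x => f x ^+ 2) - 2 * l * rint s t (fun x => f x * g x)
  + l ^+ 2 * rint s t (fun x => g x ^+ 2) = rint s t (fun x => (f x - l * g x) ^+ 2).
  have c2 (h : R -> R) : continuous h -> continuous (fun x => h x ^+ 2).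
    by move=> ch; rewrite [X in continuous X](_ : _ = fun x => h x * h x);
      [exact: cM|apply/funext => x; rewrite expr2].
  have cc (k : R) (h : R -> R) : continuous h -> continuous (fun x => k * h x).
    by move=> ch; apply: cM => // x; exact: cvg_cst.
  rewrite -rintZ; last exact: cM.
  rewrite -rintZ; last exact: c2.
  rewrite -rintB; [|exact: c2|by apply: cc; exact: cM].
  rewrite -rintD; [|by move=> x; apply: cvgB; [exact: (c2 _ cf)|exact: (cc _ _ (cM _ _ cf cg))]|exact: (cc _ _ (c2 _ cg))].
  by apply: rint_ext => x; ring.
by apply: rint_ge0 => x _; exact: sqr_ge0.
Qed.

End SegmentIntegral.

(** * Real coordinates of quaternions; completeness *)

Section QuaternionComponents.
Variable R : realType.
Local Notation H := (quat R).
Implicit Types (p q : H) (e : 'I_4).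

Definition qc e q : R :=
  match val e with 0 => qre q | 1 => qi q | 2 => qj q | _ => qk q end.

Definition qb e : H :=
  match val e with 0 => Quat 1 0 0 0 | 1 => Quat 0 1 0 0
  | 2 => Quat 0 0 1 0 | _ => Quat 0 0 0 1 end.

Lemma forall4 (P : 'I_4 -> Prop) : P 0 -> P 1 -> P 2%:R -> P 3%:R -> forall e, P e.
Proof.
move=> P0 P1 P2 P3 [[|[|[|[|//]]]] h].
- by rewrite (_ : Ordinal h = 0)//; apply: val_inj.
- by rewrite (_ : Ordinal h = 1)//; apply: val_inj.
- by rewrite (_ : Ordinal h = 2%:R)//; apply: val_inj.
- by rewrite (_ : Ordinal h = 3%:R)//; apply: val_inj.
Qed.

Lemma sum4 (V : nmodType) (F : 'I_4 -> V) :
  \sum_e F e = F 0 + F 1 + F 2%:R + F 3%:R.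
Proof.
rewrite !big_ord_recl big_ord0 addr0 !addrA.
by congr (F _ + F _ + F _ + F _); apply: val_inj.
Qed.

Lemma qcD e p q : qc e (p + q) = qc e p + qc e q.
Proof. by move: e; apply: forall4. Qed.
Lemma qcN e q : qc e (- q) = - qc e q.
Proof. by move: e; apply: forall4. Qed.
Lemma qcB e p q : qc e (p - q) = qc e p - qc e q.
Proof. by rewrite qcD qcN. Qed.
Lemma qcZ e (a : R) q : qc e (a *: q) = a * qc e q.
Proof. by move: e; apply: forall4. Qed.
Lemma qc0 e : qc e 0 = 0.
Proof. by move: e; apply: forall4. Qed.
Lemma qc_sum e I (r : seq I) (P : pred I) (F : I -> H) :
  qc e (\sum_(i <- r | P i) F i) = \sum_(i <- r | P i) qc e (F i).
Proof. by apply: (big_morph (qc e)); [exact: qcD|exact: qc0]. Qed.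
Lemma qcMn e q n : qc e (q *+ n) = qc e q *+ n.
Proof. by elim: n => [|n IH]; rewrite ?mulr0n ?qc0// !mulrS qcD IH. Qed.

Lemma quat_eqP p q : (forall e, qc e p = qc e q) -> p = q.
Proof.
move=> h; case: p q h => [a b c d] [x y z t] h.
by move: (h 0) (h 1) (h 2%:R) (h 3%:R); rewrite /qc /= => -> -> -> ->.
Qed.

Lemma qsum_basis q : q = \sum_e qc e q *: qb e.
Proof.
apply: quat_eqP => e'; rewrite qc_sum sum4 !qcZ.
by move: e'; apply: forall4; rewrite /qc /= !(mulr0, mulr1, addr0, add0r).
Qed.

Lemma norm_qb e : `|qb e| = 1.
Proof.
by move: e; apply: forall4; rewrite qnormE /qabs /= !expr0n /= ?expr1n ?(addr0, add0r) sqrtr1.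
Qed.

Lemma normsqE q : `|q| ^+ 2 = \sum_e qc e q ^+ 2.
Proof.
rewrite sum4 qnormE /qabs sqr_sqrtr //.
by rewrite !addr_ge0 // sqr_ge0.
Qed.

Lemma qc_le e q : `|qc e q| <= `|q|.
Proof.
rewrite -(ler_pXn2r (ltn0Sn 1)) ?nnegrE// normsqE real_normK ?num_real//.
by rewrite (bigD1 e)//= lerDl sumr_ge0// => i _; exact: sqr_ge0.
Qed.

Lemma norm_le_qc q : `|q| <= \sum_e `|qc e q|.
Proof.
rewrite [in leLHS](qsum_basis q); apply: le_trans (ler_norm_sum _ _ _) _.
by apply: ler_sum => e _; rewrite normrZ norm_qb mulr1.
Qed.

Lemma normqM p q : `|p * q| = `|p| * `|q|.
Proof.
case: p q => [a b c d] [x y z t]; rewrite !qnormE /qabs /=.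
rewrite -sqrtrM; last by rewrite !addr_ge0 // sqr_ge0.
by congr Num.sqrt; ring.
Qed.

Lemma norm_conj q : `|qconj q| = `|q|.
Proof. by rewrite !qnormE /qabs /= !sqrrN. Qed.

Lemma norm_real (a : R) : `|a%:A : H| = `|a|.
Proof. by rewrite normrZ (norm_qb 0) mulr1. Qed.

Lemma mulq_conj q : q * qconj q = (`|q| ^+ 2)%:A.
Proof.
rewrite normsqE sum4; case: q => [a b c d]; apply: quat_eqP; apply: forall4;
  rewrite /qc /=; ring.
Qed.

Lemma qconjK q : qconj (qconj q) = q.
Proof. by case: q => *; rewrite /qconj /= !opprK. Qed.

Lemma normqX q n : `|q ^+ n| = `|q| ^+ n.
Proof.
by elim: n => [|n IH]; [rewrite !expr0 (norm_qb 0)|rewrite !exprS normqM IH].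
Qed.

Lemma cvg_quatP (T : Type) (F : set_system T) (FF : Filter F) (f : T -> H) (l : H) :
  f @ F --> l <-> forall e, qc e \o f @ F --> qc e l.
Proof.
split=> [fl e|fl].
  apply/cvgrPdist_le => eps eps0; move/cvgrPdist_le: fl => /(_ _ eps0).
  by apply: filterS => x /=; apply: le_trans; rewrite -qcB qc_le.
apply/cvgrPdist_le => eps eps0.
have e4 : 0 < eps / 4 by rewrite divr_gt0.
have h e : \forall x \near F, `|qc e l - qc e (f x)| <= eps / 4.
  by have /cvgrPdist_le := fl e; apply.
have h0 := h 0; have h1 := h 1; have h2 := h 2%:R; have h3 := h 3%:R.
near=> x; apply: le_trans (norm_le_qc _) _.
have -> : eps = \sum_(e < 4) eps / 4 by rewrite sum4; field.
rewrite sum4 [leRHS]sum4 !qcB.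
by apply: lerD; [apply: lerD; [apply: lerD|]|]; near: x.
Unshelve. all: by end_near. Qed.

(** Completeness is inherited from R coordinate by coordinate; it makes absolutely convergent series
    of quaternions converge. *)
Lemma quat_cauchy_cvg (F : set_system H) : ProperFilter F -> cauchy F -> cvg F.
Proof.
move=> FF /cauchyP Fc.
have h e : cvg (qc e @ F).
  apply: cauchy_cvg; apply/cauchyP => eps eps0; have [q Fq] := Fc _ eps0.
  exists (qc e q); rewrite /nbhs/= /fmap /=; apply: filterS Fq => x.
  by rewrite -!ball_normE /ball_ /= -qcB; apply: le_lt_trans; exact: qc_le.
apply/cvg_ex; exists (Quat (lim (qc 0 @ F)) (lim (qc 1 @ F))
  (lim (qc 2%:R @ F)) (lim (qc 3%:R @ F))).
by apply/(cvg_quatP FF id); apply: forall4 => /=; exact: h.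
Qed.

End QuaternionComponents.

HB.instance Definition _ (R : realType) :=
  Uniform_isComplete.Build (quat R) (@quat_cauchy_cvg R).

(** * Finite sections of the Hankel form *)

Lemma sum_CS (R : rcfType) (I : finType) (P : pred I) (a b : I -> R) :
  `|\sum_(i | P i) a i * b i| <=
  Num.sqrt (\sum_(i | P i) a i ^+ 2) * Num.sqrt (\sum_(i | P i) b i ^+ 2).
Proof.
have s0 (c : I -> R) : 0 <= \sum_(i | P i) c i ^+ 2.
  by apply: sumr_ge0 => i _; exact: sqr_ge0.
rewrite -sqrtrM // -sqrtr_sqr ler_wsqrtr //; apply: quad_CS => // l.
rewrite mulr_sumr mulr_sumr -sumrB -big_split /=; apply: sumr_ge0 => i _.
by have := sqr_ge0 (a i - l * b i); congr (_ <= _); ring.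
Qed.

Definition trunc (V : nmodType) n (f : nat -> V) k := if (k < n)%N then f k else 0.

Section FiniteForms.
Variable R : realType.
Local Notation H := (quat R).
Implicit Types (b f g v : nat -> H) (M r : R).

Definition sqs n f : R := \sum_(j < n) `|f j| ^+ 2.

(** The common currency of the norm comparisons: a real bound for the Hankel form on finitely
    supported sequences. The factors keep the order of the pairing with a product [star f g]. *)
Definition QB b M := 0 <= M /\ forall n f g,
  `|\sum_(j < n) \sum_(k < n) qconj (b (j + k)%N) * f j * g k|
  <= M * Num.sqrt (sqs n f) * Num.sqrt (sqs n g).

Lemma sqs_ge0 n f : 0 <= sqs n f.
Proof. by apply: sumr_ge0 => i _; exact: sqr_ge0. Qed.

Lemma sqs_nondecreasing f m n : (m <= n)%N -> sqs m f <= sqs n f.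
Proof.
move=> mn; rewrite /sqs -!(big_mkord xpredT (fun j => `|f j| ^+ 2)).
by rewrite (big_cat_nat (leq0n _) mn)//= lerDl sumr_ge0// => i _; exact: sqr_ge0.
Qed.

Lemma sqs_support f m n : (forall k, (m <= k)%N -> f k = 0) -> (m <= n)%N ->
  sqs n f = sqs m f.
Proof.
move=> f0 mn; rewrite /sqs -!(big_mkord xpredT (fun j => `|f j| ^+ 2)).
rewrite (big_cat_nat (leq0n _) mn)//= [X in _ + X]big_nat_cond [X in _ + X]big1 ?addr0//.
by move=> i /andP[/andP[mi _] _]; rewrite f0// normr0 expr0n.
Qed.

Lemma qsum_CS n f g :
  `|\sum_(j < n) f j * g j| <= Num.sqrt (sqs n f) * Num.sqrt (sqs n g).
Proof.
apply: le_trans (ler_norm_sum _ _ _) _.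
under eq_bigr do rewrite normqM.
by apply: le_trans (ler_norm _) _; exact: sum_CS.
Qed.

(** Group the square by j + k = n. The product of two sequences supported below [N] is supported
    below [N + N], so the left sum loses no term of the square. *)
Lemma star_square (c F G : nat -> H) N :
  (forall k, (N <= k)%N -> F k = 0) -> (forall k, (N <= k)%N -> G k = 0) ->
  \sum_(n < N + N) c n * star F G n =
  \sum_(j < N) \sum_(k < N) c (j + k)%N * F j * G k.
Proof.
move=> F0 G0; rewrite /star.
transitivity (\sum_(n < N + N) \sum_(j < N | (j <= n)%N) c n * F j * G (n - j)%N).
  apply: eq_bigr => n _; rewrite mulr_sumr.
  rewrite -(big_mkord xpredT (fun j => c n * (F j * G (n - j)%N))).
  rewrite -(big_mkord (fun j => (j <= n)%N) (fun j => c n * F j * G (n - j)%N)).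
  have [nN|Nn] := leqP N n.+1.
    rewrite (big_cat_nat (leq0n _) nN)//= [X in _ + X]big_nat_cond [X in _ + X]big1 ?addr0.
      rewrite big_nat_cond [RHS]big_nat_cond; apply: eq_big => [j|j _]; last by rewrite mulrA.
      by rewrite andbT; symmetry; apply: andb_idr => jN; rewrite -ltnS (leq_trans jN).
    by move=> j /andP[/andP[Nj _] _]; rewrite F0// mul0r mulr0.
  rewrite (big_nat_widen _ _ N)//; last exact: ltnW.
  by apply: eq_bigr => j _; rewrite mulrA.
rewrite (exchange_big_dep xpredT)//=; apply: eq_bigr => j _.
rewrite -(big_mkord (fun n => (j <= n)%N) (fun n => c n * F j * G (n - j)%N)).
rewrite -(big_mkord xpredT (fun k => c (j + k)%N * F j * G k)).
rewrite (@big_cat_nat _ _ _ j)//=; last first.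
  by rewrite (leq_trans (ltnW (ltn_ord j)))// leq_addr.
rewrite [X in X + _]big_nat_cond big1 ?add0r; last first.
  by move=> i /andP[/andP[_ ij] ji]; move: (leq_trans ij ji); rewrite ltnn.
rewrite (@big_cat_nat _ _ _ (j + N)%N)//=; last 2 first.
- by rewrite leq_addr.
- by rewrite leq_add2r ltnW.
rewrite [X in _ + X]big_nat_cond [X in _ + X]big1 ?addr0; last first.
  move=> i /andP[/andP[ji _] _]; rewrite G0 ?mulr0//.
  by rewrite leq_subRL// (leq_trans _ ji)// leq_addr.
rewrite -{1}[val j]add0n big_addn addKn big_nat_cond [RHS]big_nat_cond.
apply: eq_big => [k|k _]; first by rewrite leq_addl.
by rewrite addnK addnC.
Qed.

Lemma cvg_EFin_le (S : nat -> R) (x : \bar R) : (forall n, 0 <= S n) ->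
  (\sum_(0 <= j <oo) (S j)%:E <= x)%E <->
  (forall n, ((\sum_(j < n) S j)%:E <= x)%E).
Proof.
move=> S0; split=> [h n|h].
  apply: le_trans h; rewrite -(big_mkord xpredT) -sumEFin.
  by apply: nneseries_lim_ge => k _ _; rewrite lee_fin.
apply: lime_le; first by apply: is_cvg_nneseries => k _ _; rewrite lee_fin.
by apply: nearW => n; rewrite sumEFin big_mkord.
Qed.

Lemma l2norm_ge0 v : (0 <= l2norm v)%E.
Proof. exact: sqrte_ge0. Qed.

Lemma l2norm_leP v M : 0 <= M -> (l2norm v <= M%:E)%E <-> forall n, sqs n v <= M ^+ 2.
Proof.
move=> M0; rewrite /l2norm.
have -> : M%:E = sqrte ((M ^+ 2)%:E) by rewrite /= sqrtr_sqr ger0_norm.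
rewrite lee_sqrt ?lee_fin ?sqr_ge0//.
apply: iff_trans; first by apply: cvg_EFin_le => n; exact: sqr_ge0.
by split=> h n; have := h n; rewrite lee_fin.
Qed.

Lemma l2P v : l2 v -> exists r, [/\ 0 <= r, l2norm v = r%:E & forall n, sqs n v <= r ^+ 2].
Proof.
rewrite /l2 /=; have := l2norm_ge0 v; case E : (l2norm v) => [r| |]//= r0 _.
exists r; split => //; apply/(l2norm_leP v r0).
by rewrite E.
Qed.

Lemma l2_leP v M : 0 <= M -> (forall n, sqs n v <= M ^+ 2) -> l2 v.
Proof. by move=> M0 h; rewrite /l2 /=; apply: le_lt_trans (ltry M); apply/l2norm_leP. Qed.

Lemma l2norm_gt0 v : v <> (fun=> 0) -> (0 < l2norm v)%E.
Proof.
move=> v0; rewrite lt_neqAle l2norm_ge0 andbT eq_sym; apply/eqP => e.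
apply: v0; apply/funext => k.
have /l2norm_leP : (l2norm v <= 0%:E)%E by rewrite e.
move=> /(_ (lexx _)) /(_ k.+1); rewrite expr0n /= /sqs big_ord_recr /= => h.
have h1 : `|v k| ^+ 2 <= 0 by apply: le_trans h; rewrite lerDr; exact: sqs_ge0.
by apply/eqP; rewrite -normr_eq0 -sqrf_eq0 eq_le h1 sqr_ge0.
Qed.

Lemma l2norm_support v n : (forall k, (n <= k)%N -> v k = 0) ->
  l2norm v = (Num.sqrt (sqs n v))%:E.
Proof.
move=> v0; have h m : sqs m v <= Num.sqrt (sqs n v) ^+ 2.
  rewrite sqr_sqrtr ?sqs_ge0//; have [mn|nm] := leqP m n; first exact: sqs_nondecreasing.
  by rewrite (sqs_support v0)// ltnW.
have le1 : (l2norm v <= (Num.sqrt (sqs n v))%:E)%E by apply/l2norm_leP => //; exact: sqrtr_ge0.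
apply/le_anti; rewrite le1 /=.
have [r [r0 -> hr]] := l2P (le_lt_trans le1 (ltry _)).
by rewrite lee_fin -(ger0_norm r0) -sqrtr_sqr ler_wsqrtr.
Qed.

Lemma ediv_le (x : \bar R) r M : 0 < r -> (x / r%:E <= M%:E)%E = (x <= (M * r)%:E)%E.
Proof. by move=> r0; rewrite inver gt_eqF// lee_pdivrMr// EFinM. Qed.

Lemma trunc_supp n f k : (n <= k)%N -> trunc n f k = 0.
Proof. by rewrite /trunc leqNgt => /negbTE ->. Qed.

Lemma truncE n f k : (k < n)%N -> trunc n f k = f k.
Proof. by rewrite /trunc => ->. Qed.

Lemma sqs_trunc n f : sqs n (trunc n f) = sqs n f.
Proof. by apply: eq_bigr => i _; rewrite truncE. Qed.

Lemma series_support (u : nat -> H) N : (forall k, (N <= k)%N -> u k = 0) ->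
  series u @ \oo --> \sum_(k < N) u k.
Proof.
move=> u0; apply: cvg_near_cst; exists N => // n /= Nn.
rewrite /series /= (big_cat_nat (leq0n _) Nn)//= [X in _ + X]big_nat_cond [X in _ + X]big1 ?addr0 ?big_mkord//.
by move=> i /andP[/andP[Ni _] _]; rewrite u0.
Qed.

(** Since the entries depend on j + k only, the sum against [f] can be formed first although
    quaternions do not commute. *)
Lemma form_transpose (c f g : nat -> H) n :
  \sum_(j < n) \sum_(k < n) c (j + k)%N * f j * g k =
  \sum_(j < n) (\sum_(k < n) c (j + k)%N * f k) * g j.
Proof.
rewrite exchange_big /=; apply: eq_bigr => j _; rewrite mulr_suml.
by apply: eq_bigr => k _; rewrite addnC.
Qed.

(** On a finitely supported sequence the Hankel series are finite sums, so the operator bound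
    applies to them; Cauchy-Schwarz against [g] does the rest. *)
Lemma QB_of_hankel b M : 0 <= M ->
  (hankel_norm (fun n => qconj (b n)) <= M%:E)%E -> QB b M.
Proof.
move=> M0 hM; split=> // n f g.
set a := fun n => qconj (b n) in hM *.
pose v := trunc n f.
have -> : \sum_(j < n) \sum_(k < n) a (j + k)%N * f j * g k =
   \sum_(j < n) (\sum_(k < n) a (j + k)%N * v k) * g j.
  rewrite (form_transpose a); apply: eq_bigr => j _; congr (_ * _).
  by apply: eq_bigr => k _; rewrite /v truncE.
have v0 k : (n <= k)%N -> v k = 0 by exact: trunc_supp.
have hv j : hankel_series a v j @ \oo --> \sum_(k < n) a (j + k)%N * v k.
  by apply: (@series_support (fun k => a (j + k)%N * v k)) => k /v0 ->; rewrite mulr0.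
have [v00|vn0] := pselect (v = (fun=> 0)).
  rewrite big1 ?normr0 ?mulr_ge0 ?sqrtr_ge0// => j _.
  by rewrite big1 ?mul0r// => k _; rewrite v00 mulr0.
have lv := l2norm_support v0.
have v_gt0 := l2norm_gt0 vn0.
have : (hankel_image_norm a v / l2norm v <= M%:E)%E.
  apply: le_trans hM; apply: ereal_sup_ubound; exists v => //; split.
    by rewrite /l2 /= lv ltry.
  exact/eqP.
rewrite lv ediv_le; last by rewrite lv in v_gt0.
rewrite /hankel_image_norm; case: asboolP => [_|[j]]; last by apply/cvg_ex; eexists; exact: hv.
have e0 : 0 <= M * Num.sqrt (sqs n v) by rewrite mulr_ge0 ?sqrtr_ge0.
have -> : hankel a v = fun j => \sum_(k < n) a (j + k)%N * v k.
  by apply/funext => j; exact: (cvg_lim _ (hv j)).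
move=> /(l2norm_leP _ e0) /(_ n) h.
apply: (le_trans (qsum_CS n (fun j => \sum_(k < n) a (j + k)%N * v k) g)); rewrite ler_wpM2r ?sqrtr_ge0//.
by rewrite -(sqs_trunc n f) -(ger0_norm e0) -sqrtr_sqr ler_wsqrtr.
Qed.

(** The form is tested on the unit sequences at 0 and at [n]. *)
Lemma QB_coef b M n : QB b M -> `|b n| <= M.
Proof.
move=> [M0 /(_ n.+1 (fun k => if k == 0 then 1 else 0) (fun k => if k == n then 1 else 0))].
have s1 m : (m < n.+1)%N -> sqs n.+1 (fun k => if k == m then 1 else 0) = 1.
  move=> mn; rewrite /sqs (bigD1 (Ordinal mn))//= eqxx (norm_qb _ 0) expr1n big1 ?addr0// => i im.
  by rewrite (_ : (_ == _) = false) ?normr0 ?expr0n//; apply/negbTE; apply: contraNN im => /eqP e; apply/eqP/val_inj.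
rewrite !s1// sqrtr1 !mulr1 big_ord_recl /= big_ord_recr /= eqxx !mulr1 add0n.
rewrite big1 ?add0r; last by move=> i _; rewrite ltn_eqF ?mulr0.
by rewrite big1 ?addr0 ?norm_conj// => i _; rewrite big1// => k _; rewrite mulr0 mul0r.
Qed.

Lemma series_dom_cvg (u : nat -> H) (w : nat -> R) :
  (forall n, `|u n| <= w n) -> cvgn (series w) -> cvgn (series u).
Proof.
move=> uw cw; apply: normed_cvg; apply: (series_le_cvg _ _ uw cw) => n //.
exact: le_trans (uw n).
Qed.

Lemma l2_cvg v : l2 v -> cvgn (series (fun n => `|v n| ^+ 2)).
Proof.
move=> /l2P[r [r0 _ hr]]; apply: nondecreasing_is_cvgn.
  by move=> m n mn; rewrite /series /= !big_mkord; exact: sqs_nondecreasing.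
by exists (r ^+ 2) => _ [n _ <-]; rewrite /series /= big_mkord; exact: hr.
Qed.

(** Tested on the unit sequence at 0 and on [b] itself, the form is the square sum s of [b]; then s
    <= M sqrt(s) gives the claim. Square summability of [b] is what makes the Hankel series converge
    on l2. *)
Lemma l2_coef_tail b M : QB b M -> forall n, sqs n b <= M ^+ 2.
Proof.
move=> [M0 h] n; have := h n (fun k => if k == 0 then 1 else 0) b.
have [->|n0] := posnP n; first by move=> _; rewrite /sqs big_ord0; exact: sqr_ge0.
have -> : sqs n (fun k => if k == 0 then 1 else 0) = 1.
  rewrite /sqs (bigD1 (Ordinal n0))//= (norm_qb _ 0) expr1n big1 ?addr0// => i i0.
  by rewrite (_ : (_ == _) = false) ?normr0 ?expr0n//; apply/negbTE; apply: contraNN i0 => /eqP e; apply/eqP/val_inj.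
rewrite (bigD1 (Ordinal n0))//= [X in _ + X]big1 ?addr0; last first.
  move=> i i0; rewrite big1// => k _; rewrite (_ : (_ == _) = false) ?mulr0 ?mul0r//.
  by apply/negbTE; apply: contraNN i0 => /eqP e; apply/eqP/val_inj.
under eq_bigr do rewrite mulr1 add0n.
have -> : \sum_(i < n) qconj (b i) * b i = (sqs n b)%:A.
  rewrite /sqs scaler_suml; apply: eq_bigr => i _.
  by rewrite -(norm_conj (b i)) -mulq_conj qconjK.
rewrite norm_real ger0_norm ?sqs_ge0// sqrtr1 mulr1 => h1.
have s0 := sqs_ge0 n b; have := sqr_sqrtr s0; have := sqrtr_ge0 (sqs n b).
set t := Num.sqrt _ in h1 * => t0 e; rewrite -e in h1 *; nra.
Qed.

Lemma hankel_cvg b M v j : QB b M -> l2 v ->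
  cvgn (hankel_series (fun n => qconj (b n)) v j).
Proof.
move=> hb lv; have lb : l2 (fun k => b (j + k)%N).
  apply: (@l2_leP _ M) => [|n]; first by case: hb.
  apply: le_trans (l2_coef_tail hb (j + n)); rewrite /sqs big_split_ord /=.
  by rewrite lerDr sumr_ge0// => i _; exact: sqr_ge0.
apply: (@series_dom_cvg _ (fun k => `|b (j + k)%N| ^+ 2 + `|v k| ^+ 2)) => [k|].
  rewrite normqM norm_conj; have := sqr_ge0 (`|b (j + k)%N| - `|v k|).
  have := normr_ge0 (b (j + k)%N); have := normr_ge0 (v k); nra.
by apply: (is_cvg_seriesD (l2_cvg lb) (l2_cvg lv)).
Qed.

Lemma hankel_of_QB b M : QB b M ->
  (hankel_norm (fun n => qconj (b n)) <= M%:E)%E.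
Proof.
move=> hb; have [M0 hQ] := hb; apply: ge_ereal_sup => _ [v [lv /eqP v0] <-].
have [r [r0 lvE hr]] := l2P lv; have r_gt0 := l2norm_gt0 v0.
rewrite lvE in r_gt0 *; rewrite ediv_le//.
rewrite /hankel_image_norm; case: asboolP => [cv|[]]; last by move=> j; exact: hankel_cvg hb lv.
apply/l2norm_leP => [|J]; first exact: mulr_ge0.
set a := fun n => qconj (b n) in cv *.
have key n : \sum_(j < J) `|hankel_series a v j n| ^+ 2 <= (M * r) ^+ 2.
  (* Pairing with the conjugates of the partial images turns the form into their square sum, and one
     square root of it cancels. *)
  pose g := trunc J (fun j => qconj (hankel_series a v j n)).
  have := hQ (n + J)%N (trunc n v) g.
  rewrite (form_transpose a).
  have sg : sqs (n + J) g = \sum_(j < J) `|hankel_series a v j n| ^+ 2.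
    rewrite (@sqs_support _ J) ?leq_addl//; last by move=> k; exact: trunc_supp.
    by apply: eq_bigr => j _; rewrite /g truncE// norm_conj.
  have -> : sqs (n + J) (trunc n v) = sqs n v.
    rewrite (@sqs_support _ n) ?leq_addr// ?sqs_trunc// => k; exact: trunc_supp.
  rewrite sg; set S := \sum_(j < J) _.
  have -> : \sum_(j < n + J) (\sum_(k < n + J) a (j + k)%N * trunc n v k) * g j = S%:A.
    rewrite addnC big_split_ord /= [X in _ + X]big1 ?addr0; last first.
      by move=> i _; rewrite /g trunc_supp ?leq_addr// mulr0.
    rewrite /S scaler_suml; apply: eq_bigr => j _; rewrite -mulq_conj /g truncE//.
    congr (_ * _); rewrite addnC big_split_ord /= [X in _ + X]big1 ?addr0; last first.
      by move=> i _; rewrite trunc_supp ?leq_addr// mulr0.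
    rewrite /hankel_series /series /= big_mkord; apply: eq_bigr => k _.
    by rewrite truncE.
  have S0 : 0 <= S by apply: sumr_ge0 => i _; exact: sqr_ge0.
  rewrite norm_real ger0_norm// => h.
  have sv : Num.sqrt (sqs n v) <= r by rewrite -(ger0_norm r0) -sqrtr_sqr ler_wsqrtr.
  have := sqr_sqrtr S0; have := sqrtr_ge0 S; have := sqrtr_ge0 (sqs n v).
  set t := Num.sqrt S in h *; set u := Num.sqrt _ in h sv *; move=> u0 t0 e.
  rewrite -e; rewrite -e in h.
  have [tz|tz] := eqVneq t 0; first by rewrite tz expr0n /= sqr_ge0.
  have tp : 0 < t by rewrite lt_neqAle eq_sym tz.
  have : t <= M * u by rewrite -(ler_pM2r tp) -expr2.
  move=> tMu; rewrite ler_pXn2r ?nnegrE// ?mulr_ge0//.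
  by apply: le_trans tMu _; rewrite ler_wpM2l.
have cvS : (fun n => \sum_(j < J) `|hankel_series a v j n| ^+ 2) @ \oo -->
    \sum_(j < J) `|hankel a v j| ^+ 2.
  apply: cvg_sumr => j _; rewrite expr2; under eq_fun do rewrite expr2.
  by apply: cvgM; exact: cvg_norm (cv j).
rewrite /sqs -(cvg_lim _ cvS)//; apply: limr_le; first by apply/cvg_ex; eexists; exact: cvS.
by apply: nearW => n; exact: key.
Qed.

End FiniteForms.

(** * Tails and uniqueness of power series *)

Lemma norm_lim_le (R : realType) (V : normedModType R) (T : Type) (F : set_system T)
  {FF : ProperFilter F} (f : T -> V) (l : V) (C : R) :
  f x @[x --> F] --> l -> (\forall x \near F, `|f x| <= C) -> `|l| <= C.
Proof.
move=> fl fC; have h : `|f x| @[x --> F] --> `|l| by exact: cvg_norm.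
by rewrite -(cvg_lim _ h)//; apply: limr_le => //; apply/cvg_ex; eexists; exact: h.
Qed.

Section PowerSeriesTails.
Variables (R : realType) (V : completeNormedModType R).
Implicit Types (u : nat -> V) (r C e : R).

Lemma geo_sum_le r m n : 0 <= r < 1 -> \sum_(m <= k < n) r ^+ k <= r ^+ m / (1 - r).
Proof.
move=> /andP[r0 r1]; rewrite ler_pdivlMr ?subr_gt0//.
have [mn|nm] := leqP m n; last by rewrite big_geq ?mul0r ?exprn_ge0// ltnW.
suff -> : (\sum_(m <= k < n) r ^+ k) * (1 - r) = r ^+ m - r ^+ n.
  by rewrite lerBlDr lerDl exprn_ge0.
elim: n mn => [|n IH].
  by rewrite leqn0 => /eqP ->; rewrite big_geq// mul0r subrr.
rewrite leq_eqVlt => /predU1P[->|]; first by rewrite big_geq// mul0r subrr.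
by rewrite ltnS => mn; rewrite big_nat_recr//= mulrDl IH// exprS; ring.
Qed.

Lemma geo_tail u C r : 0 <= r < 1 -> (forall n, `|u n| <= C * r ^+ n) ->
  cvgn (series u) /\
  forall N, `|limn (series u) - \sum_(k < N) u k| <= C * (r ^+ N / (1 - r)).
Proof.
move=> r01 hu; have C0 : 0 <= C.
  by have := hu 0%N; rewrite expr0 mulr1; apply: le_trans.
have cu : cvgn (series u).
  have /andP[r0 r1] := r01.
  apply: normed_cvg; apply: (@series_le_cvg _ _ (geometric C r)) => [n|n|n|] //=.
  - by rewrite mulr_ge0// exprn_ge0.
  - by apply: is_cvg_geometric_series; rewrite ger0_norm.
split=> // N.
have h : (fun m => `|series u m - \sum_(k < N) u k|) @ \oo -->
    `|limn (series u) - \sum_(k < N) u k|.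
  by apply: cvg_norm; apply: cvgB; [exact: cu|exact: cvg_cst].
rewrite -(cvg_lim _ h)//; apply: limr_le; first by apply/cvg_ex; eexists; exact: h.
near=> m; have Nm : (N <= m)%N by near: m; exact: nbhs_infty_ge.
rewrite /series /= (big_cat_nat (leq0n _) Nm)/= big_mkord addrC addrK.
apply: le_trans (ler_norm_sum _ _ _) _.
apply: (@le_trans _ _ (\sum_(N <= k < m) C * r ^+ k)); first exact: ler_sum.
by rewrite -mulr_sumr ler_wpM2l// geo_sum_le.
Unshelve. all: by end_near. Qed.

Lemma left_cauchy (F : R -> V) (c : R) :
  (forall e, 0 < e -> exists2 d, 0 < d &
    forall r s, c - d < r < c -> c - d < s < c -> `|F r - F s| <= e) ->
  cvg (F r @[r --> c^'-]).
Proof.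
move=> h; apply: cauchy_cvg; apply/cauchyP => e e0.
have [d d0 hd] := h (e / 2) (divr_gt0 e0 (ltr0Sn _ 1)).
exists (F (c - d / 2)); rewrite /nbhs /= /fmap /=.
near=> r; rewrite -ball_normE /ball_ /=.
apply: (@le_lt_trans _ _ (e / 2)); last by rewrite ltr_pdivrMr// ltr_pMr// ltr1n.
apply: hd; first by apply/andP; split; lra.
by apply/andP; split; near: r; [apply: nbhs_left_gt; lra|exact: nbhs_left_lt].
Unshelve. all: by end_near. Qed.

(** Strong induction: once the coefficients below [n] vanish, the tail estimate at radius r bounds
    |u n| by a constant times r, and r is arbitrarily small. *)
Lemma power_unique u C : (forall n, `|u n| <= C * 2 ^+ n) ->
  (forall r, 0 < r < 1 / 4 -> limn (series (fun n => r ^+ n *: u n)) = 0) ->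
  forall n, u n = 0.
Proof.
move=> hu h n; elim/ltn_ind: n => n IH.
have C0 : 0 <= C by have := hu 0%N; rewrite expr0 mulr1; apply: le_trans.
apply/eqP; rewrite -normr_eq0; apply/eqP/le_anti; rewrite normr_ge0 andbT.
apply/ler_addgt0Pr => e e0; rewrite add0r.
(* The leading 2 bounds 1 / (1 - 2 r), which is legitimate because r <= 1/8. *)
pose K := 2 * C * 2 ^+ n.+1.
have K0 : 0 <= K by rewrite !mulr_ge0// exprn_ge0.
pose r := Num.min (1 / 8) (e / (K + 1)).
have r0 : 0 < r by rewrite lt_min divr_gt0// ?divr_gt0// ltr_wpDl.
have r1 : r <= 1 / 8 by rewrite ge_min lexx.
have r2 : r <= e / (K + 1) by rewrite ge_min lexx orbT.
have hr m : `|r ^+ m *: u m| <= C * (2 * r) ^+ m.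
  rewrite normrZ ger0_norm ?exprn_ge0 ?(ltW r0)// exprMn.
  rewrite (_ : C * _ = r ^+ m * (C * 2 ^+ m)); last by ring.
  by rewrite ler_wpM2l ?exprn_ge0 ?(ltW r0)// hu.
have r3 : 0 <= 2 * r < 1 by apply/andP; split; lra.
have [_ /(_ n.+1)] := geo_tail r3 hr.
rewrite h ?r0//; last by lra.
rewrite sub0r normrN big_ord_recr /= big1 ?add0r => [|i _]; last by rewrite IH ?scaler0.
rewrite normrZ ger0_norm ?exprn_ge0 ?(ltW r0)// => hn.
have rn : 0 < r ^+ n by rewrite exprn_gt0.
rewrite -(ler_pM2l rn); apply: le_trans hn _.
apply: (@le_trans _ _ (r ^+ n * (K * r))).
  rewrite /K exprMn exprS [r ^+ n.+1]exprS.
  have -> : C * (2 * 2 ^+ n * (r * r ^+ n) / (1 - 2 * r)) =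
    r ^+ n * (C * 2 ^+ n.+1 * r) * (1 - 2 * r)^-1 by rewrite exprS; ring.
  have -> : r ^+ n * (2 * C * (2 * 2 ^+ n) * r) =  r ^+ n * (C * 2 ^+ n.+1 * r) * 2 by rewrite exprS; ring.
  apply: ler_wpM2l; first by rewrite !mulr_ge0 ?exprn_ge0 ?(ltW r0).
  by rewrite -[leRHS]invrK lef_pV2 ?posrE ?invr_gt0//; lra.
rewrite ler_wpM2l ?(ltW rn)//.
have : r * (K + 1) <= e by rewrite -ler_pdivlMr// ltr_wpDl.
by nra.
Unshelve. all: by end_near. Qed.

End PowerSeriesTails.

(** * The pairing with a product as an Abel limit *)

Section WeakDual.
Variable R : realType.
Local Notation H := (quat R).
Implicit Types (b f g h phi : nat -> H) (M r s A B C : R).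

Lemma star_support f g N n : (forall k, (N <= k)%N -> f k = 0) ->
  (forall k, (N <= k)%N -> g k = 0) -> (N + N <= n)%N -> star f g n = 0.
Proof.
move=> f0 g0 Nn; rewrite /star big1// => k _.
have [Nk|kN] := leqP N k; first by rewrite f0// mul0r.
have kn : (k <= n)%N by rewrite -ltnS.
by rewrite g0 ?mulr0// leq_subRL// (leq_trans _ Nn)// leq_add2r ltnW.
Qed.

Lemma star_norm_le f g A B n : 0 <= A -> 0 <= B ->
  (forall m, sqs m f <= A ^+ 2) -> (forall m, sqs m g <= B ^+ 2) ->
  `|star f g n| <= A * B.
Proof.
move=> A0 B0 hf hg; rewrite /star.
apply: le_trans (ler_norm_sum _ _ _) _.
under eq_bigr do rewrite normqM.
apply: le_trans (ler_norm _) _; apply: le_trans (sum_CS _ _ _) _.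
apply: ler_pM; rewrite ?sqrtr_ge0//.
  by rewrite -(ger0_norm A0) -sqrtr_sqr ler_wsqrtr//; exact: hf.
rewrite -(ger0_norm B0) -sqrtr_sqr ler_wsqrtr//; apply: le_trans (hg n.+1).
rewrite /sqs [leRHS](reindex_inj rev_ord_inj) /=.
by under [leRHS]eq_bigr do rewrite subSS.
Qed.

Lemma bounded_regular b C : (forall n, `|b n| <= C) -> regular b.
Proof.
move=> hb q q1; have q01 : 0 <= `|q| < 1 by rewrite normr_ge0.
apply: (proj1 (@geo_tail R _ _ C `|q| q01 _)) => n.
by rewrite normqM normqX mulrC ler_wpM2r ?exprn_ge0.
Qed.

Lemma sqs_coef f A n : 0 <= A -> (forall m, sqs m f <= A ^+ 2) -> `|f n| <= A.
Proof.
move=> A0 /(_ n.+1); rewrite /sqs big_ord_recr /= => h.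
rewrite -(ler_pXn2r (ltn0Sn 1)) ?nnegrE//; apply: le_trans h.
by rewrite lerDr; exact: sqs_ge0.
Qed.

Lemma l2_regular f : l2 f -> regular f.
Proof.
move=> /l2P[A [A0 _ hf]]; apply: (@bounded_regular _ A) => n.
exact: sqs_coef hf.
Qed.

Lemma H2_l2 f : l2 f -> H2 f.
Proof. by move=> lf; split => //; exact: l2_regular. Qed.

Lemma dilate_star r f g : star (dilate r f) (dilate r g) = dilate r (star f g).
Proof.
apply/funext => n; rewrite /star /dilate scaler_sumr; apply: eq_bigr => k _.
rewrite -scalerAl -scalerAr scalerA; congr (_ *: _).
by rewrite -exprD subnKC// -ltnS.
Qed.

Lemma sqs_dilate r f n : 0 <= r <= 1 -> sqs n (dilate r f) <= sqs n f.
Proof.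
move=> /andP[r0 r1]; apply: ler_sum => k _.
rewrite normrZ ger0_norm ?exprn_ge0// exprMn ler_piMl ?sqr_ge0//.
by rewrite -exprM exprn_ile1.
Qed.

Definition hform N b f g := \sum_(j < N) \sum_(k < N) qconj (b (j + k)%N) * f j * g k.

Lemma formBl N b f f' g : hform N b (fun n => f n - f' n) g = hform N b f g - hform N b f' g.
Proof.
rewrite /hform -sumrB; apply: eq_bigr => j _; rewrite -sumrB; apply: eq_bigr => k _.
by rewrite mulrBr mulrBl.
Qed.

Lemma formBr N b f g g' : hform N b f (fun n => g n - g' n) = hform N b f g - hform N b f g'.
Proof.
rewrite /hform -sumrB; apply: eq_bigr => j _; rewrite -sumrB; apply: eq_bigr => k _.
by rewrite mulrBr.
Qed.

Lemma form_trunc N b f g :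
  hform N b f g = \sum_(n < N + N) qconj (b n) * star (trunc N f) (trunc N g) n.
Proof.
rewrite (@star_square _ (fun n => qconj (b n)) _ _ N); first last.
- exact: trunc_supp.
- exact: trunc_supp.
by apply: eq_bigr => j _; apply: eq_bigr => k _; rewrite !truncE.
Qed.

Lemma form_le b M N f g A B : QB b M -> 0 <= A -> 0 <= B ->
  sqs N f <= A ^+ 2 -> sqs N g <= B ^+ 2 -> `|hform N b f g| <= M * A * B.
Proof.
move=> [M0 h] A0 B0 hf hg; apply: le_trans (h N f g) _.
have sq (x C : R) : 0 <= C -> x <= C ^+ 2 -> Num.sqrt x <= C.
  by move=> C0 xC; rewrite -[leRHS]ger0_norm// -sqrtr_sqr ler_wsqrtr.
apply: ler_pM; rewrite ?mulr_ge0 ?sqrtr_ge0//; last exact: sq.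
by rewrite ler_wpM2l//; exact: sq.
Qed.

Lemma H2inner_tail b M r phi C N : 0 <= r < 1 -> (forall n, `|b n| <= M) ->
  (forall n, `|phi n| <= C) ->
  `|H2inner (dilate r phi) b - \sum_(k < N) qconj (b k) * dilate r phi k|
  <= M * C * (r ^+ N / (1 - r)).
Proof.
move=> r01 hb hphi; apply: (proj2 (geo_tail r01 _)) => n.
have /andP[r0 _] := r01.
rewrite normqM norm_conj /dilate normrZ ger0_norm ?exprn_ge0//.
rewrite (_ : M * C * _ = M * (r ^+ n * C)); last by ring.
by apply: ler_pM; rewrite ?mulr_ge0 ?exprn_ge0// ler_wpM2l ?exprn_ge0.
Qed.

Lemma star_trunc N f g n : (n < N)%N -> star (trunc N f) (trunc N g) n = star f g n.
Proof.
move=> nN; apply: eq_bigr => k _; rewrite !truncE//.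
  by rewrite (leq_ltn_trans _ nN)// leq_subr.
by rewrite (leq_ltn_trans _ nN)// -ltnS.
Qed.

Lemma sqs_trunc_le f N A : (forall m, sqs m f <= A ^+ 2) -> forall m, sqs m (trunc N f) <= A ^+ 2.
Proof.
move=> hf m; apply: le_trans (hf m); apply: ler_sum => k _.
by rewrite /trunc; case: ifP => // _; rewrite normr0 expr0n /= sqr_ge0.
Qed.

Lemma trunc_dilate N r f : trunc N (dilate r f) = dilate r (trunc N f).
Proof. by apply/funext => k; rewrite /trunc /dilate; case: ifP => //; rewrite scaler0. Qed.

(** The form on the N by N square and the pairing with the full product involve the same
    coefficients below N; beyond N each is a geometric tail in r, whence the factor 2 in the
    error. *)
Lemma form_cvg b M r f g A B : QB b M -> 0 <= r < 1 -> 0 <= A -> 0 <= B ->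
  (forall m, sqs m f <= A ^+ 2) -> (forall m, sqs m g <= B ^+ 2) ->
  hform N b (dilate r f) (dilate r g) @[N --> \oo] --> H2inner (dilate r (star f g)) b.
Proof.
move=> hb r01 A0 B0 hf hg; have /andP[r0 r1] := r01; have M0 := proj1 hb.
have hbn n := QB_coef n hb.
apply/cvgrPdist_le => e e0.
have : (fun N => 2 * (M * (A * B) / (1 - r)) * r ^+ N) @ \oo --> 0.
  rewrite -[X in _ --> X](mulr0 (2 * (M * (A * B) / (1 - r)))).
  apply: cvgM; first exact: cvg_cst.
  have := @cvg_geometric R 1 r; rewrite ger0_norm// => /(_ r1).
  by apply: cvg_trans; apply: near_eq_cvg; near=> n; rewrite /geometric /= mul1r.
move/cvgrPdist_le => /(_ _ e0); apply: filterS => N.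
rewrite sub0r normrN ger0_norm; last first.
  by rewrite !mulr_ge0 ?invr_ge0 ?exprn_ge0// subr_ge0 ltW.
apply: le_trans.
rewrite form_trunc !trunc_dilate dilate_star.
set P := star (trunc N f) (trunc N g).
have hP n : `|P n| <= A * B by apply: star_norm_le => //; exact: sqs_trunc_le.
have hS n : `|star f g n| <= A * B by exact: star_norm_le.
have P0 : H2inner (dilate r P) b = \sum_(n < N + N) qconj (b n) * dilate r P n.
  apply: cvg_lim => //; apply: series_support => k hk.
  by rewrite /dilate /P (@star_support _ _ N) ?scaler0 ?mulr0//; exact: trunc_supp.
rewrite -P0.
have h1 := H2inner_tail N r01 hbn hS.
have h2 := H2inner_tail N r01 hbn hP.
have e12 : \sum_(k < N) qconj (b k) * dilate r P k =
           \sum_(k < N) qconj (b k) * dilate r (star f g) k.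
  by apply: eq_bigr => k _; rewrite /dilate /P star_trunc.
rewrite e12 in h2; set T := \sum_(k < N) _ in h1 h2.
rewrite -[H2inner (dilate r (star f g)) b](subrK T) -addrA.
apply: le_trans (ler_normD _ _) _; rewrite [`|T - _|]distrC.
apply: le_trans (lerD h1 h2) _.
by rewrite le_eqVlt; apply/orP; left; apply/eqP; ring.
Unshelve. all: by end_near. Qed.

Lemma Lr_le b M r f g A B : QB b M -> 0 <= r < 1 -> 0 <= A -> 0 <= B ->
  (forall m, sqs m f <= A ^+ 2) -> (forall m, sqs m g <= B ^+ 2) ->
  `|H2inner (dilate r (star f g)) b| <= M * (A * B).
Proof.
move=> hb r01 A0 B0 hf hg.
apply: (norm_lim_le (form_cvg hb r01 A0 B0 hf hg)).
have r01' : 0 <= r <= 1 by case/andP: r01 => -> /ltW ->.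
apply: nearW => N; rewrite mulrA; apply: form_le => //.
  exact: le_trans (sqs_dilate _ _ r01') (hf N).
exact: le_trans (sqs_dilate _ _ r01') (hg N).
Qed.

Lemma sqs_tail_small f A e : 0 < e -> (forall m, sqs m f <= A ^+ 2) ->
  exists K, forall n, sqs n f - sqs K f <= e.
Proof.
move=> e0 hf.
have cf : cvgn (fun n => sqs n f).
  apply: nondecreasing_is_cvgn; first by move=> m n; exact: sqs_nondecreasing.
  by exists (A ^+ 2) => _ [n _ <-].
have := cf; move/cvgrPdist_le => /(_ _ e0) [K _ hK]; exists K => n.
have := hK K (leqnn K) => /=.
have le1 : sqs n f <= limn (fun n => sqs n f).
  by apply: nondecreasing_cvgn_le => // i j; exact: sqs_nondecreasing.
by move=> h; have := ler_norm (limn (fun n => sqs n f) - sqs K f); lra.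
Qed.

Lemma expr_lip n r s : 0 <= r <= 1 -> 0 <= s <= 1 -> `|r ^+ n - s ^+ n| <= n%:R * `|r - s|.
Proof.
move=> /andP[r0 r1] /andP[s0 s1]; rewrite subrXX normrM mulrC ler_wpM2r//.
apply: le_trans (ler_norm_sum _ _ _) _.
apply: (@le_trans _ _ (\sum_(i < n) 1)); last by rewrite sumr_const card_ord.
apply: ler_sum => i _; rewrite ger0_norm ?mulr_ge0 ?exprn_ge0//.
by rewrite mulr_ile1 ?exprn_ge0// exprn_ile1.
Qed.

(** Cut at an index K beyond which the square sum is small, uniformly in r and s; below K the factor
    r^n - s^n is at most K |r - s|. Each part takes half of e^2. *)
Lemma dilate_cauchy f A e : 0 <= A -> 0 < e -> (forall m, sqs m f <= A ^+ 2) ->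
  exists2 d, 0 < d <= 1 & forall r s, 1 - d < r < 1 -> 1 - d < s < 1 -> forall N,
    sqs N (fun n => dilate r f n - dilate s f n) <= e ^+ 2.
Proof.
move=> A0 e0 hf; have e2 : 0 < e ^+ 2 / 2 by rewrite divr_gt0// exprn_gt0.
have [K hK] := sqs_tail_small e2 hf.
pose D := K%:R * A + 1.
have D0 : 0 < D by rewrite ltr_wpDl// mulr_ge0.
pose d := Num.min 1 (e / (2 * D)).
have d0 : 0 < d by rewrite lt_min ltr01 divr_gt0// mulr_gt0.
exists d; first by rewrite d0 ge_min lexx.
have d1 : d <= 1 by rewrite ge_min lexx.
move=> r s /andP[rd r1] /andP[sd s1] N.
have r01 : 0 <= r <= 1 by apply/andP; split; lra.
have s01 : 0 <= s <= 1 by apply/andP; split; lra.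
have rs : `|r - s| <= d by rewrite ler_norml; apply/andP; split; lra.
have [/andP[r0 _] /andP[s0 _]] := (r01, s01).
apply: (@le_trans _ _ (sqs (K + N) (fun n => dilate r f n - dilate s f n))).
  by apply: sqs_nondecreasing; rewrite leq_addl.
have pt n : `|dilate r f n - dilate s f n| ^+ 2 = (r ^+ n - s ^+ n) ^+ 2 * `|f n| ^+ 2.
  by rewrite /dilate -scalerBl normrZ exprMn real_normK ?num_real.
rewrite /sqs big_split_ord /= (splitr (e ^+ 2)); apply: lerD.
  apply: (@le_trans _ _ (\sum_(k < K) (K%:R * d) ^+ 2 * `|f k| ^+ 2)).
    apply: ler_sum => k _; rewrite pt ler_wpM2r ?sqr_ge0//.
    rewrite -real_normK ?num_real// ler_pXn2r ?nnegrE ?mulr_ge0 ?(ltW d0)//.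
    apply: le_trans (expr_lip _ r01 s01) _; rewrite ler_pM// ler_nat ltnW//.
  rewrite -mulr_sumr.
  apply: (@le_trans _ _ ((K%:R * d) ^+ 2 * A ^+ 2)).
    by rewrite ler_wpM2l ?sqr_ge0//; exact: hf.
  rewrite -exprMn.
  have -> : e ^+ 2 / 2 = (e / 2) ^+ 2 * 2 by field.
  apply: (@le_trans _ _ ((e / 2) ^+ 2)); last by rewrite ler_peMr ?sqr_ge0// ler1n.
  have d2 : d <= e / (2 * D) by rewrite ge_min lexx orbT.
  rewrite ler_pXn2r ?nnegrE ?mulr_ge0 ?(ltW d0) ?divr_ge0 ?(ltW e0)//.
  rewrite mulrAC; apply: (@le_trans _ _ (D * d)).
    by rewrite ler_wpM2r ?(ltW d0)// /D lerDl.
  apply: (@le_trans _ _ (D * (e / (2 * D)))); first by rewrite ler_wpM2l// ltW.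
  by rewrite le_eqVlt; apply/orP; left; apply/eqP; field; rewrite gt_eqF.
apply: le_trans (hK (K + N)%N).
have -> : sqs (K + N) f = sqs K f + \sum_(i < N) `|f (K + i)%N| ^+ 2.
  by rewrite /sqs big_split_ord.
rewrite addrAC subrr add0r.
apply: ler_sum => k _; rewrite pt ler_piMl ?sqr_ge0//.
rewrite -real_normK ?num_real// exprn_ile1// ler_norml.
have := exprn_ile1 (K + k) r0 (ltW r1); have := exprn_ile1 (K + k) s0 (ltW s1).
have := exprn_ge0 (K + k) r0; have := exprn_ge0 (K + k) s0.
by move=> *; apply/andP; split; lra.
Qed.

(** By bilinearity the dilation is changed in one factor at a time; the changed factor is small in
    l2 and the form bound applies. This is what yields the limit defining [Lambda] on products. *)
Lemma Lr_cauchy b M f g A B e : QB b M -> 0 <= A -> 0 <= B -> 0 < e ->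
  (forall m, sqs m f <= A ^+ 2) -> (forall m, sqs m g <= B ^+ 2) ->
  exists2 d, 0 < d <= 1 & forall r s, 1 - d < r < 1 -> 1 - d < s < 1 ->
    `|H2inner (dilate r (star f g)) b - H2inner (dilate s (star f g)) b| <= e.
Proof.
move=> hb A0 B0 e0 hf hg; have M0 := proj1 hb.
pose D := M * (A + B) + 1.
have D0 : 0 < D by rewrite ltr_wpDl// mulr_ge0// addr_ge0.
pose e' := e / D; have e'0 : 0 < e' by rewrite divr_gt0.
have [d1 /andP[d10 d11] h1] := dilate_cauchy A0 e'0 hf.
have [d2 /andP[d20 d21] h2] := dilate_cauchy B0 e'0 hg.
exists (Num.min d1 d2); first by rewrite lt_min d10 d20 ge_min d11.
move=> r s hr hs.
have m1 : Num.min d1 d2 <= d1 by rewrite ge_min lexx.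
have m2 : Num.min d1 d2 <= d2 by rewrite ge_min lexx orbT.
have r01 : 0 <= r < 1 by case/andP: hr => *; apply/andP; split; lra.
have s01 : 0 <= s < 1 by case/andP: hs => *; apply/andP; split; lra.
apply: (norm_lim_le (cvgB (form_cvg hb r01 A0 B0 hf hg) (form_cvg hb s01 A0 B0 hf hg))).
apply: nearW => N.
have -> : hform N b (dilate r f) (dilate r g) - hform N b (dilate s f) (dilate s g) =
  hform N b (fun n => dilate r f n - dilate s f n) (dilate r g) +
  hform N b (dilate s f) (fun n => dilate r g n - dilate s g n).
  by rewrite formBl formBr addrA subrK.
have r01' : 0 <= r <= 1 by case/andP: r01 => -> /ltW ->.
have s01' : 0 <= s <= 1 by case/andP: s01 => -> /ltW ->.
apply: le_trans (ler_normD _ _) _.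
apply: (@le_trans _ _ (M * e' * B + M * A * e')).
  apply: lerD; apply: form_le => //; rewrite ?(ltW e'0)//.
  - by apply: h1; [case/andP: hr|case/andP: hs] => *; apply/andP; split; lra.
  - exact: le_trans (sqs_dilate _ _ r01') (hg N).
  - exact: le_trans (sqs_dilate _ _ s01') (hf N).
  - by apply: h2; [case/andP: hr|case/andP: hs] => *; apply/andP; split; lra.
have -> : M * e' * B + M * A * e' = M * (A + B) * e' by ring.
apply: (@le_trans _ _ (D * e')); first by rewrite ler_wpM2r ?(ltW e'0)// /D lerDl.
by rewrite /e' mulrC divfK// gt_eqF.
Qed.

End WeakDual.

(** * Pairing with an element of the weak product *)

Section WeakProductDuality.
Variable R : realType.
Local Notation H := (quat R).
Implicit Types (b f g h phi : nat -> H) (M r s A B C : R).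

Lemma reg_eval_real phi r : reg_eval phi (r%:A) = limn (series (fun n => r ^+ n *: phi n)).
Proof.
rewrite /reg_eval; congr (limn (series _)); apply/funext => n.
have -> : (r%:A : H) ^+ n = (r ^+ n)%:A.
  elim: n => [|n IH]; first by rewrite !expr0 scale1r.
  by rewrite !exprS IH -scalerAl -scalerAr mul1r scalerA.
by rewrite -scalerAl mul1r.
Qed.

Lemma regular_coef_le phi : regular phi -> exists C, forall n, `|phi n| <= C * 2 ^+ n.
Proof.
move=> /(_ (2^-1)%:A); have hq : qball ((2^-1)%:A : H).
  by rewrite /qball /= norm_real ger0_norm// invf_lt1// ltr1n.
move=> /(_ hq) /cvg_series_cvg_0 h0.
have [C [_ hC]] := cvg_seq_bounded (cvgP _ h0).
have CC : C < C + 1 by rewrite ltrDl.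
exists (C + 1) => n; have /= := hC (C + 1) CC n Logic.I.
rewrite normqM normqX norm_real ger0_norm// exprVn mulrC.
by rewrite ler_pdivrMr ?exprn_gt0.
Qed.

(** The weak product decomposes values on the ball, whereas [Lambda] works on coefficients;
    agreement on the positive real radius is enough to pass from one to the other. *)
Lemma power_series_inj phi psi C : regular phi -> (forall n, `|psi n| <= C) ->
  (forall r, 0 < r < 1 -> reg_eval phi (r%:A) = reg_eval psi (r%:A)) -> phi = psi.
Proof.
move=> rphi hpsi h; apply/funext => n; apply/eqP; rewrite -subr_eq0; apply/eqP.
have C0 : 0 <= C by apply: le_trans (hpsi 0%N).
have [D hD] := regular_coef_le rphi.
apply: (@power_unique _ _ (fun n => phi n - psi n) (D + C)) => [m|r /andP[r0 r1]].
  apply: le_trans (ler_normB _ _) _; rewrite mulrDl; apply: lerD => //.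
  by apply: le_trans (hpsi m) _; rewrite ler_peMr// exprn_ege1// ler1n.
have q1 : qball (r%:A : H) by rewrite /qball /= norm_real ger0_norm ?(ltW r0)//; lra.
have r01 : 0 < r < 1 by apply/andP; split; lra.
have c1 := rphi _ q1.
have c2 := bounded_regular hpsi q1.
have := h r r01; rewrite !reg_eval_real.
have E a : (fun n => (r%:A : H) ^+ n * a n) = (fun n => r ^+ n *: a n).
  apply/funext => k.
  have -> : (r%:A : H) ^+ k = (r ^+ k)%:A.
    elim: k => [|k IH]; first by rewrite !expr0 scale1r.
    by rewrite !exprS IH -scalerAl -scalerAr mul1r scalerA.
  by rewrite -scalerAl mul1r.
rewrite E in c1; rewrite E in c2 => e.
have hs : series (fun n => r ^+ n *: (phi n - psi n)) @ \oo -->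
    limn (series (fun n => r ^+ n *: phi n)) - limn (series (fun n => r ^+ n *: psi n)).
  rewrite [X in X @ _](_ : _ = fun N => series (fun n => r ^+ n *: phi n) N -
    series (fun n => r ^+ n *: psi n) N); first exact: cvgB.
  by apply/funext => N; rewrite /series /= -sumrB; apply: eq_bigr => k _; rewrite scalerBr.
by rewrite (cvg_lim _ hs)// e subrr.
Qed.

Section WeakBound.
Variables (b phi : nat -> H) (M Omega : R) (f g : nat -> nat -> H) (A B : nat -> R).
Hypotheses (hb : QB b M) (rphi : regular phi).
Hypotheses (A0 : forall j, 0 <= A j) (B0 : forall j, 0 <= B j).
Hypotheses (hf : forall j m, sqs m (f j) <= A j ^+ 2) (hg : forall j m, sqs m (g j) <= B j ^+ 2).
Hypothesis hO : forall J, \sum_(j < J) A j * B j <= Omega.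
Hypothesis hphi : forall q, qball q ->
  series (fun j => reg_eval (star (f j) (g j)) q) n @[n --> \oo] --> reg_eval phi q.

Let w j := A j * B j.
Let be j n := star (f j) (g j) n.
Let w0 j : 0 <= w j. Proof. exact: mulr_ge0. Qed.
Let hbe j n : `|be j n| <= w j. Proof. exact: star_norm_le. Qed.
Let M0 : 0 <= M. Proof. by case: hb. Qed.

Let cw : cvgn (series w).
Proof.
apply: nondecreasing_is_cvgn.
  by apply/nondecreasing_seqP => n; rewrite /series /= big_nat_recr//= lerDl.
by exists Omega => _ [n _ <-]; rewrite /series /= big_mkord.
Qed.
Let tau J := limn (series w) - \sum_(j < J) w j.

Let tau_ge J J' : (J <= J')%N -> \sum_(J <= j < J') w j <= tau J.
Proof.
move=> JJ; rewrite /tau lerBrDl -(big_mkord xpredT w) -(big_cat_nat (leq0n _) JJ)/=.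
apply: (@nondecreasing_cvgn_le _ (series w)) => //.
by apply/nondecreasing_seqP => n; rewrite /series /= big_nat_recr//= lerDl.
Qed.

Let tau0 J : 0 <= tau J. Proof. by have := @tau_ge J J (leqnn J); rewrite big_geq. Qed.

Let tau_cvg : tau J @[J --> \oo] --> 0.
Proof.
rewrite -(subrr (limn (series w))); apply: cvgB; first exact: cvg_cst.
have -> : (fun J => \sum_(j < J) w j) = series w by apply/funext => J; rewrite /series /= big_mkord.
exact: cw.
Qed.

Let tail_le (u : nat -> H) (l : H) K J : 0 <= K -> (forall j, `|u j| <= K * w j) ->
  series u @ \oo --> l -> `|l - \sum_(j < J) u j| <= K * tau J.
Proof.
move=> K0 hu ul.
have h : (fun n => series u n - \sum_(j < J) u j) @ \oo --> l - \sum_(j < J) u j.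
  by apply: cvgB => //; exact: cvg_cst.
apply: (norm_lim_le h); near=> n; have Jn : (J <= n)%N by near: n; exact: nbhs_infty_ge.
rewrite /series /= (big_cat_nat (leq0n _) Jn)/= big_mkord addrC addrK.
apply: le_trans (ler_norm_sum _ _ _) _.
apply: le_trans (ler_sum _ (fun j _ => hu j)) _.
by rewrite -mulr_sumr ler_wpM2l// tau_ge.
Unshelve. all: by end_near. Qed.

(** The coefficientwise sum of the products. It is identified with [phi] below, because both take
    the same values on the real radius. *)
Let psi n := limn (series (be^~ n)).

Let psi_cvg n : series (be^~ n) @ \oo --> psi n.
Proof. exact: (series_dom_cvg (fun j => hbe j n) cw). Qed.

Let psi_tail n J : `|psi n - \sum_(j < J) be j n| <= tau J.
Proof.
have := @tail_le (be^~ n) _ 1 J ler01 _ (@psi_cvg n); rewrite mul1r; apply => j.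
by rewrite mul1r; exact: hbe.
Qed.

Let tauO : tau 0 <= Omega.
Proof.
rewrite /tau big_ord0 subr0; apply: limr_le => //.
by apply: nearW => n; rewrite /series /= big_mkord.
Qed.

Let psi_le n : `|psi n| <= Omega.
Proof. by have := psi_tail n 0; rewrite big_ord0 subr0 => /le_trans; apply. Qed.

Let comb_tail (c : nat -> H) r J : (forall n, `|c n| <= M) -> 0 <= r < 1 ->
  `|limn (series (fun n => c n * (r ^+ n *: psi n))) -
    \sum_(j < J) limn (series (fun n => c n * (r ^+ n *: be j n)))| <= M * tau J / (1 - r).
Proof.
move=> hc r01; have /andP[r0 r1] := r01.
have bd (x : nat -> H) K : (forall n, `|x n| <= K) -> forall n, `|c n * (r ^+ n *: x n)| <= M * K * r ^+ n.
  move=> hx n; rewrite normqM normrZ ger0_norm ?exprn_ge0//.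
  rewrite (_ : M * K * _ = M * (r ^+ n * K)); last by ring.
  by apply: ler_pM; rewrite ?mulr_ge0 ?exprn_ge0// ler_wpM2l ?exprn_ge0.
have c1 := proj1 (geo_tail r01 (bd _ _ psi_le)).
have c2 j := proj1 (geo_tail r01 (bd _ _ (hbe j))).
have hs : series (fun n => c n * (r ^+ n *: (psi n - \sum_(j < J) be j n))) @ \oo -->
   limn (series (fun n => c n * (r ^+ n *: psi n))) -
    \sum_(j < J) limn (series (fun n => c n * (r ^+ n *: be j n))).
  rewrite [X in X @ _](_ : _ = fun N => series (fun n => c n * (r ^+ n *: psi n)) N -
    \sum_(j < J) series (fun n => c n * (r ^+ n *: be j n)) N).
    by apply: cvgB; [exact: c1|apply: cvg_sumr => j _; exact: c2].
  apply/funext => N; rewrite /series /= exchange_big /= -sumrB; apply: eq_bigr => k _.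
  by rewrite scalerBr mulrBr scaler_sumr mulr_sumr.
rewrite -(cvg_lim _ hs)//.
have := proj2 (geo_tail r01 (bd _ _ (fun n => psi_tail n J))) 0%N.
by rewrite big_ord0 subr0 expr0 mul1r.
Qed.

Let phi_psi : phi = psi.
Proof.
apply: (power_series_inj rphi psi_le) => r /andP[r0 r1].
have q1 : qball (r%:A : H) by rewrite /qball /= norm_real ger0_norm ?(ltW r0).
have r01 : 0 <= r < 1 by rewrite ltW.
have h1 := hphi q1.
suff h2 : series (fun j => reg_eval (star (f j) (g j)) r%:A) n @[n --> \oo] --> reg_eval psi r%:A.
  exact: (cvg_unique _ h1 h2).
have M1 : 0 < M + 1 by rewrite ltr_wpDl.
rewrite reg_eval_real; apply/cvgrPdist_le => e e0.
have e1 : 0 < e * (1 - r) by rewrite mulr_gt0// subr_gt0.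
have /cvgrPdist_le/(_ _ e1) := tau_cvg; apply: filterS => J.
rewrite sub0r normrN ger0_norm// => he.
have bd (x : nat -> H) K : (forall n, `|x n| <= K) -> forall n, `|r ^+ n *: x n| <= K * r ^+ n.
  move=> hx n; rewrite normrZ ger0_norm ?exprn_ge0 ?(ltW r0)//.
  by rewrite mulrC ler_wpM2r ?exprn_ge0 ?(ltW r0).
have c1 := proj1 (geo_tail r01 (bd _ _ psi_le)).
have c2 j := proj1 (geo_tail r01 (bd _ _ (hbe j))).
have hs : series (fun n => r ^+ n *: (psi n - \sum_(j < J) be j n)) @ \oo -->
   limn (series (fun n => r ^+ n *: psi n)) -
    \sum_(j < J) limn (series (fun n => r ^+ n *: be j n)).
  rewrite [X in X @ _](_ : _ = fun N => series (fun n => r ^+ n *: psi n) N -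
    \sum_(j < J) series (fun n => r ^+ n *: be j n) N).
    by apply: cvgB; [exact: c1|apply: cvg_sumr => j _; exact: c2].
  apply/funext => N; rewrite /series /= exchange_big /= -sumrB; apply: eq_bigr => k _.
  by rewrite scalerBr scaler_sumr.
rewrite /series /= big_mkord; under eq_bigr do rewrite reg_eval_real.
rewrite -(cvg_lim _ hs)//.
have := proj2 (geo_tail r01 (bd _ _ (fun n => psi_tail n J))) 0%N.
rewrite big_ord0 subr0 expr0 mul1r => /le_trans; apply.
by rewrite ler_pdivrMr ?subr_gt0.
Qed.

Let Lr r j := H2inner (dilate r (be j)) b.

Let Lr_tail r J : 0 <= r < 1 ->
  `|H2inner (dilate r phi) b - \sum_(j < J) Lr r j| <= M * tau J.
Proof.
move=> r01; have hbn n : `|qconj (b n)| <= M by rewrite norm_conj; exact: QB_coef.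
apply: (@tail_le (Lr r)) => // [j|].
  exact: (Lr_le hb r01 (A0 j) (B0 j) (hf j) (hg j)).
have /andP[r0 r1] := r01.
apply/cvgrPdist_le => e e0.
have e1 : 0 < e * (1 - r) / (M + 1) by rewrite divr_gt0 ?mulr_gt0// ?subr_gt0// ltr_wpDl.
have /cvgrPdist_le/(_ _ e1) := tau_cvg; apply: filterS => J'.
rewrite sub0r normrN ger0_norm// ler_pdivlMr ?ltr_wpDl// => he.
rewrite phi_psi /series /= big_mkord; apply: le_trans (comb_tail J' hbn r01) _.
rewrite ler_pdivrMr ?subr_gt0//; apply: le_trans he; rewrite mulrC ler_wpM2l//.
by rewrite lerDl.
Qed.

(** Uniformly in r, the pairing with the dilate of [phi] is within [M * tau J] of the sum over the
    first J products, and each of those has a limit as r tends to 1. For J = 0 the same tail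
    estimate is the norm bound. *)
Lemma weak_bound : Lambda_defined b phi /\ `|Lambda b phi| <= M * Omega.
Proof.
have cL : Lambda_defined b phi.
  apply: left_cauchy => e e0.
  have M1 : 0 < 3 * (M + 1) by rewrite mulr_gt0// ltr_wpDl.
  have e1 : 0 < e / (3 * (M + 1)) by rewrite divr_gt0.
  have /cvgrPdist_le/(_ _ e1) [J _ /(_ J (leqnn J))] := tau_cvg.
  rewrite /= sub0r normrN ger0_norm// ler_pdivlMr// => hJ.
  have e2 : 0 < e / (3 * J.+1%:R) by rewrite divr_gt0// mulr_gt0.
  have hd j := Lr_cauchy hb (A0 j) (B0 j) e2 (hf j) (hg j).
  (* One neighbourhood of 1 serving all of the first J products, by induction on their number. *)
  have [D D0 hD] : exists2 D, 0 < D <= 1 & forall j, (j < J)%N -> forall r s,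
      1 - D < r < 1 -> 1 - D < s < 1 -> `|Lr r j - Lr s j| <= e / (3 * J.+1%:R).
    move: (e / (3 * J.+1%:R)) hd => e' hd.
    elim: (J) => [|n [D /andP[D0 D1] hD]]; first by exists 1; rewrite ?ltr01 ?lexx.
    have [D' /andP[D'0 D'1] hD'] := hd n.
    exists (Num.min D D'); first by rewrite lt_min D0 D'0 ge_min D1.
    move=> j; rewrite ltnS leq_eqVlt => /predU1P[->|jn] r s hr hs.
      have m : Num.min D D' <= D' by rewrite ge_min lexx orbT.
      have hr' : 1 - D' < r < 1 by case/andP: hr => *; apply/andP; split; lra.
      have hs' : 1 - D' < s < 1 by case/andP: hs => *; apply/andP; split; lra.
      exact: hD' r s hr' hs'.
    have m : Num.min D D' <= D by rewrite ge_min lexx.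
    by apply: hD => //; [case/andP: hr|case/andP: hs] => *; apply/andP; split; lra.
  case/andP: D0 => D0 D1; exists D => // r s hr hs.
  have r01 : 0 <= r < 1 by case/andP: hr => *; apply/andP; split; lra.
  have s01 : 0 <= s < 1 by case/andP: hs => *; apply/andP; split; lra.
  have h1 := Lr_tail J r01; have h2 := Lr_tail J s01.
  have h3 : `|\sum_(j < J) Lr r j - \sum_(j < J) Lr s j| <= e / 3.
    rewrite -sumrB; apply: le_trans (ler_norm_sum _ _ _) _.
    apply: (@le_trans _ _ (\sum_(j < J) e / (3 * J.+1%:R))).
      by apply: ler_sum => j _; exact: hD.
    rewrite sumr_const card_ord -[leLHS]mulr_natr.
    rewrite mulrAC ler_pdivrMr ?mulr_gt0//.
    have -> : e / 3 * (3 * J.+1%:R) = e * J.+1%:R by field.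
    by rewrite ler_wpM2l ?(ltW e0)// ler_nat.
  have h4 : M * tau J <= e / 3.
    have : 3 * (M * tau J) <= e by apply: le_trans hJ; have := tau0 J; nra.
    by lra.
  set x := H2inner _ _ in h1 *; set y := H2inner _ _ in h2 *.
  set X := \sum_(j < J) Lr r j in h1 h3; set Y := \sum_(j < J) _ in h2 h3.
  have -> : x - y = (x - X) + (X - Y) - (y - Y) by rewrite addrA subrK opprB addrA subrK.
  apply: le_trans (ler_normB _ _) _; apply: le_trans (lerD (ler_normD _ _) (lexx _)) _.
  by lra.
split=> //; apply: (norm_lim_le cL).
near=> r; have r01 : 0 <= r < 1.
  by apply/andP; split; near: r; [exact: nbhs_left_ge|exact: nbhs_left_lt].
have := Lr_tail 0 r01; rewrite big_ord0 subr0 => /le_trans; apply.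
by rewrite ler_wpM2l.
Unshelve. all: by end_near. Qed.

End WeakBound.
End WeakProductDuality.

(** * Equality of the form norm and the weak dual norm *)

Section NormEquality.
Variable R : realType.
Local Notation H := (quat R).
Implicit Types (b f g h phi : nat -> H) (M r s A B C : R).

Lemma ereal_le_addgt0 (x : \bar R) (y w : R) : (0 <= w) -> 
  (forall e : R, 0 < e -> (x <= (y * (w + e))%:E)%E) -> (x <= (y * w)%:E)%E.
Proof.
move=> w0 h; have [y0|y0] := leP y 0.
  have := h 1 ltr01; move=> /le_trans; apply; rewrite lee_fin; nra.
apply/lee_addgt0Pr => e e0; have := h (e / y) (divr_gt0 e0 y0).
by rewrite mulrDr [y * (e / y)]mulrC divfK// gt_eqF.
Qed.

Lemma Lambda_absE b phi : Lambda_defined b phi -> Lambda_abs b phi = `|Lambda b phi|%:E.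
Proof. by move=> d; rewrite /Lambda_abs; case: asboolP. Qed.

Lemma weak_norm_ge0 phi : (0 <= weak_norm phi)%E.
Proof.
apply: le_ereal_inf_tmp => _ [f [g [_ _ _ ->]]].
by apply: nneseries_ge0 => n _ _; apply: mule_ge0; exact: l2norm_ge0.
Qed.

Lemma weak_product_bound b M phi : QB b M -> weak_product phi ->
  Lambda_defined b phi /\ (`|Lambda b phi|%:E <= M%:E * weak_norm phi)%E.
Proof.
move=> hb [rphi].
have := weak_norm_ge0 phi; case E : (weak_norm phi) => [w| |]// w0 _.
have key e : 0 < e -> Lambda_defined b phi /\ `|Lambda b phi| <= M * (w + e).
  move=> e0; have : (weak_norm phi < (w + e)%:E)%E by rewrite E lte_fin ltrDl.
  move/ereal_inf_lt => [_ [f [g [hf hg hphi ->]]] hlt].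
  have hA j : exists A, [/\ 0 <= A, l2norm (f j) = A%:E & forall n, sqs n (f j) <= A ^+ 2].
    by apply: l2P; case: (hf j).
  have hB j : exists A, [/\ 0 <= A, l2norm (g j) = A%:E & forall n, sqs n (g j) <= A ^+ 2].
    by apply: l2P; case: (hg j).
  have [A hA'] := choice hA; have [B hB'] := choice hB.
  apply: (@weak_bound _ b phi M _ f g A B hb rphi) => //.
  - by move=> j; case: (hA' j).
  - by move=> j; case: (hB' j).
  - by move=> j m; case: (hA' j).
  - by move=> j m; case: (hB' j).
  move=> J; rewrite -lee_fin; apply: le_trans (ltW hlt).
  rewrite -sumEFin -(big_mkord xpredT (fun j => (A j * B j)%:E)).
  have -> : \sum_(0 <= j < J) (A j * B j)%:E = \sum_(0 <= j < J) (l2norm (f j) * l2norm (g j))%E.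
    by apply: eq_bigr => j _; case: (hA' j) => _ -> _; case: (hB' j) => _ -> _.
  by apply: nneseries_lim_ge => n _ _; apply: mule_ge0; exact: l2norm_ge0.
split; first by case: (key 1 ltr01).
rewrite -EFinM; apply: ereal_le_addgt0 => // e e0.
by rewrite lee_fin; case: (key e e0).
Qed.

Lemma weak_dual_le b M : QB b M -> (weak_dual_norm b <= M%:E)%E.
Proof.
move=> hb; have M0 := proj1 hb.
apply: ge_ereal_sup => _ [phi [wphi _] <-].
have [d hle] := weak_product_bound hb wphi.
rewrite Lambda_absE//; case: wphi hle => _.
have := weak_norm_ge0 phi; case: (weak_norm phi) => [w| |]// w0 _.
rewrite -EFinM lee_fin => hle.
(* The inverse of 0 is +oo here. A zero weak norm forces the pairing to vanish, and the quotient is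
   then 0 * +oo = 0. *)
have [w00|wn0] := eqVneq w 0.
  have -> : `|Lambda b phi| = 0 by apply: le_anti; rewrite normr_ge0 andbT (le_trans hle)// w00 mulr0.
  by rewrite mul0e lee_fin.
by rewrite ediv_le ?lee_fin// lt_neqAle eq_sym wn0.
Qed.

Lemma Lambda_in_weak_dual_of_QB b M : QB b M -> Lambda_in_weak_dual b.
Proof.
move=> hb; have d phi : weak_product phi -> Lambda_defined b phi.
  by move=> /(weak_product_bound hb) [].
have [rb lb] : (forall n, `|b n| <= M) /\ 0 <= M by split; [move=> n; exact: QB_coef|case: hb].
have cs phi r : weak_product phi -> 0 < r < 1 ->
    cvgn (series (fun n => qconj (b n) * dilate r phi n)).
  move=> [rphi _] /andP[r0 r1].
  (* At the midpoint of r and 1 the terms of [phi] are bounded, which leaves a geometric series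
     whose ratio is r divided by that midpoint. *)
  have q1 : qball (((r + 1) / 2)%:A : H) by rewrite /qball /= norm_real ger0_norm; lra.
  have := rphi _ q1 => /cvg_series_cvg_0 h0.
  have [C [_ hC]] := cvg_seq_bounded (cvgP _ h0).
  have CC : C < C + 1 by rewrite ltrDl.
  have rho : 0 <= r / ((r + 1) / 2) < 1.
    by rewrite divr_ge0 ?ltr_pdivrMr//=; lra.
  apply: (proj1 (@geo_tail _ _ _ (M * (C + 1)) _ rho _)) => n.
  have /= := hC (C + 1) CC n Logic.I.
  rewrite normqM normqX norm_real ger0_norm; last by lra.
  rewrite normqM norm_conj /dilate normrZ ger0_norm ?exprn_ge0 ?(ltW r0)// => h.
  have p0 : 0 < ((r + 1) / 2) ^+ n by rewrite exprn_gt0//; lra.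
  rewrite expr_div_n.
  rewrite (_ : M * (C + 1) * _ = M * (r ^+ n * ((C + 1) / ((r + 1) / 2) ^+ n))); last by ring.
  apply: ler_pM; rewrite ?mulr_ge0 ?exprn_ge0 ?(ltW r0)//.
  by rewrite ler_wpM2l ?exprn_ge0 ?(ltW r0)// ler_pdivlMr// mulrC.
split=> //.
- move=> phi psi wphi wpsi.
  suff h : H2inner (dilate r (fun n => phi n + psi n)) b @[r --> 1^'-] -->
      Lambda b phi + Lambda b psi by rewrite {1}/Lambda (cvg_lim _ h).
  have hD : H2inner (dilate r phi) b + H2inner (dilate r psi) b @[r --> 1^'-] -->
      Lambda b phi + Lambda b psi by apply: cvgD; exact: d.
  apply: (cvg_trans _ hD); apply: near_eq_cvg.
  near=> r; have r01 : 0 < r < 1.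
    by apply/andP; split; near: r; [exact: nbhs_left_gt|exact: nbhs_left_lt].
  have h : series (fun n => qconj (b n) * dilate r phi n) N +
      series (fun n => qconj (b n) * dilate r psi n) N @[N --> \oo] -->
      H2inner (dilate r phi) b + H2inner (dilate r psi) b by apply: cvgD; exact: cs.
  rewrite /H2inner /=; symmetry; apply: cvg_lim => //; apply: (cvg_trans _ h).
  apply: near_eq_cvg; near=> N; rewrite /series /= -big_split /=.
  by apply: eq_bigr => k _; rewrite /dilate scalerDr mulrDr.
- move=> phi c wphi.
  suff h : H2inner (dilate r (fun n => phi n * c)) b @[r --> 1^'-] -->
      Lambda b phi * c by rewrite {1}/Lambda (cvg_lim _ h).
  have mulc (T : Type) (F : set_system T) (FF : Filter F) (u : T -> H) (l : H) :
      u @ F --> l -> (fun x => u x * c) @ F --> l * c.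
    move=> ul; apply/cvgrPdist_le => e e0.
    have c1 : 0 < `|c| + 1 by rewrite ltr_wpDl.
    have /cvgrPdist_le/(_ _ (divr_gt0 e0 c1)) := ul; apply: filterS => x hx.
    rewrite -mulrBl normqM; apply: (@le_trans _ _ (e / (`|c| + 1) * (`|c| + 1))).
      by apply: ler_pM => //; rewrite lerDl.
    by rewrite divfK// gt_eqF.
  have hD : H2inner (dilate r phi) b * c @[r --> 1^'-] --> Lambda b phi * c.
    by apply: mulc; exact: d.
  apply: (cvg_trans _ hD); apply: near_eq_cvg.
  near=> r; have r01 : 0 < r < 1.
    by apply/andP; split; near: r; [exact: nbhs_left_gt|exact: nbhs_left_lt].
  have h : series (fun n => qconj (b n) * dilate r phi n) N * c @[N --> \oo] -->
      H2inner (dilate r phi) b * c by apply: mulc; exact: cs.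
  rewrite /H2inner /=; symmetry; apply: cvg_lim => //; apply: (cvg_trans _ h).
  apply: near_eq_cvg; near=> N; rewrite /series /= mulr_suml.
  by apply: eq_bigr => k _; rewrite /dilate scalerAl mulrA.
- by apply: le_lt_trans (ltry M); exact: weak_dual_le.
Unshelve. all: by end_near. Qed.

Lemma reg_eval_0 q : reg_eval (fun=> 0 : H) q = 0.
Proof.
apply: cvg_lim => //; have := @series_support R (fun n => q ^+ n * 0) 0.
by rewrite big_ord0; apply => k _; rewrite mulr0.
Qed.

Lemma l2norm0 : l2norm (fun=> 0 : H) = 0%E.
Proof. by rewrite (@l2norm_support _ _ 0)// /sqs big_ord0 sqrtr0. Qed.

(** A single product is an admissible decomposition once padded with zero terms. *)
Lemma weak_norm_star f g : H2 f -> H2 g ->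
  weak_product (star f g) /\ (weak_norm (star f g) <= l2norm f * l2norm g)%E.
Proof.
move=> hf hg; have [A [A0 fA hA]] := l2P (proj2 hf); have [B [B0 gB hB]] := l2P (proj2 hg).
have hle : (weak_norm (star f g) <= l2norm f * l2norm g)%E.
  apply: ereal_inf_lbound.
  have z0 : H2 (fun=> 0 : H).
    by apply: H2_l2; rewrite /l2 /= l2norm0.
  exists (fun j => if j == 0%N then f else fun=> 0), (fun j => if j == 0%N then g else fun=> 0).
  split; [by case|by case| |].
    move=> q q1; apply: cvg_near_cst; exists 1%N => // n /= n1.
    rewrite /series /= big_ltn// big1_seq ?addr0// => j /andP[_].
    rewrite mem_index_iota => /andP[j0 _]; rewrite gtn_eqF//.
    rewrite (_ : star _ _ = fun=> 0) ?reg_eval_0//.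
    by apply/funext => k; rewrite /star big1// => i _; rewrite mul0r.
  rewrite nneseries_recl//; last by move=> k _; apply: mule_ge0; exact: l2norm_ge0.
  rewrite /= eseries0 ?adde0// => k; rewrite lt0n => k0 _.
  by rewrite (negbTE k0) l2norm0 mul0e.
split=> //; split; last by apply: le_lt_trans hle _; rewrite fA gB ltry.
by apply: (@bounded_regular _ _ (A * B)) => n; exact: star_norm_le.
Qed.

Lemma Lambda_abs_ge0 b phi : (0 <= Lambda_abs b phi)%E.
Proof. by rewrite /Lambda_abs; case: ifP => // _; rewrite lee_fin. Qed.

Lemma form_norm_le_weak b M : 0 <= M -> (weak_dual_norm b <= M%:E)%E ->
  (form_norm b <= M%:E)%E.
Proof.
move=> M0 hM; apply: ge_ereal_sup => _ [f [g [hf hg /eqP f0 /eqP g0 ->]]].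
have [A [A0 fA hA]] := l2P (proj2 hf); have [B [B0 gB hB]] := l2P (proj2 hg).
have := l2norm_gt0 f0; have := l2norm_gt0 g0; rewrite fA gB !lte_fin => Bp Ap.
rewrite -EFinM ediv_le ?mulr_gt0//.
(* The dual norm only ranges over nonzero functions, so a vanishing product is treated on its own:
   it pairs to 0. *)
have [s0|sn0] := pselect (star f g = fun=> 0).
  have e : (fun r => H2inner (dilate r (star f g)) b) = fun=> 0.
    apply/funext => r; apply: cvg_lim => //; have := @series_support R (fun n => qconj (b n) * dilate r (star f g) n) 0.
    by rewrite big_ord0; apply => k _; rewrite s0 /dilate scaler0 mulr0.
  rewrite Lambda_absE; last by rewrite /Lambda_defined e; exact: is_cvg_cst.
  by rewrite /Lambda e lim_cst// normr0 lee_fin !mulr_ge0// ltW.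
have [wp wle] := weak_norm_star hf hg.
have : (Lambda_abs b (star f g) / weak_norm (star f g) <= M%:E)%E.
  apply: le_trans hM; apply: ereal_sup_ubound; exists (star f g) => //.
  by split => //; apply/eqP.
have := weak_norm_ge0 (star f g); rewrite fA gB -EFinM in wle.
case: (weak_norm (star f g)) wle => [w| |]//; rewrite !lee_fin => wAB w0.
(* A nonzero pairing over a zero weak norm would make the quotient +oo, against the bound [M]. *)
have [->|wn0] := eqVneq w 0.
  have := Lambda_abs_ge0 b (star f g); rewrite le_eqVlt => /predU1P[<- _|xp].
    by rewrite lee_fin !mulr_ge0// ltW.
  by rewrite inver eqxx gt0_muley// leye_eq.
have wp' : 0 < w by rewrite lt_neqAle eq_sym wn0.
rewrite ediv_le// => /le_trans; apply; rewrite lee_fin; exact: ler_wpM2l.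
Qed.

(** For finitely supported sequences the pairing with the dilates is a polynomial in r, so its limit
    at 1 is the finite form itself. *)
Lemma QB_of_form b M : 0 <= M -> (form_norm b <= M%:E)%E -> QB b M.
Proof.
move=> M0 hM; split=> // n f g.
rewrite -/(hform n b f g).
pose F := trunc n f; pose G := trunc n g.
have F0 k : (n <= k)%N -> F k = 0 by exact: trunc_supp.
have G0 k : (n <= k)%N -> G k = 0 by exact: trunc_supp.
have lF := l2norm_support F0; have lG := l2norm_support G0.
have fE : hform n b f g = hform n b F G.
  by apply: eq_bigr => j _; apply: eq_bigr => k _; rewrite /F /G !truncE.
have e0 : 0 <= M * Num.sqrt (sqs n f) * Num.sqrt (sqs n g) by rewrite !mulr_ge0 ?sqrtr_ge0.
have [Fz|Fnz] := pselect (F = fun=> 0).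
  by rewrite fE /hform big1 ?normr0// => j _; rewrite big1// => k _; rewrite Fz mulr0 mul0r.
have [Gz|Gnz] := pselect (G = fun=> 0).
  by rewrite fE /hform big1 ?normr0// => j _; rewrite big1// => k _; rewrite Gz mulr0.
have hF : H2 F by apply: H2_l2; rewrite /l2 /= lF ltry.
have hG : H2 G by apply: H2_l2; rewrite /l2 /= lG ltry.
have Ap := l2norm_gt0 Fnz; have Bp := l2norm_gt0 Gnz.
rewrite lF lte_fin in Ap; rewrite lG lte_fin in Bp.
have hc : H2inner (dilate r (star F G)) b @[r --> 1^'-] --> hform n b f g.
  have -> : (fun r => H2inner (dilate r (star F G)) b) =
      fun r => \sum_(k < n + n) r ^+ k *: (qconj (b k) * star F G k).
    apply/funext => r; apply: cvg_lim => //.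
    rewrite (_ : \sum_(k < n + n) _ = \sum_(k < n + n) (qconj (b k) * dilate r (star F G) k)).
      by apply: series_support => k hk; rewrite /dilate (@star_support _ _ _ n) ?scaler0 ?mulr0.
    by apply: eq_bigr => k _; rewrite /dilate scalerAr.
  rewrite form_trunc; apply: cvg_sumr => k _.
  have hk : (fun r : R => r ^+ k) @ (1 : R)^'- --> (1 : R).
    rewrite -[X in _ --> X](expr1n R k); apply: cvg_at_left_filter.
    exact: exprn_continuous.
  rewrite -[X in _ --> X]scale1r; exact: cvgZl.
have : (Lambda_abs b (star F G) / (l2norm F * l2norm G) <= M%:E)%E.
  by apply: le_trans hM; apply: ereal_sup_ubound; exists F, G; split => //; exact/eqP.
rewrite lF lG -EFinM ediv_le ?mulr_gt0// Lambda_absE; last by apply/cvg_ex; eexists; exact: hc.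
rewrite lee_fin /Lambda (cvg_lim _ hc)// mulrA.
by rewrite /F /G !sqs_trunc.
Qed.

End NormEquality.

(** * Integrals of bivariate polynomials over discs *)

Section DiscIntegral.
Variable R : realType.
Local Notation mu := (@lebesgue_measure R).
Local Notation mu2 := (mu \x mu)%E.
Local Notation A := {poly {poly R}}.
Implicit Types (p q : A) (rho x y : R).

Definition disc rho : set (R * R) := [set z | z.1 ^+ 2 + z.2 ^+ 2 < rho ^+ 2].

(** In [{poly {poly R}}] the outer variable stands for x and the inner one for y; thus ['X] is x and
    ['X%:P] is y. *)
Definition ev p (z : R * R) : R := p.[z.1%:P].[z.2].

Definition Jd rho p : R := \int[mu2]_(z in disc rho) ev p z.

Definition Dx p : A := p^`().
Definition Dy p : A := swapXY (swapXY p)^`().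
Definition cst2 (c : R) : A := c%:P%:P.
(** The weight rho^2 - x^2 - y^2. It vanishes on the bounding circle, which removes every boundary
    term from the integrations by parts. *)
Definition wt rho : A := cst2 (rho ^+ 2) - 'X * 'X - 'X%:P * 'X%:P.

Lemma evD p q z : ev (p + q) z = ev p z + ev q z.
Proof. by rewrite /ev !hornerD. Qed.
Lemma evN p z : ev (- p) z = - ev p z.
Proof. by rewrite /ev !hornerN. Qed.
Lemma evB p q z : ev (p - q) z = ev p z - ev q z.
Proof. by rewrite evD evN. Qed.
Lemma evM p q z : ev (p * q) z = ev p z * ev q z.
Proof. by rewrite /ev !hornerM. Qed.
Lemma evC c z : ev (cst2 c) z = c.
Proof. by rewrite /ev !hornerC. Qed.
Lemma evX z : ev 'X z = z.1.
Proof. by rewrite /ev hornerX hornerC. Qed.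
Lemma evY z : ev 'X%:P z = z.2.
Proof. by rewrite /ev hornerC hornerX. Qed.
Lemma ev0 z : ev 0 z = 0.
Proof. by rewrite /ev !horner0. Qed.
Lemma ev1 z : ev 1 z = 1.
Proof. by rewrite /ev -[1]polyC1 hornerC -[1]polyC1 hornerC. Qed.
Lemma ev_sum I (r : seq I) (P : pred I) (F : I -> A) z :
  ev (\sum_(i <- r | P i) F i) z = \sum_(i <- r | P i) ev (F i) z.
Proof. by apply: (big_morph (ev^~ z)) => [p q|]; rewrite ?evD ?ev0. Qed.
Lemma ev_wt rho z : ev (wt rho) z = rho ^+ 2 - z.1 ^+ 2 - z.2 ^+ 2.
Proof. by rewrite /wt !evB !evM evC evX evY !expr2. Qed.

Lemma DxD p q : Dx (p + q) = Dx p + Dx q. Proof. exact: derivD. Qed.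
Lemma DxN p : Dx (- p) = - Dx p. Proof. exact: derivN. Qed.
Lemma DxM p q : Dx (p * q) = Dx p * q + p * Dx q. Proof. exact: derivM. Qed.
Lemma DxC c : Dx (cst2 c) = 0. Proof. exact: derivC. Qed.
Lemma DxX : Dx 'X = 1. Proof. exact: derivX. Qed.
Lemma DxY : Dx 'X%:P = 0. Proof. exact: derivC. Qed.
Lemma DyD p q : Dy (p + q) = Dy p + Dy q.
Proof. by rewrite /Dy raddfD derivD raddfD. Qed.
Lemma DyN p : Dy (- p) = - Dy p.
Proof. by rewrite /Dy raddfN derivN raddfN. Qed.
Lemma DyM p q : Dy (p * q) = Dy p * q + p * Dy q.
Proof. by rewrite /Dy rmorphM derivM rmorphD !rmorphM /= !swapXYK. Qed.
Lemma DyX : Dy 'X = 0.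
Proof. by rewrite /Dy swapXY_X derivC raddf0. Qed.
Lemma DyY : Dy 'X%:P = 1.
Proof. by rewrite /Dy swapXY_Y derivX rmorph1. Qed.
Lemma DyC c : Dy (cst2 c) = 0.
Proof. by rewrite /Dy /cst2 swapXY_polyC map_polyC derivC raddf0. Qed.
Lemma DxB p q : Dx (p - q) = Dx p - Dx q. Proof. by rewrite DxD DxN. Qed.
Lemma DyB p q : Dy (p - q) = Dy p - Dy q. Proof. by rewrite DyD DyN. Qed.
Lemma Dx0 : Dx 0 = 0. Proof. exact: deriv0. Qed.
Lemma Dx1 : Dx 1 = 0. Proof. by rewrite -[1]polyC1; exact: derivC. Qed.
Lemma Dy0 : Dy 0 = 0. Proof. by rewrite /Dy !raddf0. Qed.
Lemma Dy1 : Dy 1 = 0. Proof. by rewrite /Dy rmorph1 (Dx1 : (1 : A)^`() = 0) raddf0. Qed.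

Lemma measurable_disc rho : measurable (disc rho).
Proof.
have mf : measurable_fun setT (fun z : R * R => z.1 ^+ 2 + z.2 ^+ 2).
  by apply: measurable_funD; apply: measurable_funX; [exact: measurable_fst|exact: measurable_snd].
have := mf measurableT _ (measurable_itv `]-oo, (rho ^+ 2)[).
by rewrite setTI; congr (measurable _); apply/seteqP; split => z /=; rewrite in_itv.
Qed.

Lemma horner_continuous (c : {poly R}) : continuous (fun y => c.[y]).
Proof.
move=> y; apply: differentiable_continuous.
exact/derivable1_diffP/derivable_horner.
Qed.

Lemma ev_measurable p : measurable_fun setT (ev p).
Proof.
elim/poly_ind: p => [|p c IH].
  rewrite [X in measurable_fun _ X](_ : _ = cst 0); first exact: measurable_cst.
  by apply/funext => z; rewrite ev0.
rewrite [X in measurable_fun _ X](_ : _ = fun z => ev p z * z.1 + c.[z.2]); last first.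
  by apply/funext => z; rewrite /ev hornerMXaddC hornerD hornerM hornerC.
apply: measurable_funD; first by apply: measurable_funM => //; exact: measurable_fst.
apply: (@measurableT_comp _ _ _ _ _ _ (fun y => c.[y])); last exact: measurable_snd.
by apply: continuous_measurable_fun; exact: horner_continuous.
Qed.

Lemma horner_bound (c : {poly R}) : exists C : R, forall y, `|y| <= 1 -> `|c.[y]| <= C.
Proof.
elim/poly_ind: c => [|p c [C hC]]; first by exists 0 => y _; rewrite horner0 normr0.
exists (C + `|c|) => y y1; rewrite hornerMXaddC.
apply: le_trans (ler_normD _ _) _; rewrite lerD2r normrM.
by rewrite -[C]mulr1 ler_pM// hC.
Qed.

Lemma ev_bound p : exists C : R, forall z, `|z.1| <= 1 -> `|z.2| <= 1 -> `|ev p z| <= C.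
Proof.
elim/poly_ind: p => [|p c [C hC]]; first by exists 0 => z _ _; rewrite ev0 normr0.
have [D hD] := horner_bound c; exists (C + D) => z z1 z2.
rewrite /ev hornerMXaddC hornerD hornerM hornerC.
apply: le_trans (ler_normD _ _) _; apply: lerD; last exact: hD.
by rewrite normrM -[C]mulr1 ler_pM// hC.
Qed.

Lemma disc_le1 rho z : 0 < rho <= 1 -> disc rho z -> `|z.1| <= 1 /\ `|z.2| <= 1.
Proof.
move=> /andP[r0 r1] /= h; have rr : rho ^+ 2 <= 1 by rewrite exprn_ile1// ltW.
rewrite /disc /= in h; have [a b] := (sqr_ge0 z.1, sqr_ge0 z.2).
by split; rewrite -(ler_pXn2r (ltn0Sn 1)) ?nnegrE// real_normK ?num_real// expr1n; lra.
Qed.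

Lemma disc_finite rho : 0 < rho <= 1 -> (mu2 (disc rho) <= 4%:E)%E.
Proof.
move=> r01; have sub : disc rho `<=` `[-1, 1]%classic `*` `[-1, 1]%classic.
  by move=> z /(disc_le1 r01) []; rewrite !ler_norml /= !in_itv.
apply: (@le_trans _ _ (mu2 (`[-1, 1]%classic `*` `[-1, 1]%classic))).
  by apply: le_measure => //; rewrite inE; [exact: measurable_disc|exact: measurableX].
have m1 : mu `[-1, 1]%classic = 2%:E.
  by rewrite lebesgue_measure_itv /= lte_fin ifT; [rewrite -EFinD; congr EFin; ring|lra].
by rewrite product_measure1E// [X in (X * _)%E]m1 [X in (_ * X)%E]m1 -EFinM lee_fin; lra.
Qed.

Lemma ev_integrable rho p : 0 < rho <= 1 -> mu2.-integrable (disc rho) (EFin \o ev p).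
Proof.
move=> r01; apply: measurable_bounded_integrable.
- exact: measurable_disc.
- by apply: le_lt_trans (disc_finite r01) (ltry _).
- exact: measurable_funTS (ev_measurable p).
- have [C hC] := ev_bound p; exists C; split; first exact: num_real.
  move=> M CM z /(disc_le1 r01) [z1 z2] /=.
  by apply: ltW; apply: le_lt_trans CM; exact: hC.
Qed.

Section Linearity.
Variables (rho : R) (r01 : 0 < rho <= 1).
Local Notation J := (Jd rho).

Lemma JD p q : J (p + q) = J p + J q.
Proof.
rewrite /Jd -RintegralD; [|exact: measurable_disc|exact: ev_integrable|exact: ev_integrable].
by apply: eq_Rintegral => z _; rewrite evD.
Qed.

Lemma JCM c p : J (cst2 c * p) = c * J p.
Proof.
rewrite /Jd -RintegralZl; [|exact: measurable_disc|exact: ev_integrable].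
by apply: eq_Rintegral => z _; rewrite evM evC.
Qed.

Lemma J0 : J 0 = 0.
Proof. by rewrite -[0](mul0r 0) -[X in X * _](_ : cst2 0 = 0) ?JCM ?mul0r// /cst2 !polyC0. Qed.

Lemma JN p : J (- p) = - J p.
Proof.
have := JD p (- p); rewrite subrr J0 => /eqP; rewrite eq_sym addr_eq0 => /eqP ->.
by rewrite opprK.
Qed.

Lemma JB p q : J (p - q) = J p - J q.
Proof. by rewrite JD JN. Qed.

Lemma J_sum I (r : seq I) (P : pred I) (F : I -> A) :
  J (\sum_(i <- r | P i) F i) = \sum_(i <- r | P i) J (F i).
Proof. by apply: (big_morph J) => [p q|]; [exact: JD|exact: J0]. Qed.

Lemma J_ge0 p : (forall z, disc rho z -> 0 <= ev p z) -> 0 <= J p.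
Proof. by move=> h; exact: Rintegral_ge0. Qed.

Lemma le_J p q : (forall z, disc rho z -> ev p z <= ev q z) -> J p <= J q.
Proof.
move=> h; rewrite -subr_ge0 -JB; apply: J_ge0 => z /h.
by rewrite evB subr_ge0.
Qed.

Lemma J_CS p q s : (forall z, disc rho z -> 0 <= ev s z) ->
  J (p * q * s) ^+ 2 <= J (p * p * s) * J (q * q * s).
Proof.
move=> s0; apply: quad_CS => [|l].
  by apply: J_ge0 => z hz; rewrite !evM mulr_ge0 ?s0// -expr2 sqr_ge0.
rewrite -[2 * l * J _]JCM -[l ^+ 2 * J _]JCM -JB -JD.
apply: J_ge0 => z hz; rewrite evD evB !(evM, evC).
have -> : ev p z * ev p z * ev s z - 2 * l * (ev p z * ev q z * ev s z) +
  l ^+ 2 * (ev q z * ev q z * ev s z) = (ev p z - l * ev q z) ^+ 2 * ev s z by ring.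
by rewrite mulr_ge0 ?sqr_ge0// s0.
Qed.

(** A square of side 1/8 fits in the disc. This bound and the upper bound 4 stand in for the area pi
    rho^2 in the estimates. *)
Lemma J1_ge : (1 / 4 <= rho) -> 1 / 64 <= J 1.
Proof.
move=> r4; rewrite /Jd.
have -> : \int[mu2]_(z in disc rho) ev 1 z = \int[mu2]_(z in disc rho) 1.
  by apply: eq_Rintegral => z _; rewrite ev1.
rewrite Rintegral_cst; last exact: measurable_disc.
rewrite [leRHS]mul1r -lee_fin fineK; last first.
  by rewrite ge0_fin_numE//; apply: le_lt_trans (disc_finite r01) (ltry _).
apply: (@le_trans _ _ (mu2 (`[0, 1 / 8]%classic `*` `[0, 1 / 8]%classic))).
  have m1 : mu `[0, 1 / 8]%classic = (1 / 8)%:E.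
    by rewrite lebesgue_measure_itv /= lte_fin ifT; [rewrite -EFinD; congr EFin; ring|lra].
  by rewrite product_measure1E// [X in (X * _)%E]m1 [X in (_ * X)%E]m1 -EFinM lee_fin; lra.
apply: le_measure; rewrite ?inE; [exact: measurableX|exact: measurable_disc|].
move=> z [/=]; rewrite !in_itv /= => /andP[a1 a2] /andP[b1 b2].
rewrite /disc /=; have : rho ^+ 2 >= (1/4) ^+ 2 by rewrite ler_pXn2r ?nnegrE//; lra.
by move=> h; nra.
Qed.

Lemma J1_le : J 1 <= 4.
Proof.
rewrite /Jd.
have -> : \int[mu2]_(z in disc rho) ev 1 z = \int[mu2]_(z in disc rho) 1.
  by apply: eq_Rintegral => z _; rewrite ev1.
rewrite Rintegral_cst; last exact: measurable_disc.
rewrite [leLHS]mul1r -lee_fin fineK; first exact: disc_finite.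
by rewrite ge0_fin_numE//; apply: le_lt_trans (disc_finite r01) (ltry _).
Qed.

Lemma ev_derive1 p y : forall x : R, is_derive x (1:R) (fun t => ev p (t, y)) (ev p^`() (x, y)).
Proof.
move=> x; have E q t : ev q (t, y) = (map_poly (horner_eval y) q).[t].
  by rewrite /ev /= -{2}[t](hornerC t y) horner_map.
rewrite E -deriv_map (_ : (fun t => _) = horner (map_poly (horner_eval y) p)).
  exact: is_derive_poly.
by apply/funext => t; rewrite E.
Qed.

Lemma ev_swap p z : ev (swapXY p) z = ev p (z.2, z.1).
Proof. by case: z => a b; rewrite /ev horner2_swapXY. Qed.

Lemma ev_cont1 p y : continuous (fun t => ev p (t, y)).
Proof.
move=> x; apply: differentiable_continuous; apply/derivable1_diffP.
by have [] := ev_derive1 p y x.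
Qed.

Lemma section_integral (c : R -> R) x : continuous c ->
  (\int[mu]_y (if (x ^+ 2 + y ^+ 2 < rho ^+ 2)%R then (c y)%:E else 0) =
  (if x ^+ 2 < rho ^+ 2 then
    rint (- Num.sqrt (rho ^+ 2 - x ^+ 2)) (Num.sqrt (rho ^+ 2 - x ^+ 2)) c else 0)%R%:E)%E.
Proof.
move=> cc; case: ltP => [xr|rx]; last first.
  rewrite integral0_eq// => y _; case: ltP => // h; exfalso.
  by move: h; apply/negP; rewrite -leNgt (le_trans rx)// lerDl sqr_ge0.
set s := Num.sqrt _.
have d0 : 0 <= rho ^+ 2 - x ^+ 2 by rewrite subr_ge0 ltW.
have s0 : 0 <= s by exact: sqrtr_ge0.
have ss : s ^+ 2 = rho ^+ 2 - x ^+ 2 by rewrite sqr_sqrtr.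
pose I : set R := `]- s, s[%classic.
transitivity (\int[mu]_y ((EFin \o c) \_ I) y)%E.
  apply: eq_integral => /= y _; rewrite patchE; congr (if _ then _ else _).
  move: (y : R) => {}y.
  apply/idP/idP => [h|]; last first.
    rewrite inE /I /= in_itv /= => /andP[h1 h2]; nra.
  rewrite inE /I /= in_itv /= -ltr_norml -(ltr_pXn2r (ltn0Sn 1)) ?nnegrE//.
  by rewrite real_normK ?num_real// ss; lra.
rewrite -integral_mkcond /I.
rewrite (@integral_itv_bndo_bndc _ (BRight (- s)) s (EFin \o c)); last first.
  apply/measurable_EFinP; apply: measurable_funTS; exact: continuous_measurable_fun.
rewrite integral_itv_obnd_cbnd; last first.
  apply/measurable_EFinP; apply: measurable_funTS; exact: continuous_measurable_fun.
by rewrite -rint_EFin.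
Qed.

Lemma patch_disc (p : A) : ((EFin \o ev p) \_ (disc rho)) =
  fun z => if z.1 ^+ 2 + z.2 ^+ 2 < rho ^+ 2 then (ev p z)%:E else 0%E.
Proof.
apply/funext => z; rewrite patchE; congr (if _ then _ else _).
by apply/idP/idP; rewrite inE.
Qed.

Lemma patch_integrable p : mu2.-integrable setT ((EFin \o ev p) \_ (disc rho)).
Proof.
have h := ev_integrable p r01. exact: (proj1 (@integrable_mkcond _ _ _ mu2 (disc rho) (EFin \o ev p) (measurable_disc rho)) h).
Qed.

Lemma rho2 x : x ^+ 2 < rho ^+ 2 ->
  rho ^+ 2 - x ^+ 2 - Num.sqrt (rho ^+ 2 - x ^+ 2) ^+ 2 = 0.
Proof. by move=> h; rewrite sqr_sqrtr ?subrr// subr_ge0 ltW. Qed.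

(** The weight vanishes at both ends of every chord parallel to the x axis, so each inner integral
    is zero by the fundamental theorem. *)
Lemma J_Dx p : J (Dx (wt rho * p)) = 0.
Proof.
rewrite /Jd /Rintegral integral_mkcond -integral21_prod_meas1; last exact: patch_integrable.
rewrite integral0_eq// => y _; rewrite /fubini_G patch_disc /=.
rewrite (_ : (fun x => _) = fun x => if y ^+ 2 + x ^+ 2 < rho ^+ 2 then
  (ev (Dx (wt rho * p)) (x, y))%:E else 0%E); last by apply/funext => x; rewrite addrC.
rewrite (@section_integral (fun x => ev (Dx (wt rho * p)) (x, y))); last exact: ev_cont1.
case: ltP => // yr.
set s := Num.sqrt _.
have -> : rint (- s) s (fun x => ev (Dx (wt rho * p)) (x, y)) =
    ev (wt rho * p) (s, y) - ev (wt rho * p) (- s, y).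
  apply: (@rint_FTC _ _ (fun x => ev (wt rho * p) (x, y))).
  - by rewrite ge0_cp// sqrtr_ge0.
  - exact: ev_cont1.
  - by move=> x _; exact: ev_derive1.
rewrite !evM !ev_wt /= sqrrN (addrAC _ _ (- y ^+ 2)).
by rewrite rho2// !mul0r subrr.
Qed.

Lemma J_Dy p : J (Dy (wt rho * p)) = 0.
Proof.
rewrite /Jd /Rintegral integral_mkcond -integral12_prod_meas1; last exact: patch_integrable.
rewrite integral0_eq// => x _; rewrite /fubini_F patch_disc /=.
have cy q : continuous (fun y => ev q (x, y)).
  rewrite (_ : (fun y => _) = fun y => ev (swapXY q) (y, x)); first exact: ev_cont1.
  by apply/funext => y; rewrite ev_swap.
rewrite (@section_integral (fun y => ev (Dy (wt rho * p)) (x, y)))//.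
case: ltP => // xr.
set s := Num.sqrt _.
have -> : rint (- s) s (fun y => ev (Dy (wt rho * p)) (x, y)) =
    ev (wt rho * p) (x, s) - ev (wt rho * p) (x, - s).
  apply: (@rint_FTC _ _ (fun y => ev (wt rho * p) (x, y))).
  - by rewrite ge0_cp// sqrtr_ge0.
  - exact: cy.
  - move=> y _; rewrite /Dy ev_swap /=.
    rewrite (_ : (fun y => _) = fun y => ev (swapXY (wt rho * p)) (y, x)); first exact: ev_derive1.
    by apply/funext => t; rewrite ev_swap.
by rewrite !evM !ev_wt /= sqrrN rho2// !mul0r subrr.
Qed.

End Linearity.
End DiscIntegral.

(** * Analytic polynomials, orthogonality and Green's formula *)

Section AnalyticPolynomials.
Variable R : realType.
Local Notation A := {poly {poly R}}.
Local Notation X := ('X : A).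
Local Notation Y := ('X%:P : A).
Implicit Types (a b f g : nat -> R) (p q : A) (rho : R).

(** Real and imaginary parts of (x + i y)^n as polynomials in x and y. *)
Fixpoint zpow n : A * A :=
  if n is n'.+1 then (X * (zpow n').1 - Y * (zpow n').2, X * (zpow n').2 + Y * (zpow n').1)
  else (1, 0).
Definition zc n := (zpow n).1.
Definition zs n := (zpow n).2.
Definition sq2 : A := X * X + Y * Y.

Lemma zc0 : zc 0 = 1. Proof. by []. Qed.
Lemma zs0 : zs 0 = 0. Proof. by []. Qed.
Lemma zcS n : zc n.+1 = X * zc n - Y * zs n. Proof. by []. Qed.
Lemma zsS n : zs n.+1 = X * zs n + Y * zc n. Proof. by []. Qed.

Lemma D_zpow n : [/\ Dx (zc n) = zc n.-1 *+ n, Dx (zs n) = zs n.-1 *+ n,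
  Dy (zc n) = - zs n.-1 *+ n & Dy (zs n) = zc n.-1 *+ n].
Proof.
elim: n => [|n [h1 h2 h3 h4]].
  by rewrite /zc /zs /= !mulr0n Dx1 Dx0 Dy1 Dy0.
rewrite zcS zsS !(DxB, DxD, DyB, DyD, DxM, DyM) h1 h2 h3 h4 DxX DxY DyX DyY /=.
case: n {h1 h2 h3 h4} => [|n] /=; first by rewrite /zc /zs /= !mulr0n !mulr1n; split; ring.
by rewrite !mulrSr zcS zsS; split; ring.
Qed.

Definition re N a : A := \sum_(n < N) cst2 (a n) * zc n.
Definition im N a : A := \sum_(n < N) cst2 (a n) * zs n.
Definition da a n := a n.+1 *+ n.+1.

Lemma Dx_sum I (r : seq I) (F : I -> A) : Dx (\sum_(i <- r) F i) = \sum_(i <- r) Dx (F i).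
Proof. exact: (big_morph (@Dx R) (@DxD R) (@Dx0 R)). Qed.
Lemma Dy_sum I (r : seq I) (F : I -> A) : Dy (\sum_(i <- r) F i) = \sum_(i <- r) Dy (F i).
Proof. exact: (big_morph (@Dy R) (@DyD R) (@Dy0 R)). Qed.

Lemma cst2Mn (c : R) n : cst2 (c *+ n) = cst2 c *+ n.
Proof. by rewrite /cst2 polyCMn polyCMn. Qed.

Lemma DxZ c p : Dx (cst2 c * p) = cst2 c * Dx p.
Proof. by rewrite DxM DxC mul0r add0r. Qed.
Lemma DyZ c p : Dy (cst2 c * p) = cst2 c * Dy p.
Proof. by rewrite DyM DyC mul0r add0r. Qed.

Lemma D_re N a : [/\ Dx (re N.+1 a) = re N (da a), Dx (im N.+1 a) = im N (da a),
  Dy (re N.+1 a) = - im N (da a) & Dy (im N.+1 a) = re N (da a)].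
Proof.
have h n := D_zpow n.
rewrite /re /im; split; rewrite ?Dx_sum ?Dy_sum big_ord_recl /= ?(DxZ, DyZ);
  have [e1 e2 e3 e4] := h 0%N; rewrite ?e1 ?e2 ?e3 ?e4 mulr0n mulr0 add0r -?sumrN;
  apply: eq_bigr => i _; rewrite ?(DxZ, DyZ) /bump /= add1n;
  have [f1 f2 f3 f4] := h i.+1; rewrite ?f1 ?f2 ?f3 ?f4 /da cst2Mn /=; ring.
Qed.

Definition Lap p := Dx (Dx p) + Dy (Dy p).

Lemma LapD p q : Lap (p + q) = Lap p + Lap q.
Proof. by rewrite /Lap !DxD !DyD; ring. Qed.
Lemma Lap0 : Lap 0 = 0.
Proof. by rewrite /Lap !Dx0 !Dy0 addr0. Qed.
Lemma LapN p : Lap (- p) = - Lap p.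
Proof. by rewrite /Lap !DxN !DyN opprD. Qed.
Lemma LapB p q : Lap (p - q) = Lap p - Lap q.
Proof. by rewrite LapD LapN. Qed.
Lemma LapZ c p : Lap (cst2 c * p) = cst2 c * Lap p.
Proof. by rewrite /Lap !(DxZ, DyZ) mulrDr. Qed.
Lemma LapC c : Lap (cst2 c) = 0.
Proof. by rewrite /Lap DxC DyC Dx0 Dy0 addr0. Qed.
Lemma Lap_sum I (r : seq I) (F : I -> A) : Lap (\sum_(i <- r) F i) = \sum_(i <- r) Lap (F i).
Proof. exact: (big_morph Lap LapD Lap0). Qed.

(* A pair of polynomials together with the real and imaginary parts of its first
   two complex derivatives; the equations are the Cauchy-Riemann equations. *)
Definition analytic t u p q := [/\ Dx t = p, Dx u = q, Dy t = - q & Dy u = p].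

Lemma analytic_re N a : analytic (re N.+1 a) (im N.+1 a) (re N (da a)) (im N (da a)).
Proof. exact: D_re. Qed.

Lemma Lap_analytic t u p q p' q' : analytic t u p q -> analytic p q p' q' ->
  Lap t = 0 /\ Lap (t * t + u * u) = (p * p + q * q) *+ 4.
Proof.
move=> [h1 h2 h3 h4] [k1 k2 k3 k4]; rewrite /Lap; split.
  by rewrite h1 h3 DyN k1 k4 subrr.
rewrite !(DxD, DxM, DyD, DyM, DxN, DyN, h1, h2, h3, h4, k1, k2, k3, k4).
by ring.
Qed.

Lemma re_add1 N a : (forall n, (N <= n)%N -> a n = 0) -> re N.+1 a = re N a /\ im N.+1 a = im N a.
Proof.
by move=> a0; rewrite /re /im !big_ord_recr /= a0// /cst2 !polyC0 !mul0r !addr0.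
Qed.

Definition sh j a k : R := a (j + k)%N.

(** The backward shift identity A_j = a_j + z A_(j+1), for A_j = sum_k a_(j+k) z^k. *)
Lemma re_shift N j a : (forall n, (N <= n)%N -> a n = 0) ->
  re N (sh j a) = cst2 (a j) + (X * re N (sh j.+1 a) - Y * im N (sh j.+1 a)) /\
  im N (sh j a) = X * im N (sh j.+1 a) + Y * re N (sh j.+1 a).
Proof.
move=> a0; have [z1 z2] := @re_add1 N (sh j a) (fun n h => a0 _ (leq_trans h (leq_addl _ _))).
rewrite -z1 -z2 {z1 z2}.
rewrite /re /im !big_ord_recl /= [zc 0]/(1 : A) [zs 0]/(0 : A) mulr1 mulr0 add0r /sh addn0.
rewrite !mulr_sumr -sumrB -big_split /=; split; [congr (_ + _)|]; apply: eq_bigr => i _;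
  by rewrite /bump /= add1n ?zcS ?zsS addSnnS; ring.
Qed.

(** The sum of |A_j|^2 over j >= 1, with A_j = sum_k a_(j+k) z^k; multiplied by [wt 1] it is the
    potential S. For a sequence supported below [N] the bound [N.+1] adds only zero terms and
    matches the index drop under differentiation. *)
Definition Sb N a : A := \sum_(j < N) (re N.+1 (sh j.+1 a) * re N.+1 (sh j.+1 a) +
   im N.+1 (sh j.+1 a) * im N.+1 (sh j.+1 a)).

Lemma wt1E : wt 1 = 1 - sq2 :> A.
Proof. by rewrite /wt /sq2 expr1n /cst2 !polyC1; ring. Qed.

(** Expanding |A_j - a_j|^2 = |z|^2 |A_(j+1)|^2 gives (1 - |z|^2) |A_(j+1)|^2 = |A_(j+1)|^2 -
    |A_j|^2 + 2 a_j Re A_j - a_j^2. The last two terms are harmonic, and the Laplacians of the first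
    two telescope to that of -|A_0|^2, which is -4 |A_0'|^2. *)
Lemma Lap_Sb N a : (forall n, (N <= n)%N -> a n = 0) ->
  Lap (wt 1 * Sb N a) = - (re N (da a) * re N (da a) + im N (da a) * im N (da a)) *+ 4.
Proof.
move=> a0; pose t j := re N.+1 (sh j a); pose u j := im N.+1 (sh j a).
pose p j := re N (da (sh j a)); pose q j := im N (da (sh j a)).
have a1 n : (N.+1 <= n)%N -> a n = 0 by move=> /ltnW; exact: a0.
have L j : Lap (t j) = 0 /\ Lap (t j * t j + u j * u j) = (p j * p j + q j * q j) *+ 4.
  have [p1 q1] := @re_add1 N (da (sh j a)) (fun n h =>
    etrans (congr1 (fun x => x *+ n.+1) (a0 _ (leq_trans h (leq_trans (leqnSn n) (leq_addl _ _))))) (mul0rn _ _)).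
  apply: (Lap_analytic (analytic_re N (sh j a))).
  by rewrite -p1 -q1; exact: analytic_re.
have E : wt 1 * Sb N a = \sum_(j < N) ((t j.+1 * t j.+1 + u j.+1 * u j.+1)
   - (t j * t j + u j * u j) + cst2 (2 * a j) * t j - cst2 (a j ^+ 2)).
  rewrite /Sb wt1E mulr_sumr; apply: eq_bigr => j _.
  have [e1 e2] := re_shift j a1; rewrite -/(t j) -/(u j) -/(t j.+1) -/(u j.+1) in e1 e2 *.
  have -> : cst2 (2 * a j) = cst2 (a j) *+ 2 by rewrite -cst2Mn mulr_natl.
  have -> : cst2 (a j ^+ 2) = cst2 (a j) * cst2 (a j) by rewrite /cst2 expr2 !polyCM.
  by rewrite e1 e2 /sq2; ring.
rewrite E Lap_sum.
have -> : \sum_(j < N) Lap ((t j.+1 * t j.+1 + u j.+1 * u j.+1)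
   - (t j * t j + u j * u j) + cst2 (2 * a j) * t j - cst2 (a j ^+ 2)) =
   \sum_(0 <= j < N) ((p j.+1 * p j.+1 + q j.+1 * q j.+1) *+ 4 - (p j * p j + q j * q j) *+ 4).
  rewrite big_mkord; apply: eq_bigr => j _; rewrite LapB LapD LapB LapZ LapC.
  by have [-> ->] := L j; have [_ ->] := L j.+1; rewrite mulr0 subr0 addr0.
rewrite telescope_sumr//.
have pN : p N = 0 /\ q N = 0.
  by split; rewrite /p /q /re /im big1// => i _; rewrite /da /sh a0 ?leq_addr// mul0rn /cst2 !polyC0 mul0r.
have [-> ->] := pN; rewrite !mul0r addr0 mul0rn sub0r mulNrn.
by [].
Qed.

Section OnDisc.
Variables (rho : R) (r01 : 0 < rho <= 1).
Local Notation J := (Jd rho).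
Local Notation w := (wt rho).

Lemma JMn p n : J (p *+ n) = J p *+ n.
Proof. by elim: n => [|n IH]; rewrite ?mulr0n ?(J0 r01)// !mulrS (JD r01) IH. Qed.

Lemma wtE : w = cst2 (rho ^+ 2) - sq2.
Proof. by rewrite /wt /sq2; ring. Qed.

Lemma D_sq2X k : Dx (sq2 ^+ k.+1) = (X * sq2 ^+ k) *+ (2 * k.+1) /\
  Dy (sq2 ^+ k.+1) = (Y * sq2 ^+ k) *+ (2 * k.+1).
Proof.
have e1 : Dx sq2 = X *+ 2 by rewrite /sq2 DxD !DxM DxX DxY; ring.
have e2 : Dy sq2 = Y *+ 2 by rewrite /sq2 DyD !DyM DyX DyY; ring.
elim: k => [|k [IH1 IH2]]; first by rewrite !expr1 e1 e2 expr0; split; ring.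
by rewrite [sq2 ^+ k.+2]exprS DxM DyM e1 e2 IH1 IH2 exprS; split; ring.
Qed.

(** Instead of polar coordinates: the field wt |z|^(2k) (Re z^m, -Im z^m) has integral divergence
    zero, and computing this divergence gives a recursion in k. *)
Lemma J_sq2_zc k m : J (sq2 ^+ k * zc m.+1) = 0.
Proof.
have D_w : Dx w = - X *+ 2 /\ Dy w = - Y *+ 2.
  by rewrite /wt !(DxB, DyB, DxM, DyM, DxC, DyC) DxX DxY DyX DyY; split; ring.
have [w1 w2] := D_w.
have [d1 d2 d3 d4] := D_zpow m.
elim: k => [|k IH].
  have := J_Dx r01 (zc m); have := J_Dy r01 (zs m) => h1 h2.
  have : J (Dx (w * zc m) - Dy (w * zs m)) = 0 by rewrite (JB r01) h1 h2 subrr.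
  have -> : Dx (w * zc m) - Dy (w * zs m) = - (zc m.+1 *+ 2).
    by rewrite DxM DyM w1 w2 d1 d4 zcS; ring.
  rewrite (JN r01) JMn expr0 mul1r; lra.
have [e1 e2] := D_sq2X k.
have h1 := J_Dx r01 (sq2 ^+ k.+1 * zc m); have h2 := J_Dy r01 (sq2 ^+ k.+1 * zs m).
have : J (Dx (w * (sq2 ^+ k.+1 * zc m)) - Dy (w * (sq2 ^+ k.+1 * zs m))) = 0.
  by rewrite (JB r01) h1 h2 subrr.
have -> : Dx (w * (sq2 ^+ k.+1 * zc m)) - Dy (w * (sq2 ^+ k.+1 * zs m)) =
   (cst2 (rho ^+ 2) * (sq2 ^+ k * zc m.+1)) *+ (2 * k.+1) - (sq2 ^+ k.+1 * zc m.+1) *+ (2 * k.+2).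
  rewrite !(DxM, DyM) w1 w2 e1 e2 d1 d4 zcS wtE exprS.
  by ring.
rewrite (JB r01) !JMn (JCM r01) IH mulr0 mul0rn sub0r => /eqP.
by rewrite oppr_eq0 mulrn_eq0 /= => /eqP.
Qed.

(** The divergence of wt |z|^(2k) (x, y) integrates to zero, which relates consecutive moments;
    everything is expressed through the area [J 1]. *)
Lemma J_sq2 k : J (sq2 ^+ k) = rho ^+ (2 * k) / k.+1%:R * J 1.
Proof.
have [w1 w2] : Dx w = - X *+ 2 /\ Dy w = - Y *+ 2.
  by rewrite /wt !(DxB, DyB, DxM, DyM, DxC, DyC) DxX DxY DyX DyY; split; ring.
elim: k => [|k IH]; first by rewrite muln0 !expr0 divr1 mul1r.
have h1 := J_Dx r01 (sq2 ^+ k * X); have h2 := J_Dy r01 (sq2 ^+ k * Y).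
have : J (Dx (w * (sq2 ^+ k * X)) + Dy (w * (sq2 ^+ k * Y))) = 0.
  by rewrite (JD r01) h1 h2 addr0.
have -> : Dx (w * (sq2 ^+ k * X)) + Dy (w * (sq2 ^+ k * Y)) =
   (cst2 (rho ^+ 2) * sq2 ^+ k) *+ (2 * k.+1) - (sq2 ^+ k.+1) *+ (2 * k.+2).
  case: k {IH h1 h2} => [|k].
    by rewrite !expr0 !expr1 !mul1r !(DxM, DyM) w1 w2 DxX DyY wtE /sq2; ring.
  have [e1 e2] := D_sq2X k.
  rewrite !(DxM, DyM) w1 w2 e1 e2 DxX DyY wtE [sq2 ^+ k.+2]exprS [sq2 ^+ k.+1]exprS.
  by move: (sq2 ^+ k) => P; rewrite /sq2; ring.
rewrite (JB r01) !JMn (JCM r01) IH => h.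
have k1 : k.+1%:R != 0 :> R by rewrite pnatr_eq0.
have k2 : k.+2%:R != 0 :> R by rewrite pnatr_eq0.
have h' : 2 * k.+2%:R * J (sq2 ^+ k.+1) = 2 * rho ^+ 2 * rho ^+ (2 * k) * J 1.
  move: h; rewrite -[_ *+ (2 * k.+1)]mulr_natr -[_ *+ (2 * k.+2)]mulr_natr !natrM => /eqP.
  rewrite subr_eq0 => /eqP h; rewrite [LHS]mulrC -h; by field.
have c0 : 2 * k.+2%:R != 0 :> R by rewrite mulf_neq0.
apply: (mulfI c0); rewrite h' mulnS exprD; by field.
Qed.

(** The real part of z^(m+d) times the conjugate of z^m. *)
Lemma zip_shift m d : zc (m + d) * zc m + zs (m + d) * zs m = sq2 ^+ m * zc d.
Proof.
elim: m => [|m IH]; first by rewrite expr0 /zc /zs /=; ring.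
rewrite addSn !zcS !zsS exprS -mulrA -IH /sq2; ring.
Qed.

Lemma J_zip_le m d : J (zc (m + d) * zc m + zs (m + d) * zs m) =
    (if d == 0 then rho ^+ (2 * m) / m.+1%:R * J 1 else 0) /\
  J (w * (zc (m + d) * zc m + zs (m + d) * zs m)) =
    (if d == 0 then rho ^+ (2 * m.+1) / (m.+1 * m.+2)%:R * J 1 else 0).
Proof.
have -> : w * (zc (m + d) * zc m + zs (m + d) * zs m) =
    cst2 (rho ^+ 2) * (sq2 ^+ m * zc d) - sq2 ^+ m.+1 * zc d.
  by rewrite zip_shift wtE [sq2 ^+ m.+1]exprS; ring.
rewrite zip_shift (JB r01) (JCM r01); case: d => [|d]; last first.
  by rewrite !J_sq2_zc mulr0 subr0.
rewrite eqxx [zc 0]/(1 : A) !mulr1 !J_sq2; split=> //.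
have k1 : m.+1%:R != 0 :> R by rewrite pnatr_eq0.
have k2 : m.+2%:R != 0 :> R by rewrite pnatr_eq0.
rewrite mulnS exprD natrM; move: k1 k2; rewrite -[m.+2]addn1 natrD => k1 k2.
by field; apply/andP; split.
Qed.

Lemma J_zip n m : J (zc n * zc m + zs n * zs m) =
    (if n == m then rho ^+ (2 * m) / m.+1%:R * J 1 else 0) /\
  J (w * (zc n * zc m + zs n * zs m)) =
    (if n == m then rho ^+ (2 * m.+1) / (m.+1 * m.+2)%:R * J 1 else 0).
Proof.
have [mn|nm] := leqP m n.
  have := J_zip_le m (n - m); rewrite subnKC//.
  by rewrite subn_eq0 (_ : (n <= m)%N = (n == m))// eqn_leq mn andbT.
have := J_zip_le n (m - n); rewrite subnKC ?(ltnW nm)//.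
rewrite subn_eq0 leqNgt nm /= (ltn_eqF nm) => -[h1 h2].
by split; [rewrite -[RHS]h1|rewrite -[RHS]h2]; congr Jd; ring.
Qed.

(** The real inner products of the Bergman spaces with weights 1 and rho^2 - |z|^2, in which the
    monomials are orthogonal. *)
Lemma J_pair N M a b : (N <= M)%N ->
  J (re N a * re M b + im N a * im M b) =
    J 1 * \sum_(n < N) a n * b n * (rho ^+ (2 * n) / n.+1%:R) /\
  J (w * (re N a * re M b + im N a * im M b)) =
    J 1 * \sum_(n < N) a n * b n * (rho ^+ (2 * n.+1) / (n.+1 * n.+2)%:R).
Proof.
move=> NM.
have E : re N a * re M b + im N a * im M b = \sum_(n < N) \sum_(m < M)
    cst2 (a n * b m) * (zc n * zc m + zs n * zs m).
  rewrite /re /im !big_distrlr /= -big_split /=; apply: eq_bigr => n _.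
  rewrite -big_split /=; apply: eq_bigr => m _.
  by rewrite (_ : cst2 (a n * b m) = cst2 (a n) * cst2 (b m)); [ring|rewrite /cst2 !polyCM].
have pick (F : nat -> R) (n : 'I_N) : \sum_(m < M) a n * b m * (if val n == m :> nat then F m else 0) = a n * b n * F n.
  rewrite (bigD1 (widen_ord NM n))//= eqxx big1 ?addr0// => i /eqP ni.
  rewrite ifF ?mulr0//; apply/negP => /eqP e; apply: ni; exact/val_inj.
rewrite E; split.
  rewrite (J_sum r01) mulr_sumr; apply: eq_bigr => n _; rewrite (J_sum r01).
  rewrite -(pick (fun m => rho ^+ (2 * m) / m.+1%:R)) mulr_sumr; apply: eq_bigr => m _.
  rewrite (JCM r01) (proj1 (J_zip n m)) mulrCA; congr (_ * _).
  by case: ifP; rewrite ?mulr0// mulrC.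
rewrite !mulr_sumr (J_sum r01); apply: eq_bigr => n _; rewrite mulr_sumr (J_sum r01).
rewrite -(pick (fun m => rho ^+ (2 * m.+1) / (m.+1 * m.+2)%:R)) mulr_sumr; apply: eq_bigr => m _.
rewrite mulrCA (JCM r01) (proj2 (J_zip n m)) mulrCA; congr (_ * _).
by case: ifP; rewrite ?mulr0// mulrC.
Qed.

(** One integration by parts against the weight trades the Laplacian for the radial derivative,
    integrated over the disc rather than over its boundary. *)
Lemma green V : J (w * Lap V) = J (X * Dx V + Y * Dy V) *+ 2.
Proof.
have h1 := J_Dx r01 (Dx V); have h2 := J_Dy r01 (Dy V).
have : J (Dx (w * Dx V) + Dy (w * Dy V)) = 0 by rewrite (JD r01) h1 h2 addr0.
have [w1 w2] : Dx w = - X *+ 2 /\ Dy w = - Y *+ 2.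
  by rewrite /wt !(DxB, DyB, DxM, DyM, DxC, DyC) DxX DxY DyX DyY; split; ring.
have -> : Dx (w * Dx V) + Dy (w * Dy V) = w * Lap V - (X * Dx V + Y * Dy V) *+ 2.
  by rewrite DxM DyM w1 w2 /Lap; ring.
by rewrite (JB r01) JMn => /eqP; rewrite subr_eq0 => /eqP.
Qed.

Lemma J_radial_w Q : J (X * Dx (w * Q) + Y * Dy (w * Q)) = - J (w * Q) *+ 2.
Proof.
have h1 := J_Dx r01 (X * Q); have h2 := J_Dy r01 (Y * Q).
have : J (Dx (w * (X * Q)) + Dy (w * (Y * Q))) = 0 by rewrite (JD r01) h1 h2 addr0.
have -> : Dx (w * (X * Q)) + Dy (w * (Y * Q)) =
   X * Dx (w * Q) + Y * Dy (w * Q) + (w * Q) *+ 2.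
  by rewrite !(DxM, DyM) DxX DyY; ring.
rewrite (JD r01) JMn => /eqP; rewrite addr_eq0 => /eqP ->.
by rewrite mulNrn.
Qed.

End OnDisc.
End AnalyticPolynomials.

(** * The Carleson inequality on the disc and its bilinear converse *)

Section CarlesonOnDisc.
Variable R : realType.
Local Notation A := {poly {poly R}}.
Local Notation X := ('X : A).
Local Notation Y := ('X%:P : A).
Local Notation zc := (@zc R).
Local Notation zs := (@zs R).
Implicit Types (a b f g : nat -> R) (p q : A) (rho : R).

Definition mod2 N a : A := re N a * re N a + im N a * im N a.

Lemma ev_mod2 N a z : ev (mod2 N a) z = ev (re N a) z ^+ 2 + ev (im N a) z ^+ 2.
Proof. by rewrite /mod2 evD !evM !expr2. Qed.

Lemma disc_wt_ge0 rho z : disc rho z -> 0 <= ev (wt rho) z.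
Proof. by rewrite /disc /= ev_wt => h; lra. Qed.

Lemma analytic_re2 N a : (forall n, (N <= n)%N -> a n = 0) ->
  analytic (re N (da a)) (im N (da a)) (re N (da (da a))) (im N (da (da a))).
Proof.
move=> a0; have d0 n : (N <= n)%N -> da a n = 0.
  by move=> Nn; rewrite /da a0 ?mul0rn// (leq_trans Nn).
have [<- <-] := re_add1 d0; exact: analytic_re.
Qed.

Lemma Lap_product (u F : A) : Lap ((1 + u * u) * F) = (1 + u * u) * Lap F +
  (u * Lap u *+ 2 + (Dx u * Dx u + Dy u * Dy u) *+ 2) * F + (u * (Dx u * Dx F + Dy u * Dy F)) *+ 4.
Proof. by rewrite /Lap !(DxD, DyD, DxM, DyM, Dx1, Dy1, Dx0, Dy0); ring. Qed.

Lemma radial_split (F q : A) : X * Dx (F *+ 2 - q) + Y * Dy (F *+ 2 - q) =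
  (X * Dx F + Y * Dy F) *+ 2 - (X * Dx q + Y * Dy q).
Proof. by rewrite !mulr2n !(DxB, DyB, DxD, DyD); ring. Qed.

Lemma evMn p n z : ev (p *+ n) z = ev p z *+ n.
Proof.
elim: n => [|n IH].
  by rewrite !mulr0n ev0.
by rewrite !mulrS evD IH.
Qed.

Lemma ev_energy (u F P ux uy x1 x2 y1 y2 t : A) z :
  ev ((1 + u * u) * P *+ 4 + (u * (ux * (x1 * y1 + x2 * y2) + uy * (x2 * y1 - x1 * y2))) *+ 8 +
    F * (u * t) *+ 8 + F * (ux * ux + uy * uy) *+ 2) z =
  (1 + ev u z * ev u z) * ev P z *+ 4 + (ev u z * (ev ux z * (ev x1 z * ev y1 z + ev x2 z * ev y2 z)
   + ev uy z * (ev x2 z * ev y1 z - ev x1 z * ev y2 z))) *+ 8 +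
    ev F z * (ev u z * ev t z) *+ 8 + ev F z * (ev ux z * ev ux z + ev uy z * ev uy z) *+ 2.
Proof. by rewrite !(evMn, evM, evN, evD, ev1). Qed.

Lemma energy_arith (c1 c2 c3 c4 c5 : R) : c1 *+ 4 = c2 *+ 2 -> c3 = c4 *+ 2 - c5 ->
  0 <= c3 -> (c2 *+ 2 + c5 *+ 2) *+ 2 <= 8 * (c1 + c4).
Proof. by move=> *; lra. Qed.

Section Energy.
Variables (N : nat) (a f : nat -> R) (G : R).
Hypotheses (a0 : forall n, (N <= n)%N -> a n = 0) (f0 : forall n, (N <= n)%N -> f n = 0).
Hypotheses (G0 : 0 < G) (hG : forall z, disc 1 z -> ev (wt 1 * Sb N a) z <= G).
Local Notation J := (Jd (1 : R)).
Local Notation w := (wt (1 : R)).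
Let r01 : 0 < (1 : R) <= 1. Proof. by rewrite ltr01 lexx. Qed.

Let k : A := cst2 (2 * G)^-1.
Let U : A := 1 - k * (w * Sb N a).
Let F := mod2 N f.
Let B := mod2 N (da a).
Let P := mod2 N (da f).
Let V := (1 + U * U) * F.

Let LapU : Lap U = (k * B) *+ 4.
Proof.
rewrite /U LapB LapZ (Lap_Sb a0) (_ : Lap 1 = 0); last first.
  by rewrite /Lap Dx1 Dy1 Dx0 Dy0 addr0.
by rewrite /B /mod2; ring.
Qed.

Let anf : analytic (re N f) (im N f) (re N (da f)) (im N (da f)).
Proof. by have [<- <-] := re_add1 f0; exact: analytic_re. Qed.

Let LapF : Lap F = P *+ 4.
Proof. by have [_] := Lap_analytic anf (analytic_re2 f0). Qed.

Let Ux := Dx U.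
Let Uy := Dy U.
Let f1 := re N f.
Let f2 := im N f.
Let p1 := re N (da f).
Let p2 := im N (da f).

Let LapV : Lap V = (1 + U * U) * P *+ 4 +
  (U * (Ux * (f1 * p1 + f2 * p2) + Uy * (f2 * p1 - f1 * p2))) *+ 8 +
  F * (U * (k * B)) *+ 8 + F * (Ux * Ux + Uy * Uy) *+ 2.
Proof.
have E := Lap_product U F.
have [h1 h2 h3 h4] := anf.
rewrite /V E LapF LapU -/Ux -/Uy.
have -> : Dx F = (f1 * p1 + f2 * p2) *+ 2.
  by rewrite /F /mod2 DxD !DxM h1 h2 /f1 /f2 /p1 /p2; ring.
have -> : Dy F = (f2 * p1 - f1 * p2) *+ 2.
  by rewrite /F /mod2 DyD !DyM h3 h4 /f1 /f2 /p1 /p2; ring.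
by ring.
Qed.

(** Write u for [U], which lies in [1/2, 1] because 0 <= S <= G. The cross term between f' and the
    gradient of u is completed to a square that uses up 8 u^2 |f'|^2. Since 4 (1 + u^2) = 8 u^2 + 4
    (1 - u^2), the summand 1 in 1 + u^2 pays for this as long as u <= 1; and u >= 1/2 keeps half of
    the Carleson term. *)
Let LapV_ge z : disc 1 z -> ev (F * (k * B) *+ 4) z <= ev (Lap V) z.
Proof.
move=> hz; have wz := disc_wt_ge0 hz.
have Sz : 0 <= ev (Sb N a) z.
  by rewrite /Sb ev_sum sumr_ge0// => j _; rewrite evD !evM -!expr2 addr_ge0 ?sqr_ge0.
have uz : 1 / 2 <= ev U z <= 1.
  have hg := hG hz; rewrite evM in hg.
  rewrite /U evB ev1 evM evC evM; set t := ev w z * _ in hg *.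
  have t0 : 0 <= t by rewrite mulr_ge0.
  have Gi : (2 * G)^-1 * t <= 1 / 2.
    by rewrite mulrC ler_pdivrMr ?mulr_gt0//; lra.
  have : 0 <= (2 * G)^-1 * t by rewrite mulr_ge0// invr_ge0 mulr_ge0// ltW.
  by move=> h; apply/andP; split; lra.
have kz : 0 <= ev k z by rewrite evC invr_ge0 mulr_ge0// ltW.
have Bz : 0 <= ev B z by rewrite ev_mod2 addr_ge0 ?sqr_ge0.
rewrite LapV ev_energy evMn [ev (F * _) z]evM.
have -> : ev F z = ev f1 z ^+ 2 + ev f2 z ^+ 2 by rewrite ev_mod2.
have -> : ev P z = ev p1 z ^+ 2 + ev p2 z ^+ 2 by rewrite ev_mod2.
have kB : 0 <= ev (k * B) z by rewrite evM mulr_ge0.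
move: (ev (k * B) z) kB => t t0; clear kz Bz wz Sz.
move: (ev U z) uz (ev Ux z) (ev Uy z) (ev f1 z) (ev f2 z) (ev p1 z) (ev p2 z) =>
  u /andP[u1 u2] ux uy x1 x2 y1 y2.
have d1 : 0 <= (1 - u ^+ 2) * (y1 ^+ 2 + y2 ^+ 2).
  by apply: mulr_ge0; [nra|rewrite addr_ge0 ?sqr_ge0].
have d2 : 0 <= (u - 1 / 2) * t * (x1 ^+ 2 + x2 ^+ 2).
  by apply: mulr_ge0; [apply: mulr_ge0 => //; lra|rewrite addr_ge0 ?sqr_ge0].
have d3 := sqr_ge0 (2 * u * y1 + (x1 * ux + x2 * uy)).
have d4 := sqr_ge0 (2 * u * y2 + (x2 * ux - x1 * uy)).
rewrite -subr_ge0.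
rewrite [leRHS](_ : _ = 4 * ((1 - u ^+ 2) * (y1 ^+ 2 + y2 ^+ 2)) +
  8 * ((u - 1 / 2) * t * (x1 ^+ 2 + x2 ^+ 2)) +
  2 * ((2 * u * y1 + (x1 * ux + x2 * uy)) ^+ 2 + (2 * u * y2 + (x2 * ux - x1 * uy)) ^+ 2));
  last by field.
by rewrite !addr_ge0// mulr_ge0// addr_ge0.
Qed.

(** [V] is 2 |f|^2 minus a multiple of the weight, so Green's formula for [V] differs from that for
    |f|^2 only through the integral of [w * Q]; positivity of [J V] bounds that integral by twice
    the integral of |f|^2. *)
Lemma disc_carleson : J (w * (F * B)) <= 4 * G * J 1 * \sum_(n < N) f n ^+ 2.
Proof.
have G2 : 2 * G != 0 by rewrite mulf_neq0// gt_eqF.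
have le1 : J (w * (F * (k * B) *+ 4)) <= J (w * Lap V).
  apply: (le_J r01) => z hz; rewrite !(evM _ _ z) ler_wpM2l ?LapV_ge//.
  exact: disc_wt_ge0.
have -> : J (w * (F * B)) = G / 2 * J (w * (F * (k * B) *+ 4)).
  rewrite (_ : w * (F * (k * B) *+ 4) = cst2 (4 * (2 * G)^-1) * (w * (F * B))).
    by rewrite (JCM r01); field; rewrite gt_eqF.
  have -> : cst2 (4 * (2 * G)^-1) = k *+ 4 by rewrite /k -cst2Mn mulr_natl.
  by ring.
pose Q := ((k * Sb N a) *+ 2 - k * k * w * Sb N a * Sb N a) * F.
have VQ : V = F *+ 2 - w * Q by rewrite /V /Q /U; ring.
have V0 : 0 <= J V.
  apply: J_ge0 => z hz; rewrite /V evM evD evM ev1 ev_mod2 -expr2.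
  by rewrite mulr_ge0// addr_ge0// ?sqr_ge0.
have JV : J V = J F *+ 2 - J (w * Q) by rewrite VQ (JB r01) (JMn r01).
have DV : J (X * Dx V + Y * Dy V) = J (X * Dx F + Y * Dy F) *+ 2 + J (w * Q) *+ 2.
  rewrite VQ radial_split.
  by rewrite (JB r01) (JMn r01) (J_radial_w r01) mulNrn opprK.
have GF := green r01 F; have GV := green r01 V.
have JP : J (w * Lap F) = J (w * P) *+ 4.
  by rewrite LapF (_ : w * (P *+ 4) = (w * P) *+ 4) ?(JMn r01)//; ring.
have [JFE _] := J_pair r01 f f (leqnn N).
have [_ JPE] := J_pair r01 (da f) (da f) (leqnn N).
have J1 : 0 <= J 1 by apply: J_ge0 => z _; rewrite ev1.
(* The coefficient n gets the weight 1/(n+1) from |f|^2 and n/(n+1) from |f'|^2; they add up to 1,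
   which reproduces the square norm of f. *)
have key : J (w * P) + J F <= J 1 * \sum_(n < N) f n ^+ 2.
  rewrite /P /F /mod2 JFE JPE -mulrDr ler_wpM2l//.
  under eq_bigr do rewrite expr1n.
  under [X in _ + X]eq_bigr do rewrite expr1n.
  case: N f0 => [|M] ff; first by rewrite !big_ord0 addr0.
  have dM : da f M = 0 by rewrite /da ff ?mul0rn.
  rewrite big_ord_recr /= dM !mul0r addr0.
  rewrite [X in _ + X]big_ord_recl [leRHS]big_ord_recl /= addrCA; apply: lerD.
    by rewrite divr1 mulr1 expr2.
  rewrite -big_split /=; apply: ler_sum => i _.
  rewrite /bump /= add1n /da -mulr_natr natrM le_eqVlt; apply/orP; left; apply/eqP.
  have k1 : i.+1%:R != 0 :> R by rewrite pnatr_eq0.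
  have k2 : i.+2%:R != 0 :> R by rewrite pnatr_eq0.
  by move: k1 k2; rewrite -[i.+2]addn1 natrD => k1 k2; field; apply/andP; split.
apply: (@le_trans _ _ (G / 2 * J (w * Lap V))).
  by rewrite ler_wpM2l// divr_ge0// ltW.
have : J (w * Lap V) <= 8 * (J (w * P) + J F).
  by rewrite GV DV; rewrite JP in GF; exact: energy_arith GF JV V0.
move=> h; rewrite (_ : 4 * G * J 1 * \sum_(n < N) f n ^+ 2 =
   G / 2 * (8 * (J 1 * \sum_(n < N) f n ^+ 2))); last by field.
apply: ler_wpM2l; first by rewrite divr_ge0// ltW.
by apply: le_trans h _; rewrite ler_wpM2l.
Qed.

End Energy.

Lemma sqrt_ge_eighth (x : R) : 1 / 64 <= x -> 1 / 8 <= Num.sqrt x.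
Proof.
move=> h; have e0 : 0 <= 1 / 8 :> R by lra.
by rewrite -(ger0_norm e0) -sqrtr_sqr ler_wsqrtr//; lra.
Qed.

Lemma eighth_arith (s z t : R) : 1 / 8 <= s -> 0 <= z -> s * z <= 4 * t -> z <= 32 * t.
Proof. by move=> *; nra. Qed.

Section PairingBound.
Variables (rho : R) (r01 : 0 < rho <= 1).
Local Notation J := (Jd rho).
Local Notation w := (wt rho).

(** The coefficients of the derivative of z f(z). *)
Definition ez f k := f k *+ k.+1.

Lemma J_ez N f : J (w * mod2 N (ez f)) <= J 1 * \sum_(n < N) f n ^+ 2.
Proof.
have J1 : 0 <= J 1 by apply: J_ge0 => z _; rewrite ev1.
have [_ ->] := J_pair r01 (ez f) (ez f) (leqnn N).
rewrite ler_wpM2l//; apply: ler_sum => n _.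
have /andP[r0 r1] := r01.
have n1 : n.+1%:R != 0 :> R by rewrite pnatr_eq0.
have n2 : n.+2%:R != 0 :> R by rewrite pnatr_eq0.
rewrite /ez -mulr_natr natrM.
rewrite (_ : _ * _ = f n ^+ 2 * (rho ^+ (2 * n.+1) * (n.+1%:R / n.+2%:R))); last first.
  by move: n1 n2; rewrite -[n.+2]addn1 natrD => n1 n2; field; apply/andP; split.
rewrite ler_piMr ?sqr_ge0// mulr_ile1 ?exprn_ge0 ?exprn_ile1 ?(ltW r0)//.
by rewrite ler_pdivrMr ?ltr0n// mul1r ler_nat.
Qed.

Lemma J_trilinear n M a f g : (n + n <= M)%N ->
  J (w * ((re n f * re n g - im n f * im n g) * re M (da a) +
          (re n f * im n g + im n f * re n g) * im M (da a))) =
  J 1 * \sum_(j < n) \sum_(k < n) f j * g k * a (j + k)%N.+1 * (rho ^+ (2 * (j + k).+1) / (j + k)%N.+2%:R).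
Proof.
move=> nM.
have zadd (j k : nat) : zc (j + k)%N = zc j * zc k - zs j * zs k :> A /\
    zs (j + k)%N = zc j * zs k + zs j * zc k :> A.
  elim: j => [|j [IH1 IH2]]; first by rewrite add0n /zc /zs /=; split; ring.
  by rewrite addSn !zcS !zsS IH1 IH2; split; ring.
have cM (x y : R) : cst2 (x * y) = cst2 x * cst2 y :> A by rewrite /cst2 !polyCM.
have E : (re n f * re n g - im n f * im n g) * re M (da a) +
          (re n f * im n g + im n f * re n g) * im M (da a) =
  \sum_(j < n) \sum_(k < n) cst2 (f j * g k) * (zc (j + k)%N * re M (da a) + zs (j + k)%N * im M (da a)).
  have -> : re n f * re n g - im n f * im n g = \sum_(j < n) \sum_(k < n) cst2 (f j * g k) * zc (j + k)%N.
    rewrite /re /im !big_distrlr /= -sumrB; apply: eq_bigr => j _.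
    rewrite -sumrB; apply: eq_bigr => k _; rewrite (proj1 (zadd j k)) cM; ring.
  have -> : re n f * im n g + im n f * re n g = \sum_(j < n) \sum_(k < n) cst2 (f j * g k) * zs (j + k)%N.
    rewrite /re /im !big_distrlr /= -big_split; apply: eq_bigr => j _.
    rewrite -big_split; apply: eq_bigr => k _; rewrite (proj2 (zadd j k)) cM /=; ring.
  rewrite !mulr_suml -big_split; apply: eq_bigr => j _ /=.
  rewrite !mulr_suml -big_split; apply: eq_bigr => k _ /=.
  by ring.
rewrite E mulr_sumr (J_sum r01) mulr_sumr; apply: eq_bigr => j _.
rewrite mulr_sumr (J_sum r01) mulr_sumr; apply: eq_bigr => k _.
rewrite mulrCA (JCM r01) -[X in _ = J 1 * X]mulrA [RHS]mulrCA; congr (_ * _).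
have jkM : (j + k < M)%N.
  by apply: leq_trans nM; rewrite -addSn leq_add// ltnW.
have -> : zc (j + k)%N * re M (da a) + zs (j + k)%N * im M (da a) =
   \sum_(m < M) cst2 (da a m) * (zc (j + k)%N * zc m + zs (j + k)%N * zs m).
  rewrite /re /im !mulr_sumr -big_split; apply: eq_bigr => m _ /=; ring.
rewrite mulr_sumr (J_sum r01) (bigD1 (Ordinal jkM))//= [X in _ + X]big1 ?addr0; last first.
  move=> i ij; rewrite mulrCA (JCM r01) (proj2 (J_zip r01 _ _)) ifF ?mulr0//.
  by apply/negP => /eqP e; move/eqP: ij; apply; exact/val_inj.
rewrite mulrCA (JCM r01) (proj2 (J_zip r01 _ _)) eqxx /da natrM -mulr_natr.
have n1 : (j + k)%N.+1%:R != 0 :> R by rewrite pnatr_eq0.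
have n2 : (j + k)%N.+2%:R != 0 :> R by rewrite pnatr_eq0.
by field; apply/andP; split.
Qed.

Lemma trilinear_le n M a f g K : 0 <= K ->
  J (w * (mod2 n g * mod2 M (da a))) <= K ->
  `|J (w * ((re n f * re n g - im n f * im n g) * re M (da a) +
          (re n f * im n g + im n f * re n g) * im M (da a)))| <=
  2 * (Num.sqrt (J (w * mod2 n f)) * Num.sqrt K).
Proof.
move=> K0; rewrite /mod2.
move: (re n f) (im n f) (re n g) (im n g) (re M (da a)) (im M (da a)) =>
  e1 e2 g1 g2 p1 p2 hK.
(* m1 + i m2 is conj(g) a'. Its square modulus |g|^2 |a'|^2 is the Carleson integrand, and f is left
   as the other factor of Cauchy-Schwarz. *)
pose m1 := g1 * p1 + g2 * p2; pose m2 := g1 * p2 - g2 * p1.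
have -> : w * ((e1 * g1 - e2 * g2) * p1 + (e1 * g2 + e2 * g1) * p2) =
    e1 * m1 * w + e2 * m2 * w by rewrite /m1 /m2; ring.
have w0 z : disc rho z -> 0 <= ev w z by exact: disc_wt_ge0.
have sq0 p z : disc rho z -> 0 <= ev (p * p * w) z.
  by move=> hz; rewrite evM [ev (p * p) z]evM mulr_ge0 ?w0// -expr2 sqr_ge0.
have E q1 q2 : w * (q1 * q1 + q2 * q2) = q1 * q1 * w + q2 * q2 * w by ring.
have m12 : w * ((g1 * g1 + g2 * g2) * (p1 * p1 + p2 * p2)) = m1 * m1 * w + m2 * m2 * w.
  by rewrite /m1 /m2; ring.
rewrite m12 (JD r01) in hK; rewrite E (JD r01).
have J0 p : 0 <= J (p * p * w) by apply: J_ge0 => z hz; exact: sq0.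
have cs p q : `|J (p * q * w)| <= Num.sqrt (J (p * p * w)) * Num.sqrt (J (q * q * w)).
  rewrite -sqrtrM ?J0// -sqrtr_sqr ler_wsqrtr//; exact: (J_CS r01).
rewrite (JD r01); apply: le_trans (ler_normD _ _) _.
rewrite mulr2n mulrDl mul1r; apply: lerD; apply: le_trans (cs _ _) _;
  apply: ler_pM; rewrite ?sqrtr_ge0// ler_wsqrtr//.
- by rewrite lerDl J0.
- by apply: le_trans hK; rewrite lerDl J0.
- by rewrite lerDr J0.
- by apply: le_trans hK; rewrite lerDr J0.
Qed.

(** The Hankel form is an integral of (z f g)' + f g against conj(a'), up to the area. Splitting it
    symmetrically lets the Carleson inequality act on the factor that is not differentiated. *)
Lemma pairing_bound n M a f g K : 1 / 4 <= rho -> 0 <= K -> (n + n <= M)%N ->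
  (forall h : nat -> R, J (w * (mod2 n h * mod2 M (da a))) <= K * \sum_(k < n) h k ^+ 2) ->
  `|\sum_(j < n) \sum_(k < n) f j * g k * (a (j + k)%N.+1 * rho ^+ (2 * (j + k).+1))| <=
  32 * Num.sqrt K * (Num.sqrt (\sum_(k < n) f k ^+ 2) * Num.sqrt (\sum_(k < n) g k ^+ 2)).
Proof.
move=> r4 K0 nM hK.
have S0 (h : nat -> R) : 0 <= \sum_(k < n) h k ^+ 2 by apply: sumr_ge0 => k _; exact: sqr_ge0.
have J1 := J1_ge r01 r4.
have J10 : 0 < J 1 by apply: lt_le_trans J1; lra.
pose T f g := J (w * ((re n f * re n g - im n f * im n g) * re M (da a) +
          (re n f * im n g + im n f * re n g) * im M (da a))).
(* In (z f)' g + f (z g)' the coefficient is (j + 1) + (k + 1) = j + k + 2, which cancels the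
   denominator left by the weighted integral. *)
have e1 : J 1 * \sum_(j < n) \sum_(k < n) f j * g k * (a (j + k)%N.+1 * rho ^+ (2 * (j + k).+1)) =
    T (ez f) g + T (ez g) f.
  have Tsym : T (ez g) f = T f (ez g) by rewrite /T; congr Jd; ring.
  rewrite Tsym /T !(J_trilinear a _ _ nM) -mulrDr; congr (_ * _).
  rewrite -big_split; apply: eq_bigr => j _; rewrite -big_split; apply: eq_bigr => k _ /=.
  have n2 : (j + k)%N.+2%:R != 0 :> R by rewrite pnatr_eq0.
  have n2E : (j + k)%N.+2%:R = j.+1%:R + k.+1%:R :> R by rewrite -natrD addSn addnS.
  rewrite /ez -[f j *+ _]mulr_natr -[g k *+ _]mulr_natr; rewrite n2E in n2 *; by field.
have bnd f' g' : `|T (ez f') g'| <= 2 * (Num.sqrt (J 1) * Num.sqrt (\sum_(k < n) f' k ^+ 2) *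
    (Num.sqrt K * Num.sqrt (\sum_(k < n) g' k ^+ 2))).
  apply: le_trans (trilinear_le (ez f') _ (hK g')) _; first exact: mulr_ge0.
  rewrite ler_wpM2l// -[X in _ <= _ * X]sqrtrM//; apply: ler_wpM2r; first exact: sqrtr_ge0.
  by rewrite -sqrtrM ?(ltW J10)// ler_wsqrtr//; exact: J_ez.
set Z := \sum_(j < n) _ in e1 *; set a1 := Num.sqrt (\sum_(k < n) f k ^+ 2) in bnd *.
set a2 := Num.sqrt (\sum_(k < n) g k ^+ 2).
have := bnd f g; have := bnd g f; rewrite -/a1 -/a2 => b1 b2.
have s1 : 0 < Num.sqrt (J 1) by rewrite sqrtr_gt0.
have s2 : Num.sqrt (J 1) * Num.sqrt (J 1) = J 1 by rewrite -expr2 sqr_sqrtr// ltW.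
have s3 := sqrt_ge_eighth J1.
have h : J 1 * `|Z| <= 4 * Num.sqrt (J 1) * (Num.sqrt K * (a1 * a2)).
  rewrite -{1}(ger0_norm (ltW J10)) -normrM e1.
  by apply: le_trans (ler_normD _ _) _; apply: le_trans (lerD b2 b1) _; rewrite le_eqVlt; apply/orP; left; apply/eqP; ring.
have h2 : Num.sqrt (J 1) * `|Z| <= 4 * (Num.sqrt K * (a1 * a2)).
  rewrite -(ler_pM2l s1) [leLHS]mulrA s2; apply: le_trans h _.
  by rewrite le_eqVlt; apply/orP; left; apply/eqP; ring.
(* 32 = 4 * 8, the 8 coming from [1 / 8 <= Num.sqrt (J 1)]. *)
by rewrite -[32 * _ * _]mulrA; exact: eighth_arith s3 (normr_ge0 Z) h2.
Qed.

End PairingBound.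
End CarlesonOnDisc.

(** * Restriction of regular functions to slices *)

Section Slices.
Variable R : realType.
Local Notation H := (quat R).
Local Notation zc := (@zc R).
Local Notation zs := (@zs R).
Implicit Types (a : nat -> R) (b : nat -> H) (z : R * R) (x y r rho : R) (I : H).

Lemma qsphereP I : qsphere I -> qre I = 0 /\ `|I| = 1.
Proof.
rewrite /qsphere /= => h.
have n1 : `|I| ^+ 2 = 1 by rewrite -normqX h normrN (norm_qb _ 0).
have I1 : `|I| = 1.
  by apply/eqP; rewrite -(eqrXn2 (ltn0Sn 1)) ?n1 ?expr1n.
split=> //; have := congr1 (@qre R) h; move: n1; rewrite normsqE sum4 /qc /= expr2.
case: I {h I1} => a b c d /=; rewrite /qmul /= => n1 h.
have : a ^+ 2 *+ 2 = 0 by move: n1 h; rewrite !expr2; lra.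
by move/eqP; rewrite mulrn_eq0 /= sqrf_eq0 => /eqP.
Qed.

Lemma qsphere_sqr I : qsphere I -> I * I = - 1.
Proof. by rewrite /qsphere /= expr2. Qed.

Lemma slice_pow I x y n : qsphere I ->
  slice_pt I x y ^+ n = (ev (zc n) (x, y))%:A + ev (zs n) (x, y) *: I.
Proof.
move=> /qsphere_sqr II; elim: n => [|n IH].
  by rewrite expr0 /zc /zs /= ev1 ev0 scale1r scale0r addr0.
rewrite exprS IH zcS zsS evB !evD !evM evX evY /= /slice_pt.
rewrite !mulrDl !mulrDr -!scalerAl -!scalerAr !mul1r !mulr1 II !scalerA.
rewrite scalerN scalerBl scalerDl [RHS]addrAC -!addrA; congr (_ + _).
Qed.

Lemma slice_norm I x y : qsphere I -> `|slice_pt I x y| ^+ 2 = x ^+ 2 + y ^+ 2.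
Proof.
move=> /qsphereP[re0 n1]; move: n1 => /(congr1 (fun t => t ^+ 2)).
rewrite expr1n !normsqE !sum4 /slice_pt !qcD !qcZ /qc /=.
case: I re0 => a b c d /= ->; rewrite expr0n /= add0r => h.
rewrite !(mulr0, mulr1, addr0, add0r) !exprMn -addrA -addrA; congr (_ + _).
by rewrite -!mulrDr addrA h mulr1.
Qed.

Lemma zpow_norm n z : ev (zc n) z ^+ 2 + ev (zs n) z ^+ 2 = (z.1 ^+ 2 + z.2 ^+ 2) ^+ n.
Proof.
elim: n => [|n IH]; first by rewrite /zc /zs /= ev1 ev0 !expr0 expr1n expr0n addr0.
by rewrite [RHS]exprS -IH zcS zsS evB evD !evM evX evY; ring.
Qed.

Definition Ufun a z := limn (fun N => ev (re N a) z).
Definition Vfun a z := limn (fun N => ev (im N a) z).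
(** Radius of convergence at least 1, in the form of Cauchy's estimates; this form passes easily to
    coordinates and to derivatives. *)
Definition rregular a := forall rho, 0 < rho < 1 -> exists C, forall n, `|a n| * rho ^+ n <= C.

Lemma rregular_le a rho : rregular a -> 0 <= rho < 1 ->
  exists C r, [/\ 0 <= C, rho < r < 1 & forall n, `|a n| * rho ^+ n <= C * (rho / r) ^+ n].
Proof.
move=> ha /andP[r0 r1]; pose r := (rho + 1) / 2.
have rr : rho < r < 1 by apply/andP; split; rewrite /r; lra.
have /andP[h1 h2] := rr; have rp : 0 < r by apply: le_lt_trans h1.
have [|C hC] := ha r; first by rewrite rp.
have C0 : 0 <= C by apply: le_trans (hC 0%N); rewrite mulr_ge0.
exists C, r; split => // n; rewrite expr_div_n mulrA ler_pdivlMr ?exprn_gt0//.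
by rewrite mulrAC ler_wpM2r ?exprn_ge0.
Qed.

Lemma natr_expr_le r n : 0 <= r < 1 -> n.+1%:R * r ^+ n <= (1 - r)^-1.
Proof.
move=> /andP[r0 r1].
have -> : n.+1%:R * r ^+ n = \sum_(0 <= k < n.+1) r ^+ n :> R.
  by rewrite big_mkord sumr_const card_ord mulr_natl.
apply: (@le_trans _ _ (\sum_(0 <= k < n.+1) r ^+ k)).
  rewrite !big_mkord; apply: ler_sum => k _.
  by rewrite ler_wiXn2l ?(ltW r1)// -ltnS.
by have := @geo_sum_le R r 0 n.+1; rewrite r0 r1 expr0 mul1r; apply.
Qed.

Lemma rregular_da a : rregular a -> rregular (da a).
Proof.
move=> ha rho /andP[r0 r1].
have rr : 0 <= rho < 1 by rewrite ltW.
have [C [r [C0 /andP[rr1 r'1] hC]]] := rregular_le ha rr.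
have q01 : 0 <= rho / r < 1.
  by rewrite divr_ge0 ?ltr_pdivrMr ?mul1r//; lra.
exists (C * (1 - rho / r)^-1 / rho) => n; rewrite ler_pdivlMr// /da -mulrA -exprSr.
rewrite -[a n.+1 *+ _]mulr_natl normrM normr_nat -mulrA.
apply: (@le_trans _ _ (n.+1%:R * (C * (rho / r) ^+ n.+1))); first by rewrite ler_wpM2l.
rewrite mulrCA ler_wpM2l//; apply: le_trans (natr_expr_le n q01).
rewrite ler_wpM2l// ler_wiXn2l//; by case/andP: q01 => // _ /ltW.
Qed.

Lemma regular_rregular b e : regular b -> rregular (fun n => qc e (b n)).
Proof.
move=> hb rho /andP[r0 r1].
have q1 : qball (rho%:A : H) by rewrite /qball /= norm_real ger0_norm ?(ltW r0).
have /cvg_series_cvg_0 h0 := hb _ q1.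
have [C [_ hC]] := cvg_seq_bounded (cvgP _ h0).
have CC : C < C + 1 by rewrite ltrDl.
exists (C + 1) => n; have /= := hC (C + 1) CC n Logic.I.
rewrite normqM normqX norm_real ger0_norm ?(ltW r0)// mulrC.
by apply: le_trans; rewrite ler_wpM2r ?exprn_ge0 ?(ltW r0)// qc_le.
Qed.

Lemma ev_re N a z : ev (re N a) z = \sum_(n < N) a n * ev (zc n) z.
Proof. by rewrite /re ev_sum; apply: eq_bigr => n _; rewrite evM evC. Qed.
Lemma ev_im N a z : ev (im N a) z = \sum_(n < N) a n * ev (zs n) z.
Proof. by rewrite /im ev_sum; apply: eq_bigr => n _; rewrite evM evC. Qed.

Lemma zc_le n z rho : 0 <= rho -> z.1 ^+ 2 + z.2 ^+ 2 <= rho ^+ 2 ->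
  `|ev (zc n) z| <= rho ^+ n /\ `|ev (zs n) z| <= rho ^+ n.
Proof.
move=> r0 hz; have h : ev (zc n) z ^+ 2 + ev (zs n) z ^+ 2 <= (rho ^+ n) ^+ 2.
  rewrite zpow_norm -exprM mulnC exprM lerXn2r ?nnegrE ?exprn_ge0//.
  by rewrite addr_ge0 ?sqr_ge0.
have [p1 p2] := (sqr_ge0 (ev (zc n) z), sqr_ge0 (ev (zs n) z)).
by split; rewrite -(ler_pXn2r (ltn0Sn 1)) ?nnegrE ?exprn_ge0// real_normK ?num_real//; lra.
Qed.

(** The rate is uniform on the closed disc of radius [rho]; this is what allows partial sums to
    replace the functions inside integrals over circles and discs. *)
Lemma UV_tail a rho : rregular a -> 0 <= rho < 1 -> exists C q, [/\ 0 <= C, 0 <= q < 1 &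
  forall z, z.1 ^+ 2 + z.2 ^+ 2 <= rho ^+ 2 ->
  [/\ ev (re N a) z @[N --> \oo] --> Ufun a z, ev (im N a) z @[N --> \oo] --> Vfun a z &
  forall N, `|Ufun a z - ev (re N a) z| <= C * q ^+ N /\ `|Vfun a z - ev (im N a) z| <= C * q ^+ N]].
Proof.
move=> ha rr; have [C [r [C0 /andP[h1 h2] hC]]] := rregular_le ha rr.
have /andP[r0 r1] := rr.
have q01 : 0 <= rho / r < 1.
  by rewrite divr_ge0 ?ltr_pdivrMr ?mul1r//; lra.
exists (C / (1 - rho / r)), (rho / r).
have /andP[q0 q1] := q01.
split=> //; first by rewrite divr_ge0// subr_ge0 ltW.
move=> z hz.
have b1 n : `|a n * ev (zc n) z : R^o| <= C * (rho / r) ^+ n.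
  rewrite normrM; apply: le_trans (hC n); rewrite ler_wpM2l//.
  by case: (zc_le n r0 hz).
have b2 n : `|a n * ev (zs n) z : R^o| <= C * (rho / r) ^+ n.
  rewrite normrM; apply: le_trans (hC n); rewrite ler_wpM2l//.
  by case: (zc_le n r0 hz).
have [c1 t1] := geo_tail q01 b1; have [c2 t2] := geo_tail q01 b2.
have e1 : (fun N => ev (re N a) z) = series (fun n => a n * ev (zc n) z : R^o).
  by apply/funext => N; rewrite ev_re /series /= big_mkord.
have e2 : (fun N => ev (im N a) z) = series (fun n => a n * ev (zs n) z : R^o).
  by apply/funext => N; rewrite ev_im /series /= big_mkord.
split; [by rewrite /Ufun e1|by rewrite /Vfun e2|].
move=> N; rewrite /Ufun /Vfun e1 e2 ev_re ev_im mulrAC -mulrA.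
by split; [exact: t1|exact: t2].
Qed.

Lemma cseq_cderiv b e : (fun n => qc e (cderiv b n)) = da (fun n => qc e (b n)).
Proof. by apply/funext => n; rewrite /cderiv qcMn. Qed.

Definition QU b z : H := \sum_e Ufun (fun n => qc e (b n)) z *: qb R e.
Definition QV b z : H := \sum_e Vfun (fun n => qc e (b n)) z *: qb R e.

Lemma qc_sum_qb (F : 'I_4 -> R) e : qc e (\sum_e' F e' *: qb R e') = F e.
Proof.
rewrite qc_sum sum4 !qcZ; move: e; apply: forall4; rewrite /qc /=;
  by rewrite !(mulr0, mulr1, addr0, add0r).
Qed.

Lemma reg_eval_slice b I x y : (forall e, rregular (fun n => qc e (b n))) -> qsphere I ->
  x ^+ 2 + y ^+ 2 < 1 ->
  reg_eval b (slice_pt I x y) = QU b (x, y) + I * QV b (x, y).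
Proof.
move=> hb hI xy; pose rho := Num.sqrt (x ^+ 2 + y ^+ 2).
have rr : 0 <= rho < 1.
  by rewrite sqrtr_ge0 /= -[ltRHS]sqrtr1 ltr_sqrt.
have hz : (x, y).1 ^+ 2 + (x, y).2 ^+ 2 <= rho ^+ 2.
  by rewrite sqr_sqrtr ?addr_ge0 ?sqr_ge0.
have mulI (l : H) (u : nat -> H) : u @ \oo --> l -> (fun N => I * u N) @ \oo --> I * l.
  move=> ul; apply/cvgrPdist_le => eps e0; have /cvgrPdist_le/(_ _ e0) := ul.
  apply: filterS => N; rewrite -mulrBr normqM (proj2 (qsphereP hI)) mul1r//.
apply: cvg_lim => //.
have -> : series (fun n => slice_pt I x y ^+ n * b n) = fun N =>
   \sum_(n < N) ev (zc n) (x, y) *: b n + I * \sum_(n < N) ev (zs n) (x, y) *: b n.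
  apply/funext => N; rewrite /series /= big_mkord mulr_sumr -big_split; apply: eq_bigr => n _ /=.
  by rewrite slice_pow// mulrDl -scalerAl mul1r -scalerAl -scalerAr.
apply: cvgD; last apply: mulI; apply/cvg_quatP => e /=.
  rewrite qc_sum_qb; have [C [q [_ _ /(_ _ hz) [h _ _]]]] := UV_tail (hb e) rr.
  apply: cvg_trans h; apply: near_eq_cvg; near=> N; rewrite /= ev_re qc_sum.
  by apply: eq_bigr => n _; rewrite qcZ mulrC.
rewrite qc_sum_qb; have [C [q [_ _ /(_ _ hz) [_ h _]]]] := UV_tail (hb e) rr.
apply: cvg_trans h; apply: near_eq_cvg; near=> N; rewrite /= ev_im qc_sum.
by apply: eq_bigr => n _; rewrite qcZ mulrC.
Unshelve. all: by end_near. Qed.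

End Slices.

(** * Iterated integrals over the half disc *)

Section IteratedIntegrals.
Variable R : realType.
Local Notation mu := (@lebesgue_measure R).
Local Notation mu2 := (mu \x mu)%E.
Local Notation A := {poly {poly R}}.
Implicit Types (rho K : R).

(** A nonnegative integral is a supremum over simple functions below the integrand. Comparing these
    suprema handles inner integrals as functions of the outer variables without a study of their
    measurability. *)
Lemma integral_mono d (T : measurableType d) (nu : {measure set T -> \bar R})
  (D D' : set T) (f g : T -> \bar R) : D `<=` D' ->
  (forall x, D x -> (0 <= f x)%E) -> (forall x, D' x -> (0 <= g x)%E) ->
  (forall x, D x -> (f x <= g x)%E) ->
  (\int[nu]_(x in D) f x <= \int[nu]_(x in D') g x)%E.
Proof.
move=> DD f0 g0 fg; rewrite integral_mkcond [leRHS]integral_mkcond.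
have F0 x : (0 <= (f \_ D) x)%E by rewrite patchE; case: ifPn => // /set_mem /f0.
have G0 x : (0 <= (g \_ D') x)%E by rewrite patchE; case: ifPn => // /set_mem /g0.
rewrite !ge0_integralTE//; apply: ereal_sup_le => _ [h hf <-]; exists h => // x.
apply: le_trans (hf x) _; rewrite !patchE; case: ifPn => [/set_mem Dx|_].
  by rewrite mem_set; [exact: fg|exact: DD].
by case: ifPn => // /set_mem /g0.
Qed.

Definition hdisc rho : set (R * R) := [set z | 0 < z.2 /\ disc rho z].

Lemma measurable_hdisc rho : measurable (hdisc rho).
Proof.
have -> : hdisc rho = (snd @^-1` `]0, +oo[) `&` disc rho.
  by apply/seteqP; split => z /=; rewrite in_itv /= andbT.
apply: measurableI; last exact: measurable_disc.
by rewrite -[X in measurable X]setTI; exact: measurable_snd.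
Qed.

Lemma limn_einf_le (u : nat -> \bar R) (K : \bar R) :
  (forall n, (u n <= K)%E) -> (limn_einf u <= K)%E.
Proof.
move=> uK; rewrite limn_einf_lim; apply: lime_le.
  by apply: ereal_nondecreasing_is_cvgn; exact: nondecreasing_einfs.
apply: nearW => n; apply: le_trans (uK n).
by apply: ereal_inf_lbound; exists n => /=.
Qed.

(** The integral over the ball is an iterated one. Fatou's lemma is applied in y and again in x, and
    Tonelli's theorem only to the approximating polynomials. *)
Lemma iterated_fatou (p : nat -> A) K (F : R -> R -> \bar R) :
  (forall n z, disc 1 z -> 0 <= ev (p n) z) -> (forall n, Jd 1 (p n) <= K) ->
  (forall x y, disc 1 (x, y) -> (0 <= F x y)%E) ->
  (forall x y, disc 1 (x, y) -> (F x y <= limn_einf (fun n => (ev (p n) (x, y))%:E))%E) ->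
  (\int[mu]_x \int[mu]_(y in [set y : R | (0 < y)%R /\ (x ^+ 2 + y ^+ 2 < 1)%R]) F x y <= K%:E)%E.
Proof.
move=> p0 pK F0 hF.
have r01 : 0 < (1 : R) <= 1 by rewrite ltr01 lexx.
pose g n : R * R -> \bar R := (EFin \o ev (p n)) \_ (disc 1).
have g0 n z : (0 <= g n z)%E.
  by rewrite /g patchE; case: ifPn => // /set_mem h; rewrite lee_fin; exact: p0.
have mg n : measurable_fun setT (g n).
  apply/(measurable_restrictT _ _).1; first exact: measurable_disc.
  by apply/measurable_EFinP; exact: measurable_funTS (ev_measurable (p n)).
pose G n := fubini_F mu (g n).
have mG n : measurable_fun setT (G n) by exact: (@measurable_fun_fubini_tonelli_F _ _ _ _ _ mu (g n) (mg n) (g0 n)).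
have G0 n x : (0 <= G n x)%E by apply: integral_ge0 => y _; exact: g0.
have JE n : (\int[mu]_x G n x = (Jd 1 (p n))%:E)%E.
  transitivity (\int[mu2]_z g n z)%E.
    by symmetry; exact: (@fubini_tonelli1 _ _ _ _ _ mu mu (g n) (mg n) (g0 n)).
  rewrite /g -integral_mkcond /Jd /Rintegral fineK//.
  by apply: integrable_fin_num; do ?[exact: measurable_disc|exact: (ev_integrable _ r01)].
have D1 x y : [set y : R | (0 < y)%R /\ (x ^+ 2 + y ^+ 2 < 1)%R] y -> disc 1 (x, y).
  by move=> [_]; rewrite /disc /= expr1n.
have einf0 (u : nat -> \bar R) : (forall n, (0 <= u n)%E) -> (0 <= limn_einf u)%E.
  move=> u0; rewrite limn_einf_lim; apply: lime_ge.
    by apply: ereal_nondecreasing_is_cvgn; exact: nondecreasing_einfs.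
  by apply: nearW => n; apply: le_ereal_inf_tmp => _ [m _ <-].
apply: (@le_trans _ _ (\int[mu]_x limn_einf (G^~ x))%E).
  apply: integral_mono => // x _; first by apply: integral_ge0 => y /D1; exact: F0.
    by apply: einf0.
  apply: (@le_trans _ _ (\int[mu]_y limn_einf (fun n => g n (x, y)))%E).
    apply: integral_mono => // y hy.
    - exact/F0/D1.
    - exact: einf0.
    - apply: le_trans (hF _ _ (D1 _ _ hy)) _.
      rewrite (_ : (fun n => g n (x, y)) = fun n => (ev (p n) (x, y))%:E)//.
      by apply/funext => n; rewrite /g patchE mem_set//; exact: D1.
  apply: (@fatou _ _ _ mu setT measurableT (fun n y => g n (x, y))) => // n.
  exact: (measurableT_comp (mg n) (pair1_measurable x)).
apply: le_trans (@fatou _ _ _ mu setT measurableT G mG (fun n x _ => G0 n x)) _.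
by apply: limn_einf_le => n; rewrite JE lee_fin.
Qed.

Lemma iterated_EFin (D : set (R * R)) (h : R * R -> R) (C : R) : measurable D ->
  (mu2 D < +oo)%E -> measurable_fun D h -> (forall z, D z -> 0 <= h z <= C) ->
  (\int[mu]_x \int[mu]_(y in [set y : R | D (x, y)]) (h (x, y))%:E =
    (\int[mu2]_(z in D) h z)%R%:E)%E.
Proof.
move=> mD fD mh hC.
pose g : R * R -> \bar R := (EFin \o h) \_ D.
have g0 z : (0 <= g z)%E.
  by rewrite /g patchE; case: ifPn => // /set_mem /hC /andP[].
have mg : measurable_fun setT g.
  by apply/(measurable_restrictT _ _).1 => //; apply/measurable_EFinP.
transitivity (\int[mu2]_z g z)%E.
  rewrite (@fubini_tonelli1 _ _ _ _ _ mu mu g mg g0); apply: eq_integral => x _.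
  rewrite integral_mkcond; apply: eq_integral => y _; rewrite /g !patchE.
  by congr (if _ then _ else _); apply/idP/idP; rewrite !inE.
rewrite /g -integral_mkcond /Rintegral fineK//; apply: integrable_fin_num => //.
apply: measurable_bounded_integrable => //.
exists C; split; first exact: num_real.
move=> M CM z /hC /andP[h0 h1] /=; rewrite ger0_norm//; exact: ltW (le_lt_trans h1 CM).
Qed.

Lemma hdisc_finite rho : 0 < rho <= 1 -> (mu2 (hdisc rho) <= 4%:E)%E.
Proof.
move=> r01; apply: le_trans (disc_finite r01); apply: le_measure; rewrite ?inE.
- exact: measurable_hdisc.
- exact: measurable_disc.
- by move=> z [].
Qed.

Definition Jh rho (F : R * R -> R) : R := \int[mu2]_(z in hdisc rho) F z.

(** The ball is parametrised by y > 0, while monomials are orthogonal over the full disc; reflection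
    in the real axis accounts for the factor 2. *)
Lemma Jh_even rho (p : A) : 0 < rho <= 1 -> (forall x y, ev p (x, - y) = ev p (x, y)) ->
  (forall z, disc rho z -> 0 <= ev p z) -> Jd rho p = 2 * Jh rho (ev p).
Proof.
move=> r01 pe p0; have [C hC] := ev_bound p.
have bd z : disc rho z -> 0 <= ev p z <= C.
  move=> hz; rewrite p0//=; have [z1 z2] := disc_le1 r01 hz.
  by apply: le_trans (hC z z1 z2); exact: ler_norm.
apply: EFin_inj; rewrite EFinM.
rewrite -(@iterated_EFin (disc rho) (ev p) C)//; first last.
- exact: measurable_funTS (ev_measurable p).
- by apply: le_lt_trans (disc_finite r01) (ltry _).
- exact: measurable_disc.
rewrite /Jh -(@iterated_EFin (hdisc rho) (ev p) C)//; first last.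
- by move=> z [_]; exact: bd.
- exact: measurable_funTS (ev_measurable p).
- by apply: le_lt_trans (hdisc_finite r01) (ltry _).
- exact: measurable_hdisc.
have cy x : continuous (fun y => ev p (x, y)).
  rewrite (_ : (fun y => _) = fun y => ev (swapXY p) (y, x)); first exact: ev_cont1.
  by apply/funext => y; rewrite ev_swap.
pose s x := Num.sqrt (rho ^+ 2 - x ^+ 2).
have s0 x : 0 <= s x by exact: sqrtr_ge0.
have E1 x : (\int[mu]_(y in [set y : R | disc rho (x, y)]) (ev p (x, y))%:E =
   (if x ^+ 2 < rho ^+ 2 then rint (- s x) (s x) (fun y => ev p (x, y)) else 0)%R%:E)%E.
  rewrite -(section_integral rho x (cy x)) integral_mkcond; apply: eq_integral => y _.
  by rewrite patchE; congr (if _ then _ else _); apply/idP/idP; rewrite inE.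
have E2 x : (\int[mu]_(y in [set y : R | hdisc rho (x, y)]) (ev p (x, y))%:E =
   (if x ^+ 2 < rho ^+ 2 then rint 0 (s x) (fun y => ev p (x, y)) else 0)%R%:E)%E.
  case: ltP => xr; last first.
    rewrite (_ : [set y | _] = set0) ?integral_set0//.
    by apply/seteqP; split => // y [_]; rewrite /disc /= => h; have := sqr_ge0 y; lra.
  have ss : s x ^+ 2 = rho ^+ 2 - x ^+ 2 by rewrite sqr_sqrtr// subr_ge0 ltW.
  pose I : set R := `]0, (s x)[%classic.
  rewrite (_ : [set y | _] = I).
    rewrite /I (@integral_itv_bndo_bndc _ (BRight 0) (s x) (EFin \o fun y => ev p (x, y))); last first.
      by apply/measurable_EFinP; apply: measurable_funTS; exact: continuous_measurable_fun.
    rewrite integral_itv_obnd_cbnd; last first.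
      by apply/measurable_EFinP; apply: measurable_funTS; exact: continuous_measurable_fun.
    by rewrite -rint_EFin.
  apply/seteqP; split => y; rewrite /hdisc /disc /I /= in_itv /=.
    move=> [y0 h]; rewrite y0 /= -(ltr_pXn2r (ltn0Sn 1)) ?nnegrE ?(ltW y0)// ss; lra.
  by move=> /andP[y0 ys]; split=> //; nra.
under eq_integral do rewrite E1.
under [in RHS]eq_integral do rewrite E2.
have E3 (x : R) : (if x ^+ 2 < rho ^+ 2 then rint (- s x) (s x) (fun y => ev p (x, y)) else 0) =
  2 * (if x ^+ 2 < rho ^+ 2 then rint 0 (s x) (fun y => ev p (x, y)) else 0).
  case: ifP => _; last by rewrite mulr0.
  rewrite (@rint_chasles _ _ 0)// ?s0 ?oppr_le0 ?s0//.
  rewrite -{1}oppr0 rint_opp//.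
  by rewrite (@rint_ext _ _ (fun y => ev p (x, y))) => [|y]; [ring|exact: pe].
under eq_integral do rewrite E3 EFinM.
have mg : measurable_fun setT (fun x : R => (if x ^+ 2 < rho ^+ 2 then
    rint 0 (s x) (fun y => ev p (x, y)) else 0)%:E).
  rewrite (_ : (fun x => _) = fubini_F mu ((EFin \o ev p) \_ (hdisc rho))).
    apply: measurable_fun_fubini_tonelli_F.
      apply/(measurable_restrictT _ _).1; first exact: measurable_hdisc.
      by apply/measurable_EFinP; exact: measurable_funTS (ev_measurable p).
    by move=> z; rewrite patchE; case: ifPn => // /set_mem [_ /bd /andP[]].
  apply/funext => x; rewrite -E2 integral_mkcond; apply: eq_integral => y _.
  by rewrite !patchE; congr (if _ then _ else _); apply/idP/idP; rewrite !inE.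
rewrite ge0_integralZl_EFin// => x _; rewrite -E2.
by apply: integral_ge0 => y [_ /bd /andP[]].
Qed.

End IteratedIntegrals.

(** * Upper bound for integrals over the ball *)

Section BallIntegral.
Variable R : realType.
Local Notation mu := (@lebesgue_measure R).
Local Notation mu2 := (mu \x mu)%E.
Local Notation H := (quat R).
Local Notation A := {poly {poly R}}.
Local Notation pi := (@pi R).
Implicit Types (rho K x y t s : R) (b : nat -> H) (z : R * R) (I : H).

Definition cq b (e : 'I_4) (n : nat) : R := qc e (b n).

(** |P|^2 + |Q|^2 for b = P + I Q on the slices, a quantity free of I. *)
Definition UV2 b z : R := \sum_e (Ufun (cq b e) z ^+ 2 + Vfun (cq b e) z ^+ 2).

Lemma UV2_norm b z : UV2 b z = `|QU b z| ^+ 2 + `|QV b z| ^+ 2.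
Proof.
rewrite !normsqE -big_split; apply: eq_bigr => e _ /=.
by rewrite /QU /QV !qc_sum_qb.
Qed.

Lemma qsphere_sphere_pt t s : qsphere (sphere_pt t s).
Proof.
rewrite /qsphere /= expr2 /sphere_pt; apply: quat_eqP; apply: forall4; rewrite /qc /=.
- have h1 := cos2Dsin2 t; have h2 := cos2Dsin2 s.
  rewrite mulr0 sub0r -[RHS](congr1 -%R h1).
  rewrite [LHS](_ : _ = - ((cos s ^+ 2 + sin s ^+ 2) * sin t ^+ 2 + cos t ^+ 2)); last by ring.
  by rewrite h2; ring.
- by ring.
- by ring.
- by ring.
Qed.

Lemma UV2_ge0 b z : 0 <= UV2 b z.
Proof. by apply: sumr_ge0 => e _; rewrite addr_ge0 ?sqr_ge0. Qed.

Lemma cderiv_regular b : (forall e, rregular (cq b e)) -> forall e, rregular (cq (cderiv b) e).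
Proof.
move=> hb e; rewrite /cq cseq_cderiv; exact/rregular_da/hb.
Qed.

Lemma slice_upper_r b I x y : (forall e, rregular (cq b e)) -> qsphere I -> disc 1 (x, y) ->
  `|reg_eval b (slice_pt I x y)| ^+ 2 <= 2 * UV2 b (x, y).
Proof.
move=> hb hI; rewrite /disc /= expr1n => xy.
rewrite reg_eval_slice// UV2_norm; set p := QU _ _; set q := QV _ _.
have h := ler_normD p (I * q); rewrite normqM (proj2 (qsphereP hI)) mul1r in h.
have := sqr_ge0 (`|p| - `|q|); have := normr_ge0 (p + I * q).
have := normr_ge0 p; have := normr_ge0 q; nra.
Qed.

Lemma lebesgue_itv0 K : 0 <= K -> mu `[0, K]%classic = K%:E.
Proof.
move=> K0; rewrite lebesgue_measure_itv /= lte_fin; case: ltgtP K0 => // [h _|h _].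
  by rewrite -EFinD oppr0 addr0.
by rewrite -h.
Qed.

(** Bounding sin t by 1 gives 2 pi^2 in place of the area 4 pi of the sphere. *)
Lemma sphere_integral_le (F : H -> \bar R) K : 0 <= K ->
  (forall I, qsphere I -> (0 <= F I <= K%:E)%E) ->
  (sphere_integral F <= (K * (2 * pi) * pi)%:E)%E.
Proof.
move=> K0 hF; have pi0 := pi_ge0 R; rewrite /sphere_integral.
have F0 t s : (0 <= F (sphere_pt t s))%E by case/andP: (hF _ (qsphere_sphere_pt t s)).
have st t : `[0, pi]%classic t -> 0 <= sin t.
  by rewrite /= in_itv /= => h; exact: sin_ge0_pi.
apply: (@le_trans _ _ (\int[mu]_(t in `[0%R, pi]) (K * (2 * pi))%:E)%E).
  apply: integral_mono => // t ht.
  - by apply: integral_ge0 => s _; rewrite mule_ge0// lee_fin st.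
  - by rewrite lee_fin !mulr_ge0.
  apply: (@le_trans _ _ (\int[mu]_(s in `[0%R, (2 * pi)%R]) K%:E)%E).
    apply: integral_mono => // s hs; rewrite ?lee_fin//.
    - by rewrite mule_ge0// lee_fin st.
    - apply: (@le_trans _ _ (1 * F (sphere_pt t s))%E).
        by rewrite lee_wpmul2r// lee_fin sin_le1.
      by rewrite mul1e; case/andP: (hF _ (qsphere_sphere_pt t s)).
  rewrite integral_cst//= lebesgue_itv0; last by rewrite mulr_ge0.
  by rewrite -EFinM.
by rewrite integral_cst//= lebesgue_itv0// -EFinM.
Qed.

Lemma upper_arith (p q w u v : R) : 0 <= w -> p ^+ 2 <= 2 * u -> q ^+ 2 <= 2 * v ->
  p ^+ 2 * (q ^+ 2 * w) <= 4 * (w * (u * v)).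
Proof.
move=> w0 h1 h2; rewrite [leRHS](_ : _ = (2 * u) * (2 * v * w)); last by ring.
by apply: ler_pM => //; [exact: sqr_ge0|exact: mulr_ge0 (sqr_ge0 q) w0|rewrite ler_wpM2r].
Qed.

(** On every slice |P + I Q|^2 <= 2 (|P|^2 + |Q|^2), used once for [f] and once for the derivative
    of [b]. The resulting 4 cancels the 1/4 of the volume element and leaves 2 pi^2. *)
Lemma ball_upper (b f : nat -> H) (p : nat -> A) K : 0 <= K ->
  (forall e, rregular (cq b e)) -> (forall e, rregular (cq f e)) ->
  (forall n z, disc 1 z -> 0 <= ev (p n) z) -> (forall n, Jd 1 (p n) <= K) ->
  (forall z, disc 1 z -> ev (p n) z @[n --> \oo] -->
     ev (wt 1) z * (UV2 f z * UV2 (cderiv b) z)) ->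
  (ball_integral (fun q => (`|reg_eval f q| ^+ 2 * mu_density b q)%:E)
    <= (2 * pi ^+ 2 * K)%:E)%E.
Proof.
move=> K0 hb hf p0 pK pl.
have r01 : 0 < (1 : R) <= 1 by rewrite ltr01 lexx.
rewrite /ball_integral.
have -> : 2 * pi ^+ 2 * K = 4^-1 * (4 * K * (2 * pi) * pi) by field.
rewrite EFinM lee_pmul2l ?lte_fin//.
apply: sphere_integral_le => [|I hI]; first by rewrite mulr_ge0.
have dens x y : disc 1 (x, y) -> 0 <= mu_density b (slice_pt I x y).
  move=> hz; rewrite /mu_density mulr_ge0 ?sqr_ge0// slice_norm//.
  by move: hz; rewrite /disc /= expr1n; lra.
apply/andP; split.
  apply: integral_ge0 => x _; apply: integral_ge0 => y [_ xy].
  by rewrite lee_fin mulr_ge0 ?sqr_ge0// dens// /disc /= expr1n.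
apply: (@iterated_fatou _ (fun n => cst2 4 * p n)).
- by move=> n z hz; rewrite evM evC mulr_ge0// p0.
- by move=> n; rewrite (JCM r01) ler_wpM2l.
- by move=> x y hz; rewrite lee_fin mulr_ge0 ?sqr_ge0// dens.
move=> x y hz.
have hl : (ev (cst2 4 * p n) (x, y))%:E @[n --> \oo] -->
   (4 * (ev (wt 1) (x, y) * (UV2 f (x, y) * UV2 (cderiv b) (x, y))))%:E.
  apply: cvg_EFin; first by apply: nearW.
  rewrite [X in X @ _](_ : _ = fun n => 4 * ev (p n) (x, y)); last first.
    by apply/funext => n /=; rewrite evM evC.
  by apply: cvgM; [exact: cvg_cst|exact: pl].
rewrite is_cvg_limn_einfE; last by apply/cvg_ex; eexists; exact: hl.
rewrite (cvg_lim _ hl)// lee_fin.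
have h1 := slice_upper_r hf hI hz.
have h2 := slice_upper_r (cderiv_regular hb) hI hz.
rewrite /mu_density slice_norm// ev_wt /= expr1n.
have w0 : 0 <= 1 - x ^+ 2 - y ^+ 2.
  by move: (ltW hz); rewrite /= expr1n -subr_ge0 opprD addrA.
rewrite opprD addrA; exact: (upper_arith w0 h1 h2).
Qed.

(** The linear functions of I have mean zero on the sphere, so only the constant term survives. *)
Lemma sphere_linear (c0 c1 c2 c3 : R) :
  (\int[mu]_(t in `[0%R, pi]) \int[mu]_(s in `[0%R, (2 * pi)%R])
     (sin t * (c0 + sin t * cos s * c1 + sin t * sin s * c2 + cos t * c3))%:E = (4 * pi * c0)%:E)%E.
Proof.
have pi0 := pi_ge0 R.
have pi2 : 2 * pi = pi *+ 2 by rewrite mulr_natl.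
have inner t : (\int[mu]_(s in `[0%R, (2 * pi)%R])
     (sin t * (c0 + sin t * cos s * c1 + sin t * sin s * c2 + cos t * c3))%:E =
     (2 * pi * (sin t * (c0 + cos t * c3)))%:E)%E.
  pose f s := sin t * (c0 + sin t * cos s * c1 + sin t * sin s * c2 + cos t * c3).
  pose F s := sin t * ((c0 + cos t * c3) * s + sin t * c1 * sin s - sin t * c2 * cos s).
  have dF (s : R) : is_derive s (1 : R) F (f s).
    rewrite /F /f; apply: is_derive_eq.
    by rewrite /GRing.scale /=; ring.
  have cf : continuous f.
    move=> s; rewrite /f; apply: cvgM; first exact: cvg_cst.
    apply: cvgD; last exact: cvg_cst; apply: cvgD; last first.
      apply: cvgM; last exact: cvg_cst; apply: cvgM; first exact: cvg_cst.
      exact: continuous_sin.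
    apply: cvgD; first exact: cvg_cst.
    apply: cvgM; last exact: cvg_cst; apply: cvgM; first exact: cvg_cst.
    exact: continuous_cos.
  rewrite (rint_EFin _ _ cf); congr EFin.
  have -> : rint 0 (2 * pi) f = F (2 * pi) - F 0.
    by apply: (@rint_FTC _ f F) => //; rewrite mulr_ge0.
  by rewrite /F sin0 cos0 pi2 sin2pi cos2pi; ring.
under eq_integral => t _ do rewrite inner.
pose f (t : R) := 2 * pi * (sin t * (c0 + cos t * c3)).
pose F (t : R) := - (2 * pi * (c0 * cos t + c3 / 2 * cos t ^+ 2)).
have dF (s : R) : is_derive s (1 : R) F (f s).
  rewrite /F /f; apply: is_derive_eq.
  by rewrite /GRing.scale /=; field.
have cf : continuous f.
  move=> s; rewrite /f; apply: cvgM; first exact: cvg_cst.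
  apply: cvgM; first exact: continuous_sin.
  apply: cvgD; first exact: cvg_cst.
  apply: cvgM; last exact: cvg_cst; exact: continuous_cos.
rewrite (rint_EFin _ _ cf); congr EFin.
have -> : rint 0 pi f = F pi - F 0 by apply: (@rint_FTC _ f F).
by rewrite /F cos0 cospi; field.
Qed.

End BallIntegral.

(** * Lower bound for integrals over the ball *)

Section BallLower.
Variable R : realType.
Local Notation mu := (@lebesgue_measure R).
Local Notation mu2 := (mu \x mu)%E.
Local Notation H := (quat R).
Local Notation A := {poly {poly R}}.
Local Notation pi := (@pi R).
Implicit Types (rho K x y t s : R) (a f : nat -> R) (b : nat -> H) (z : R * R) (I p q : H).

(** The coefficients of |p + I q|^2 - |p|^2 - |q|^2 as a linear form in the imaginary unit I; every
    index other than 1 and 2 stands for the third coordinate. *)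
Definition cross (i : nat) p q : R := 2 * match i with
  | 1%N => - qre p * qi q + qi p * qre q - qj p * qk q + qk p * qj q
  | 2%N => - qre p * qj q + qi p * qk q + qj p * qre q - qk p * qi q
  | _ => - qre p * qk q - qi p * qj q + qj p * qi q + qk p * qre q end.

Lemma norm_slice p q I : qsphere I -> `|p + I * q| ^+ 2 =
  `|p| ^+ 2 + `|q| ^+ 2 + (qi I * cross 1 p q + qj I * cross 2 p q + qk I * cross 3 p q).
Proof.
move=> /qsphereP[re0 /(congr1 (fun t => t ^+ 2))]; rewrite expr1n !normsqE !sum4 !qcD /qc /cross /= => n1.
case: I re0 n1 => a i j k /= -> {a}.
case: p => p0 p1 p2 p3; case: q => q0 q1 q2 q3 /=; rewrite expr0n /= add0r => n1.
apply/eqP; rewrite -subr_eq0; apply/eqP.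
transitivity ((i ^+ 2 + j ^+ 2 + k ^+ 2 - 1) * (q0 ^+ 2 + q1 ^+ 2 + q2 ^+ 2 + q3 ^+ 2)); first by ring.
by rewrite n1 subrr mul0r.
Qed.

Definition bmeas (D : set (R * R)) (h : R * R -> R) :=
  measurable_fun D h /\ exists C, forall z, D z -> `|h z| <= C.

Lemma bmeasD D h k : bmeas D h -> bmeas D k -> bmeas D (fun z => h z + k z).
Proof.
move=> [mh [C hC]] [mk [E hE]]; split; first exact: measurable_funD.
exists (C + E) => z Dz; apply: le_trans (ler_normD _ _) _.
by apply: lerD; [exact: hC|exact: hE].
Qed.

Lemma bmeasM D h k : bmeas D h -> bmeas D k -> bmeas D (fun z => h z * k z).
Proof.
move=> [mh [C hC]] [mk [E hE]]; split; first exact: measurable_funM.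
exists (C * E) => z Dz; rewrite normrM.
by apply: ler_pM => //; [exact: hC|exact: hE].
Qed.

Lemma bmeas_cst D c : bmeas D (fun=> c).
Proof. by split; [exact: measurable_cst|exists `|c|]. Qed.

Lemma bmeasN D h : bmeas D h -> bmeas D (fun z => - h z).
Proof.
move=> hh; have := bmeasM (bmeas_cst D (- 1)) hh.
by under eq_fun do rewrite mulN1r.
Qed.

Lemma bmeas_sum D (h : 'I_4 -> R * R -> R) : (forall e, bmeas D (h e)) ->
  bmeas D (fun z => \sum_e h e z).
Proof.
move=> hh; rewrite [X in bmeas D X](_ : _ = fun z => h 0 z + h 1 z + h 2%:R z + h 3%:R z); last first.
  by apply/funext => z; rewrite sum4.
by do 3 (apply: bmeasD => //).
Qed.

Lemma bmeasX2 D h : bmeas D h -> bmeas D (fun z => h z ^+ 2).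
Proof. by move=> hh; under eq_fun do rewrite expr2; exact: bmeasM. Qed.

Lemma bmeas_int D h : measurable D -> (mu2 D < +oo)%E -> bmeas D h ->
  mu2.-integrable D (EFin \o h).
Proof.
move=> mD fD [mh [C hC]]; apply: measurable_bounded_integrable => //.
exists C; split; first exact: num_real.
by move=> M CM z Dz /=; apply: ltW; apply: le_lt_trans CM; exact: hC.
Qed.

Section Disc.
Variables (rho : R) (r01 : 0 < rho < 1).
Local Notation D := (hdisc rho).

Lemma hdisc_sub z : D z -> z.1 ^+ 2 + z.2 ^+ 2 <= rho ^+ 2.
Proof. by move=> [_ /ltW]. Qed.

Lemma bmeas_ev (p : A) : bmeas D (ev p).
Proof.
split; first exact: measurable_funTS (ev_measurable p).
have [C hC] := ev_bound p; exists C => z [_ hz].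
have [|z1 z2] := disc_le1 _ hz; last exact: hC.
by case/andP: r01 => -> /ltW.
Qed.

Lemma bmeas_UV a : rregular a -> bmeas D (Ufun a) /\ bmeas D (Vfun a).
Proof.
move=> ha; have rr : 0 <= rho < 1 by case/andP: r01 => /ltW -> ->.
have [C [q [C0 q01 hC]]] := UV_tail ha rr.
split; split.
- apply: (@measurable_fun_cvg _ _ _ _ (fun N => ev (re N a))).
    by move=> N; exact: measurable_funTS (ev_measurable _).
  by move=> z /hdisc_sub /hC[].
- exists C => z /hdisc_sub /hC[_ _ /(_ 0%N) []].
  by rewrite /re /im !big_ord0 ev0 subr0 expr0 mulr1.
- apply: (@measurable_fun_cvg _ _ _ _ (fun N => ev (im N a))).
    by move=> N; exact: measurable_funTS (ev_measurable _).
  by move=> z /hdisc_sub /hC[].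
- exists C => z /hdisc_sub /hC[_ _ /(_ 0%N) []].
  by rewrite /re /im !big_ord0 ev0 !subr0 expr0 mulr1.
Qed.

Lemma bmeas_QUV b : (forall e, rregular (cq b e)) ->
  (forall e, bmeas D (fun z => qc e (QU b z))) /\ (forall e, bmeas D (fun z => qc e (QV b z))).
Proof.
move=> hb; split => e; have [h1 h2] := bmeas_UV (hb e);
by rewrite /QU /QV; under eq_fun do rewrite qc_sum_qb.
Qed.

Lemma bmeas_cross b i : (forall e, rregular (cq b e)) ->
  bmeas D (fun z => cross i (QU b z) (QV b z)).
Proof.
move=> hb; have [hU hV] := bmeas_QUV hb.
have U0 := hU 0; have U1 := hU 1; have U2 := hU 2%:R; have U3 := hU 3%:R.
have V0 := hV 0; have V1 := hV 1; have V2 := hV 2%:R; have V3 := hV 3%:R.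
apply: bmeasM; first exact: bmeas_cst.
by case: i => [|[|[|i]]]; repeat (apply: bmeasD || apply: bmeasM || apply: bmeasN).
Qed.

Lemma bmeas_UV2 b : (forall e, rregular (cq b e)) -> bmeas D (UV2 b).
Proof.
move=> hb; apply: bmeas_sum => e; have [h1 h2] := bmeas_UV (hb e).
by apply: bmeasD; apply: bmeasX2.
Qed.

End Disc.

Lemma reg_eval_trunc n f I x y : qsphere I -> x ^+ 2 + y ^+ 2 < 1 ->
  `|reg_eval (fun k => (trunc n f k)%:A) (slice_pt I x y)| ^+ 2 = ev (mod2 n f) (x, y).
Proof.
move=> hI xy; have s0 k : (n <= k)%N -> slice_pt I x y ^+ k * ((trunc n f k)%:A : H) = 0.
  by move=> nk; rewrite /trunc ltnNge nk scale0r mulr0.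
rewrite /reg_eval (cvg_lim _ (series_support s0))//.
rewrite (_ : \sum_(k < n) _ = (ev (re n f) (x, y))%:A + (ev (im n f) (x, y)) *: I); last first.
  rewrite ev_re ev_im !scaler_suml -big_split; apply: eq_bigr => k _ /=.
  rewrite /trunc ltn_ord slice_pow// mulrDl -!scalerAl mul1r -scalerAr mulr1 !scalerA.
  by rewrite mulrC [X in _ + X *: _]mulrC.
by rewrite ev_mod2 slice_norm.
Qed.

Lemma trunc_H2 n f : H2 (fun k => (trunc n f k)%:A : H).
Proof.
split => [q _|].
  apply: (cvgP _ (@series_support _ _ n _)) => k nk.
  by rewrite /trunc ltnNge nk scale0r mulr0.
rewrite (@l2norm_support _ _ n) ?ltry// => k nk.
by rewrite /trunc ltnNge nk scale0r.
Qed.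

Lemma l2norm_trunc n f : (l2norm (fun k => (trunc n f k)%:A : H) ^+ 2 = (\sum_(k < n) f k ^+ 2)%:E)%E.
Proof.
rewrite (@l2norm_support _ _ n) => [|k nk]; last by rewrite /trunc ltnNge nk scale0r.
rewrite -EFin_expe sqr_sqrtr ?sqs_ge0//; congr EFin; apply: eq_bigr => k _.
by rewrite /trunc ltn_ord norm_real -normrX ger0_norm ?sqr_ge0.
Qed.

(** A test function with real coefficients has the same modulus on all slices. The integrand is then
    |P|^2 + |Q|^2 plus a linear form in I, and averaging over the sphere removes the latter. The
    radius [rho < 1] keeps all functions bounded. *)
Lemma ball_lower b K rho n f : regular b -> 0 < rho < 1 -> carleson_bound (mu_density b) K ->
  pi * Jh rho (fun z => ev (mod2 n f) z * ev (wt 1) z * UV2 (cderiv b) z) <=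
  K * \sum_(k < n) f k ^+ 2.
Proof.
move=> hb r01 [K0 hK].
have {}hb e : rregular (cq b e) by exact: regular_rregular.
have hb' := cderiv_regular hb.
have r01' : 0 < rho <= 1 by case/andP: r01 => -> /ltW ->.
have rho1 : rho ^+ 2 < 1 by case/andP: r01 => r0 r1; rewrite expr_lt1// ltW.
pose g z := ev (mod2 n f) z * ev (wt 1) z.
pose D := hdisc rho.
have mD : measurable D := measurable_hdisc rho.
have fD : (mu2 D < +oo)%E by apply: le_lt_trans (hdisc_finite r01') (ltry _).
have D1 z : D z -> z.1 ^+ 2 + z.2 ^+ 2 < 1 by move=> /hdisc_sub h; apply: le_lt_trans rho1.
have w0 z : z.1 ^+ 2 + z.2 ^+ 2 < 1 -> 0 <= ev (wt 1) z.
  by move=> h; rewrite ev_wt expr1n -addrA -opprD subr_ge0 ltW.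
have g0 z : z.1 ^+ 2 + z.2 ^+ 2 < 1 -> 0 <= g z.
  by move=> h; rewrite /g mulr_ge0 ?w0// ev_mod2 addr_ge0 ?sqr_ge0.
have bg : bmeas D g by apply: bmeasM; exact: bmeas_ev.
pose b' := cderiv b.
pose h I z := g z * `|QU b' z + I * QV b' z| ^+ 2.
pose c0 := \int[mu2]_(z in D) (g z * UV2 b' z).
pose c i := \int[mu2]_(z in D) (g z * cross i (QU b' z) (QV b' z)).
have hE I z : qsphere I -> h I z = g z * UV2 b' z + (qi I * (g z * cross 1 (QU b' z) (QV b' z)) +
    qj I * (g z * cross 2 (QU b' z) (QV b' z)) + qk I * (g z * cross 3 (QU b' z) (QV b' z))).
  by move=> hI; rewrite /h norm_slice// -UV2_norm; ring.
have b0 : bmeas D (fun z => g z * UV2 b' z) by apply: bmeasM => //; exact: bmeas_UV2.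
have bc i : bmeas D (fun z => g z * cross i (QU b' z) (QV b' z)).
  by apply: bmeasM => //; exact: bmeas_cross.
have bI r i : bmeas D (fun z => r * (g z * cross i (QU b' z) (QV b' z))).
  by apply: bmeasM => //; exact: bmeas_cst.
have I_h I : qsphere I -> \int[mu2]_(z in D) h I z = c0 + (qi I * c 1%N + qj I * c 2%N + qk I * c 3%N).
  move=> hI; under eq_Rintegral => z _ do rewrite (hE I z hI).
  have i0 := bmeas_int mD fD b0; have ii r i := bmeas_int mD fD (bI r i).
  have ij i := bmeas_int mD fD (bc i).
  have i12 := bmeas_int mD fD (bmeasD (bI (qi I) 1%N) (bI (qj I) 2%N)).
  have i123 := bmeas_int mD fD (bmeasD (bmeasD (bI (qi I) 1%N) (bI (qj I) 2%N)) (bI (qk I) 3%N)).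
  by rewrite RintegralD// RintegralD// RintegralD// !RintegralZl.
have h0 I z : D z -> 0 <= h I z.
  by move=> /D1 /g0 hz; rewrite /h mulr_ge0 ?sqr_ge0.
have it I : qsphere I ->
  (\int[mu]_x \int[mu]_(y in [set y : R | D (x, y)]) (h I (x, y))%:E =
    (c0 + (qi I * c 1%N + qj I * c 2%N + qk I * c 3%N))%:E)%E.
  move=> hI; rewrite -I_h//; have bh : bmeas D (h I).
    have -> : h I = fun z => g z * UV2 b' z + (qi I * (g z * cross 1 (QU b' z) (QV b' z)) +
    qj I * (g z * cross 2 (QU b' z) (QV b' z)) + qk I * (g z * cross 3 (QU b' z) (QV b' z))).
      by apply/funext => z; exact: hE.
    by apply: bmeasD => //; apply: bmeasD => //; apply: bmeasD.
  have [mh [C hC]] := bh; apply: (@iterated_EFin _ _ _ C) => // z Dz.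
  by rewrite h0//=; apply: le_trans (hC _ Dz); exact: ler_norm.
have := hK _ (trunc_H2 n f); rewrite l2norm_trunc -EFinM -lee_fin; apply: le_trans.
have -> : Jh rho (fun z => ev (mod2 n f) z * ev (wt 1) z * UV2 (cderiv b) z) = c0 by [].
have -> : pi * c0 = 4^-1 * (4 * pi * c0) by field.
rewrite EFinM /ball_integral lee_pmul2l ?lte_fin//.
rewrite -(sphere_linear c0 (c 1%N) (c 2%N) (c 3%N)) /sphere_integral.
have st t : `[0, pi]%classic t -> 0 <= sin t.
  by rewrite /= in_itv /= => ht; exact: sin_ge0_pi.
have c_ge0 t s : 0 <= c0 + sin t * cos s * c 1%N + sin t * sin s * c 2%N + cos t * c 3%N.
  have := I_h _ (qsphere_sphere_pt t s); rewrite /= => e.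
  rewrite -!addrA (_ : _ + (_ + _) = \int[mu2]_(z in D) h (sphere_pt t s) z); last first.
    by rewrite e !addrA.
  by apply: Rintegral_ge0 => z Dz; exact: h0.
apply: integral_mono => // t ht.
- by apply: integral_ge0 => s _; rewrite lee_fin mulr_ge0// st.
- apply: integral_ge0 => s _; rewrite mule_ge0 ?lee_fin ?st//.
  apply: integral_ge0 => x _; apply: integral_ge0 => y [_ xy].
  rewrite lee_fin mulr_ge0 ?sqr_ge0// /mu_density mulr_ge0 ?sqr_ge0//.
  by rewrite slice_norm ?subr_ge0 ?ltW//; exact: qsphere_sphere_pt.
apply: integral_mono => // s hs.
- by rewrite lee_fin mulr_ge0// st.
- rewrite mule_ge0 ?lee_fin ?st//.
  apply: integral_ge0 => x _; apply: integral_ge0 => y [_ xy].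
  rewrite lee_fin mulr_ge0 ?sqr_ge0// /mu_density mulr_ge0 ?sqr_ge0//.
  by rewrite slice_norm ?subr_ge0 ?ltW//; exact: qsphere_sphere_pt.
have hI := qsphere_sphere_pt t s.
rewrite EFinM lee_wpmul2l ?lee_fin ?st//.
rewrite -!addrA [X in (X%:E <= _)%E](_ : _ = c0 + (qi (sphere_pt t s) * c 1%N + qj (sphere_pt t s) * c 2%N + qk (sphere_pt t s) * c 3%N)); last first.
  by rewrite /= !addrA.
rewrite -it//.
apply: integral_mono => // x _.
- by apply: integral_ge0 => y Dy; rewrite lee_fin h0.
- apply: integral_ge0 => y [_ xy].
  rewrite lee_fin mulr_ge0 ?sqr_ge0// /mu_density mulr_ge0 ?sqr_ge0//.
  by rewrite slice_norm ?subr_ge0 ?ltW.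
apply: integral_mono => [y Dy|y Dy|y [_ xy]|y Dy].
- by split; [case: Dy|exact: (D1 _ Dy)].
- by rewrite lee_fin h0.
- rewrite lee_fin mulr_ge0 ?sqr_ge0// /mu_density mulr_ge0 ?sqr_ge0//.
  by rewrite slice_norm ?subr_ge0 ?ltW.
have xy := D1 _ Dy; rewrite /= in xy.
rewrite lee_fin /mu_density reg_eval_trunc// reg_eval_slice// slice_norm//.
rewrite /h /g ev_wt /= expr1n -addrA -opprD.
by rewrite le_eqVlt -mulrA [X in _ * X == _]mulrC eqxx.
Qed.

End BallLower.

(** * From the Carleson inequality to the Hankel form *)

Section CarlesonHankel.
Variable R : realType.
Local Notation mu := (@lebesgue_measure R).
Local Notation mu2 := (mu \x mu)%E.
Local Notation H := (quat R).
Local Notation A := {poly {poly R}}.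
Local Notation pi := (@pi R).
Implicit Types (rho K x y t s : R) (a f h : nat -> R) (b : nat -> H) (z : R * R).

Lemma ev_zpow_conj n x y : ev (zc R n) (x, - y) = ev (zc R n) (x, y) /\
  ev (zs R n) (x, - y) = - ev (zs R n) (x, y).
Proof.
elim: n => [|n [h1 h2]]; first by rewrite /zc /zs /= !ev1 !ev0 oppr0.
by rewrite !zcS !zsS !evB !evD !evM !evX !evY /= h1 h2; split; ring.
Qed.

Lemma ev_mod2_conj n a x y : ev (mod2 n a) (x, - y) = ev (mod2 n a) (x, y).
Proof.
rewrite !ev_mod2 !ev_re !ev_im; congr (_ ^+ 2 + _).
  by apply: eq_bigr => k _; rewrite (proj1 (ev_zpow_conj _ _ _)).
rewrite -[RHS]sqrrN -sumrN; congr (_ ^+ 2).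
by apply: eq_bigr => k _; rewrite (proj2 (ev_zpow_conj _ _ _)) mulrN.
Qed.

Lemma sum_sqr_le n (h : nat -> R) (w : nat -> R) : (forall k, `|w k| <= 1) ->
  (\sum_(k < n) h k * w k) ^+ 2 <= n%:R * \sum_(k < n) h k ^+ 2.
Proof.
move=> w1; have := @sum_CS R 'I_n xpredT (fun k => h k) (fun k => w k).
set S := \sum_(k < n) _ * _; set B := \sum_(k < n) h k ^+ 2; set W := \sum_(k < n) w k ^+ 2.
move=> hS; have B0 : 0 <= B by apply: sumr_ge0 => k _; exact: sqr_ge0.
have W0 : 0 <= W by apply: sumr_ge0 => k _; exact: sqr_ge0.
have Wn : W <= n%:R.
  rewrite -[n in n%:R]card_ord -sum1_card natr_sum; apply: ler_sum => k _.
  by rewrite -(real_normK (num_real (w k))) expr_le1.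
rewrite -(real_normK (num_real S)).
apply: (@le_trans _ _ ((Num.sqrt B * Num.sqrt W) ^+ 2)).
  by rewrite lerXn2r ?nnegrE ?mulr_ge0 ?sqrtr_ge0.
by rewrite exprMn !sqr_sqrtr// mulrC ler_wpM2r.
Qed.

Lemma mod2_le n h z : z.1 ^+ 2 + z.2 ^+ 2 < 1 ->
  ev (mod2 n h) z <= 2 * n%:R * \sum_(k < n) h k ^+ 2.
Proof.
move=> z1; have hz : z.1 ^+ 2 + z.2 ^+ 2 <= 1 ^+ 2 by rewrite expr1n ltW.
have c1 k : `|ev (zc R k) z| <= 1 by have [] := zc_le k ler01 hz; rewrite expr1n.
have s1 k : `|ev (zs R k) z| <= 1 by have [] := zc_le k ler01 hz; rewrite expr1n.
rewrite ev_mod2 ev_re ev_im -mulrA mulr_natl mulr2n.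
by apply: lerD; [exact: (@sum_sqr_le n h (fun k => ev (zc R k) z))|exact: (@sum_sqr_le n h (fun k => ev (zs R k) z))].
Qed.

Lemma sqr_tail_arith (u v C e : R) : `|u| <= C -> `|u - v| <= e -> e <= C ->
  v ^+ 2 <= u ^+ 2 + 3 * C * e.
Proof.
rewrite !ler_norml => /andP[u1 u2] /andP[d1 d2] eC.
have -> : v = u - (u - v) by ring.
move: (u - v) d1 d2 => d d1 d2; nra.
Qed.

(** One coordinate is dominated by the sum over all four; replacing its derivative by a partial sum
    costs a geometric term. *)
Lemma mod2_da_le b e rho : 0 < rho < 1 -> (forall e, rregular (cq b e)) ->
  exists C q, [/\ 0 <= C, 0 <= q < 1 & forall M z, z.1 ^+ 2 + z.2 ^+ 2 <= rho ^+ 2 ->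
    ev (mod2 M (da (cq b e))) z <= UV2 (cderiv b) z + C * q ^+ M].
Proof.
move=> r01 hb; have hb' := cderiv_regular hb e.
have rr : 0 <= rho < 1 by case/andP: r01 => /ltW -> ->.
have [C [q [C0 q01 hC]]] := UV_tail hb' rr.
exists (6 * C * C), q; split => // [|M z hz]; first by rewrite !mulr_ge0.
have [_ _ hN] := hC z hz.
have [] := hN 0%N; rewrite /re /im !big_ord0 ev0 !subr0 expr0 mulr1 => u1 v1.
have [u2 v2] := hN M.
have qC : C * q ^+ M <= C by rewrite ler_piMr// exprn_ile1//; case/andP: q01 => // ? /ltW.
have h1 := sqr_tail_arith u1 u2 qC; have h2 := sqr_tail_arith v1 v2 qC.
have e1 : cq (cderiv b) e = da (cq b e) by exact: cseq_cderiv.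
have : Ufun (cq (cderiv b) e) z ^+ 2 + Vfun (cq (cderiv b) e) z ^+ 2 <= UV2 (cderiv b) z.
  rewrite /UV2 (bigD1 e)//= lerDl; apply: sumr_ge0 => e' _.
  by rewrite addr_ge0 ?sqr_ge0.
rewrite ev_mod2 -e1 -mulrA; move: (C * q ^+ M) h1 h2 => D h1 h2 h3.
by move: (ev _ z) (ev (im _ _) z) h1 h2 => s t h1 h2; lra.
Qed.

Lemma bound_arith (w v m U n t B : R) : 0 <= w -> w <= v -> v <= 1 -> 0 <= m -> 0 <= n ->
  n <= U + t -> m <= B -> 0 <= U -> 0 <= t -> w * (m * n) <= m * v * U + B * t.
Proof.
move=> w0 ww w1 m0 n0 h1 h2 U0 t0.
have mn : m * n <= m * (U + t) by rewrite ler_wpM2l.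
have : w * (m * n) <= v * (m * (U + t)) by apply: ler_pM => //; rewrite mulr_ge0.
have : v * (m * t) <= 1 * (B * t) by apply: ler_pM => //; rewrite ?mulr_ge0 ?ler_wpM2r//; lra.
lra.
Qed.

(** K / pi is what averaging over the imaginary units leaves, and the 2 counts both half discs; the
    geometric remainder is due to the truncation of the derivative at [M]. *)
Lemma Jh_bound b K e rho n f : regular b -> 0 < rho < 1 -> carleson_bound (mu_density b) K ->
  exists C q, [/\ 0 <= C, 0 <= q < 1 & forall M (h : nat -> R),
    Jd rho (wt rho * (mod2 n h * mod2 M (da (cq b e)))) <=
      (2 * K / pi + C * q ^+ M) * \sum_(k < n) h k ^+ 2].
Proof.
move=> hb r01 hK; have hr e' : rregular (cq b e') by exact: regular_rregular.
have [C [q [C0 q01 hC]]] := mod2_da_le e r01 hr.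
have r01' : 0 < rho <= 1 by case/andP: r01 => -> /ltW ->.
have rho1 : rho ^+ 2 < 1 by case/andP: r01 => r0 r1; rewrite expr_lt1// ltW.
exists (16 * n%:R * C), q; split => // [|M h]; first by rewrite !mulr_ge0 ?ler0n.
have S0 : 0 <= \sum_(k < n) h k ^+ 2 by apply: sumr_ge0 => k _; exact: sqr_ge0.
set S := \sum_(k < n) _ in S0 *.
have q0 : 0 <= q ^+ M by rewrite exprn_ge0//; case/andP: q01.
rewrite Jh_even//; last 2 first.
- move=> x y; rewrite !(evM _ _ (_, _)) !ev_mod2_conj; congr (_ * _).
  by rewrite !ev_wt /= sqrrN.
- move=> z hz; rewrite !(evM _ _ z) mulr_ge0 ?disc_wt_ge0//.
  by rewrite !ev_mod2 mulr_ge0// addr_ge0 ?sqr_ge0.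
pose D := hdisc rho.
have mD : measurable D := measurable_hdisc rho.
have fD4 := hdisc_finite r01'.
have fD : (mu2 D < +oo)%E by apply: le_lt_trans fD4 (ltry _).
pose E := 2 * n%:R * S * (C * q ^+ M).
have E0 : 0 <= E by rewrite !mulr_ge0 ?ler0n.
pose G z := ev (mod2 n h) z * ev (wt 1) z * UV2 (cderiv b) z.
have bG : bmeas D G.
  apply: bmeasM; last by apply: bmeas_UV2 => //; exact: cderiv_regular.
  by apply: bmeasM; exact: bmeas_ev.
have JhE : Jh rho (ev (wt rho * (mod2 n h * mod2 M (da (cq b e))))) <= Jh rho G + 4 * E.
  apply: (@le_trans _ _ (\int[mu2]_(z in D) (G z + E))).
    apply: le_Rintegral => //.
    - by apply: bmeas_int => //; exact: bmeas_ev.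
    - by apply: bmeas_int => //; apply: bmeasD => //; exact: bmeas_cst.
    move=> z Dz; have z1 := hdisc_sub Dz.
    have z2 : z.1 ^+ 2 + z.2 ^+ 2 < 1 by apply: le_lt_trans rho1.
    have h1 := hC M z z1; have h2 := mod2_le n h z2.
    have w0 : 0 <= ev (wt rho) z by apply: disc_wt_ge0; case: Dz.
    have w1 : ev (wt rho) z <= ev (wt 1) z by rewrite !ev_wt !lerD2r expr1n ltW.
    have w2 : ev (wt 1) z <= 1.
      by rewrite ev_wt expr1n -addrA -opprD gerBl addr_ge0 ?sqr_ge0.
    have m0 : 0 <= ev (mod2 n h) z by rewrite ev_mod2 addr_ge0 ?sqr_ge0.
    have n0 : 0 <= ev (mod2 M (da (cq b e))) z by rewrite ev_mod2 addr_ge0 ?sqr_ge0.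
    rewrite !(evM _ _ z) /G /E; have U0 := UV2_ge0 (cderiv b) z.
    have t0 : 0 <= C * q ^+ M by rewrite mulr_ge0.
    exact: (bound_arith w0 w1 w2 m0 n0 h1 h2 U0 t0).
  rewrite RintegralD//; last 2 first.
  - exact: bmeas_int.
  - by apply: bmeas_int => //; exact: bmeas_cst.
  rewrite lerD2l Rintegral_cst// mulrC ler_wpM2r//.
  rewrite -lee_fin fineK//.
  by rewrite ge0_fin_numE//; apply: le_lt_trans fD4 (ltry _).
have := ball_lower n h hb r01 hK; rewrite -/G -/S => hG.
have pi0 := pi_gt0 R.
have {}hG : Jh rho G <= K / pi * S.
  by rewrite mulrAC ler_pdivlMr// mulrC.
rewrite (_ : (2 * K / pi + _) * S = 2 * (K / pi * S + 4 * E)); last by rewrite /E; ring.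
by rewrite ler_pM2l//; apply: le_trans JhE _; rewrite lerD2r.
Qed.

(** At a fixed radius the truncation index tends to infinity, which removes the remainder; then the
    radius tends to 1 in a finite sum. *)
Lemma carleson_hankel b K e n (f g : nat -> R) : regular b -> carleson_bound (mu_density b) K ->
  `|\sum_(j < n) \sum_(k < n) f j * g k * cq b e (j + k).+1| <=
  32 * Num.sqrt (2 * K / pi) * (Num.sqrt (\sum_(k < n) f k ^+ 2) * Num.sqrt (\sum_(k < n) g k ^+ 2)).
Proof.
move=> hb hK; set F := Num.sqrt (\sum_(k < n) f k ^+ 2); set G := Num.sqrt (\sum_(k < n) g k ^+ 2).
have K0 : 0 <= 2 * K / pi by rewrite !mulr_ge0 ?invr_ge0 ?pi_ge0//; case: hK.
pose T rho := \sum_(j < n) \sum_(k < n) f j * g k * (cq b e (j + k)%N.+1 * rho ^+ (2 * (j + k).+1)).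
have hT rho : 1 / 4 <= rho < 1 -> `|T rho| <= 32 * Num.sqrt (2 * K / pi) * (F * G).
  move=> /andP[r4 r1]; have r01 : 0 < rho < 1 by rewrite r1 andbT; lra.
  have r01' : 0 < rho <= 1 by case/andP: r01 => -> /ltW ->.
  have [C [q [C0 q01 hC]]] := @Jh_bound b K e rho n f hb r01 hK.
  pose u M := 32 * Num.sqrt (2 * K / pi + C * q ^+ M) * (F * G).
  have uc : u M @[M --> \oo] --> 32 * Num.sqrt (2 * K / pi) * (F * G).
    apply: cvgM; last exact: cvg_cst; apply: cvgM; first exact: cvg_cst.
    apply: continuous_cvg; first exact: sqrt_continuous.
    rewrite -[X in _ --> X]addr0; apply: cvgD; first exact: cvg_cst.
    rewrite -(mulr0 C); apply: cvgM; first exact: cvg_cst.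
    by apply: cvg_expr; case/andP: q01 => q0 q1; rewrite ger0_norm.
  apply: (cvgr_to_ge uc); near=> M.
  have P1 : 0 <= 2 * K / pi + C * q ^+ M.
    by rewrite addr_ge0// mulr_ge0// exprn_ge0//; case/andP: q01.
  have P2 : (n + n <= M)%N by near: M; exists (n + n)%N.
  exact: (@pairing_bound _ rho r01' n M (cq b e) f g _ r4 P1 P2 (hC M)).
have Tc : T rho @[rho --> (1 : R)^'-] --> T 1.
  apply: cvg_at_left_filter; rewrite /T.
  apply: cvg_sumr => j _; apply: cvg_sumr => k _.
  apply: cvgM; first exact: cvg_cst.
  apply: cvgM; first exact: cvg_cst.
  exact: exprn_continuous.
have -> : \sum_(j < n) \sum_(k < n) f j * g k * cq b e (j + k).+1 = T 1.
  by apply: eq_bigr => j _; apply: eq_bigr => k _; rewrite expr1n mulr1.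

apply: (norm_lim_le Tc); near=> rho.
apply: hT; apply/andP; split; last by [].
by near: rho; apply: nbhs_left_ge; lra.
Unshelve. all: by end_near. Qed.

End CarlesonHankel.

(** * Real Hankel forms of the four coordinates *)

Section RealForms.
Variable R : realType.
Local Notation H := (quat R).
Implicit Types (a f g : nat -> R) (b : nat -> H) (M N : R).

Definition rs n f : R := \sum_(k < n) f k ^+ 2.
Definition HB a M := 0 <= M /\ forall n f g,
  `|\sum_(j < n) \sum_(k < n) f j * g k * a (j + k)%N| <= M * (Num.sqrt (rs n f) * Num.sqrt (rs n g)).
Definition seq_shift a n : R := a n.+1.

Lemma rs_ge0 n f : 0 <= rs n f.
Proof. by apply: sumr_ge0 => k _; exact: sqr_ge0. Qed.

Lemma sqs_real n f : sqs n (fun k => (f k)%:A : H) = rs n f.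
Proof. by apply: eq_bigr => k _; rewrite norm_real real_normK ?num_real. Qed.

(** Real test sequences commute with quaternions, so each coordinate of the quaternionic form is, up
    to sign, the real form of that coordinate. *)
Lemma QB_HB b M e : QB b M -> HB (cq b e) M.
Proof.
move=> [M0 hb]; split=> // n f g; have := hb n (fun k => (f k)%:A) (fun k => (g k)%:A).
rewrite !sqs_real -mulrA; apply: le_trans; apply: le_trans (qc_le e _).
rewrite qc_sum; under [X in _ <= `|X|]eq_bigr do rewrite qc_sum.
have -> : \sum_(i < n) \sum_(i0 < n) qc e (qconj (b (i + i0)%N) * (f i)%:A * (g i0)%:A) =
  qc e (qconj (qb R e)) * \sum_(j < n) \sum_(k < n) f j * g k * cq b e (j + k)%N.
  rewrite mulr_sumr; apply: eq_bigr => j _; rewrite mulr_sumr; apply: eq_bigr => k _.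
  have e1 (p : H) : p * (f j)%:A * (g k)%:A = g k *: (f j *: p) by rewrite -!scalerAr !mulr1.
  rewrite e1 !qcZ /cq; move: (b (j + k)%N) => q.
  by move: e; apply: forall4; rewrite /qc /qb /=; ring.
rewrite normrM (_ : `|qc e _| = 1) ?mul1r//.
by move: e; apply: forall4; rewrite /qc /qb /= ?normrN normr1.
Qed.

Lemma rs_shift n f : rs n (seq_shift f) <= rs n.+1 f.
Proof. by rewrite /rs big_ord_recl /= lerDr sqr_ge0. Qed.

Lemma HB_shift a M : HB a M -> HB (seq_shift a) M.
Proof.
move=> [M0 ha]; split=> // n f g.
pose f' k := if k is k'.+1 then f k' else 0.
have := ha n.+1 f' (fun k => trunc n g k).
have -> : rs n.+1 f' = rs n f by rewrite /rs big_ord_recl /= expr0n add0r.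
have -> : rs n.+1 (trunc n g) = rs n g.
  rewrite /rs big_ord_recr /= {2}/trunc ltnn expr0n addr0.
  by apply: eq_bigr => k _; rewrite /trunc ltn_ord.
apply: le_trans; rewrite big_ord_recl /= [X in _ <= `|X + _|]big1 ?add0r; last by move=> k _; rewrite !mul0r.
rewrite le_eqVlt; apply/orP; left; apply/eqP; congr `|_|; apply: eq_bigr => j _.
rewrite big_ord_recr /= {2}/trunc ltnn mulr0 mul0r addr0.
by apply: eq_bigr => k _; rewrite /trunc ltn_ord.
Qed.

(** The matrix splits into its corner, the rest of its first row, and the remaining rows. The last
    two are values of the form of the shifted sequence, hence [2 * N]; the corner is the constant
    term, which (c) and (d) do not control. *)
Lemma HB_unshift a N : HB (seq_shift a) N -> HB a (`|a 0%N| + 2 * N).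
Proof.
move=> [N0 ha]; split => [|n f g]; first by rewrite addr_ge0 ?mulr_ge0.
case: n => [|n]; first by rewrite big_ord0 normr0 !mulr_ge0 ?sqrtr_ge0 ?addr_ge0 ?mulr_ge0.
set F := Num.sqrt (rs n.+1 f); set G := Num.sqrt (rs n.+1 g).
have le0 h m : (m < n.+1)%N -> `|h m| <= Num.sqrt (rs n.+1 h).
  move=> mn; rewrite -sqrtr_sqr ler_wsqrtr// /rs (bigD1 (Ordinal mn))//= lerDl.
  by apply: sumr_ge0 => k _; exact: sqr_ge0.
pose tr (h : nat -> R) k := if (k < n)%N then h k.+1 else 0.
have rtr h : Num.sqrt (rs n.+1 (tr h)) <= Num.sqrt (rs n.+1 h).
  rewrite ler_wsqrtr//; apply: le_trans (rs_shift n h).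
  rewrite /rs big_ord_recr /= /tr ltnn expr0n addr0.
  by apply: ler_sum => k _; rewrite ltn_ord.
pose d0 (k : nat) : R := if k == 0%N then f 0%N else 0.
have rd0 : Num.sqrt (rs n.+1 d0) <= F.
  rewrite /rs big_ord_recl /= big1 ?addr0 => [|k _]; last by rewrite expr0n.
  by rewrite sqrtr_sqr; exact: (le0 f 0%N).
rewrite big_ord_recl /= big_ord_recl /= addn0.
have := ha n.+1 d0 (tr g); rewrite big_ord_recl /= [X in `|_ + X|]big1 ?addr0; last first.
  by move=> j _; rewrite big1// => k _; rewrite !mul0r.
rewrite big_ord_recr /= {2}/tr ltnn mulr0 mul0r addr0 => h1.
have := ha n.+1 (tr f) g; rewrite big_ord_recr /= [X in `|_ + X|]big1 ?addr0; last first.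
  by move=> k _; rewrite /tr ltnn !mul0r.
move=> h2.
rewrite -addrA.
have e1 : \sum_(i < n) f 0%N * g (bump 0 i) * a (0 + bump 0 i)%N =
   \sum_(i < n) d0 0%N * tr g i * seq_shift a (0 + i)%N.
  by apply: eq_bigr => i _; rewrite /tr ltn_ord /d0 /seq_shift /bump /= !add0n add1n.
have e2 : \sum_(i < n) \sum_(k < n.+1) f (bump 0 i) * g k * a (bump 0 i + k)%N =
   \sum_(i < n) \sum_(k < n.+1) tr f i * g k * seq_shift a (i + k)%N.
  by apply: eq_bigr => i _; apply: eq_bigr => k _; rewrite /tr ltn_ord /seq_shift /bump /= add1n addSn.
rewrite e1 e2.
set S1 := \sum_(i < n) _ in h1 *; set S2 := \sum_(i < n) \sum_(k < n.+1) _ in h2 *.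
apply: (le_trans (ler_normD _ _)); rewrite mulrDl; apply: lerD.
  rewrite normrM mulrC ler_wpM2l// normrM; apply: ler_pM => //; exact: le0.
apply: (le_trans (ler_normD _ _)); rewrite -mulrA mulr_natl mulr2n; apply: lerD.
  apply: (le_trans h1); rewrite ler_wpM2l//; by apply: ler_pM; [exact: sqrtr_ge0|exact: sqrtr_ge0|exact: rd0|exact: rtr].
apply: (le_trans h2); rewrite ler_wpM2l//.
by apply: ler_pM; [exact: sqrtr_ge0|exact: sqrtr_ge0|exact: rtr|exact: lexx].
Qed.

Lemma rs_qc n (f : nat -> H) e : Num.sqrt (rs n (fun k => qc e (f k))) <= Num.sqrt (sqs n f).
Proof.
rewrite ler_wsqrtr//; apply: ler_sum => k _.
by rewrite -(real_normK (num_real (qc e (f k)))) lerXn2r ?nnegrE// qc_le.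
Qed.

Lemma quat_trilinear (p x y : H) : qconj p * x * y = \sum_e \sum_d \sum_c
  (qc d x * qc c y * qc e p) *: (qconj (qb R e) * qb R d * qb R c).
Proof.
have -> : qconj p = \sum_e qc e p *: qconj (qb R e).
  apply: quat_eqP => e; rewrite qc_sum sum4 !qcZ; move: e; apply: forall4; rewrite /qc /qb /=; ring.
rewrite {1}(qsum_basis x) {1}(qsum_basis y) -!mulrA mulr_suml.
apply: eq_bigr => e _; rewrite mulr_suml mulr_sumr.
apply: eq_bigr => d _; rewrite !mulr_sumr.
have h (s t u : R) (p1 p2 p3 : H) : (s *: p1) * ((t *: p2) * (u *: p3)) = (t * u * s) *: (p1 * p2 * p3).
  by rewrite -scalerAl -scalerAl -!scalerAr !scalerA mulrA; congr (_ *: _); ring.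
by apply: eq_bigr => c _; exact: h.
Qed.

(** 64 = 4^3 counts the triples of coordinates, one for each of the three factors. *)
Lemma QB_of_HB b M : (forall e, HB (cq b e) M) -> QB b (64 * M).
Proof.
move=> hb; have M0 : 0 <= M by case: (hb 0).
split=> [|n f g]; first by rewrite mulr_ge0.
pose S e d c := \sum_(j < n) \sum_(k < n) qc d (f j) * qc c (g k) * cq b e (j + k)%N.
have -> : \sum_(j < n) \sum_(k < n) qconj (b (j + k)%N) * f j * g k =
   \sum_e \sum_d \sum_c S e d c *: (qconj (qb R e) * qb R d * qb R c).
  under eq_bigr => j _ do under eq_bigr => k _ do rewrite quat_trilinear.
  under eq_bigr => j _ do rewrite exchange_big.
  rewrite exchange_big; apply: eq_bigr => e _ /=.
  under eq_bigr => j _ do rewrite exchange_big.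
  rewrite exchange_big; apply: eq_bigr => d _ /=.
  under eq_bigr => j _ do rewrite exchange_big.
  rewrite exchange_big; apply: eq_bigr => c _ /=.
  rewrite /S scaler_suml; apply: eq_bigr => j _.
  by rewrite scaler_suml.
have SB e d c : `|S e d c *: (qconj (qb R e) * qb R d * qb R c)| <= M * Num.sqrt (sqs n f) * Num.sqrt (sqs n g).
  rewrite normrZ !normqM norm_conj !norm_qb !mulr1 -mulrA.
  apply: le_trans (proj2 (hb e) n (fun k => qc d (f k)) (fun k => qc c (g k))) _.
  by rewrite ler_wpM2l//; apply: ler_pM; rewrite ?sqrtr_ge0 ?rs_qc.
move: SB; set B := M * _ * _ => SB.
rewrite (_ : 64 * M * _ * _ = \sum_(e < 4) \sum_(d < 4) \sum_(c < 4) B); last first.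
  by rewrite !sumr_const !card_ord /B; ring.
apply: le_trans (ler_norm_sum _ _ _) _; apply: ler_sum => e _.
apply: le_trans (ler_norm_sum _ _ _) _; apply: ler_sum => d _.
apply: le_trans (ler_norm_sum _ _ _) _; apply: ler_sum => c _.
exact: SB.
Qed.

Lemma QB_of_shift b N : (forall e, HB (seq_shift (cq b e)) N) -> QB b (64 * (`|b 0%N| + 2 * N)).
Proof.
move=> hb; apply: QB_of_HB => e; have [h1 h2] := HB_unshift (hb e); have N0 := proj1 (hb e).
split=> [|n f g]; first by rewrite addr_ge0 ?mulr_ge0.
apply: le_trans (h2 n f g) _; rewrite ler_wpM2r ?mulr_ge0 ?sqrtr_ge0//.
by rewrite lerD2r qc_le.
Qed.

End RealForms.

(** * Trigonometric integrals and the Poisson kernel *)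

Section Circle.
Variable R : realType.
Local Notation pi := (@pi R).
Local Notation circ := (rint (- pi) pi).
Implicit Types (f g : R -> R) (c s t rho : R).

Lemma contD f g : continuous f -> continuous g -> continuous (fun t => f t + g t).
Proof. by move=> hf hg t; apply: cvgD; [exact: hf|exact: hg]. Qed.
Lemma contB f g : continuous f -> continuous g -> continuous (fun t => f t - g t).
Proof. by move=> hf hg t; apply: cvgB; [exact: hf|exact: hg]. Qed.
Lemma contM f g : continuous f -> continuous g -> continuous (fun t => f t * g t).
Proof. by move=> hf hg t; apply: cvgM; [exact: hf|exact: hg]. Qed.
Lemma contN f : continuous f -> continuous (fun t => - f t).
Proof. by move=> hf t; apply: cvgN; exact: hf. Qed.
Lemma contC c : continuous (fun _ : R => c).
Proof. by move=> t; exact: cvg_cst. Qed.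
Lemma contX f n : continuous f -> continuous (fun t => f t ^+ n).
Proof.
move=> hf; elim: n => [|n IH]; first by under eq_fun do rewrite expr0; exact: contC.
by under eq_fun do rewrite exprS; exact: contM.
Qed.
Lemma cont_comp f g : continuous f -> continuous g -> continuous (fun t => f (g t)).
Proof. by move=> hf hg t; apply: continuous_comp; [exact: hg|exact: hf]. Qed.
Lemma contId : continuous (fun t : R => t).
Proof. by move=> t; exact: cvg_id. Qed.
Lemma cont_norm f : continuous f -> continuous (fun t => `|f t|).
Proof. by move=> hf t; apply: cvg_norm; exact: hf. Qed.
Lemma cont_sum n (F : nat -> R -> R) : (forall k, continuous (F k)) ->
  continuous (fun t => \sum_(k < n) F k t).
Proof. by move=> hF t; apply: cvg_sumr => k _; exact: hF. Qed.
Lemma cont_cos f : continuous f -> continuous (fun t => cos (f t)).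
Proof. by move=> hf; apply: cont_comp => //; exact: continuous_cos. Qed.
Lemma cont_sin f : continuous f -> continuous (fun t => sin (f t)).
Proof. by move=> hf; apply: cont_comp => //; exact: continuous_sin. Qed.

Ltac cont := repeat (lazymatch goal with
  | |- forall x, continuous_at x ?F => lazymatch F with
    | (fun t => t) => exact: contId
    | (fun t => @?f t + @?g t) => apply: (@contD f g)
    | (fun t => - @?f t) => apply: (@contN f)
    | (fun t => @?f t * @?g t) => apply: (@contM f g)
    | (fun t => @?f t ^+ ?n) => apply: (@contX f n)
    | (fun t => cos (@?f t)) => apply: (@cont_cos f)
    | (fun t => sin (@?f t)) => apply: (@cont_sin f)
    | (fun t => `|@?f t|) => apply: (@cont_norm f)
    | _ => first [assumption | exact: contC] end end).

Lemma rint_sum n (F : nat -> R -> R) s t : (forall k, continuous (F k)) ->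
  rint s t (fun x => \sum_(k < n) F k x) = \sum_(k < n) rint s t (F k).
Proof.
move=> hF; elim: n => [|n IH].
  rewrite big_ord0 (@rint_ext _ _ (fun x => 0 * 0)); last by move=> x; rewrite big_ord0 mul0r.
  by rewrite rintZ ?mul0r//; exact: contC.
rewrite big_ord_recr /= -IH -rintD//; last exact: cont_sum.
by apply: rint_ext => x; rewrite big_ord_recr.
Qed.

Lemma sin_npi n : sin (n%:R * pi) = 0.
Proof.
elim: n => [|n IH]; first by rewrite mul0r sin0.
by rewrite -natr1 mulrDl mul1r sinDpi IH oppr0.
Qed.

Lemma cos_2npi n t : cos (n%:R * (t + 2 * pi)) = cos (n%:R * t) /\
  sin (n%:R * (t + 2 * pi)) = sin (n%:R * t).
Proof.
elim: n => [|n [h1 h2]]; first by rewrite !mul0r.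
have e : n.+1%:R * (t + 2 * pi) = n%:R * (t + 2 * pi) + (t + pi *+ 2).
  by rewrite -natr1; ring.
have e' : n.+1%:R * t = n%:R * t + t by rewrite -natr1; ring.
rewrite e e'; move: h1 h2; move: (n%:R * (t + 2 * pi)) (n%:R * t) => x y h1 h2.
by rewrite (cosD x) (sinD x) (cosD y) (sinD y) cosD2pi sinD2pi h1 h2.
Qed.

Lemma int_diff (j k : nat) :
  circ (fun t => cos (j%:R * t - k%:R * t)) = (if j == k then 2 * pi else 0) /\
  circ (fun t => sin (j%:R * t - k%:R * t)) = 0.
Proof.
have pi0 := pi_ge0 R; have pp : - pi <= pi by lra.
have [->|jk] := eqVneq j k.
  rewrite (@rint_ext _ _ (fun=> 1)) => [|t]; last by rewrite subrr cos0.
  rewrite (@rint_ext _ (fun t => sin _) (fun=> 0)) => [|t]; last by rewrite subrr sin0.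
  by rewrite !rint_cst//; split => /=; ring.
pose c : R := j%:R - k%:R.
have c0 : c != 0 by rewrite subr_eq0 eqr_nat.
have sc : sin (c * pi) = 0.
  by rewrite mulrBl sinB !sin_npi mul0r mulr0 subrr.
split.
  rewrite (@rint_ext _ _ (fun t => cos (c * t))) => [|t]; last by rewrite mulrBl.
  have -> : circ (fun t => cos (c * t)) = c^-1 * sin (c * pi) - c^-1 * sin (c * - pi).
    apply: (@rint_FTC _ _ (fun t => c^-1 * sin (c * t))) => //; first by cont.
    by move=> t _; apply: is_derive_eq; rewrite /GRing.scale /=; field.
  by rewrite mulrN sinN sc oppr0 mulr0 subrr.
rewrite (@rint_ext _ _ (fun t => sin (c * t))) => [|t]; last by rewrite mulrBl.
have -> : circ (fun t => sin (c * t)) = - c^-1 * cos (c * pi) - (- c^-1 * cos (c * - pi)).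
  apply: (@rint_FTC _ _ (fun t => - c^-1 * cos (c * t))) => //; first by cont.
  by move=> t _; apply: is_derive_eq; rewrite /GRing.scale /=; field.
by rewrite mulrN cosN subrr.
Qed.

(** The two sums are the real and imaginary parts of sum_j (p_j + i q_j) e^(i j t). *)
Lemma parseval n (p q : nat -> R) :
  circ (fun t => (\sum_(j < n) (p j * cos (j%:R * t) - q j * sin (j%:R * t))) ^+ 2 +
    (\sum_(j < n) (p j * sin (j%:R * t) + q j * cos (j%:R * t))) ^+ 2) =
  2 * pi * \sum_(j < n) (p j ^+ 2 + q j ^+ 2).
Proof.
pose F (j k : nat) t := (p j * p k + q j * q k) * cos (j%:R * t - k%:R * t) +
  (p j * q k - q j * p k) * sin (j%:R * t - k%:R * t).
rewrite (@rint_ext _ _ (fun t => \sum_(j < n) \sum_(k < n) F j k t)); last first.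
  move=> t; rewrite !expr2 !mulr_suml -big_split; apply: eq_bigr => j _ /=.
  rewrite !mulr_sumr -big_split; apply: eq_bigr => k _ /=.
  by rewrite /F cosB sinB; ring.
have cF j k : continuous (F j k) by rewrite /F; cont.
rewrite (@rint_sum n (fun j t => \sum_(k < n) F j k t)) => [|j]; last first.
  by apply: (@cont_sum n (F j)).
rewrite mulr_sumr; apply: eq_bigr => j _.
rewrite (@rint_sum n (F j))//.
rewrite (bigD1 j)//= [X in _ + X]big1 ?addr0 => [|k kj].
  rewrite /F rintD ?rintZ; [|by cont..].
  by have [-> ->] := int_diff j j; rewrite eqxx; ring.
rewrite /F rintD ?rintZ; [|by cont..].
have [-> ->] := int_diff j k; rewrite (_ : (nat_of_ord j == k) = false) ?mulr0 ?addr0//.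
by apply/negbTE; rewrite eq_sym; exact: kj.
Qed.

Lemma int_cos_cos j k : (k <= j)%N -> circ (fun t => cos (j%:R * t) * cos (k%:R * t)) =
  if j == k then (if j == 0%N then 2 * pi else pi) else 0.
Proof.
move=> kj.
rewrite (@rint_ext _ _ (fun t => 2^-1 * (cos (j%:R * t - k%:R * t) + cos ((j + k)%:R * t - 0%:R * t)))).
  rewrite rintZ ?rintD; [|by cont..].
  have [-> _] := int_diff j k; have [-> _] := int_diff (j + k) 0.
  rewrite addn_eq0; have [->|jk] := eqVneq j k.
    by have [_|_] := eqVneq k 0%N; rewrite /= ?andbT ?andbF; field.
  case: ifP => [/andP[/eqP j0 /eqP k0]|_]; last by rewrite addr0 mulr0.
  by move: jk; rewrite j0 k0.
move=> t; rewrite mul0r subr0 natrD mulrDl cosB cosD.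
by field.
Qed.

Section Poisson.
Variables (rho : R) (r01 : 0 <= rho < 1).

Definition pden s : R := 1 - 2 * rho * cos s + rho ^+ 2.
Definition poisson s : R := (1 - rho ^+ 2) / pden s.

Lemma pden_ge s : (1 - rho) ^+ 2 <= pden s.
Proof. by rewrite /pden; have := cos_le1 s; case/andP: r01; nra. Qed.

Lemma pden_gt0 s : 0 < pden s.
Proof.
apply: lt_le_trans (pden_ge s); rewrite exprn_gt0// subr_gt0.
by case/andP: r01.
Qed.

Lemma rho2_lt1 : rho ^+ 2 < 1.
Proof. by case/andP: r01 => r0 r1; rewrite expr_lt1. Qed.

Lemma poisson_gt0 s : 0 < poisson s.
Proof. by rewrite /poisson divr_gt0 ?pden_gt0// subr_gt0 rho2_lt1. Qed.

Lemma poisson_cont : continuous poisson.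
Proof.
have cp : continuous pden by rewrite /pden; cont.
move=> s; apply: cvgM; first exact: cvg_cst.
by apply: cvgV; [rewrite gt_eqF// pden_gt0|exact: cp].
Qed.

Lemma poissonN s : poisson (- s) = poisson s.
Proof. by rewrite /poisson /pden cosN. Qed.

Lemma poisson_period s : poisson (s + 2 * pi) = poisson s.
Proof. by rewrite /poisson /pden (_ : s + 2 * pi = s + pi *+ 2) ?cosD2pi// [2 * pi]mulr_natl. Qed.

Definition pker K s : R := 1 + 2 * \sum_(k < K) rho ^+ k.+1 * cos (k.+1%:R * s).

(** [pker] is a partial sum of the Fourier series of the Poisson kernel. Multiplied by the
    denominator it telescopes, by 2 cos s cos(k s) = cos((k+1) s) + cos((k-1) s). *)
Lemma pker_pden K s : pden s * pker K s =
  1 - rho ^+ 2 + 2 * rho ^+ K.+2 * cos (K%:R * s) - 2 * rho ^+ K.+1 * cos (K.+1%:R * s).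
Proof.
elim: K => [|K IH].
  by rewrite /pker /pden big_ord0 mul0r cos0 !mul1r !expr1; ring.
have -> : pker K.+1 s = pker K s + 2 * rho ^+ K.+1 * cos (K.+1%:R * s).
  by rewrite /pker big_ord_recr /=; ring.
rewrite mulrDr IH /pden.
have e : 2 * cos s * cos (K.+1%:R * s) = cos (K.+2%:R * s) + cos (K%:R * s).
  have -> : K.+2%:R * s = K.+1%:R * s + s by rewrite -natr1 mulrDl mul1r.
  have -> : K%:R * s = K.+1%:R * s - s by rewrite -[K.+1%:R]natr1 mulrDl mul1r addrK.
  by rewrite cosD cosB; ring.
rewrite !exprS; move: (rho ^+ K) e => r e.
have -> : cos (K.+2%:R * s) = 2 * cos s * cos (K.+1%:R * s) - cos (K%:R * s) by rewrite e addrK.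
by ring.
Qed.

Lemma pker_cont K : continuous (pker K).
Proof.
rewrite /pker; cont.
by apply: (@cont_sum K (fun k s => rho ^+ k.+1 * cos (k.+1%:R * s))) => k; cont.
Qed.

Lemma pker_approx K s : `|poisson s - pker K s| <= 4 / (1 - rho) ^+ 2 * rho ^+ K.+1.
Proof.
have := pker_pden K s; have p0 := pden_gt0 s => e.
have -> : poisson s - pker K s =
  (2 * rho ^+ K.+1 * cos (K.+1%:R * s) - 2 * rho ^+ K.+2 * cos (K%:R * s)) / pden s.
  apply: (mulIf (lt0r_neq0 p0)); rewrite mulrBl [pker _ _ * _]mulrC e /poisson.
  by rewrite -!mulrA !mulVf ?lt0r_neq0// !mulr1; ring.
case/andP: r01 => r0 r1.
have rK : 0 <= rho ^+ K.+1 by rewrite exprn_ge0.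
rewrite normrM normfV (ger0_norm (ltW p0)) [leRHS]mulrAC.
apply: ler_pM; rewrite ?invr_ge0 ?(ltW p0)//.
  rewrite (exprS _ K.+1); apply: le_trans (ler_normB _ _) _.
  rewrite !normrM (@ger0_norm _ 2)// (ger0_norm rK) (ger0_norm r0).
  have := cos_max (K.+1%:R * s); have := cos_max (K%:R * s).
  move: (rho ^+ K.+1) rK => r rK.
  move: (cos _) (cos (K.+1%:R * _)) => x y; have := normr_ge0 x; have := normr_ge0 y.
  move: `|x| `|y| => X Y Y0 X0 X1 Y1.
  have h1 : r * Y <= r by rewrite ler_piMr.
  have h2 : rho * r <= r by rewrite ler_piMl// ltW.
  have h3 : rho * r * X <= rho * r by rewrite ler_piMr// mulr_ge0.
  by lra.
by rewrite lef_pV2 ?pden_ge ?posrE ?pden_gt0// exprn_gt0// subr_gt0.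
Qed.

Lemma pker_cos K n : (n <= K)%N -> circ (fun s => pker K s * cos (n%:R * s)) = 2 * pi * rho ^+ n.
Proof.
move=> nK.
pose F k s := (if k == 0%N then 1 else 2) * rho ^+ k * (cos (k%:R * s) * cos (n%:R * s)).
have cF k : continuous (F k) by rewrite /F; cont.
rewrite (@rint_ext _ _ (fun s => \sum_(k < K.+1) F k s)); last first.
  move=> s; rewrite big_ord_recl /F /= mul0r cos0 /pker mulrDl; congr (_ + _).
    by rewrite expr0; ring.
  rewrite -mulrA mulr_suml mulr_sumr; apply: eq_bigr => k _.
  by rewrite /bump /= add1n; ring.
rewrite rint_sum// (bigD1 (inord n))//= [X in _ + X]big1 ?addr0 => [|k kn].
  rewrite inordK// /F rintZ; last by cont.
  rewrite int_cos_cos// eqxx.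
  by case: eqVneq => [->|_]; rewrite ?expr0; ring.
rewrite /F rintZ; last by cont.
have kn' : (nat_of_ord k == n) = false.
  by apply/negbTE; apply: contra kn => /eqP kn; apply/eqP/val_inj; rewrite /= inordK.
have [h|/ltnW h] := leqP n k; first by rewrite int_cos_cos// kn' mulr0.
rewrite (@rint_ext _ _ (fun t => cos (n%:R * t) * cos (k%:R * t))) => [|t]; last by rewrite mulrC.
by rewrite int_cos_cos// (eq_sym n) kn' mulr0.
Qed.

(** The partial sums give the exact value as soon as they contain the frequency [n], and their
    uniform error tends to 0. *)
Lemma poisson_cos n : circ (fun s => poisson s * cos (n%:R * s)) = 2 * pi * rho ^+ n.
Proof.
have pi0 := pi_ge0 R; have pp : - pi <= pi by lra.
apply/eqP; rewrite -subr_eq0 -normr_le0.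
have cP := poisson_cont.
case/andP: (r01) => r0 r1.
pose C := 4 / (1 - rho) ^+ 2 * (2 * pi).
have hK K : (n <= K)%N -> `|circ (fun s => poisson s * cos (n%:R * s)) - 2 * pi * rho ^+ n| <= C * rho ^+ K.+1.
  move=> nK; rewrite -(pker_cos nK); have cK := pker_cont (K := K).
  rewrite -rintB; [|by cont..].
  apply: le_trans (rint_norm _ _ _) _; first by cont.
  apply: (@le_trans _ _ (circ (fun=> 4 / (1 - rho) ^+ 2 * rho ^+ K.+1))); last first.
    by rewrite rint_cst// /C le_eqVlt; apply/orP; left; apply/eqP; ring.
  apply: le_rint; [by cont|by cont|move=> s _].
  rewrite -mulrBl normrM -[leRHS]mulr1; apply: ler_pM => //; first exact: pker_approx.
  exact: cos_max.
have lim : C * rho ^+ K.+1 @[K --> \oo] --> 0.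
  rewrite -(mulr0 C); apply: cvgM; first exact: cvg_cst.
  rewrite (cvg_shiftS (fun K => rho ^+ K)); apply: cvg_expr.
  by rewrite ger0_norm.
apply: (cvgr_to_ge lim); near=> K; apply: hK.
by near: K; exists n.
Unshelve. all: by end_near. Qed.

Lemma poisson_sin n : circ (fun s => poisson s * sin (n%:R * s)) = 0.
Proof.
have pi0 := pi_ge0 R; have pp : - pi <= pi by lra.
have cP := poisson_cont.
have c1 : continuous (fun s => poisson s * sin (n%:R * s)) by cont.
have := rint_opp pp c1; rewrite opprK => e.
have : circ (fun x => poisson (- x) * sin (n%:R * - x)) = - 1 * circ (fun s => poisson s * sin (n%:R * s)).
  rewrite -rintZ//; apply: rint_ext => x.
  by rewrite poissonN mulrN sinN; ring.
by rewrite -e mulN1r; lra.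
Qed.

End Poisson.
End Circle.

Ltac cont := repeat (lazymatch goal with
  | |- forall x, continuous_at x ?F => lazymatch F with
    | (fun t => t) => exact: contId
    | (fun t => @?f t + @?g t) => apply: (@contD _ f g)
    | (fun t => - @?f t) => apply: (@contN _ f)
    | (fun t => @?f t * @?g t) => apply: (@contM _ f g)
    | (fun t => @?f t ^+ ?n) => apply: (@contX _ f n)
    | (fun t => cos (@?f t)) => apply: (@cont_cos _ f)
    | (fun t => sin (@?f t)) => apply: (@cont_sin _ f)
    | (fun t => `|@?f t|) => apply: (@cont_norm _ f)
    | _ => first [assumption | exact: contC] end end).

(** * Garsia's identity for polynomials *)

Section Garsia.
Variable R : realType.
Local Notation pi := (@pi R).
Local Notation circ := (rint (- pi) pi).
Local Notation zc := (@zc R).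
Local Notation zs := (@zs R).
Implicit Types (f g : R -> R) (a : nat -> R) (c s t x y rho phi : R).

(** From cos <= 1 by integration from 0; the bounds for cos and sin that follow arise by integrating
    again. *)
Lemma sin_le_id x : 0 <= x -> sin x <= x.
Proof.
move=> x0; have c1 : continuous (fun t : R => cos t) by cont.
have <- : rint 0 x (fun t => cos t) = sin x.
  have -> : sin x = sin x - sin 0 by rewrite sin0 subr0.
  by apply: (@rint_FTC _ _ sin) => // t _; exact: is_derive_sin.
apply: (@le_trans _ _ (rint 0 x (fun=> 1))); last by rewrite rint_cst// mul1r subr0.
by apply: le_rint => [||t _]; [exact: c1|exact: contC|exact: cos_le1].
Qed.

Lemma cos_ge_quad x : 1 - x ^+ 2 / 2 <= cos x.
Proof.
wlog x0 : x / 0 <= x.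
  move=> h; have [/h//|/ltW x0] := leP 0 x; rewrite -cosN -sqrrN; apply: h.
  by rewrite oppr_ge0.
have c1 : continuous (fun t : R => sin t) by cont.
have c2 : continuous (fun t : R => t) by cont.
have e1 : rint 0 x (fun t => sin t) = 1 - cos x.
  have -> : 1 - cos x = - cos x - (- cos 0) by rewrite cos0; ring.
  apply: (@rint_FTC _ _ (fun t => - cos t)) => // t _.
  by apply: is_derive_eq; rewrite /GRing.scale /=; ring.
have e2 : rint 0 x (fun t => t) = x ^+ 2 / 2.
  have -> : x ^+ 2 / 2 = x ^+ 2 / 2 - 0 ^+ 2 / 2 by rewrite expr0n mul0r subr0.
  apply: (@rint_FTC _ _ (fun t => t ^+ 2 / 2)) => // t _.
  by apply: is_derive_eq; rewrite /GRing.scale /=; field.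
have : rint 0 x (fun t => sin t) <= rint 0 x (fun t => t).
  by apply: le_rint => // t /andP[t0 _]; exact: sin_le_id.
by rewrite e1 e2; lra.
Qed.

Lemma sin_ge_cub x : 0 <= x -> x - x ^+ 3 / 6 <= sin x.
Proof.
move=> x0; have c1 : continuous (fun t : R => cos t) by cont.
have c2 : continuous (fun t : R => 1 - t ^+ 2 / 2).
  by move=> t; apply: cvgB; [exact: cvg_cst|apply: cvgM; [exact: exprn_continuous|exact: cvg_cst]].
have <- : rint 0 x (fun t => cos t) = sin x.
  have -> : sin x = sin x - sin 0 by rewrite sin0 subr0.
  by apply: (@rint_FTC _ _ sin) => // t _; exact: is_derive_sin.
have <- : rint 0 x (fun t => 1 - t ^+ 2 / 2) = x - x ^+ 3 / 6.
  have -> : x - x ^+ 3 / 6 = x - x ^+ 3 / 6 - (0 - 0 ^+ 3 / 6) by rewrite !expr0n /=; ring.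
  apply: (@rint_FTC _ _ (fun t => t - t ^+ 3 / 6)) => // t _.
  by apply: is_derive_eq; rewrite /GRing.scale /=; field.
by apply: le_rint => // t _; exact: cos_ge_quad.
Qed.

Lemma pden_half rho y : pden rho y = (1 - rho) ^+ 2 + 4 * rho * sin (y / 2) ^+ 2.
Proof.
have {1}-> : y = y / 2 + y / 2 by field.
rewrite /pden cosD -!expr2; have := cos2Dsin2 (y / 2); move: (cos _) (sin _) => u v h.
have -> : u ^+ 2 = 1 - v ^+ 2 by rewrite -h addrK.
by ring.
Qed.

Lemma pden_le rho y : 0 <= rho < 1 -> pden rho y <= (1 - rho) ^+ 2 + y ^+ 2.
Proof.
move=> /andP[r0 r1]; rewrite /pden; have := cos_ge_quad y; have := sqr_ge0 y.
by move: (cos y) (y ^+ 2) => u v *; nra.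
Qed.

Lemma pden_ge_quad rho y : 0 <= rho < 1 -> `|y| <= pi -> rho * y ^+ 2 / 9 <= pden rho y.
Proof.
move=> /andP[r0 r1] yp.
suff h : y ^+ 2 / 36 <= sin (y / 2) ^+ 2.
  by rewrite pden_half; have := sqr_ge0 (1 - rho); nra.
wlog y0 : y yp / 0 <= y.
  move=> h; have [/h->//|/ltW y0] := leP 0 y.
  have := h (- y); rewrite normrN oppr_ge0 mulNr sinN !sqrrN; exact.
have y4 : y / 2 <= 2 by have := @pihalf_lt2 R; rewrite ger0_norm// in yp; lra.
have := sin_ge_cub (divr_ge0 y0 (ltW (ltr0Sn _ 1))).
have := sin_ge0_pi (x := y / 2); move=> _.
set v := y / 2 in y4 *; have v0 : 0 <= v by rewrite divr_ge0.
have -> : y = 2 * v by rewrite /v; field.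
(* v <= 2 gives v^3 / 6 <= 2 v / 3. *)
move=> h; have h3 : v / 3 <= sin v by apply: le_trans h; nra.
have -> : (2 * v) ^+ 2 / 36 = (v / 3) ^+ 2 by field.
by rewrite lerXn2r// ?nnegrE//; [rewrite divr_ge0|apply: le_trans h3; rewrite divr_ge0].
Qed.

Lemma zpow_polar n rho phi : ev (zc n) (rho * cos phi, rho * sin phi) = rho ^+ n * cos (n%:R * phi) /\
  ev (zs n) (rho * cos phi, rho * sin phi) = rho ^+ n * sin (n%:R * phi).
Proof.
elim: n => [|n [h1 h2]].
  by rewrite zc0 zs0 /= ev1 ev0 mul0r cos0 sin0 expr0 !mul1r.
rewrite zcS zsS evB evD !evM !evX !evY /= h1 h2.
have -> : n.+1%:R * phi = n%:R * phi + phi by rewrite -natr1; ring.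
by rewrite exprS cosD sinD; split; ring.
Qed.

Definition pc N a t := \sum_(n < N) a n * cos (n%:R * t).
Definition ps N a t := \sum_(n < N) a n * sin (n%:R * t).

Lemma pc_cont N a : continuous (pc N a).
Proof. by rewrite /pc; apply: (@cont_sum _ N (fun n t => a n * cos (n%:R * t))) => n; cont. Qed.
Lemma ps_cont N a : continuous (ps N a).
Proof. by rewrite /ps; apply: (@cont_sum _ N (fun n t => a n * sin (n%:R * t))) => n; cont. Qed.
Lemma pc_period N a t : pc N a (t + 2 * pi) = pc N a t.
Proof. by apply: eq_bigr => n _; rewrite (proj1 (cos_2npi _ _)). Qed.
Lemma ps_period N a t : ps N a (t + 2 * pi) = ps N a t.
Proof. by apply: eq_bigr => n _; rewrite (proj2 (cos_2npi _ _)). Qed.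

Lemma circ_shift f phi : continuous f -> (forall x, f (x + 2 * pi) = f x) ->
  circ (fun t => f (t - phi)) = circ f.
Proof.
move=> cf pf; have pi0 := pi_ge0 R; have pp : - pi <= pi by lra.
rewrite -(@rint_shift _ f (- phi))//.
have := @rint_period _ f (2 * pi) (- pi - phi) (- pi) _ cf pf.
have -> : - pi - phi + 2 * pi = pi - phi by ring.
have -> : - pi + 2 * pi = pi by ring.
by apply; rewrite mulr_ge0.
Qed.

Section Kernel.
Variables (rho : R) (r01 : 0 <= rho < 1).

Lemma poisson_shift_cont phi : continuous (fun t => poisson rho (t - phi)).
Proof. by apply: (@cont_comp _ _ (fun t => t - phi) (poisson_cont r01)); cont. Qed.

Lemma poisson_trig phi n :
  circ (fun t => poisson rho (t - phi) * cos (n%:R * t)) = 2 * pi * (rho ^+ n * cos (n%:R * phi)) /\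
  circ (fun t => poisson rho (t - phi) * sin (n%:R * t)) = 2 * pi * (rho ^+ n * sin (n%:R * phi)).
Proof.
have cP := poisson_cont r01.
have c1 : continuous (fun t => poisson rho t * cos (n%:R * t)) by cont.
have c2 : continuous (fun t => poisson rho t * sin (n%:R * t)) by cont.
have p1 x : poisson rho (x + 2 * pi) * cos (n%:R * (x + 2 * pi)) = poisson rho x * cos (n%:R * x).
  by rewrite (poisson_period rho) (proj1 (cos_2npi _ _)).
have p2 x : poisson rho (x + 2 * pi) * sin (n%:R * (x + 2 * pi)) = poisson rho x * sin (n%:R * x).
  by rewrite (poisson_period rho) (proj2 (cos_2npi _ _)).
have s1 := circ_shift phi c1 p1; have s2 := circ_shift phi c2 p2.
have d1 : continuous (fun t => poisson rho (t - phi) * cos (n%:R * (t - phi))).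
  by apply: (@cont_comp _ _ (fun t => t - phi) c1); cont.
have d2 : continuous (fun t => poisson rho (t - phi) * sin (n%:R * (t - phi))).
  by apply: (@cont_comp _ _ (fun t => t - phi) c2); cont.
have e t : n%:R * t = n%:R * (t - phi) + n%:R * phi by ring.
have cP' := @poisson_shift_cont phi.
have k1 := poisson_cos r01 n; have k2 := poisson_sin r01 n.
split.
  rewrite (@rint_ext _ _ (fun t => cos (n%:R * phi) * (poisson rho (t - phi) * cos (n%:R * (t - phi))) -
    sin (n%:R * phi) * (poisson rho (t - phi) * sin (n%:R * (t - phi))))); last first.
    by move=> t; rewrite (e t) cosD; ring.
  rewrite rintB ?rintZ//; [|by cont..].
  by rewrite s1 s2 k1 k2; ring.
rewrite (@rint_ext _ _ (fun t => cos (n%:R * phi) * (poisson rho (t - phi) * sin (n%:R * (t - phi))) +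
    sin (n%:R * phi) * (poisson rho (t - phi) * cos (n%:R * (t - phi))))); last first.
  by move=> t; rewrite (e t) sinD; ring.
rewrite rintD ?rintZ//; [|by cont..].
by rewrite s1 s2 k1 k2; ring.
Qed.

Lemma poisson_one phi : circ (fun t => poisson rho (t - phi)) = 2 * pi.
Proof.
have [h _] := poisson_trig phi 0; rewrite !mul0r cos0 expr0 !mulr1 in h.
by rewrite -[RHS]h; apply: rint_ext => t; rewrite mul0r cos0 mulr1.
Qed.

Lemma poisson_pc phi N a : circ (fun t => pc N a t * poisson rho (t - phi)) =
  2 * pi * ev (re N a) (rho * cos phi, rho * sin phi).
Proof.
have cP := @poisson_shift_cont phi.
pose F n t := a n * (poisson rho (t - phi) * cos (n%:R * t)).
have cF n : continuous (F n) by rewrite /F; cont.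
rewrite (@rint_ext _ _ (fun t => \sum_(n < N) F n t)) => [|t]; last first.
  by rewrite /pc mulr_suml; apply: eq_bigr => n _; rewrite /F; ring.
rewrite rint_sum// ev_re mulr_sumr; apply: eq_bigr => n _.
rewrite /F rintZ; last by cont.
by rewrite (proj1 (poisson_trig _ _)) (proj1 (zpow_polar _ _ _)); ring.
Qed.

Lemma poisson_ps phi N a : circ (fun t => ps N a t * poisson rho (t - phi)) =
  2 * pi * ev (im N a) (rho * cos phi, rho * sin phi).
Proof.
have cP := @poisson_shift_cont phi.
pose F n t := a n * (poisson rho (t - phi) * sin (n%:R * t)).
have cF n : continuous (F n) by rewrite /F; cont.
rewrite (@rint_ext _ _ (fun t => \sum_(n < N) F n t)) => [|t]; last first.
  by rewrite /ps mulr_suml; apply: eq_bigr => n _; rewrite /F; ring.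
rewrite rint_sum// ev_im mulr_sumr; apply: eq_bigr => n _.
rewrite /F rintZ; last by cont.
by rewrite (proj2 (poisson_trig _ _)) (proj2 (zpow_polar _ _ _)); ring.
Qed.

(** The mean minimises the second moment of a measure, here of the Poisson kernel; any convenient
    constant [c] may therefore replace the value [U] in an upper bound. *)
Lemma poisson_variance phi f U c : continuous f ->
  circ (fun t => f t * poisson rho (t - phi)) = 2 * pi * U ->
  circ (fun t => (f t - U) ^+ 2 * poisson rho (t - phi)) <=
  circ (fun t => (f t - c) ^+ 2 * poisson rho (t - phi)).
Proof.
move=> cf fU; have cP := @poisson_shift_cont phi; have p1 := poisson_one phi.
rewrite [leRHS](@rint_ext _ _ (fun t => (f t - U) ^+ 2 * poisson rho (t - phi) +
   (2 * (U - c) * (f t * poisson rho (t - phi)) + ((U - c) ^+ 2 - 2 * (U - c) * U) * poisson rho (t - phi)))); last first.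
  by move=> t; ring.
have c1 : continuous (fun t => (f t - U) ^+ 2 * poisson rho (t - phi)) by cont.
have c2 : continuous (fun t => f t * poisson rho (t - phi)) by cont.
have c3 : continuous (fun t => 2 * (U - c) * (f t * poisson rho (t - phi))) by cont.
have c4 : continuous (fun t => ((U - c) ^+ 2 - 2 * (U - c) * U) * poisson rho (t - phi)) by cont.
have c5 := contD c3 c4.
rewrite (rintD _ _ c1 c5) (rintD _ _ c3 c4) (rintZ _ _ _ c2) (rintZ _ _ _ cP).
rewrite fU p1 lerDl; have -> : 2 * (U - c) * (2 * pi * U) + ((U - c) ^+ 2 - 2 * (U - c) * U) * (2 * pi) =
  (U - c) ^+ 2 * (2 * pi) by ring.
by rewrite mulr_ge0 ?sqr_ge0// mulr_ge0// pi_ge0.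
Qed.

Section Identity.
Variables (N : nat) (a : nat -> R) (phi : R).
Hypothesis a0 : forall n, (N <= n)%N -> a n = 0.
Local Notation z := (rho * cos phi, rho * sin phi).
Local Notation P := (fun k => ev (re N (sh k a)) z).
Local Notation Q := (fun k => ev (im N (sh k a)) z).

(** With A_j = P_j + i Q_j, these are the two parts of sum_(j<M) a_j e^(i j t) - A_0 = (e^(i t) - z)
    sum_(j<M) A_(j+1) e^(i j t) - A_M e^(i M t), which telescopes by A_j = a_j + z A_(j+1). *)
Lemma difference_quotient M t :
  (\sum_(j < M) a j * cos (j%:R * t) - P 0%N =
    (cos t - z.1) * (\sum_(j < M) (P j.+1 * cos (j%:R * t) - Q j.+1 * sin (j%:R * t)))
  - (sin t - z.2) * (\sum_(j < M) (P j.+1 * sin (j%:R * t) + Q j.+1 * cos (j%:R * t)))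
  - (P M * cos (M%:R * t) - Q M * sin (M%:R * t))) /\
  (\sum_(j < M) a j * sin (j%:R * t) - Q 0%N =
    (cos t - z.1) * (\sum_(j < M) (P j.+1 * sin (j%:R * t) + Q j.+1 * cos (j%:R * t)))
  + (sin t - z.2) * (\sum_(j < M) (P j.+1 * cos (j%:R * t) - Q j.+1 * sin (j%:R * t)))
  - (P M * sin (M%:R * t) + Q M * cos (M%:R * t))).
Proof.
elim: M => [|M [h1 h2]].
  by rewrite !big_ord0 mul0r cos0 sin0; split; ring.
have [] := re_shift M a0 => /(congr1 (fun p => ev p z)) e1 /(congr1 (fun p => ev p z)) e2.
move: e1 e2; rewrite !evD !evN ?evB !evM !evC !evX !evY /= => e1 e2.
rewrite !big_ord_recr /=.
have -> : M.+1%:R * t = M%:R * t + t by rewrite -natr1; ring.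
rewrite cosD sinD.
rewrite /= in h1 h2 *; move: h1 h2 e1 e2 => /(canRL (subrK _)) -> /(canRL (subrK _)) -> -> ->.
by split; ring.
Qed.

(** |e^(i t) - z|^2 is the denominator of the Poisson kernel, so it cancels against the difference
    quotient; Parseval's identity applies to what remains. *)
Lemma garsia : circ (fun t => ((pc N a t - P 0%N) ^+ 2 + (ps N a t - Q 0%N) ^+ 2) * poisson rho (t - phi)) =
  2 * pi * ev (wt 1 * Sb N a) z.
Proof.
have PN k : P (N + k)%N = 0 /\ Q (N + k)%N = 0.
  rewrite ev_re ev_im; split; apply: big1 => n _; rewrite /sh a0 ?mul0r//;
  by rewrite -addnA leq_addr.
have [PN0 QN0] := PN 0%N; rewrite addn0 in PN0 QN0.
rewrite (@rint_ext _ _ (fun t => (1 - rho ^+ 2) *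
  ((\sum_(j < N) (P j.+1 * cos (j%:R * t) - Q j.+1 * sin (j%:R * t))) ^+ 2 +
    (\sum_(j < N) (P j.+1 * sin (j%:R * t) + Q j.+1 * cos (j%:R * t))) ^+ 2))); last first.
  move=> t; have [] := difference_quotient N t; rewrite PN0 QN0 !mul0r subrr addr0 !subr0 => h1 h2.
  rewrite /pc /ps h1 h2; set S := \sum_(j < N) _; set T := \sum_(j < N) _.
  have e : (cos t - z.1) ^+ 2 + (sin t - z.2) ^+ 2 = pden rho (t - phi).
    rewrite /pden cosB /=; have k1 := cos2Dsin2 t; have k2 := cos2Dsin2 phi.
    transitivity ((cos t ^+ 2 + sin t ^+ 2) - 2 * rho * (cos t * cos phi + sin t * sin phi)
      + rho ^+ 2 * (cos phi ^+ 2 + sin phi ^+ 2)); first by ring.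
    by rewrite k1 k2 mulr1.
  rewrite [X in X * _](_ : _ = ((cos t - z.1) ^+ 2 + (sin t - z.2) ^+ 2) * (S ^+ 2 + T ^+ 2)); last by ring.
  rewrite e /poisson; have := pden_gt0 r01 (t - phi); move: (pden _ _) => d d0.
  by field; rewrite gt_eqF.
rewrite rintZ; last first.
  have cS (p q : nat -> R) : continuous (fun t => \sum_(j < N) (p j * cos (j%:R * t) - q j * sin (j%:R * t))).
    by apply: (@cont_sum _ N (fun j t => p j * cos (j%:R * t) - q j * sin (j%:R * t))) => j; cont.
  have cT (p q : nat -> R) : continuous (fun t => \sum_(j < N) (p j * sin (j%:R * t) + q j * cos (j%:R * t))).
    by apply: (@cont_sum _ N (fun j t => p j * sin (j%:R * t) + q j * cos (j%:R * t))) => j; cont.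
  by apply: contD; apply: contX; [exact: (cS (fun j => P j.+1) (fun j => Q j.+1))|exact: (cT (fun j => P j.+1) (fun j => Q j.+1))].
rewrite (parseval N (fun j => P j.+1) (fun j => Q j.+1)).
rewrite evM ev_wt /Sb ev_sum /= mulrCA; congr (_ * (_ * _)).
  rewrite expr1n; have k2 := cos2Dsin2 phi.
  transitivity (1 - rho ^+ 2 * (cos phi ^+ 2 + sin phi ^+ 2)); last by ring.
  by rewrite k2 mulr1.
apply: eq_bigr => j _; rewrite evD !evM -!expr2.
have s0 n : (N <= n)%N -> sh j.+1 a n = 0 by move=> Nn; rewrite /sh a0// (leq_trans Nn)// leq_addl.
by have [-> ->] := re_add1 s0.
Qed.

End Identity.
End Kernel.
End Garsia.

(** * The John-Nirenberg inequality for second moments *)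

Section JohnNirenberg.
Variable R : realType.
Local Notation pi := (@pi R).
Local Notation circ := (rint (- pi) pi).
Implicit Types (u f g : R -> R) (c s t x y beta lam : R).

Definition mean u s t : R := rint s t u / (t - s).

Lemma rint_mean u s t : s < t -> rint s t u = mean u s t * (t - s).
Proof. by move=> st; rewrite /mean divfK// subr_eq0 gt_eqF. Qed.

Lemma mean_le u s t c : continuous u -> s < t ->
  `|mean u s t - c| * (t - s) <= rint s t (fun x => `|u x - c|).
Proof.
move=> cu st; have ts : 0 <= t - s by rewrite subr_ge0 ltW.
rewrite -[X in _ * X](ger0_norm ts) -normrM mulrBl -rint_mean//.
rewrite -(rint_cst c (ltW st)) -rintB//; last exact: contC.
by apply: rint_norm; cont.
Qed.

Section Tree.
Variables (u : R -> R).
Hypothesis cu : continuous u.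

(** The average, over the 2^h dyadic subintervals, of the squared distance of the mean of u from c:
    a discrete second moment. *)
Fixpoint leafsq h s t c : R :=
  if h is h'.+1 then (leafsq h' s ((s + t) / 2) c + leafsq h' ((s + t) / 2) t c) / 2
  else (mean u s t - c) ^+ 2.

(** A stopping time: the proportion of [s, t] covered by the largest dyadic subintervals, down to
    depth h, whose mean is farther than lam from c. *)
Fixpoint stopped h s t c lam : R :=
  if lam < `|mean u s t - c| then 1 else
  if h is h'.+1 then (stopped h' s ((s + t) / 2) c lam + stopped h' ((s + t) / 2) t c lam) / 2
  else 0.

Lemma midP s t : s < t -> [/\ s < (s + t) / 2, (s + t) / 2 < t,
  (s + t) / 2 - s = (t - s) / 2 & t - (s + t) / 2 = (t - s) / 2].
Proof. by move=> st; split; [lra|lra|field|field]. Qed.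

Lemma rint_mid f s t : continuous f -> s < t ->
  rint s t f = rint s ((s + t) / 2) f + rint ((s + t) / 2) t f.
Proof.
by move=> cf st; have [h1 h2 _ _] := midP st; apply: rint_chasles => //; rewrite !ltW.
Qed.

(** The weak type inequality of the dyadic maximal function: each stopped interval carries at least
    lam times its length of the integral, and these intervals do not overlap. *)
Lemma stopped_le h s t c lam : 0 < lam -> s < t ->
  stopped h s t c lam * (t - s) * lam <= rint s t (fun x => `|u x - c|).
Proof.
move=> l0; elim: h s t => [|h IH] s t st /=; have ts : 0 < t - s by rewrite subr_gt0.
  case: ifP => [h|_]; last by rewrite !mul0r; apply: rint_ge0.
  apply: le_trans (mean_le c cu st); rewrite mul1r mulrC ler_wpM2r// ltW//.
case: ifP => [hl|_].
  by apply: le_trans (mean_le c cu st); rewrite mul1r mulrC ler_wpM2r// ltW.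
have [h1 h2 e1 e2] := midP st.
rewrite (rint_mid _ st); last by cont.
have := IH _ _ h1; have := IH _ _ h2; rewrite e1 e2.
by lra.
Qed.

Lemma leafsq_shift h s t c d : leafsq h s t c <= 2 * leafsq h s t d + 2 * (d - c) ^+ 2.
Proof.
elim: h s t => [|h IH] s t /=.
  rewrite -subr_ge0 (_ : _ - _ = ((mean u s t - d) - (d - c)) ^+ 2) ?sqr_ge0//; ring.
by have := IH s ((s + t) / 2); have := IH ((s + t) / 2) t; lra.
Qed.

Section Bmo.
Variables (beta S0 T0 : R).
Hypothesis b0 : 0 < beta.
Hypothesis osc : forall s t, S0 <= s -> s < t -> t <= T0 ->
  rint s t (fun x => `|u x - mean u s t|) <= beta * (t - s).

(** Leaves that are never stopped deviate by at most 4 beta, which gives 16 beta^2. A stopped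
    interval deviates by at most 6 beta, since its parent was within 4 beta and one halving moves
    the mean by at most 2 beta; recentring at its own mean gives 2 A + 2 (6 beta)^2. *)
Lemma leafsq_stop A h s t c : S0 <= s -> s < t -> t <= T0 ->
  (forall k s' t', (k <= h)%N -> S0 <= s' -> s' < t' -> t' <= T0 ->
    `|mean u s' t' - c| <= 4 * beta -> True) ->
  (forall k s' t', (k <= h)%N -> S0 <= s' -> s' < t' -> t' <= T0 ->
    leafsq k s' t' (mean u s' t') <= A) ->
  `|mean u s t - c| <= 6 * beta ->
  leafsq h s t c <= 16 * beta ^+ 2 + stopped h s t c (4 * beta) * (2 * A + 72 * beta ^+ 2).
Proof.
move=> + + + _; elim: h s t => [|h IH] s t s0 st t0 hA m6 /=.
  have hA0 := hA 0%N s t (leqnn _) s0 st t0; rewrite /= subrr expr0n /= in hA0.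
  have m2 := real_normK (num_real (mean u s t - c)); rewrite -m2.
  move: `|mean u s t - c| m6 (normr_ge0 (mean u s t - c)) => m m6 m0; case: ltP => hm.
    by nra.
  by nra.
have hA1 := hA h.+1 s t (leqnn _) s0 st t0.
case: ifP => hm.
  have := leafsq_shift h.+1 s t c (mean u s t); move=> /= h1.
  have m2 := real_normK (num_real (mean u s t - c)); rewrite -m2 in h1.
  move: hA1 => /= hA1.
  have : `|mean u s t - c| ^+ 2 <= (6 * beta) ^+ 2 by rewrite lerXn2r ?nnegrE ?mulr_ge0// ltW.
  by have := sqr_ge0 beta; rewrite mul1r; lra.
have {}hm : `|mean u s t - c| <= 4 * beta by rewrite leNgt hm.
have [h1 h2 e1 e2] := midP st.
set m := (s + t) / 2 in h1 h2 e1 e2 *.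
have ts : 0 < t - s by rewrite subr_gt0.
(* A half carries at most the whole integral of the oscillation on half the length, so the mean
   moves by at most 2 beta. *)
have half p q : s <= p -> p < q -> q <= t -> q - p = (t - s) / 2 -> `|mean u p q - mean u s t| <= 2 * beta.
  move=> sp pq qt e; have c1 : continuous (fun x => `|u x - mean u s t|) by cont.
  have k1 := mean_le (mean u s t) cu pq.
  have k2 : rint p q (fun x => `|u x - mean u s t|) <= rint s t (fun x => `|u x - mean u s t|).
    have sq : s <= p <= t by rewrite sp (le_trans (ltW pq)).
    rewrite (rint_chasles c1 sq) (@rint_chasles _ _ q p t c1) ?(ltW pq)//.
    have := @rint_ge0 _ (fun x => `|u x - mean u s t|) s p (fun _ _ => normr_ge0 _).
    have := @rint_ge0 _ (fun x => `|u x - mean u s t|) q t (fun _ _ => normr_ge0 _).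
    by lra.
  have k3 := osc s0 st t0.
  have k4 := le_trans k1 (le_trans k2 k3); rewrite e in k4.
  have : `|mean u p q - mean u s t| * (t - s) <= 2 * beta * (t - s) by lra.
  by rewrite ler_pM2r.
have tri p q : `|mean u p q - mean u s t| <= 2 * beta -> `|mean u p q - c| <= 6 * beta.
  move=> k; have := ler_normD (mean u p q - mean u s t) (mean u s t - c).
  by rewrite addrA subrK; lra.
have q1 := IH s m s0 h1 (le_trans (ltW h2) t0) (fun k s' t' kh => hA k s' t' (leqW kh)) (tri _ _ (half _ _ (lexx _) h1 (ltW h2) e1)).
have q2 := IH m t (le_trans s0 (ltW h1)) h2 t0 (fun k s' t' kh => hA k s' t' (leqW kh)) (tri _ _ (half _ _ (ltW h1) h2 (lexx _) e2)).
by lra.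
Qed.

(** 68 beta^2 is the fixed point of A = 16 beta^2 + (2 A + 72 beta^2) / 4, where 1/4 bounds the
    proportion stopped at level 4 beta. *)
Lemma leafsq_bound h s t : S0 <= s -> s < t -> t <= T0 -> leafsq h s t (mean u s t) <= 68 * beta ^+ 2.
Proof.
elim/ltn_ind: h s t => h IH s t s0 st t0; have bb := sqr_ge0 beta.
case: h IH => [|h] IH; first by rewrite /= subrr expr0n /= mulr_ge0.
have ts : 0 < t - s by rewrite subr_gt0.
have := stopped_le h.+1 (mean u s t) (mulr_gt0 (ltr0Sn R 3) b0) st.
move=> /le_trans /(_ (osc s0 st t0)); rewrite [X in _ <= X]mulrC [X in X <= _]mulrAC [X in X <= _]mulrC ler_pM2l//.
rewrite mulrA -[X in _ <= X]mul1r ler_pM2r// => pS.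
have [h1 h2 e1 e2] := midP st.
set m := (s + t) / 2 in h1 h2 e1 e2 *.
move: pS => /=; rewrite subrr normr0 ltNge (mulr_ge0 (ler0n R 4) (ltW b0))/= -/m => pS.
have ch p q : s <= p -> p < q -> q <= t -> q - p = (t - s) / 2 ->
  leafsq h p q (mean u s t) <= 16 * beta ^+ 2 + stopped h p q (mean u s t) (4 * beta) * (2 * (68 * beta ^+ 2) + 72 * beta ^+ 2).
  move=> sp pq qt e; have c1 : continuous (fun x => `|u x - mean u s t|) by cont.
  apply: leafsq_stop => //; [exact: le_trans sp|exact: le_trans t0| |].
    by move=> k s' t' kh; apply: IH; rewrite ltnS.
  have k1 := mean_le (mean u s t) cu pq.
  have k2 : rint p q (fun x => `|u x - mean u s t|) <= rint s t (fun x => `|u x - mean u s t|).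
    have sq : s <= p <= t by rewrite sp (le_trans (ltW pq)).
    rewrite (rint_chasles c1 sq) (@rint_chasles _ _ q p t c1) ?(ltW pq)//.
    have := @rint_ge0 _ (fun x => `|u x - mean u s t|) s p (fun _ _ => normr_ge0 _).
    have := @rint_ge0 _ (fun x => `|u x - mean u s t|) q t (fun _ _ => normr_ge0 _).
    by lra.
  have k4 := le_trans k1 (le_trans k2 (osc s0 st t0)); rewrite e in k4.
  have : `|mean u p q - mean u s t| * (t - s) <= 2 * beta * (t - s) by lra.
  by rewrite ler_pM2r// => k5; apply: le_trans k5 _; rewrite ler_pM2r// ler_nat.
have q1 := ch _ _ (lexx _) h1 (ltW h2) e1.
have q2 := ch _ _ (ltW h1) h2 (lexx _) e2.
move: (stopped h s m _ _) (stopped h m t _ _) pS q1 q2 => x y pS q1 q2.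
have : (x + y) * beta ^+ 2 <= 1 / 2 * beta ^+ 2 by rewrite ler_wpM2r//; lra.
by lra.
Qed.

End Bmo.

(** On each leaf a Lipschitz function stays within L times the mesh of its mean, which is all that
    is lost by replacing it there by that mean. *)
Lemma rint_leafsq L h s t c : (forall x y, `|u x - u y| <= L * `|x - y|) -> 0 <= L -> s < t ->
  rint s t (fun x => (u x - c) ^+ 2) <= (leafsq h s t c + (L * ((t - s) / 2 ^+ h)) ^+ 2) * (t - s).
Proof.
move=> hL L0; elim: h s t => [|h IH] s t st /=; have ts : 0 < t - s by rewrite subr_gt0.
  have c1 : continuous (fun x => (u x - c) ^+ 2) by cont.
  have mx x : s <= x <= t -> `|u x - mean u s t| <= L * (t - s).
    move=> /andP[sx xt]; have := mean_le (u x) cu st; rewrite distrC => k.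
    have : `|u x - mean u s t| * (t - s) <= L * (t - s) * (t - s).
      apply: le_trans k _; rewrite -(rint_cst _ (ltW st)).
      apply: le_rint => [||y /andP[sy yt]]; [by cont|exact: contC|].
      apply: le_trans (hL _ _) _; rewrite ler_wpM2l// ler_norml; apply/andP; split; lra.
    by rewrite ler_pM2r.
  rewrite (@rint_ext _ _ (fun x => (u x - mean u s t) ^+ 2 +
     (2 * (mean u s t - c) * u x + ((mean u s t - c) ^+ 2 - 2 * (mean u s t - c) * mean u s t)))); last by move=> x; ring.
  rewrite rintD ?rintD ?rintZ ?(rint_cst _ (ltW st))//; [|by cont..].
  have -> : rint s t (fun x => u x) = mean u s t * (t - s) by exact: rint_mean.
  rewrite expr0 divr1.
  have : rint s t (fun x => (u x - mean u s t) ^+ 2) <= rint s t (fun=> (L * (t - s)) ^+ 2).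
    apply: le_rint => [||x xst]; [by cont|exact: contC|].
    rewrite -(real_normK (num_real (u x - mean u s t))) lerXn2r ?nnegrE ?mulr_ge0 ?(ltW ts)//.
    exact: mx.
  rewrite (rint_cst _ (ltW st)); set J := rint s t _ => k.
  rewrite -subr_ge0 (_ : _ - _ = (L * (t - s)) ^+ 2 * (t - s) - J) ?subr_ge0//.
  by ring.
have [h1 h2 e1 e2] := midP st.
rewrite (rint_mid _ st); last by cont.
have := IH _ _ h1; have := IH _ _ h2; rewrite e1 e2 !exprS.
have -> : (t - s) / 2 / 2 ^+ h = (t - s) / (2 * 2 ^+ h) by rewrite -mulrA -invfM.
by move: (L * _) => B; lra.
Qed.

(** The discrete bound is independent of the depth; letting the mesh tend to 0 makes the Lipschitz
    constant [L] disappear. *)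
Lemma john_nirenberg L beta S0 T0 : (forall x y, `|u x - u y| <= L * `|x - y|) -> 0 < beta ->
  (forall s t, S0 <= s -> s < t -> t <= T0 ->
    rint s t (fun x => `|u x - mean u s t|) <= beta * (t - s)) ->
  forall s t, S0 <= s -> s < t -> t <= T0 ->
  rint s t (fun x => (u x - mean u s t) ^+ 2) <= 68 * beta ^+ 2 * (t - s).
Proof.
move=> hL b0 osc s t s0 st t0; have ts : 0 < t - s by rewrite subr_gt0.
have L0 : 0 <= L by have := le_trans (normr_ge0 _) (hL 1 0); rewrite subr0 normr1 mulr1.
pose v h := (68 * beta ^+ 2 + (L * ((t - s) / 2 ^+ h)) ^+ 2) * (t - s).
have vc : v h @[h --> \oo] --> 68 * beta ^+ 2 * (t - s).
  apply: cvgM; last exact: cvg_cst.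
  rewrite -[X in _ --> X]addr0; apply: cvgD; first exact: cvg_cst.
  have : (L * ((t - s) * 2^-1 ^+ h)) @[h --> \oo] --> L * ((t - s) * 0).
    apply: cvgM; first exact: cvg_cst; apply: cvgM; first exact: cvg_cst.
    by apply: cvg_expr; rewrite ger0_norm; lra.
  rewrite !mulr0 => h0; rewrite -[X in _ --> X](mulr0 0).
  rewrite (_ : (fun h => _) = fun h => (L * ((t - s) * 2^-1 ^+ h)) * (L * ((t - s) * 2^-1 ^+ h))).
    exact: (cvgM h0 h0).
  by apply/funext => h; rewrite exprVn expr2.
apply: (cvgr_to_ge vc); apply: nearW => h.
apply: le_trans (rint_leafsq h _ hL L0 st) _.
by rewrite /v ler_pM2r// lerD2r; apply: (leafsq_bound b0 osc).
Qed.

End Tree.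
End JohnNirenberg.

(** * Mean oscillation controls Poisson averages *)

Section GarsiaBounds.
Variable R : realType.
Local Notation pi := (@pi R).
Local Notation circ := (rint (- pi) pi).
Implicit Types (u f g : R -> R) (a : nat -> R) (c s t x y rho phi beta : R).

Lemma disc_polar z : disc 1 z -> exists rho phi : R, 0 <= rho < 1 /\ z = (rho * cos phi, rho * sin phi).
Proof.
rewrite /disc /= expr1n => z1; pose rho := Num.sqrt (z.1 ^+ 2 + z.2 ^+ 2).
have s0 : 0 <= z.1 ^+ 2 + z.2 ^+ 2 by rewrite addr_ge0 ?sqr_ge0.
have r2 : rho ^+ 2 = z.1 ^+ 2 + z.2 ^+ 2 by rewrite sqr_sqrtr.
have r0 : 0 <= rho by rewrite sqrtr_ge0.
have r1 : rho < 1 by rewrite -(@ltr_pXn2r _ 2) ?nnegrE// expr1n r2.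
have [r00|rn0] := eqVneq rho 0.
  exists 0, 0; split; first by rewrite lexx ltr01.
  move: r2; rewrite r00 expr0n /= => /esym/eqP.
  rewrite paddr_eq0 ?sqr_ge0// !sqrf_eq0 => /andP[/eqP e1 /eqP e2].
  by rewrite !mul0r [z]surjective_pairing e1 e2.
have rp : 0 < rho by rewrite lt_def rn0.
pose x := z.1 / rho.
have x2 : x ^+ 2 + (z.2 / rho) ^+ 2 = 1.
  by rewrite !expr_div_n -mulrDl -r2 mulfV// expf_neq0.
have x1 : -1 <= x <= 1.
  have := sqr_ge0 (z.2 / rho) => h.
  have : x ^+ 2 <= 1 by rewrite -x2 lerDl.
  by move=> h2; apply/andP; split; nra.
have [y0|y0] := leP 0 z.2.
  exists rho, (acos x); rewrite r0 r1; split => //.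
  rewrite acosK ?in_itv//= sin_acos// -x2 addrC addKr sqrtr_sqr ger0_norm ?divr_ge0//.
  by rewrite /x ![rho * _]mulrC !divfK//; case: (z).
exists rho, (- acos x); rewrite r0 r1; split => //.
rewrite cosN sinN acosK ?in_itv//= sin_acos// -x2 addrC addKr sqrtr_sqr.
rewrite ler0_norm; last by rewrite pmulr_lle0 ?invr_gt0// ltW.
by rewrite opprK /x ![rho * _]mulrC !divfK//; case: (z).
Qed.

Section Upper.
Variables (u : R -> R) (L beta : R).
Hypothesis cu : continuous u.
Hypothesis uL : forall x y, `|u x - u y| <= L * `|x - y|.
Hypothesis b0 : 0 < beta.
Hypothesis osc : forall s t, s < t -> t <= s + 2 * pi ->
  rint s t (fun x => `|u x - mean u s t|) <= beta * (t - s).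

Lemma jn s t : s < t -> t <= s + 2 * pi ->
  rint s t (fun x => (u x - mean u s t) ^+ 2) <= 68 * beta ^+ 2 * (t - s).
Proof.
move=> st t0; apply: (@john_nirenberg _ u cu L beta s t uL b0) => // s' t' s0 st' t0'.
by apply: osc => //; lra.
Qed.

Variables (phi r0 : R).
Hypothesis r0_gt0 : 0 < r0.
Local Notation r k := (r0 * 2 ^+ k).
Local Notation m k := (mean u (phi - r k) (phi + r k)).

Lemma r_gt0 k : 0 < r k. Proof. by rewrite mulr_gt0// exprn_gt0. Qed.

Lemma rint_sub f s t p q : continuous f -> (forall x, 0 <= f x) -> s <= p -> p <= q -> q <= t ->
  rint p q f <= rint s t f.
Proof.
move=> cf f0 sp pq qt.
rewrite (@rint_chasles _ _ p s t cf) ?sp ?(le_trans pq)//.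
rewrite (@rint_chasles _ _ q p t cf) ?pq//.
have := @rint_ge0 _ f s p (fun x _ => f0 x); have := @rint_ge0 _ f q t (fun x _ => f0 x).
by lra.
Qed.

(** Doubling the interval moves the mean by at most 2 beta, so the drift is linear in the number of
    scales. *)
Lemma mean_dyadic k : r k <= pi -> `|m k - m 0%N| <= 2 * k%:R * beta.
Proof.
elim: k => [|k IH]; first by rewrite subrr normr0 mulr0 mul0r.
have rS : r k.+1 = 2 * r k by rewrite exprS mulrCA.
have rk := r_gt0 k; rewrite rS => rp.
have {}IH : `|m k - m 0%N| <= 2 * k%:R * beta by apply: IH; lra.
have st : phi - r k < phi + r k by lra.
have c1 : continuous (fun x => `|u x - mean u (phi - 2 * r k) (phi + 2 * r k)|) by cont.
have h1 := mean_le (mean u (phi - 2 * r k) (phi + 2 * r k)) cu st.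
have h2 : rint (phi - r k) (phi + r k) (fun x => `|u x - mean u (phi - 2 * r k) (phi + 2 * r k)|) <=
  rint (phi - 2 * r k) (phi + 2 * r k) (fun x => `|u x - mean u (phi - 2 * r k) (phi + 2 * r k)|).
  by apply: rint_sub => //; lra.
have h3 : rint (phi - 2 * r k) (phi + 2 * r k) (fun x => `|u x - mean u (phi - 2 * r k) (phi + 2 * r k)|)
   <= beta * (phi + 2 * r k - (phi - 2 * r k)) by apply: osc; lra.
have h4 := le_trans h1 (le_trans h2 h3).
have h5 : `|m k - mean u (phi - 2 * r k) (phi + 2 * r k)| <= 2 * beta.
  have : `|m k - mean u (phi - 2 * r k) (phi + 2 * r k)| * r k <= 2 * beta * r k by lra.
  by rewrite ler_pM2r.
have := ler_distD (m k) (mean u (phi - 2 * r k) (phi + 2 * r k)) (m 0%N).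
by rewrite distrC in h5; rewrite -natr1; lra.
Qed.

(** 136 = 2 * 68 from the second moment bound and 8 k^2 = 2 (2 k)^2 from the drift of the means. *)
Lemma I_dyadic k : r k <= pi -> rint (phi - r k) (phi + r k) (fun x => (u x - m 0%N) ^+ 2) <=
  (136 + 8 * k%:R ^+ 2) * beta ^+ 2 * (2 * r k).
Proof.
move=> rp; have rk := r_gt0 k; have st : phi - r k < phi + r k by lra.
have h1 : rint (phi - r k) (phi + r k) (fun x => (u x - m k) ^+ 2) <= 68 * beta ^+ 2 * (phi + r k - (phi - r k)).
  by apply: jn => //; lra.
have h2 : (m k - m 0%N) ^+ 2 <= (2 * k%:R * beta) ^+ 2.
  rewrite -(real_normK (num_real (m k - m 0%N))) lerXn2r ?nnegrE ?mulr_ge0 ?ler0n ?(ltW b0)//.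
  exact: mean_dyadic.
have c1 : continuous (fun x => (u x - m k) ^+ 2) by cont.
apply: (@le_trans _ _ (rint (phi - r k) (phi + r k) (fun x => 2 * (u x - m k) ^+ 2 + 2 * (m k - m 0%N) ^+ 2))).
  apply: le_rint => [||x _]; [by cont|by cont|].
  rewrite -subr_ge0 (_ : _ - _ = ((u x - m k) - (m k - m 0%N)) ^+ 2) ?sqr_ge0//.
  by ring.
rewrite rintD ?rintZ ?(rint_cst _ (ltW st))//; [|by cont..].
rewrite (_ : phi + r k - (phi - r k) = 2 * r k) in h1 *; last by ring.
have h3 : (m k - m 0%N) ^+ 2 * (2 * r k) <= (2 * k%:R * beta) ^+ 2 * (2 * r k).
  by rewrite ler_wpM2r//; lra.
rewrite (_ : (136 + _) * _ * _ = 2 * (68 * beta ^+ 2 * (2 * r k)) + 2 * ((2 * k%:R * beta) ^+ 2 * (2 * r k))); last by ring.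
by lra.
Qed.

Variables (P : R -> R).
Hypothesis cP : continuous P.
Hypothesis P0 : forall y, 0 <= P y.
Hypothesis Pmax : forall y, P y <= 8 / r0.
Hypothesis Pdec : forall y, `|y| <= pi -> P y * y ^+ 2 <= 128 * r0.
Local Notation E k := (rint (phi - r k) (phi + r k) (fun x => (u x - m 0%N) ^+ 2 * P (x - phi))).

(** The annulus added at step k + 1 costs at most 512 (136 + 8 (k+1)^2) beta^2 2^-k. The extra term
    on the left equals the sum of all costs still to come, so the right side need not grow: 2176 is
    the central interval and 512 * 368 the whole series. *)
Lemma E_dyadic k : r k <= pi ->
  E k + 512 * (320 + 32 * k.+1%:R + 16 * k.+1%:R ^+ 2) * beta ^+ 2 * 2^-1 ^+ k <=
  (2176 + 512 * 368) * beta ^+ 2.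
Proof.
have cPs : continuous (fun x => P (x - phi)) by apply: (@cont_comp _ P (fun x => x - phi) cP); cont.
have cF : continuous (fun x => (u x - m 0%N) ^+ 2 * P (x - phi)) by cont.
have cG : continuous (fun x => (u x - m 0%N) ^+ 2) by cont.
have F0 x : 0 <= (u x - m 0%N) ^+ 2 * P (x - phi) by rewrite mulr_ge0 ?sqr_ge0.
elim: k => [|k IH] rp.
  have h := I_dyadic rp; move: h rp; rewrite !expr0 !mulr1 expr0n /= mulr0 addr0 => h rp.
  have h1 : rint (phi - r0) (phi + r0) (fun x => (u x - mean u (phi - r0) (phi + r0)) ^+ 2 * P (x - phi)) <=
    rint (phi - r0) (phi + r0) (fun x => 8 / r0 * (u x - mean u (phi - r0) (phi + r0)) ^+ 2).
    by apply: le_rint => [||x _]; [by cont|by cont|rewrite mulrC ler_wpM2r ?sqr_ge0].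
  rewrite rintZ in h1; last by cont.
  have h2 : 8 / r0 * rint (phi - r0) (phi + r0) (fun x => (u x - mean u (phi - r0) (phi + r0)) ^+ 2) <= 8 / r0 * (136 * beta ^+ 2 * (2 * r0)).
    by rewrite ler_wpM2l ?divr_ge0 ?(ltW r0_gt0).
  have e : 8 / r0 * (136 * beta ^+ 2 * (2 * r0)) = 2176 * beta ^+ 2 by field; rewrite gt_eqF.
  have := le_trans h1 h2; rewrite e; move: (rint _ _ _) => J h3.
  by rewrite expr1n !mulr1; lra.
have rS : r k.+1 = 2 * r k by rewrite exprS mulrCA.
have rk := r_gt0 k; have := I_dyadic rp; move: rp; rewrite rS => rp hI.
have {}IH := IH (ltac:(lra)).
have pk : 0 < 2 ^+ k :> R by rewrite exprn_gt0.
rewrite (@rint_chasles _ _ (phi - r k) (phi - 2 * r k) _ cF); last by apply/andP; split; lra.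
rewrite (@rint_chasles _ _ (phi + r k) (phi - r k) _ cF); last by apply/andP; split; lra.
(* The bound 128 r0 / (r k)^2 of the kernel outside the interval of radius [r k], rewritten with r k
   = r0 2^k. *)
pose A := 128 / (r k * 2 ^+ k).
have A0 : 0 <= A by rewrite divr_ge0// mulr_ge0 ?(ltW rk) ?(ltW pk).
have out s t : s <= t -> (forall x, s <= x <= t -> r k <= `|x - phi| <= pi) ->
  rint s t (fun x => (u x - m 0%N) ^+ 2 * P (x - phi)) <= A * rint s t (fun x => (u x - m 0%N) ^+ 2).
  move=> st hx; rewrite -rintZ//; apply: le_rint => [||x xst]; [by []|by cont|].
  rewrite mulrC ler_wpM2r ?sqr_ge0//; have /andP[x1 x2] := hx x xst.
  have x0 : 0 < (x - phi) ^+ 2.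
    by rewrite -(real_normK (num_real (x - phi))) exprn_gt0// (lt_le_trans rk).
  rewrite -(ler_pM2r x0); apply: le_trans (Pdec x2) _.
  have : r k ^+ 2 <= (x - phi) ^+ 2.
    by rewrite -(real_normK (num_real (x - phi))) lerXn2r ?nnegrE ?(ltW rk).
  move=> /(ler_wpM2l A0); apply: le_trans; rewrite /A le_eqVlt; apply/orP; left; apply/eqP.
  by field; rewrite !gt_eqF.
have o1 := out (phi - 2 * r k) (phi - r k) (ltac:(lra)) (fun x => fun hx => ltac:(move/andP: hx => [hx1 hx2]; rewrite ler0_norm; [apply/andP; split; lra|lra])).
have o2 := out (phi + r k) (phi + 2 * r k) (ltac:(lra)) (fun x => fun hx => ltac:(move/andP: hx => [hx1 hx2]; rewrite ger0_norm; [apply/andP; split; lra|lra])).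
move: hI; rewrite (@rint_chasles _ _ (phi - r k) (phi - 2 * r k) _ cG); last by apply/andP; split; lra.
rewrite (@rint_chasles _ _ (phi + r k) (phi - r k) _ cG); last by apply/andP; split; lra.
have g0 : 0 <= rint (phi - r k) (phi + r k) (fun x => (u x - m 0%N) ^+ 2) by apply: rint_ge0 => x _; exact: sqr_ge0.
set E1 := rint (phi - 2 * r k) (phi - r k) (fun x => (u x - m 0%N) ^+ 2 * P (x - phi)) in o1 *.
set E2 := rint (phi + r k) (phi + 2 * r k) (fun x => (u x - m 0%N) ^+ 2 * P (x - phi)) in o2 *.
set E3 := rint (phi - r k) (phi + r k) (fun x => (u x - m 0%N) ^+ 2 * P (x - phi)) in IH *.
set G1 := rint (phi - 2 * r k) (phi - r k) (fun x => (u x - m 0%N) ^+ 2) in o1 *.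
set G2 := rint (phi + r k) (phi + 2 * r k) (fun x => (u x - m 0%N) ^+ 2) in o2 *.
set G3 := rint (phi - r k) (phi + r k) (fun x => (u x - m 0%N) ^+ 2) in g0 *.
move=> hI; clearbody E1 E2 E3 G1 G2 G3.
have : A * (G1 + (G3 + G2)) <= A * ((136 + 8 * k.+1%:R ^+ 2) * beta ^+ 2 * (2 * (2 * r k))) by rewrite ler_wpM2l.
have -> : A * ((136 + 8 * k.+1%:R ^+ 2) * beta ^+ 2 * (2 * (2 * r k))) = 512 * (136 + 8 * k.+1%:R ^+ 2) * beta ^+ 2 * 2^-1 ^+ k.
  by rewrite /A exprVn; field; rewrite !gt_eqF.
have : 0 <= A * G3 by rewrite mulr_ge0.
rewrite -[k.+2%:R]natr1 [2^-1 ^+ k.+1]exprS.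
move: IH; set q := 2^-1 ^+ k; move: (k.+1%:R) => n.
by lra.
Qed.

(** 2176 + 512 * 368 = 190592 is below 2^18. *)
Lemma dyadic_bound k : r k <= pi -> E k <= 2 ^+ 18 * beta ^+ 2.
Proof.
move=> rp; have := E_dyadic rp.
have e9 : 2 ^+ 9 = 512 :> R by rewrite -natrX.
have e : 2 ^+ 18 = 512 * 512 :> R by rewrite -e9 -exprD.
rewrite e; have n0 : 0 <= k.+1%:R :> R by exact: ler0n.
have n2 : 0 <= k.+1%:R ^+ 2 :> R by exact: sqr_ge0.
move: (k.+1%:R) n2 n0 => n n20 n0.
have q0 : 0 <= 320 + 32 * n + 16 * n ^+ 2 by lra.
have bb := sqr_ge0 beta; have p0 : 0 <= 2^-1 ^+ k :> R by apply: exprn_ge0; rewrite invr_ge0 ler0n.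
have := mulr_ge0 (mulr_ge0 q0 bb) p0; set J := rint _ _ _.
rewrite -!(mulrA 512); set T := _ * 2^-1 ^+ k => T0 hJ; clearbody J T.
by lra.
Qed.

End Upper.
End GarsiaBounds.

(** * Mean oscillation and the Garsia seminorm, in both directions *)

Section GarsiaInterval.
Variable R : realType.
Local Notation pi := (@pi R).
Local Notation circ := (rint (- pi) pi).
Implicit Types (u f g : R -> R) (a : nat -> R) (c s t x y rho phi beta : R).

Lemma poisson_max rho y : 0 <= rho < 1 -> poisson rho y <= 2 / (1 - rho).
Proof.
move=> r01; have /andP[r0 r1] := r01; have d := pden_ge r01 y.
rewrite /poisson ler_pdivrMr ?pden_gt0// mulrAC ler_pdivlMr ?subr_gt0//.
have -> : (1 - rho ^+ 2) * (1 - rho) = (1 + rho) * (1 - rho) ^+ 2 by ring.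
by apply: ler_pM => //; [lra|exact: sqr_ge0|lra].
Qed.

(** For rho >= 1/2 the denominator is at least y^2 / 18. For rho < 1/2 the kernel is at most 4 and
    y^2 at most 16, while r0 > 1 - rho > 1/2. *)
Lemma poisson_dec rho r0 y : 0 <= rho < 1 -> pi * (1 - rho) < 2 * r0 -> r0 <= pi -> `|y| <= pi ->
  poisson rho y * y ^+ 2 <= 128 * r0.
Proof.
move=> r01 h1 h2 yp; have /andP[r0' r1] := r01.
have p2 := @pi_ge2 R; have p4 := @pihalf_lt2 R.
have y2 : y ^+ 2 <= 16.
  rewrite -(real_normK (num_real y)); have := normr_ge0 y; have : `|y| <= 4 by lra.
  by move: `|y| => v; nra.
have y0 := sqr_ge0 y.
have k1 : 2 * (1 - rho) <= pi * (1 - rho) by rewrite ler_wpM2r// subr_ge0 ltW.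
have k2 : 1 - rho ^+ 2 <= 2 * (1 - rho) by nra.
have rp : 0 < r0 by lra.
have [h|h] := leP (1 / 2) rho.
  have d := pden_ge_quad r01 yp; have d0 := pden_gt0 r01 y.
  have k3 : y ^+ 2 / 18 <= rho * y ^+ 2 / 9 by nra.
  have : y ^+ 2 <= 18 * pden rho y by lra.
  rewrite /poisson mulrAC ler_pdivrMr//; move: (pden _ _) d0 => D d0 hD.
  have : (1 - rho ^+ 2) * y ^+ 2 <= (2 * r0) * (18 * D).
    apply: ler_pM => //; first by rewrite subr_ge0 (ltW (rho2_lt1 r01)).
    by lra.
  have : 0 <= r0 * D by rewrite mulr_ge0// ltW.
  by lra.
have := poisson_max y r01; have P0 := poisson_gt0 r01 y.
have : 2 / (1 - rho) <= 4 by rewrite ler_pdivrMr; lra.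
move=> q1 q2; apply: (@le_trans _ _ (4 * 16)); last by lra.
by apply: ler_pM => //; [exact: ltW|exact: le_trans q2 q1].
Qed.

(** A radius comparable with 1 - rho, at which the kernel concentrates, chosen as pi / 2^K so that
    the last dyadic interval is exactly one period. *)
Lemma dyadic_radius rho : 0 <= rho < 1 -> exists K : nat, exists r0 : R,
  [/\ 0 < r0, r0 * 2 ^+ K = pi, r0 <= pi * (1 - rho) & pi * (1 - rho) < 2 * r0].
Proof.
move=> /andP[r0 r1]; have pi0 := pi_gt0 R; set d := 1 - rho.
have d0 : 0 < d by rewrite subr_gt0.
have ex : exists K, 2^-1 ^+ K <= d.
  have c0 : (2^-1 ^+ K : R) @[K --> \oo] --> 0 by apply: cvg_expr; rewrite ger0_norm; lra.
  have [K _ hK] := @cvgr_lt _ _ _ _ _ 0 c0 d d0.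
  by exists K; apply: ltW; apply: hK => /=.
pose K := ex_minn ex.
exists K, (pi * 2^-1 ^+ K); rewrite /K; case: ex_minnP => m hm mmin; split.
- by rewrite mulr_gt0// exprn_gt0// invr_gt0.
- by rewrite -mulrA exprVn mulVf ?mulr1// expf_neq0.
- by rewrite ler_pM2l.
rewrite mulrCA ltr_pM2l//; case: m hm mmin => [|m] hm mmin.
  by rewrite expr0 mulr1 /d; lra.
rewrite exprS mulrA mulfV// mul1r ltNge; apply/negP => /mmin.
by rewrite ltnn.
Qed.

Section PolyUpper.
Variables (N : nat) (a : nat -> R) (beta : R).
Hypothesis a0 : forall n, (N <= n)%N -> a n = 0.
Hypothesis b0 : 0 < beta.
Hypothesis osc_c : forall s t, s < t -> t <= s + 2 * pi ->
  rint s t (fun x => `|pc N a x - mean (pc N a) s t|) <= beta * (t - s).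
Hypothesis osc_s : forall s t, s < t -> t <= s + 2 * pi ->
  rint s t (fun x => `|ps N a x - mean (ps N a) s t|) <= beta * (t - s).

Lemma poisson_upper u L rho phi : continuous u -> (forall x, u (x + 2 * pi) = u x) ->
  (forall x y, `|u x - u y| <= L * `|x - y|) ->
  (forall s t, s < t -> t <= s + 2 * pi ->
    rint s t (fun x => `|u x - mean u s t|) <= beta * (t - s)) ->
  0 <= rho < 1 ->
  exists c, circ (fun t => (u t - c) ^+ 2 * poisson rho (t - phi)) <= 2 ^+ 18 * beta ^+ 2.
Proof.
move=> cu pu uL osc r01; have /andP[r0' r1] := r01; have pi0 := pi_gt0 R.
have [K [r0 [rp rK h1 h2]]] := dyadic_radius r01.
(* Centring at the mean over the shortest interval of the dyadic family. *)
exists (mean u (phi - r0 * 2 ^+ 0) (phi + r0 * 2 ^+ 0)).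
have cP := poisson_cont r01.
have r0pi : r0 <= pi by rewrite -rK ler_peMr ?(ltW rp)// exprn_ege1// ler1n.
have P0 y : 0 <= poisson rho y by rewrite ltW// poisson_gt0.
have Pm y : poisson rho y <= 8 / r0.
  apply: le_trans (poisson_max y r01) _; have p4 := @pihalf_lt2 R.
  by rewrite ler_pdivrMr ?subr_gt0// mulrAC ler_pdivlMr//; nra.
have Pd y : `|y| <= pi -> poisson rho y * y ^+ 2 <= 128 * r0 by exact: poisson_dec.
have := @dyadic_bound R u L beta cu uL b0 osc phi r0 rp (poisson rho) cP P0 Pm Pd K.
rewrite rK => /(_ (lexx _)); set c := mean _ _ _ => hE.
pose F x := (u x - c) ^+ 2 * poisson rho (x - phi).
have cF : continuous F.
  rewrite /F; apply: contM; [by cont|].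
  by apply: (@cont_comp _ _ (fun t => t - phi) cP); cont.
have pF x : F (x + 2 * pi) = F x.
  by rewrite /F pu (_ : x + 2 * pi - phi = x - phi + 2 * pi) ?poisson_period//; ring.
have -> : circ (fun t => (u t - c) ^+ 2 * poisson rho (t - phi)) = rint (phi - pi) (phi + pi) F.
  have := @rint_period _ F (2 * pi) (- pi) (phi - pi) _ cF pF.
  have -> : - pi + 2 * pi = pi by ring.
  have -> : phi - pi + 2 * pi = phi + pi by ring.
  by apply; rewrite mulr_ge0// ltW.
exact: hE.
Qed.

Lemma cos_lip c x y : `|cos (c * x) - cos (c * y)| <= `|c| * `|x - y| /\
  `|sin (c * x) - sin (c * y)| <= `|c| * `|x - y|.
Proof.
wlog yx : x y / y <= x.
  move=> h; have [/h//|/ltW/h[h1 h2]] := leP y x.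
  by rewrite (distrC (cos _)) (distrC (sin _)) (distrC x).
have B f : continuous f -> (forall t, `|f t| <= 1) -> `|rint y x (fun t => c * f t)| <= `|c| * `|x - y|.
  move=> cf f1; apply: le_trans (rint_norm _ _ _) _; first by cont.
  rewrite [`|x - y|]ger0_norm ?subr_ge0// -rint_cst//.
  apply: le_rint => [||t _]; [by cont|exact: contC|].
  by rewrite normrM ler_piMr.
split.
  have -> : cos (c * x) - cos (c * y) = rint y x (fun t => c * - sin (c * t)).
    symmetry; apply: (@rint_FTC _ _ (fun t => cos (c * t))) => //; first by cont.
    by move=> t _; apply: is_derive_eq; rewrite /GRing.scale /=; ring.
  by apply: B => [|t]; [by cont|rewrite normrN; exact: sin_max].
have -> : sin (c * x) - sin (c * y) = rint y x (fun t => c * cos (c * t)).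
  symmetry; apply: (@rint_FTC _ _ (fun t => sin (c * t))) => //; first by cont.
  by move=> t _; apply: is_derive_eq; rewrite /GRing.scale /=; ring.
by apply: B => [|t]; [by cont|exact: cos_max].
Qed.

Lemma pc_lip : exists L, forall x y, `|pc N a x - pc N a y| <= L * `|x - y| /\
  `|ps N a x - ps N a y| <= L * `|x - y|.
Proof.
exists (\sum_(n < N) `|a n| * n%:R) => x y; rewrite /pc /ps -!sumrB mulr_suml.
by split; (apply: le_trans (ler_norm_sum _ _ _) _; apply: ler_sum => n _);
   have [h1 h2] := cos_lip n%:R x y; rewrite -mulrBr normrM -mulrA ler_wpM2l//;
   (apply: le_trans h1 _ || apply: le_trans h2 _); rewrite normr_nat.
Qed.

(** The real and the imaginary part contribute at most 2^18 beta^2 each; dividing by 2 pi absorbs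
    the factor 2. *)
Lemma garsia_upper z : disc 1 z -> ev (wt 1 * Sb N a) z <= 2 ^+ 18 * beta ^+ 2.
Proof.
move=> /disc_polar[rho [phi [r01 ->]]]; have pi2 := @pi_ge2 R.
have [L hL] := pc_lip.
have [c1 h1] := @poisson_upper (pc N a) L rho phi (@pc_cont _ N a) (@pc_period _ N a) (fun x y => proj1 (hL x y)) osc_c r01.
have [c2 h2] := @poisson_upper (ps N a) L rho phi (@ps_cont _ N a) (@ps_period _ N a) (fun x y => proj2 (hL x y)) osc_s r01.
have v1 := poisson_variance r01 c1 (@pc_cont _ N a) (poisson_pc r01 phi N a).
have v2 := poisson_variance r01 c2 (@ps_cont _ N a) (poisson_ps r01 phi N a).
have := garsia r01 phi a0; set G := ev (wt 1 * _) _.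
rewrite (_ : sh 0 a = a); last by apply/funext => n; rewrite /sh add0n.
set z0 := (_, _) in v1 v2 * => hG.
have cP := @poisson_shift_cont _ _ r01 phi; have cc := @pc_cont _ N a; have cs := @ps_cont _ N a.
have : 2 * pi * G <= 2 * (2 ^+ 18 * beta ^+ 2).
  rewrite -hG (@rint_ext _ _ (fun t => (pc N a t - ev (re N a) z0) ^+ 2 * poisson rho (t - phi)
    + (ps N a t - ev (im N a) z0) ^+ 2 * poisson rho (t - phi))) => [|t]; last by rewrite mulrDl.
  have k1 : continuous (fun t => (pc N a t - ev (re N a) z0) ^+ 2 * poisson rho (t - phi)) by cont.
  have k2 : continuous (fun t => (ps N a t - ev (im N a) z0) ^+ 2 * poisson rho (t - phi)) by cont.
  by rewrite (rintD _ _ k1 k2); lra.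
have bb := sqr_ge0 beta.
have : 0 <= 2 ^+ 18 * beta ^+ 2 by apply: mulr_ge0 => //; apply: exprn_ge0; rewrite ler0n.
by move: G {hG} => G; move: (2 ^+ 18 * _) => B B0 hG; nra.
Qed.

End PolyUpper.

Section PolyLower.
Variables (N : nat) (a : nat -> R) (G : R).
Hypothesis a0 : forall n, (N <= n)%N -> a n = 0.
Hypothesis hG : forall z, disc 1 z -> ev (wt 1 * Sb N a) z <= G.

(** Taking 1 - rho to be the fraction of the circle occupied by [s, t] makes the kernel centred at
    the midpoint comparable with 1 / (t - s) on the whole interval. *)
Lemma poisson_interval s t x : s < t -> t <= s + 2 * pi -> s <= x <= t ->
  1 <= 2 * pi * (t - s) * poisson (1 - (t - s) / (2 * pi)) (x - (s + t) / 2).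
Proof.
move=> st ts sxt; have pi0 := pi_gt0 R; have pi2 := @pi_ge2 R.
set l := t - s; set d := l / (2 * pi); have l0 : 0 < l by rewrite subr_gt0.
have d0 : 0 < d by rewrite divr_gt0// mulr_gt0.
have d1 : d <= 1 by rewrite ler_pdivrMr ?mulr_gt0// mul1r /l; lra.
have dl : l = d * (2 * pi) by rewrite /d divfK// gt_eqF// mulr_gt0.
have r01 : 0 <= 1 - d < 1 by apply/andP; split; lra.
have h := pden_le (x - (s + t) / 2) r01; have p0 := pden_gt0 r01 (x - (s + t) / 2).
have x2 : (x - (s + t) / 2) ^+ 2 <= (l / 2) ^+ 2.
  rewrite -(real_normK (num_real (_ - _))) lerXn2r ?nnegrE ?divr_ge0 ?(ltW l0)//.
  by case/andP: sxt => *; rewrite /l ler_norml; apply/andP; split; lra.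
rewrite /poisson mulrA ler_pdivlMr// mul1r; apply: le_trans h _.
have e : (1 - (1 - d)) = d by ring.
rewrite e; apply: (@le_trans _ _ (d ^+ 2 + (l / 2) ^+ 2)); first by rewrite lerD2l.
have dd : d <= 1 - (1 - d) ^+ 2 by nra.
apply: (@le_trans _ _ (2 * pi * l * d)); last by rewrite ler_wpM2l// !mulr_ge0 ?(ltW pi0) ?(ltW l0).
have -> : 2 * pi * l * d = l ^+ 2 by rewrite dl; ring.
have : d <= l / 4 by rewrite dl; nra.
by nra.
Qed.

(** With l = t - s, inserting the kernel bounds the second moment on [s, t] by (2 pi l) (2 pi G);
    Cauchy-Schwarz contributes another l under the square root. *)
Lemma osc_lower u U s t : continuous u -> (forall x, u (x + 2 * pi) = u x) -> s < t -> t <= s + 2 * pi ->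
  circ (fun x => (u x - U) ^+ 2 * poisson (1 - (t - s) / (2 * pi)) (x - (s + t) / 2)) <= 2 * pi * G ->
  rint s t (fun x => `|u x - U|) <= 2 * pi * Num.sqrt G * (t - s).
Proof.
move=> cu pu st ts hc; have pi0 := pi_gt0 R.
set l := t - s; have l0 : 0 < l by rewrite subr_gt0.
set rho := 1 - _ in hc; set phi := (s + t) / 2 in hc.
have r01 : 0 <= rho < 1.
  rewrite /rho -/l subr_ge0 ler_pdivrMr ?mulr_gt0// mul1r gtrBl divr_gt0 ?mulr_gt0// andbT.
  by rewrite /l; lra.
have cP := @poisson_shift_cont _ _ r01 phi.
pose F x := (u x - U) ^+ 2 * poisson rho (x - phi).
have cF : continuous F by rewrite /F; cont.
have pF x : F (x + 2 * pi) = F x.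
  by rewrite /F pu (_ : x + 2 * pi - phi = x - phi + 2 * pi) ?poisson_period//; ring.
have F0 x : 0 <= F x by rewrite /F mulr_ge0 ?sqr_ge0// ltW// poisson_gt0.
have hF : rint s t F <= 2 * pi * G.
  apply: le_trans hc; rewrite -/F.
  have := @rint_period _ F (2 * pi) (- pi) s _ cF pF.
  have -> : - pi + 2 * pi = pi by ring.
  move=> ->; last by rewrite mulr_ge0// ltW.
  by apply: rint_sub => //; exact: ltW.
have h2 : rint s t (fun x => (u x - U) ^+ 2) <= 2 * pi * l * (2 * pi * G).
  apply: (@le_trans _ _ (rint s t (fun x => 2 * pi * l * F x))).
    apply: le_rint => [||x sxt]; [by cont|by cont|].
    have := poisson_interval st ts sxt; rewrite -/l -/rho -/phi /F.
    by have := sqr_ge0 (u x - U); move: (_ ^+ 2) => A A0 /(ler_wpM2l A0); rewrite mulr1 => h; apply: le_trans h _; rewrite le_eqVlt; apply/orP; left; apply/eqP; ring.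
  rewrite rintZ// ler_wpM2l// !mulr_ge0 ?(ltW pi0) ?(ltW l0)//.
have G0 : 0 <= G.
  have := le_trans (rint_ge0 (s := s) (t := t) (fun x _ => F0 x)) hF.
  by rewrite pmulr_rge0// mulr_gt0.
have c1 : continuous (fun x => `|u x - U|) by cont.
have := rint_CS c1 (@contC _ 1) (ltW st).
rewrite (@rint_ext _ (fun x => `|u x - U| * 1) (fun x => `|u x - U|)) => [|x]; last by rewrite mulr1.
rewrite (@rint_ext _ (fun x => 1 ^+ 2) (fun=> 1)) => [|x]; last by rewrite expr1n.
rewrite (@rint_ext _ (fun x => `|u x - U| ^+ 2) (fun x => (u x - U) ^+ 2)) => [|x]; last first.
  by rewrite real_normK ?num_real.
rewrite (rint_cst _ (ltW st)) mul1r -/l => hCS.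
have J0 : 0 <= rint s t (fun x => `|u x - U|) by apply: rint_ge0.
rewrite -(@ler_pXn2r _ 2) ?nnegrE//; last by rewrite !mulr_ge0 ?sqrtr_ge0 ?(ltW pi0) ?(ltW l0).
apply: le_trans hCS _; rewrite !exprMn sqr_sqrtr//.
have -> : 2 ^+ 2 * pi ^+ 2 * G * l ^+ 2 = (2 * pi * l * (2 * pi * G)) * l by ring.
by rewrite ler_wpM2r// ltW.
Qed.

(** The constants are the real and imaginary parts of the polynomial at the disc point associated
    with the arc. *)
Lemma garsia_lower s t : s < t -> t <= s + 2 * pi -> exists c d,
  rint s t (fun x => `|pc N a x - c|) <= 2 * pi * Num.sqrt G * (t - s) /\
  rint s t (fun x => `|ps N a x - d|) <= 2 * pi * Num.sqrt G * (t - s).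
Proof.
move=> st ts; have pi0 := pi_gt0 R.
set rho := 1 - (t - s) / (2 * pi); set phi := (s + t) / 2.
have r01 : 0 <= rho < 1.
  rewrite /rho subr_ge0 ler_pdivrMr ?mulr_gt0// mul1r gtrBl divr_gt0 ?mulr_gt0 ?subr_gt0// andbT.
  by lra.
have := garsia r01 phi a0; set z := (_, _).
have zd : disc 1 z.
  rewrite /disc /= !exprMn -mulrDr cos2Dsin2 mulr1 expr1n; exact: rho2_lt1.
have := hG zd; set Gz := ev _ z; set U := ev _ z; set V := ev _ z => GG hg.
exists U, V.
have cP := @poisson_shift_cont _ _ r01 phi; have cc := @pc_cont _ N a; have cs := @ps_cont _ N a.
have k1 : continuous (fun t => (pc N a t - U) ^+ 2 * poisson rho (t - phi)) by cont.
have k2 : continuous (fun t => (ps N a t - V) ^+ 2 * poisson rho (t - phi)) by cont.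
move: hg; rewrite (@rint_ext _ _ (fun t => (pc N a t - U) ^+ 2 * poisson rho (t - phi)
    + (ps N a t - V) ^+ 2 * poisson rho (t - phi))) => [|x]; last by rewrite mulrDl.
rewrite (rintD _ _ k1 k2) => hg.
have P0 x : 0 <= poisson rho (x - phi) by rewrite ltW// poisson_gt0.
have i1 : 0 <= circ (fun t => (pc N a t - U) ^+ 2 * poisson rho (t - phi)).
  by apply: rint_ge0 => x _; rewrite mulr_ge0 ?sqr_ge0.
have i2 : 0 <= circ (fun t => (ps N a t - V) ^+ 2 * poisson rho (t - phi)).
  by apply: rint_ge0 => x _; rewrite mulr_ge0 ?sqr_ge0.
have GG' : 2 * pi * Gz <= 2 * pi * G by rewrite ler_pM2l// mulr_gt0.
by split; apply: osc_lower => //; [exact: pc_period|lra|exact: ps_period|lra].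
Qed.

End PolyLower.
End GarsiaInterval.

(** * Boundary functions in mean *)

Section Fatou.
Variable R : realType.
Local Notation mu := (@lebesgue_measure R).
Local Notation pi := (@pi R).
Local Notation circ := (rint (- pi) pi).
Implicit Types (f g : R -> R) (c s t x y r rho phi : R).

Lemma circ_period f s : continuous f -> (forall x, f (x + 2 * pi) = f x) ->
  rint s (s + 2 * pi) f = circ f.
Proof.
move=> cf pf; have := @rint_period _ f (2 * pi) s (- pi) _ cf pf.
have -> : - pi + 2 * pi = pi by ring.
by apply; rewrite mulr_ge0 ?pi_ge0.
Qed.

Lemma cont_meas f (D : set R) : continuous f -> measurable D -> measurable_fun D f.
Proof. by move=> cf mD; apply: measurable_funTS; exact: continuous_measurable_fun. Qed.

Lemma half_sum_le n k : \sum_(j < n) (2^-1 : R) ^+ (k + j) <= 2 * 2^-1 ^+ k.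
Proof.
suff h : \sum_(j < n) (2^-1 : R) ^+ (k + j) + 2 * 2^-1 ^+ (k + n) = 2 * 2^-1 ^+ k.
  by rewrite -h lerDl mulr_ge0// exprn_ge0// invr_ge0.
elim: n => [|n IH]; first by rewrite big_ord0 add0r addn0.
by rewrite -IH big_ord_recr /= addnS exprS; field.
Qed.

Section Boundary.
Variable v : R -> R -> R.
Hypothesis vc : forall rho, 0 < rho < 1 -> continuous (v rho).
Hypothesis vp : forall rho x, 0 < rho < 1 -> v rho (x + 2 * pi) = v rho x.
Hypothesis vP : forall rho r phi, 0 < rho < 1 -> 0 < r < 1 ->
  circ (fun t => v rho t * poisson r (t - phi)) = 2 * pi * v (r * rho) phi.
Hypothesis vr : forall r phi, 0 < r < 1 -> v (r * rho) phi @[rho --> (1 : R)^'-] --> v r phi.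
Hypothesis vL : forall e, 0 < e -> exists2 tau, 0 < tau < 1 &
  forall rho rho', tau < rho < 1 -> tau < rho' < 1 -> circ (fun t => `|v rho t - v rho' t|) <= e.

(** Thresholds chosen for the errors 2^-k make the consecutive L1 distances summable; the lower
    bound 1 - 1/(k+2) drives the radii to 1. *)
Lemma cauchy_sequence : exists rk : nat -> R, exists tk : nat -> R,
  (forall k, [/\ 0 < tk k < 1, 1 - k.+2%:R^-1 <= tk k, tk k < rk k < 1 & tk k < rk k.+1]) /\
  forall k rho rho', tk k < rho < 1 -> tk k < rho' < 1 ->
    circ (fun t => `|v rho t - v rho' t|) <= 2^-1 ^+ k.
Proof.
have h2 k : 0 < (2^-1 : R) ^+ k by rewrite exprn_gt0// invr_gt0.
have /choice[tk htk] : forall k : nat, exists tau, [/\ 0 < tau < 1, 1 - k.+2%:R^-1 <= tau &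
  forall rho rho', tau < rho < 1 -> tau < rho' < 1 -> circ (fun t => `|v rho t - v rho' t|) <= 2^-1 ^+ k].
  move=> k; have [tau /andP[t0 t1] ht] := vL (h2 k).
  have k0 : 0 < (k.+2%:R : R)^-1 by rewrite invr_gt0.
  exists (Num.max tau (1 - k.+2%:R^-1)); split.
  - by rewrite lt_max t0/= gt_max t1/= gtrBl.
  - by rewrite le_max lexx orbT.
  - by move=> r r'; rewrite !gt_max => /andP[/andP[h _] hr] /andP[/andP[h' _] hr']; apply: ht; apply/andP.
pose fix rk k := if k is k'.+1 then (1 + Num.max (rk k') (tk k)) / 2 else (1 + tk 0%N) / 2.
have hk k : tk k < rk k < 1.
  elim: k => [|k IH] /=; have [/andP[a1 a2] _ _] := htk 0%N; first by apply/andP; split; lra.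
  have [/andP[b1 b2] _ _] := htk k.+1; case/andP: IH => c1 c2.
  have m1 : Num.max (rk k) (tk k.+1) < 1 by rewrite gt_max c2.
  have m2 : tk k.+1 <= Num.max (rk k) (tk k.+1) by rewrite le_max lexx orbT.
  by move: (Num.max _ _) m1 m2 => m *; apply/andP; split; lra.
exists rk, tk; split; last by move=> k; have [] := htk k.
move=> k; have [t01 tb _] := htk k; split => //.
have /andP[h1 h1'] := hk k; have [/andP[b1 b2] _ _] := htk k.+1 => /=.
have m1 : Num.max (rk k) (tk k.+1) < 1 by rewrite gt_max h1'.
have m2 : rk k <= Num.max (rk k) (tk k.+1) by rewrite le_max lexx.
by move: (Num.max _ _) m1 m2 => m *; lra.
Qed.

(** Where the sum of the increments is finite the values converge, and where it is infinite the
    estimate by that sum says nothing, so no exceptional set is removed. Defining f by an upper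
    limit makes it total, measurable and periodic at once. *)
Lemma boundary_function : exists rk : nat -> R, exists tk : nat -> R, exists f : R -> R,
  [/\ forall k, [/\ 0 < tk k < 1, 1 - k.+2%:R^-1 <= tk k & tk k < rk k < 1],
    measurable_fun setT f, forall x, f (x + 2 * pi) = f x,
    forall k s, (\int[mu]_(t in `[s, (s + 2 * pi)%R]) `|v (rk k) t - f t|%:E <= (2 * 2^-1 ^+ k)%:E)%E &
    forall k s rho, tk k < rho < 1 ->
      (\int[mu]_(t in `[s, (s + 2 * pi)%R]) `|v rho t - f t|%:E <= (3 * 2^-1 ^+ k)%:E)%E].
Proof.
have [rk [tk [hrk hc]]] := cauchy_sequence.
have r01 k : 0 < rk k < 1.
  by have [/andP[a1 a2] _ /andP[a3 a4] _] := hrk k; rewrite a4 andbT (lt_trans a1).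
pose d k t := `|v (rk k.+1) t - v (rk k) t|.
have cd k : continuous (d k) by rewrite /d; have h1 := vc (r01 k); have h2 := vc (r01 k.+1); cont.
have d_int k s : rint s (s + 2 * pi) (d k) <= 2^-1 ^+ k.
  rewrite circ_period//; last by move=> x; rewrite /d !vp.
  have [_ _ /andP[a1 a2] a3] := hrk k; have [_ _ /andP[_ b2] _] := hrk k.+1.
  by apply: hc; apply/andP.
pose S k t := (\sum_(0 <= j <oo) (d (k + j)%N t)%:E)%E.
have S_int k s : (\int[mu]_(t in `[s, (s + 2 * pi)%R]) S k t <= (2 * 2^-1 ^+ k)%:E)%E.
  rewrite integral_nneseries//; last 2 first.
  - by move=> n; apply/measurable_EFinP; exact: cont_meas.
  - by move=> n x _; rewrite lee_fin /d.
  under eq_eseriesr do rewrite (rint_EFin _ _ (cd _)).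
  apply/cvg_EFin_le => [n|n]; first by apply: rint_ge0 => x _; rewrite /d.
  rewrite lee_fin; apply: le_trans (half_sum_le n k); apply: ler_sum => j _; exact: d_int.
pose f t := fine (limn_esup (fun k => (v (rk k) t)%:E)).
have f_le k t : (`|v (rk k) t - f t|%:E <= S k t)%E.
  have [->|Soo] := eqVneq (S k t) +oo%E; first exact: leey.
  have S0 : (0 <= S k t)%E by apply: nneseries_ge0 => *; rewrite lee_fin /d.
  have /fineK eS : S k t \is a fin_num by rewrite ge0_fin_numE// ltey.
  have hS : forall n, \sum_(j < n) d (k + j)%N t <= fine (S k t).
    move=> n; rewrite -lee_fin eS.
    have [hh _] := @cvg_EFin_le _ (fun j => d (k + j)%N t) (S k t) (fun j => normr_ge0 _).
    exact: hh (lexx _) n.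
  pose w j := v (rk (k + j).+1) t - v (rk (k + j)%N) t.
  have wS n : series w n = v (rk (k + n)%N) t - v (rk k) t.
    by rewrite /series /= (@telescope_sumr_eq _ 0 n (fun j => v (rk (k + j)%N) t))// ?addn0// => j _; rewrite /w addnS.
  have cw : cvgn (series w).
    apply: normed_cvg; apply: nondecreasing_is_cvgn.
      by apply/nondecreasing_seqP => n; rewrite /= !seriesSr lerDl.
    exists (fine (S k t)) => _ [n _ <-]; apply: le_trans (hS n).
    by rewrite -(big_mkord xpredT (fun j => d (k + j)%N t)); exact: lexx.
  have lv : v (rk n) t @[n --> \oo] --> limn (series w) + v (rk k) t.
    rewrite -(cvg_shiftn k); rewrite (_ : (fun n => _) = fun n => series w n + v (rk k) t).
      by apply: cvgD; [exact: cw|exact: cvg_cst].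
    by apply/funext => n; rewrite wS subrK addnC.
  have -> : f t = limn (series w) + v (rk k) t.
    rewrite /f; have lE : (v (rk n) t)%:E @[n --> \oo] --> (limn (series w) + v (rk k) t)%:E.
      by apply: cvg_EFin => //; exact: nearW.
    rewrite is_cvg_limn_esupE; last by apply/cvg_ex; eexists; exact: lE.
    by rewrite (cvg_lim _ lE).
  rewrite opprD addrCA subrr addr0 normrN -eS lee_fin.
  apply: (norm_lim_le cw); apply: nearW => n; apply: le_trans (hS n).
  rewrite -(big_mkord xpredT (fun j => d (k + j)%N t)); apply: le_trans (ler_norm_sum _ _ _) _.
  exact: lexx.
have mf : measurable_fun setT f.
  apply: measurableT_comp => //; apply: measurable_fun_limn_esup => k.
  by apply/measurable_EFinP; apply: cont_meas => //; exact: vc.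
have mS k : measurable_fun setT (S k).
  by apply: ge0_emeasurable_sum => *; [rewrite lee_fin /d|apply/measurable_EFinP; exact: cont_meas].
have fint k s : (\int[mu]_(t in `[s, (s + 2 * pi)%R]) `|v (rk k) t - f t|%:E <= (2 * 2^-1 ^+ k)%:E)%E.
  by apply: le_trans (S_int k s); apply: integral_mono => // t _; apply: nneseries_ge0 => *; rewrite lee_fin /d.
exists rk, tk, f; split => //.
- by move=> k; have [] := hrk k.
- by move=> x; rewrite /f; congr (fine (limn_esup _)); apply/funext => k; rewrite vp.
move=> k s rho hrho; have [/andP[t0 t1] _ ht _] := hrk k.
have rho01 : 0 < rho < 1 by case/andP: hrho => h1 ->; rewrite (lt_trans t0).
have c1 : continuous (fun t => `|v rho t - v (rk k) t|).
  by have h1 := vc rho01; have h2 := vc (r01 k); cont.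
apply: (@le_trans _ _ (\int[mu]_(t in `[s, (s + 2 * pi)%R]) (`|v rho t - v (rk k) t|%:E + `|v (rk k) t - f t|%:E))%E).
  by apply: integral_mono => // t _; rewrite ?adde_ge0 ?lee_fin//= ler_distD.
rewrite ge0_integralD//; last 2 first.
- by apply/measurable_EFinP; exact: cont_meas.
- apply/measurable_EFinP; apply: measurableT_comp => //; apply: measurable_funB.
    by apply: cont_meas => //; exact: vc.
  exact: measurable_funTS.
have -> : 3 * 2^-1 ^+ k = 2^-1 ^+ k + 2 * 2^-1 ^+ k :> R by ring.
rewrite EFinD; apply: leeD => //.
rewrite (rint_EFin _ _ c1) lee_fin circ_period//; last by move=> x; rewrite !vp.
exact: hc.
Qed.

End Boundary.

Section LebesguePoint.
Variables (g : R -> R) (phi : R).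
Hypothesis mg : measurable_fun setT g.
Hypothesis g0 : forall x, 0 <= g x.
Local Notation A r := (\int[mu]_(t in `[(phi - r)%R, (phi + r)%R]) (g t)%:E)%E.

(** On the annulus reaching the scale k + 1 the kernel is at most 128 r0 / r_k^2 with r_k = r0 2^k,
    and g has integral at most D (k+1) r_(k+1); the product is 512 * 2^-(k+1) * D (k+1). *)
Lemma dyadic_average (P : R -> R) (r0 : R) (D : nat -> R) K : 0 < r0 -> continuous P ->
  (forall y, 0 <= P y) -> (forall y, P y <= 8 / r0) ->
  (forall y, `|y| <= pi -> P y * y ^+ 2 <= 128 * r0) -> r0 * 2 ^+ K <= pi ->
  (forall k, (k <= K)%N -> (A (r0 * 2 ^+ k) <= (D k * (r0 * 2 ^+ k))%:E)%E) ->
  (\int[mu]_(t in `[(phi - r0 * 2 ^+ K)%R, (phi + r0 * 2 ^+ K)%R]) (g t * P (t - phi))%:E <=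
    (512 * \sum_(k < K.+1) 2^-1 ^+ k * D k)%:E)%E.
Proof.
move=> rp cP P0 Pm Pd; have cPs : continuous (fun t => P (t - phi)).
  by apply: (@cont_comp _ P (fun t => t - phi) cP); cont.
have mgP : measurable_fun setT (fun t => (g t * P (t - phi))%:E).
  by apply/measurable_EFinP; apply: measurable_funM => //; exact: cont_meas.
have mgE (E : set R) : measurable E -> measurable_fun E (EFin \o g).
  by move=> mE; apply/measurable_EFinP; exact: measurable_funTS.
elim: K => [|K IH] rK hD.
  rewrite expr0 mulr1; apply: (@le_trans _ _ (\int[mu]_(t in `[(phi - r0)%R, (phi + r0)%R]) ((8 / r0)%:E * (g t)%:E))%E).
    apply: integral_mono => // t _; rewrite -?EFinM lee_fin; first by rewrite mulr_ge0.
      by rewrite mulr_ge0// divr_ge0// ltW.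
    by rewrite mulrC ler_wpM2r.
  rewrite ge0_integralZl//; [|exact: mgE|by move=> x _; rewrite lee_fin|by rewrite lee_fin divr_ge0// ltW].
  have := hD 0%N (leq0n _); rewrite expr0 mulr1 => h.
  apply: (@le_trans _ _ ((8 / r0)%:E * (D 0%N * r0)%:E)%E); first by rewrite lee_wpmul2l// lee_fin divr_ge0// ltW.
  have D0 : 0 <= D 0%N.
    rewrite -(pmulr_lge0 _ rp) -lee_fin; apply: le_trans h.
    by apply: integral_ge0 => x _; rewrite lee_fin.
  rewrite -EFinM lee_fin big_ord_recr big_ord0 /= add0r expr0 mul1r.
  have -> : 8 / r0 * (D 0%N * r0) = 8 * D 0%N by field; rewrite gt_eqF.
  by rewrite ler_wpM2r// ler_nat.
have rk : 0 < r0 * 2 ^+ K by rewrite mulr_gt0// exprn_gt0.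
have e2 : r0 * 2 ^+ K.+1 = 2 * (r0 * 2 ^+ K) by rewrite exprS; ring.
set J := `[(phi - r0 * 2 ^+ K)%R, (phi + r0 * 2 ^+ K)%R]%classic.
set J' := `[(phi - r0 * 2 ^+ K.+1)%R, (phi + r0 * 2 ^+ K.+1)%R]%classic.
have mJ' : measurable J' by exact: measurable_itv.
have JJ : J `<=` J'.
  move=> x; rewrite /J /J' /= !in_itv /= e2 => /andP[h1 h2]; apply/andP; split; lra.
have -> : J' = J `|` (J' `\` J).
  by apply/seteqP; split=> [x hx|x [/JJ//|[]//]]; case: (pselect (J x)) => h; [left|right].
rewrite ge0_integral_setU//=; last 4 first.
- by apply: measurableD => //; exact: measurable_itv.
- by apply: measurable_funTS.
- by move=> x _; rewrite lee_fin mulr_ge0.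
- by apply/disj_setPS => x [h1 [_ h2]].
have {}IH := IH (ltac:(rewrite -(ler_pM2l (ltr0Sn R 1)) -e2; lra)) (fun k kK => hD k (leqW kK)).
rewrite big_ord_recr /= mulrDr EFinD; apply: leeD => //.
have w0 : 0 <= 512 * (2^-1 ^+ K.+1 / (r0 * 2 ^+ K.+1)).
  by rewrite !mulr_ge0 ?invr_ge0 ?mulr_ge0 ?exprn_ge0 ?invr_ge0 ?(ltW rp)//.
apply: (@le_trans _ _ (\int[mu]_(t in J') ((512 * (2^-1 ^+ K.+1 / (r0 * 2 ^+ K.+1)))%:E * (g t)%:E))%E).
  apply: integral_mono => [x []//|x _|x _|x [xJ' xJ]].
  - by rewrite lee_fin mulr_ge0.
  - by rewrite -EFinM lee_fin mulr_ge0.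
  rewrite -EFinM lee_fin mulrC ler_wpM2r//.
  have x2 : r0 * 2 ^+ K <= `|x - phi|.
    rewrite leNgt; apply/negP => /ltW; rewrite ler_norml => /andP[h1 h2]; apply: xJ.
    by rewrite /J /= in_itv /=; apply/andP; split; lra.
  have x3 : `|x - phi| <= pi.
    apply: le_trans rK; move: xJ'; rewrite /J' /= in_itv /= => /andP[h1 h2].
    by rewrite ler_norml; apply/andP; split; lra.
  have xx : (r0 * 2 ^+ K) ^+ 2 <= (x - phi) ^+ 2.
    by rewrite -(real_normK (num_real (x - phi))) lerXn2r ?nnegrE ?(ltW rk).
  have xp : 0 < (x - phi) ^+ 2 by apply: lt_le_trans xx; rewrite exprn_gt0.
  rewrite -(ler_pM2r xp); apply: le_trans (Pd _ x3) _.
  apply: le_trans (ler_wpM2l w0 xx); rewrite e2 le_eqVlt; apply/orP; left; apply/eqP.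
  rewrite exprS exprVn; have p2 : 2 ^+ K != 0 :> R by rewrite expf_neq0.
  by field; rewrite p2 gt_eqF.
rewrite ge0_integralZl//; [|exact: mgE|by move=> x _; rewrite lee_fin].
have h := hD K.+1 (leqnn _).
apply: (@le_trans _ _ ((512 * (2^-1 ^+ K.+1 / (r0 * 2 ^+ K.+1)))%:E * (D K.+1 * (r0 * 2 ^+ K.+1))%:E)%E).
  by rewrite lee_wpmul2l.
rewrite -EFinM lee_fin le_eqVlt; apply/orP; left; apply/eqP.
have p2 : 2 ^+ K.+1 != 0 :> R by rewrite expf_neq0.
move: (2 ^+ K.+1) (2^-1 ^+ K.+1) p2 => q q' q0.
by field; rewrite q0 gt_eqF.
exact: measurable_itv.
Qed.

End LebesguePoint.

Lemma integral_ball (g : R -> R) phi r : measurable_fun setT g -> 0 < r ->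
  lebesgue_pt g phi -> forall eta, 0 < eta -> exists2 d, 0 < d & forall r, 0 < r < d ->
  (\int[mu]_(t in `[(phi - r)%R, (phi + r)%R]) `|g t - g phi|%:E <= (eta * r)%:E)%E.
Proof.
move=> mg _ /= hp eta e0; have e4 : 0 < eta / 4 by rewrite divr_gt0.
have hn : \forall r \near (0:R)^'+, (davg g phi r < (eta / 4)%:E)%E.
  move: hp => /fine_cvgP[hf hp].
  have := @cvgr_lt _ _ _ _ _ _ hp _ e4; near_simpl => h.
  near=> q; have -> : davg g phi q = (fine (davg g phi q))%:E.
    by rewrite fineK//; near: q.
  by rewrite lte_fin; near: q; exact: h.
have [d /= d0 hd] := hn; exists (d / 2); first by rewrite divr_gt0.
(* [davg] averages over an open ball. The ball of radius 2 q contains the closed interval of radius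
   q and has measure 4 q, whence the initial eta / 4. *)
move=> q /andP[q0 qd]; have q2 : 0 < 2 * q by rewrite mulr_gt0.
have := hd (2 * q); rewrite /= sub0r normrN ger0_norm ?(ltW q2)// => /(_ _ q2) h.
have {}h : (davg g phi (2 * q) < (eta / 4)%:E)%E by apply: h; lra.
rewrite /davg /iavg in h; have mb : mu (ball phi (2 * q)) = (4 * q)%:E.
  by rewrite lebesgue_measure_ball ?(ltW q2)//; congr EFin; ring.
rewrite mb in h.
have h2 : (\int[mu]_(t in `[(phi - q)%R, (phi + q)%R]) `|g t - g phi|%:E <=
   \int[mu]_(y in ball phi (2 * q)) `|((center (g phi) \o g) y)%:E|)%E.
  apply: integral_mono => [t|t _|t _|t _]; rewrite ?lee_fin//.
  by rewrite /= in_itv /= => /andP[h1 h2]; rewrite /ball /= ltr_norml; apply/andP; split; lra.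
apply: (le_trans h2); have q4 : 0 < 4 * q by rewrite mulr_gt0.
move: h; rewrite inver gt_eqF// muleC.
set I := integral _ _ _ => h; have : (I < (eta / 4 * (4 * q))%:E)%E.
  by rewrite EFinM -lte_pdivrMr//.
have -> : eta / 4 * (4 * q) = eta * q by field.
exact: ltW.
Unshelve. all: by end_near. Qed.

(** The scales below [m] have total weight at most 2; beyond [m] the geometric weights leave the
    factor 2^-m, which beats a large D2. *)
Lemma half_tail (D1 D2 : R) n m : 0 <= D1 -> 0 <= D2 ->
  \sum_(k < n) 2^-1 ^+ k * (if (k < m)%N then D1 else D2) <= 2 * D1 + 2 * D2 * 2^-1 ^+ m.
Proof.
move=> d1 d2; have p k : 0 <= (2^-1 : R) ^+ k by rewrite exprn_ge0// invr_ge0.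
apply: (@le_trans _ _ (\sum_(k < n) (2^-1 ^+ k * D1 + D2 * (if (k < m)%N then 0 else 2^-1 ^+ k)))).
  apply: ler_sum => k _; case: ifP => _; rewrite ?mulr0 ?addr0//.
  by rewrite [D2 * _]mulrC lerDr mulr_ge0.
rewrite big_split /= -mulr_suml -mulr_sumr; apply: lerD.
  rewrite ler_wpM2r//; have := half_sum_le n 0; rewrite expr0 mulr1.
  by under eq_bigr do rewrite add0n.
rewrite [2 * _ * _]mulrAC [leRHS]mulrC ler_wpM2l//.
have [nm|mn] := leqP n m.
  by rewrite big1 ?mulr_ge0// => k _; rewrite (leq_trans (ltn_ord k)).
rewrite -(subnKC (ltnW mn)) big_split_ord /= big1 ?add0r => [|k _]; last by rewrite ltn_ord.
apply: le_trans (half_sum_le (n - m) m); apply: ler_sum => k _.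
by rewrite ltnNge leq_addr.
Qed.

End Fatou.

(** * Radial limits at Lebesgue points *)

Section Fatou.
Variable R : realType.
Local Notation mu := (@lebesgue_measure R).
Local Notation pi := (@pi R).
Local Notation circ := (rint (- pi) pi).
Implicit Types (f g : R -> R) (c s t x y r rho phi : R).

Section RadialLimit.
Variable v : R -> R -> R.
Hypothesis vc : forall rho, 0 < rho < 1 -> continuous (v rho).
Hypothesis vp : forall rho x, 0 < rho < 1 -> v rho (x + 2 * pi) = v rho x.
Hypothesis vP : forall rho r phi, 0 < rho < 1 -> 0 < r < 1 ->
  circ (fun t => v rho t * poisson r (t - phi)) = 2 * pi * v (r * rho) phi.
Hypothesis vr : forall r phi, 0 < r < 1 -> v (r * rho) phi @[rho --> (1 : R)^'-] --> v r phi.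
Variables (rk tk : nat -> R) (f : R -> R).
Hypothesis hrk : forall k, [/\ 0 < tk k < 1, 1 - k.+2%:R^-1 <= tk k & tk k < rk k < 1].
Hypothesis mf : measurable_fun setT f.
Hypothesis hf : forall k s, (\int[mu]_(t in `[s, (s + 2 * pi)%R]) `|v (rk k) t - f t|%:E <= (2 * 2^-1 ^+ k)%:E)%E.

Lemma rk01 k : 0 < rk k < 1.
Proof. by have [/andP[a1 a2] _ /andP[a3 a4]] := hrk k; rewrite a4 andbT (lt_trans a1). Qed.

Lemma rk_cvg (r phi : R) : 0 < r < 1 -> v (r * rk k) phi @[k --> \oo] --> v r phi.
Proof.
move=> r01; have /cvg_at_leftP h := @vr r phi r01; apply: h; split => [k|].
  by case/andP: (rk01 k).
apply: (@squeeze_cvgr _ _ _ _ (fun k => 1 - k.+2%:R^-1) (fun=> 1)).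
- by apply: nearW => k; have [_ h1 /andP[h2 h3]] := hrk k; rewrite (ltW h3) andbT (le_trans h1)// ltW.
- rewrite -[X in _ --> X]subr0; apply: cvgB; first exact: cvg_cst.
  rewrite (cvg_shiftS (fun k => (k.+1%:R : R)^-1)); exact: cvg_harmonic.
- exact: cvg_cst.
Qed.

Lemma mfc c (E : set R) : measurable E -> measurable_fun E (fun t => `|f t - c|).
Proof.
by move=> mE; apply: measurableT_comp => //; apply: measurable_funB => //; exact: measurable_funTS.
Qed.

Lemma f_center c phi : (\int[mu]_(t in `[(phi - pi)%R, (phi + pi)%R]) `|f t - c|%:E < +oo)%E.
Proof.
have cv := vc (rk01 0).
have c1 : continuous (fun t => `|v (rk 0%N) t - c|) by cont.
have -> : phi + pi = phi - pi + 2 * pi by ring.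
apply: (@le_lt_trans _ _ (\int[mu]_(t in `[(phi - pi)%R, (phi - pi + 2 * pi)%R]) (`|v (rk 0%N) t - f t|%:E + `|v (rk 0%N) t - c|%:E))%E).
  apply: integral_mono => // t _; rewrite ?adde_ge0 ?lee_fin//= distrC.
  by have := ler_distD (v (rk 0%N) t) c (f t); rewrite addrC ![`|c - _|]distrC.
rewrite ge0_integralD//; last 2 first.
- apply/measurable_EFinP; apply: measurableT_comp => //; apply: measurable_funB.
    exact: cont_meas.
  exact: measurable_funTS.
- by apply/measurable_EFinP; exact: cont_meas.
rewrite (rint_EFin _ _ c1); apply: (@le_lt_trans _ _ ((2 * 2^-1 ^+ 0)%:E + (rint (phi - pi) (phi - pi + 2 * pi) (fun t => `|v (rk 0%N) t - c|))%:E)%E).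
  by rewrite leeD2r.
by rewrite -EFinD ltry.
Qed.

(** The Poisson formula holds on the circles of radius r_k < 1. At a fixed r the kernel is bounded,
    so convergence in mean of the values on these circles to f carries the inequality to the
    boundary. *)
Lemma poisson_boundary r phi c : 0 < r < 1 -> ((2 * pi * `|v r phi - c|)%:E <=
  \int[mu]_(t in `[(phi - pi)%R, (phi + pi)%R]) (`|f t - c| * poisson r (t - phi))%:E)%E.
Proof.
move=> r01; have r01' : 0 <= r < 1 by case/andP: r01 => /ltW -> ->.
have pi0 := pi_gt0 R.
set X := integral _ _ _.
have P0 y : 0 <= poisson r y by rewrite ltW// poisson_gt0.
have cP := @poisson_shift_cont _ _ r01' phi.
have X0 : (0 <= X)%E by apply: integral_ge0 => t _; rewrite lee_fin mulr_ge0.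
have mfP : measurable_fun `[(phi - pi)%R, (phi + pi)%R] (fun t => (`|f t - c| * poisson r (t - phi))%:E).
  apply/measurable_EFinP; apply: measurable_funM; first exact: mfc.
  exact: cont_meas.
pose B := 2 / (1 - r); have B0 : 0 <= B by rewrite divr_ge0// subr_ge0 ltW//; case/andP: r01.
have hk k : ((2 * pi * `|v (r * rk k) phi - c|)%:E <= X + (B * (2 * 2^-1 ^+ k))%:E)%E.
  have cv := vc (rk01 k).
  have c1 : continuous (fun t => v (rk k) t * poisson r (t - phi)) by cont.
  have c2 : continuous (fun t => (v (rk k) t - c) * poisson r (t - phi)) by cont.
  have c3 : continuous (fun t => `|(v (rk k) t - c) * poisson r (t - phi)|) by cont.
  have p2 x : (v (rk k) (x + 2 * pi) - c) * poisson r (x + 2 * pi - phi) = (v (rk k) x - c) * poisson r (x - phi).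
    by rewrite vp ?rk01// (_ : x + 2 * pi - phi = x - phi + 2 * pi) ?poisson_period//; ring.
  have -> : 2 * pi * `|v (r * rk k) phi - c| = `|rint (phi - pi) (phi - pi + 2 * pi) (fun t => (v (rk k) t - c) * poisson r (t - phi))|.
    rewrite (circ_period _ c2 p2) (@rint_ext _ _ (fun t => v (rk k) t * poisson r (t - phi) - c * poisson r (t - phi))) => [|t]; last by rewrite mulrBl.
    have c4 : continuous (fun t => c * poisson r (t - phi)) by cont.
    rewrite (rintB _ _ c1 c4) (rintZ _ _ _ cP) vP ?rk01// poisson_one//.
    rewrite -[2 * pi in LHS](@ger0_norm _ (2 * pi)); last by rewrite mulr_ge0// ltW.
    by rewrite -normrM; congr `|_|; ring.
  apply: (@le_trans _ _ (rint (phi - pi) (phi - pi + 2 * pi) (fun t => `|(v (rk k) t - c) * poisson r (t - phi)|))%:E).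
    by rewrite lee_fin; exact: rint_norm.
  rewrite -(rint_EFin _ _ c3) (_ : phi - pi + 2 * pi = phi + pi); last by ring.
  apply: (@le_trans _ _ (\int[mu]_(t in `[(phi - pi)%R, (phi + pi)%R]) ((`|f t - c| * poisson r (t - phi))%:E + B%:E * `|v (rk k) t - f t|%:E))%E).
    apply: integral_mono => // t _.
      by rewrite -EFinM -EFinD lee_fin; apply: addr_ge0; apply: mulr_ge0.
    rewrite -EFinM -EFinD lee_fin normrM [`|poisson _ _|]ger0_norm//.
    have h1 := ler_distD (f t) (v (rk k) t) c; have h2 := poisson_max (t - phi) r01'.
    apply: (le_trans (ler_wpM2r (P0 _) h1)); rewrite mulrDl addrC lerD2l mulrC.
    by rewrite ler_wpM2r.
  have mv : measurable_fun `[(phi - pi)%R, (phi + pi)%R] (fun t => `|v (rk k) t - f t|%:E).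
    apply/measurable_EFinP; apply: measurableT_comp => //; apply: measurable_funB; first exact: cont_meas.
    exact: measurable_funTS.
  rewrite ge0_integralD//; last 3 first.
  - by move=> t _; rewrite lee_fin mulr_ge0.
  - by move=> t _; rewrite -EFinM lee_fin mulr_ge0.
  - by apply: measurable_funeM.
  have -> : (\int[mu]_(t in `[(phi - pi)%R, (phi + pi)%R]) (B%:E * `|v (rk k) t - f t|%:E) =
    B%:E * \int[mu]_(t in `[(phi - pi)%R, (phi + pi)%R]) `|v (rk k) t - f t|%:E)%E.
    by rewrite ge0_integralZl// lee_fin.
  rewrite leeD2l// [X in (_ <= X)%E]EFinM lee_wpmul2l ?lee_fin//.
  have := hf k (phi - pi); rewrite (_ : phi - pi + 2 * pi = phi + pi)//; ring.
have [->|Xoo] := eqVneq X +oo%E; first exact: leey.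
have /fineK eX : X \is a fin_num by rewrite ge0_fin_numE// ltey.
rewrite -eX lee_fin.
have lim1 : 2 * pi * `|v (r * rk k) phi - c| @[k --> \oo] --> 2 * pi * `|v r phi - c|.
  apply: cvgM; first exact: cvg_cst; apply: cvg_norm; apply: cvgB; last exact: cvg_cst.
  exact: rk_cvg.
have lim2 : fine X + B * (2 * 2^-1 ^+ k) @[k --> \oo] --> fine X.
  rewrite -[X in _ --> X]addr0; apply: cvgD; first exact: cvg_cst.
  rewrite -[X in _ --> X](mulr0 B); apply: cvgM; first exact: cvg_cst.
  rewrite -[X in _ --> X](mulr0 2); apply: cvgM; first exact: cvg_cst.
  by apply: cvg_expr; rewrite ger0_norm ?invr_ge0// invf_lt1// ltr1n.
apply: (ler_cvg_to lim1 lim2); apply: nearW => k.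
by have := hk k; rewrite -eX -EFinD lee_fin.
Qed.

Lemma radial_limit phi : lebesgue_pt f phi -> v r phi @[r --> (1 : R)^'-] --> f phi.
Proof.
move=> hp; apply/cvgrPdist_le => e e0; have pi0 := pi_gt0 R; have pi2 := @pi_ge2 R.
(* 2^11 = 4 * 512: the dyadic average costs 512, and the near and the far scales cost 2 eta each. *)
pose eta := e / 2 ^+ 11; have eta0 : 0 < eta by rewrite divr_gt0// exprn_gt0.
have [d d0 hd] := integral_ball mf (ltr01) hp eta0.
pose A r := (\int[mu]_(t in `[(phi - r)%R, (phi + r)%R]) `|f t - f phi|%:E)%E.
have A0 r : (0 <= A r)%E by apply: integral_ge0 => t _; rewrite lee_fin.
have /fineK eA : A pi \is a fin_num by rewrite ge0_fin_numE//; exact: f_center.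
have fA0 : 0 <= fine (A pi) by apply: fine_ge0.
(* At scales beyond d only the integral over a whole period is available, and dividing by d gives a
   bound for the average there. *)
pose D2 := eta + fine (A pi) / d.
have D20 : 0 <= D2 by rewrite addr_ge0 ?divr_ge0// ltW.
have [m hm] : exists m, 2 * D2 * 2^-1 ^+ m <= 2 * eta.
  have : 2 * D2 * 2^-1 ^+ m @[m --> \oo] --> 2 * D2 * 0.
    apply: cvgM; first exact: cvg_cst.
    by apply: cvg_expr; rewrite ger0_norm ?invr_ge0// invf_lt1// ltr1n.
  rewrite mulr0 => h; have e2 : 0 < 2 * eta by rewrite mulr_gt0.
  have [N _ hN] := @cvgr_lt _ _ _ _ _ _ h _ e2.
  by exists N; apply: ltW; apply: hN => /=.
near=> r; have r01 : 0 < r < 1 by apply/andP; split; near: r; [exact: nbhs_left_gt|exact: nbhs_left_lt].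
have r01' : 0 <= r < 1 by case/andP: r01 => /ltW -> ->.
have [K [r0 [rp rK h1 h2]]] := dyadic_radius r01'.
(* For r near 1 the first m scales all lie below d, where the Lebesgue point property applies. *)
have small : r0 * 2 ^+ m < d.
  apply: (@le_lt_trans _ _ (pi * (1 - r) * 2 ^+ m)); first by rewrite ler_wpM2r ?exprn_ge0.
  rewrite mulrAC mulrC -ltr_pdivlMr ?mulr_gt0 ?exprn_gt0// ltrBlDl -ltrBlDr.
  by near: r; apply: nbhs_left_gt; rewrite ltrBlDr ltrDl divr_gt0// mulr_gt0// exprn_gt0.
have r0pi : r0 <= pi by rewrite -rK ler_peMr ?(ltW rp)// exprn_ege1// ler1n.
have mg : measurable_fun setT (fun t => `|f t - f phi|) by exact: mfc.
have Pm y : poisson r y <= 8 / r0.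
  apply: le_trans (poisson_max y r01') _; have p4 := @pihalf_lt2 R.
  by rewrite ler_pdivrMr ?subr_gt0; [rewrite mulrAC ler_pdivlMr//; nra|case/andP: r01].
pose D k := if (k < m)%N then eta else D2.
have hD k : (k <= K)%N -> (A (r0 * 2 ^+ k)%R <= (D k * (r0 * 2 ^+ k))%:E)%E.
  move=> kK; have rk0 : 0 < r0 * 2 ^+ k by rewrite mulr_gt0// exprn_gt0.
  have rkpi : r0 * 2 ^+ k <= pi by rewrite -rK ler_pM2l// ler_eXn2l// ltr1n.
  have [lt_d|ge_d] := ltP (r0 * 2 ^+ k) d.
    apply: le_trans (hd _ _) _; first by rewrite rk0.
    by rewrite lee_fin ler_wpM2r ?(ltW rk0)// /D; case: ifP => // _; rewrite lerDl divr_ge0// ltW.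
  rewrite /D; case: ifP => km.
    have q : r0 * 2 ^+ k <= r0 * 2 ^+ m by rewrite ler_pM2l// ler_weXn2l ?ler1n// ltnW.
    by have := lt_le_trans (le_lt_trans q small) ge_d; rewrite ltxx.
  apply: (@le_trans _ _ (A pi)).
    apply: integral_mono => [t|t _|t _|t _]; rewrite ?lee_fin//.
    by rewrite /= !in_itv /= => /andP[q1 q2]; apply/andP; split; lra.
  rewrite -eA lee_fin /D2 mulrDl; apply: (@le_trans _ _ (fine (A pi) / d * (r0 * 2 ^+ k))).
    by rewrite mulrAC ler_pdivlMr// ler_wpM2l.
  by rewrite lerDr mulr_ge0// ltW.
have P0 y : 0 <= poisson r y by rewrite ltW// poisson_gt0.
have Pd y : `|y| <= pi -> poisson r y * y ^+ 2 <= 128 * r0 by exact: poisson_dec.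
have := @dyadic_average R (fun t => `|f t - f phi|) phi mg (fun _ => normr_ge0 _) (poisson r) r0 D K rp
  (poisson_cont r01') P0 Pm Pd.
rewrite rK => /(_ (lexx _) hD) hX.
have := le_trans (poisson_boundary phi (f phi) r01) hX; rewrite lee_fin => hY.
have hT := @half_tail R eta D2 K.+1 m (ltW eta0) D20.
rewrite distrC; have e1 : e = 4 * 512 * eta.
  have e11 : 2 ^+ 11 = 4 * 512 :> R by rewrite -[11%N]/(2 + 9)%N exprD -!natrX.
  by rewrite -e11 /eta mulrC divfK// expf_neq0.
have n0 := normr_ge0 (v r phi - f phi).
have : `|v r phi - f phi| <= 2 * pi * `|v r phi - f phi| by rewrite ler_peMl//; lra.
by rewrite e1; move: hT; rewrite -/(D _); move: (\sum_(k < K.+1) _) hY => S *; lra.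
Unshelve. all: by end_near. Qed.

Lemma f_locally_integrable : locally_integrable setT f.
Proof.
split => //; first exact: openT.
move=> E _ cE; have pi0 := pi_gt0 R.
have I n s : (\int[mu]_(t in `[s, (s + n%:R * (2 * pi))%R]) `|f t|%:E < +oo)%E.
  elim: n s => [|n IH] s; first by rewrite mul0r addr0 set_itv1 integral_set1.
  have l1 : s <= s + n%:R * (2 * pi) by rewrite lerDl !mulr_ge0// ltW.
  have -> : s + n.+1%:R * (2 * pi) = s + n%:R * (2 * pi) + 2 * pi by rewrite -natr1; ring.
  rewrite (@itv_bndbnd_setU _ _ (BLeft s) (BRight (s + n%:R * (2 * pi)))) ?bnd_simp//; last by rewrite lerDl mulr_ge0// ltW.
  have mfE (X : set R) : measurable X -> measurable_fun X (fun t => `|f t|%:E).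
    by move=> mX; apply/measurable_EFinP; apply: measurableT_comp => //; exact: measurable_funTS.
  rewrite ge0_integral_setU//=; last 2 first.
  - by apply: mfE; apply: measurableU.
  - by apply/disj_setPS => x []; rewrite /= !in_itv /= => /andP[_ a1] /andP[a2 _]; move: (le_lt_trans a1 a2); rewrite ltxx.
  apply: lte_add_pinfty => //.
  have := f_center 0 (s + n%:R * (2 * pi) + pi).
  have -> : s + n%:R * (2 * pi) + pi - pi = s + n%:R * (2 * pi) by ring.
  have -> : s + n%:R * (2 * pi) + pi + pi = s + n%:R * (2 * pi) + 2 * pi by ring.
  apply: le_lt_trans; apply: integral_mono => [t|t _|t _|t _]; rewrite ?lee_fin ?subr0//.
  by rewrite /= !in_itv /= => /andP[/ltW -> ->].
have [M [Mr hM]] := compact_bounded cE.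
have hM1 := hM (`|M| + 1) (ltr_pwDr ltr01 (ler_norm M)).
pose n := (Num.truncn (2 * (`|M| + 1))).+1.
apply: le_lt_trans (I n (- (`|M| + 1))).
apply: integral_mono => // t Et; have := hM1 _ Et; rewrite /= ler_norml in_itv /= => /andP[-> h].
apply: le_trans h _.
have : 2 * (`|M| + 1) < n%:R by exact: truncnS_gt.
have : n%:R * 1 <= n%:R * (2 * pi) by rewrite ler_wpM2l// ?ler0n//; have := @pi_ge2 R; lra.
lra.
Qed.

Lemma radial_limit_ae : {ae mu, forall t, v r t @[r --> (1 : R)^'-] --> f t}.
Proof.
have [N [mN N0 sub]] := lebesgue_differentiation f_locally_integrable.
exists N; split => // t ht; apply: sub => h; apply: ht; exact: radial_limit.
Qed.

End RadialLimit.
End Fatou.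

From mathcomp Require Import complex.

(** * Approximate factorization of polynomials on the unit circle *)

Section Factorization.
Variable R : realType.
Local Notation C := R[i].
Local Notation nc := (@ComplexField.Normc.normc R).
Implicit Types (p q g h : {poly C}) (x y z a : C) (e : R).

Lemma nc_ge0 x : 0 <= nc x.
Proof. by case: x => u v; exact: sqrtr_ge0. Qed.
Lemma ncM x y : nc (x * y) = nc x * nc y. Proof. exact: ComplexField.Normc.normcM. Qed.
Lemma ncD x y : nc (x + y) <= nc x + nc y. Proof.
by case: x y => [a b] [c d]; have := ler_normD (Complex a b) (Complex c d); rewrite !normc_def /= -rmorphD lecR.
Qed.
Lemma ncN x : nc (- x) = nc x. Proof. by case: x => u v; rewrite /ComplexField.Normc.normc /= !sqrrN. Qed.
Lemma nc1 : nc 1 = 1. Proof. exact: ComplexField.Normc.normc1. Qed.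
Lemma nc0 : nc 0 = 0. Proof. exact: ComplexField.Normc.normc0. Qed.
Lemma ncV x : nc x^-1 = (nc x)^-1. Proof. exact: ComplexField.Normc.normcV. Qed.
Lemma ncX x n : nc (x ^+ n) = nc x ^+ n.
Proof. by elim: n => [|n IH]; rewrite ?expr0 ?nc1// !exprS ncM IH. Qed.
Lemma nc_real (r : R) : nc r%:C%C = `|r|.
Proof. by rewrite /ComplexField.Normc.normc /= expr0n addr0 sqrtr_sqr. Qed.
Lemma nc_sqr x : nc x ^+ 2 = complex.Re x ^+ 2 + complex.Im x ^+ 2.
Proof. by case: x => u v; rewrite sqr_sqrtr// addr_ge0 ?sqr_ge0. Qed.
Lemma ncB x y : `|nc x - nc y| <= nc (x - y).
Proof.
rewrite ler_norml; apply/andP; split.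
  by rewrite lerNl opprB lerBlDr -[nc (x - y)]ncN opprB; apply: le_trans (ncD _ _); rewrite subrK.
by rewrite lerBlDr; apply: le_trans (ncD _ _); rewrite subrK.
Qed.
Lemma nc_conj x : nc (conjc x) = nc x.
Proof. by case: x => u v; rewrite /ComplexField.Normc.normc /= sqrrN. Qed.
Lemma conj_unit x : nc x = 1 -> x * conjc x = 1.
Proof.
move=> h; have := nc_sqr x; rewrite h expr1n; case: x {h} => u v /= h.
by apply/eqP; rewrite eq_complex /=; apply/andP; split; apply/eqP; [rewrite h; ring|ring].
Qed.

Definition unimodular x := nc x = 1.

(** An approximate form, on the unit circle only, of the factorization of an H1 function into two H2
    factors of equal modulus. It is stable under products, so linear factors suffice. *)
Definition factorable p := forall e, 0 < e -> exists g h, forall x, unimodular x ->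
  [/\ nc (g.[x] * h.[x] - p.[x]) <= e, `|nc g.[x] ^+ 2 - nc p.[x]| <= e &
      `|nc h.[x] ^+ 2 - nc p.[x]| <= e].

Lemma poly_bound p : exists2 M, 0 <= M & forall x, unimodular x -> nc p.[x] <= M.
Proof.
elim/poly_ind: p => [|p c [M M0 hM]].
  by exists 0 => // x _; rewrite horner0 nc0.
exists (M + nc c) => [|x x1]; first by rewrite addr_ge0 ?nc_ge0.
rewrite hornerMXaddC; apply: le_trans (ncD _ _) _; rewrite lerD2r ncM x1 mulr1; exact: hM.
Qed.

Lemma prod_dist (u v p q d P Q : R) : `|u - p| <= d -> `|v - q| <= d -> 0 <= d <= 1 ->
  `|p| <= P -> `|q| <= Q -> `|u * v - p * q| <= d * (P + Q + 1).
Proof.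
move=> h1 h2 /andP[d0 d1] hp hq.
have -> : u * v - p * q = (u - p) * q + (u - p) * (v - q) + p * (v - q) by ring.
have k1 : `|(u - p) * q| <= d * Q by rewrite normrM; apply: ler_pM.
have k2 : `|(u - p) * (v - q)| <= d * 1.
  by rewrite normrM; apply: ler_pM => //; exact: le_trans h2 d1.
have k3 : `|p * (v - q)| <= P * d by rewrite normrM; apply: ler_pM.
have := ler_normD ((u - p) * q + (u - p) * (v - q)) (p * (v - q)).
have := ler_normD ((u - p) * q) ((u - p) * (v - q)).
by lra.
Qed.

Lemma nc_prod_dist x y z w (d P Q : R) : nc (x - z) <= d -> nc (y - w) <= d -> 0 <= d <= 1 ->
  nc z <= P -> nc w <= Q -> nc (x * y - z * w) <= d * (P + Q + 1).
Proof.
move=> h1 h2 /andP[d0 d1] hp hq; have n0 := nc_ge0.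
have -> : x * y - z * w = (x - z) * w + (x - z) * (y - w) + z * (y - w) by ring.
have k1 : nc ((x - z) * w) <= d * Q by rewrite ncM; apply: ler_pM.
have k2 : nc ((x - z) * (y - w)) <= d * 1.
  by rewrite ncM; apply: ler_pM => //; exact: le_trans h2 d1.
have k3 : nc (z * (y - w)) <= P * d by rewrite ncM; apply: ler_pM.
have := ncD ((x - z) * w + (x - z) * (y - w)) (z * (y - w)).
have := ncD ((x - z) * w) ((x - z) * (y - w)).
by lra.
Qed.

Lemma factorable_mul p q : factorable p -> factorable q -> factorable (p * q).
Proof.
move=> fp fq e e0; have [P P0 hP] := poly_bound p; have [Q Q0 hQ] := poly_bound q.
have K0 : 0 < P + Q + 1 by lra.
pose d := Num.min 1 (e / (P + Q + 1)).
have d0 : 0 < d by rewrite lt_min ltr01/= divr_gt0.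
have d1 : 0 <= d <= 1 by rewrite (ltW d0)/= ge_min lexx.
have de : d * (P + Q + 1) <= e by rewrite -ler_pdivlMr// ge_min lexx orbT.
have [g1 [h1 H1]] := fp d d0; have [g2 [h2 H2]] := fq d d0.
exists (g1 * g2), (h1 * h2) => x x1; have [a1 a2 a3] := H1 x x1; have [b1 b2 b3] := H2 x x1.
have pP := hP x x1; have qQ := hQ x x1; rewrite !hornerM.
have nP : `|nc p.[x]| <= P by rewrite ger0_norm ?nc_ge0.
have nQ : `|nc q.[x]| <= Q by rewrite ger0_norm ?nc_ge0.
split.
- have -> : g1.[x] * g2.[x] * (h1.[x] * h2.[x]) = (g1.[x] * h1.[x]) * (g2.[x] * h2.[x]) by ring.
  by apply: le_trans de; exact: nc_prod_dist.
- by rewrite !ncM exprMn; apply: le_trans de; exact: prod_dist.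
- by rewrite !ncM exprMn; apply: le_trans de; exact: prod_dist.
Qed.

Lemma factorable_const (c : C) : factorable c%:P.
Proof.
move=> e e0; exists (sqrtC c)%:P, (sqrtC c)%:P => x _.
by rewrite !hornerC -!expr2 -ncX sqrtCK !subrr nc0 normr0 ltW.
Qed.

(** The iteration w -> (y + w^2) / 2, which approximates 1 - sqrt(1 - y). On the closed unit disc it
    and its steps are dominated by those of [wreal], its value at y = 1. *)
Fixpoint wpoly n : {poly C} := if n is n'.+1 then (2^-1)%:P * ('X + wpoly n' ^+ 2) else 0.
Fixpoint wreal n : R := if n is n'.+1 then 2^-1 * (1 + wreal n' ^+ 2) else 0.

Lemma nc_half : nc 2^-1 = 2^-1.
Proof. by rewrite ncV (_ : 2 = (2 : R)%:C%C :> C) ?nc_real ?ger0_norm// rmorphMn. Qed.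

Lemma wreal01 n : 0 <= wreal n <= 1.
Proof. by elim: n => [|n /andP[h1 h2]] /=; rewrite ?lexx ?ler01//; apply/andP; split; nra. Qed.

Lemma wpoly_le n y : nc y <= 1 -> nc (wpoly n).[y] <= wreal n /\
  nc ((wpoly n.+1).[y] - (wpoly n).[y]) <= wreal n.+1 - wreal n.
Proof.
move=> y1; have n0 := nc_ge0.
have sq m : nc (wpoly m).[y] <= wreal m -> nc (wpoly m.+1).[y] <= wreal m.+1.
  move=> h /=; rewrite hornerM hornerC hornerD hornerX horner_exp ncM nc_half ler_pM2l ?invr_gt0//.
  apply: le_trans (ncD _ _) _; apply: lerD => //; rewrite ncX lerXn2r ?nnegrE//.
  by case/andP: (wreal01 m).
elim: n => [|n [IH1 IH2]].
  rewrite /= horner0 nc0 subr0; split=> //.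
  rewrite hornerM hornerC hornerD hornerX expr0n /= horner0 addr0 subr0 ncM nc_half expr0n /= addr0.
  by rewrite ler_pM2l ?invr_gt0.
have k1 := sq _ IH1; split=> //.
have -> : (wpoly n.+2).[y] - (wpoly n.+1).[y] =
  2^-1 * (((wpoly n.+1).[y] - (wpoly n).[y]) * ((wpoly n.+1).[y] + (wpoly n).[y])).
  have E m : (wpoly m.+1).[y] = 2^-1 * (y + (wpoly m).[y] ^+ 2).
    by rewrite /= hornerM hornerC hornerD hornerX horner_exp.
  by rewrite (E n.+1) {2}(E n); ring.
have -> : wreal n.+2 - wreal n.+1 = 2^-1 * ((wreal n.+1 - wreal n) * (wreal n.+1 + wreal n)).
  have E m : wreal m.+1 = 2^-1 * (1 + wreal m ^+ 2) by [].
  by rewrite (E n.+1) {2}(E n); ring.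
rewrite !ncM nc_half ler_pM2l ?invr_gt0//; apply: ler_pM => //.
by apply: le_trans (ncD _ _) _; apply: lerD.
Qed.

(** If every step exceeded e, the sequence, which starts at 0, would leave [0, 1]. *)
Lemma wreal_step e : 0 < e -> exists n, wreal n.+1 - wreal n <= e.
Proof.
move=> e0; apply: contrapT => /forallNP h.
have h2 n : n%:R * e <= wreal n.
  elim: n => [|n IH]; first by rewrite mul0r.
  have /negP := h n; rewrite -ltNge => h1; rewrite -natr1 mulrDl mul1r; lra.
have := truncnS_gt (e^-1); set n := (_.+1) => hn.
have := h2 n; have /andP[_ w1] := wreal01 n.
have : 1 < n%:R * e by rewrite -ltr_pdivrMr// mul1r.
by lra.
Qed.

(** The residual of the approximate square root 1 - w_n is exactly twice the next step of the
    iteration. *)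
Lemma sqrt_poly e : 0 < e -> exists q, forall y, nc y <= 1 -> nc (q.[y] ^+ 2 - (1 - y)) <= e.
Proof.
move=> e0; have [n hn] := wreal_step (divr_gt0 e0 (ltr0Sn R 1)).
exists (1 - wpoly n) => y y1; rewrite hornerD hornerN hornerC.
have -> : (1 - (wpoly n).[y]) ^+ 2 - (1 - y) = 2 * ((wpoly n.+1).[y] - (wpoly n).[y]).
  rewrite /= hornerM hornerC hornerD hornerX horner_exp.
  by field.
have [_ h] := wpoly_le n y1; rewrite ncM (_ : nc 2 = 2); last first.
  by rewrite (_ : 2 = (2 : R)%:C%C :> C) ?nc_real ?ger0_norm// rmorphMn.
by lra.
Qed.

Lemma horner_scaleX q (c x : C) : (q \Po (c *: 'X)).[x] = q.[c * x].
Proof. by rewrite horner_comp hornerZ hornerX. Qed.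

(** x - a = -a (1 - x / a) with |x / a| <= 1, so both factors can be one polynomial approximating a
    square root. *)
Lemma factorable_lin_out a : 1 <= nc a -> factorable ('X - a%:P).
Proof.
move=> a1 e e0; have ap : 0 < nc a by apply: lt_le_trans a1.
have an : a != 0 by apply/eqP => a0; move: ap; rewrite a0 nc0 ltxx.
have [q hq] := sqrt_poly (divr_gt0 e0 ap).
pose g := (sqrtC (- a))%:P * (q \Po (a^-1 *: 'X)).
have hg x : unimodular x -> nc (g.[x] ^+ 2 - (x - a)) <= e.
  move=> x1; rewrite /g hornerM hornerC horner_scaleX exprMn sqrtCK.
  have -> : - a * q.[a^-1 * x] ^+ 2 - (x - a) = - a * (q.[a^-1 * x] ^+ 2 - (1 - a^-1 * x)).
    by rewrite mulrBr mulrBr mulr1 mulNr mulNr [a * (_ * x)]mulrA mulfV// mul1r; ring.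
  rewrite ncM ncN mulrC -ler_pdivlMr//; apply: hq.
  by rewrite ncM x1 mulr1 ncV invf_le1.
exists g, g => x x1; have h := hg x x1; rewrite hornerD hornerN hornerX hornerC -expr2.
by have := ncB (g.[x] ^+ 2) (x - a); rewrite ncX => k; split => //; exact: le_trans k h.
Qed.

(** A root inside the disc carries the Blaschke factor (x - a) / (1 - conj(a) x), of modulus 1 on
    the circle. It is given to one factor, in polynomial form by cutting a geometric series, and a
    square root of 1 - conj(a) x goes to both. *)
Lemma factorable_lin_in a : nc a < 1 -> factorable ('X - a%:P).
Proof.
move=> a1 e e0; have e8 : 0 < e / 8 by rewrite divr_gt0.
have [n hn] : exists n, nc a ^+ n <= Num.min 1 (e / 16).
  have c0 : nc a ^+ n @[n --> \oo] --> 0 by apply: cvg_expr; rewrite ger0_norm ?nc_ge0.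
  have m0 : 0 < Num.min 1 (e / 16) by rewrite lt_min ltr01 divr_gt0.
  have [N _ hN] := @cvgr_lt _ _ _ _ _ _ c0 _ m0.
  by exists N; apply: ltW; apply: hN => /=.
have [q hq] := sqrt_poly e8; pose c := conjc a.
pose B := ('X - a%:P) * \sum_(j < n) (c *: 'X) ^+ j.
exists (B * (q \Po (c *: 'X))), (q \Po (c *: 'X)) => x x1.
have cx : nc (c * x) = nc a by rewrite ncM x1 mulr1 nc_conj.
set s := (c * x) ^+ n; have ns : nc s = nc a ^+ n by rewrite /s ncX cx.
have [ks1 ks2] : nc s <= 1 /\ nc s <= e / 16 by move: hn; rewrite ns le_min => /andP.
pose d := 1 - c * x.
(* On the unit circle 1 - conj(a) x = x conj(x - a). *)
have nd : nc d = nc (x - a).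
  have -> : d = x * conjc (x - a) by rewrite /d rmorphB mulrBr conj_unit// [c * x]mulrC.
  by rewrite ncM x1 mul1r nc_conj.
have dp : 0 < nc d.
  have := ncB 1 (c * x); rewrite nc1 cx => h; apply: lt_le_trans h.
  by rewrite normr_gt0 subr_eq0 eq_sym lt_eqF.
have d2 : nc d <= 2.
  by apply: le_trans (ncD _ _) _; rewrite ncN cx nc1; lra.
have dn : d != 0 by apply/eqP => d0; move: dp; rewrite d0 nc0 ltxx.
have Bd : B.[x] * d = (x - a) * (1 - s).
  rewrite /B hornerM hornerD hornerN hornerX hornerC -mulrA; congr (_ * _).
  have -> : (\sum_(j < n) (c *: 'X) ^+ j).[x] = \sum_(j < n) (c * x) ^+ j.
    by rewrite horner_sum; apply: eq_bigr => j _; rewrite horner_exp hornerZ hornerX.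
  have := subrX1 (c * x) n; rewrite -/s => e1; have -> : 1 - s = - (s - 1) by rewrite opprB.
  by rewrite e1 /d; ring.
have nB : nc B.[x] = nc (1 - s).
  have := congr1 nc Bd; rewrite !ncM -nd [nc d * _]mulrC => /mulIf; apply.
  by rewrite gt_eqF.
have nB1 : `|nc B.[x] - 1| <= nc s.
  by rewrite nB -nc1; apply: le_trans (ncB _ _) _; rewrite addrAC subrr add0r ncN.
have B0 := nc_ge0 B.[x].
have B2 : nc B.[x] <= 2 by have := ler_norm (nc B.[x] - 1); lra.
have Bsq : `|nc B.[x] ^+ 2 - 1| <= 3 * nc s.
  have -> : nc B.[x] ^+ 2 - 1 = (nc B.[x] - 1) * (nc B.[x] + 1) by ring.
  rewrite normrM mulrC; apply: ler_pM => //.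
  by rewrite ger0_norm ?addr_ge0//; lra.
clearbody B.
have hqx := hq (c * x) (ltac:(by rewrite cx ltW)).
rewrite !hornerM !horner_scaleX hornerD hornerN hornerX hornerC.
set w := q.[c * x] in hqx *; rewrite -/d in hqx.
have hw : `|nc w ^+ 2 - nc (x - a)| <= e / 8 by rewrite -ncX -nd; exact: le_trans (ncB _ _) hqx.
split; last by apply: le_trans hw _; lra.
  have -> : B.[x] * w * w - (x - a) = B.[x] * (w ^+ 2 - d) - (x - a) * s.
    by have := Bd; move: (B.[x]) => b hb; rewrite mulrBr hb; ring.
  apply: le_trans (ncD _ _) _; rewrite ncN !ncM -nd.
  have k1 : nc B.[x] * nc (w ^+ 2 - d) <= 2 * (e / 8) by apply: ler_pM => //; exact: nc_ge0.
  have k2 : nc d * nc s <= 2 * (e / 16) by apply: ler_pM => //; exact: nc_ge0.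
  lra.
rewrite ncM exprMn.
have -> : nc B.[x] ^+ 2 * nc w ^+ 2 - nc (x - a) =
  nc B.[x] ^+ 2 * (nc w ^+ 2 - nc (x - a)) + nc (x - a) * (nc B.[x] ^+ 2 - 1) by ring.
apply: le_trans (ler_normD _ _) _; rewrite (normrM (nc B.[x] ^+ 2)) (normrM (nc (x - a))).
have k1 : `|nc B.[x] ^+ 2| * `|nc w ^+ 2 - nc (x - a)| <= 4 * (e / 8).
  by apply: ler_pM => //; rewrite ger0_norm ?sqr_ge0//; nra.
have k2 : `|nc (x - a)| * `|nc B.[x] ^+ 2 - 1| <= 2 * (3 * (e / 16)).
  apply: ler_pM => //; first by rewrite ger0_norm ?nc_ge0// -nd.
  by apply: le_trans Bsq _; lra.
by apply: le_trans (lerD k1 k2) _; lra.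
Qed.

Lemma poly_factorable p : factorable p.
Proof.
have [r ->] := closed_field_poly_normal p; rewrite -mul_polyC.
apply: factorable_mul; first exact: factorable_const.
elim: r => [|a r IH]; first by rewrite big_nil; exact: factorable_const.
rewrite big_cons; apply: factorable_mul => //.
by have [h|h] := leP 1 (nc a); [exact: factorable_lin_out|exact: factorable_lin_in].
Qed.

End Factorization.

(** * Factorization of an H1 function into square summable factors *)

Section HardyFactor.
Variable R : realType.
Local Notation C := R[i].
Local Notation nc := (@ComplexField.Normc.normc R).
Local Notation pi := (@pi R).
Local Notation circ := (rint (- pi) pi).
Local Notation Rp := (@complex.Re R).
Local Notation Ip := (@complex.Im R).
Implicit Types (a : nat -> R) (g h : nat -> C) (t rho : R) (p q : {poly C}).

Definition ci t : C := Complex (cos t) (sin t).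

Lemma ci_unimodular t : unimodular (ci t).
Proof. by rewrite /unimodular /ComplexField.Normc.normc /= cos2Dsin2 sqrtr1. Qed.

Lemma ciX t n : ci t ^+ n = Complex (cos (n%:R * t)) (sin (n%:R * t)).
Proof.
elim: n => [|n IH]; first by rewrite expr0 mul0r cos0 sin0.
rewrite exprSr IH /ci; have -> : n.+1%:R * t = n%:R * t + t by rewrite -natr1; ring.
rewrite cosD sinD; apply/eqP; rewrite eq_complex /=; apply/andP; split; apply/eqP; ring.
Qed.

Lemma Re_sum n (F : nat -> C) : Rp (\sum_(k < n) F k) = \sum_(k < n) Rp (F k) /\
  Ip (\sum_(k < n) F k) = \sum_(k < n) Ip (F k).
Proof.
elim: n => [|n [h1 h2]]; first by rewrite !big_ord0.
rewrite !big_ord_recr /= -h1 -h2; move: (\sum_(k < n) _) (F n) => x y.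
by case: x; case: y.
Qed.

Lemma Re_mul (x y : C) : Rp (x * y) = Rp x * Rp y - Ip x * Ip y /\ Ip (x * y) = Rp x * Ip y + Ip x * Rp y.
Proof. by case: x => ? ?; case: y. Qed.

Lemma horner_ci p N t : (size p <= N)%N ->
  Rp p.[ci t] = \sum_(j < N) (Rp p`_j * cos (j%:R * t) - Ip p`_j * sin (j%:R * t)) /\
  Ip p.[ci t] = \sum_(j < N) (Rp p`_j * sin (j%:R * t) + Ip p`_j * cos (j%:R * t)).
Proof.
move=> sp; rewrite (horner_coef_wide _ sp).
have [-> ->] := Re_sum N (fun j => p`_j * ci t ^+ j).
by split; apply: eq_bigr => j _; rewrite ciX; have [h1 h2] := Re_mul p`_j (Complex (cos (j%:R * t)) (sin (j%:R * t))); rewrite ?h1 ?h2.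
Qed.

Lemma parsevalC p N : (size p <= N)%N ->
  circ (fun t => nc p.[ci t] ^+ 2) = 2 * pi * \sum_(j < N) nc p`_j ^+ 2.
Proof.
move=> sp; rewrite (@rint_ext _ _ (fun t => (\sum_(j < N) (Rp p`_j * cos (j%:R * t) - Ip p`_j * sin (j%:R * t))) ^+ 2 +
    (\sum_(j < N) (Rp p`_j * sin (j%:R * t) + Ip p`_j * cos (j%:R * t))) ^+ 2)); last first.
  by move=> t; rewrite nc_sqr; have [-> ->] := horner_ci t sp.
rewrite (parseval N (fun j => Rp p`_j) (fun j => Ip p`_j)); congr (_ * _).
by apply: eq_bigr => j _; rewrite nc_sqr.
Qed.

Lemma nc_sqrt (x : C) : nc x = Num.sqrt (Rp x ^+ 2 + Ip x ^+ 2).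
Proof. by case: x. Qed.

Lemma nc_cont p : continuous (fun t => nc p.[ci t]).
Proof.
rewrite (_ : (fun t => _) = fun t => Num.sqrt ((\sum_(j < size p) (Rp p`_j * cos (j%:R * t) - Ip p`_j * sin (j%:R * t))) ^+ 2 +
    (\sum_(j < size p) (Rp p`_j * sin (j%:R * t) + Ip p`_j * cos (j%:R * t))) ^+ 2)); last first.
  by apply/funext => t; rewrite nc_sqrt; have [-> ->] := horner_ci t (leqnn (size p)).
apply: (@cont_comp _ (fun x => Num.sqrt x)); first exact: sqrt_continuous.
apply: contD; apply: contX.
  by apply: (@cont_sum _ _ (fun j t => Rp p`_j * cos (j%:R * t) - Ip p`_j * sin (j%:R * t))) => j; cont.
by apply: (@cont_sum _ _ (fun j t => Rp p`_j * sin (j%:R * t) + Ip p`_j * cos (j%:R * t))) => j; cont.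
Qed.

(** By Parseval's identity a single coefficient is at most the mean square on the circle. *)
Lemma coef_le_sup p e n : 0 <= e -> (forall t, nc p.[ci t] <= e) -> nc p`_n <= e.
Proof.
move=> e0 hp; have pi0 := pi_gt0 R; have pp : - pi <= pi by have := ltW pi0; lra.
have [sn|ns] := leqP (size p) n; first by rewrite nth_default// nc0.
have := parsevalC (leqnn (size p)).
have : circ (fun t => nc p.[ci t] ^+ 2) <= circ (fun=> e ^+ 2).
  apply: le_rint => [||t _]; [by apply: contX; exact: nc_cont|exact: contC|].
  by rewrite lerXn2r ?nnegrE ?nc_ge0.
rewrite rint_cst// => h1 h2.
have : nc p`_n ^+ 2 <= \sum_(j < size p) nc p`_j ^+ 2.
  by rewrite (bigD1 (Ordinal ns))//= lerDl; apply: sumr_ge0 => j _; exact: sqr_ge0.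
move=> h3; rewrite -(@ler_pXn2r _ 2) ?nnegrE ?nc_ge0//; apply: le_trans h3 _.
rewrite -(ler_pM2l (mulr_gt0 (ltr0Sn R 1) pi0)) -h2; apply: le_trans h1 _.
by rewrite le_eqVlt; apply/orP; left; apply/eqP; ring.
Qed.

Definition dil a rho n := a n * rho ^+ n.
Definition uf a rho t := Ufun a (rho * cos t, rho * sin t).
Definition vf a rho t := Vfun a (rho * cos t, rho * sin t).

Lemma uf_tail a rho : rregular a -> 0 <= rho < 1 -> exists B r' : R, [/\ 0 <= B, 0 <= r' < 1 &
  forall r t N, 0 <= r <= rho -> `|uf a r t - pc N (dil a r) t| <= B * r' ^+ N /\ `|vf a r t - ps N (dil a r) t| <= B * r' ^+ N].
Proof.
move=> ha r01; have [B [q [B0 q01 hB]]] := UV_tail ha r01; exists B, q; split => // r t N /andP[r0 rr].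
have hz : (r * cos t, r * sin t).1 ^+ 2 + (r * cos t, r * sin t).2 ^+ 2 <= rho ^+ 2.
  by rewrite /= !exprMn -mulrDr cos2Dsin2 mulr1 lerXn2r ?nnegrE ?(le_trans r0).
have [_ _ /(_ N)[]] := hB _ hz; rewrite ev_re ev_im /uf /vf.
have -> : \sum_(n < N) a n * ev (zc R n) (r * cos t, r * sin t) = pc N (dil a r) t.
  by apply: eq_bigr => n _; rewrite (proj1 (zpow_polar _ _ _)) /dil mulrA.
have -> : \sum_(n < N) a n * ev (zs R n) (r * cos t, r * sin t) = ps N (dil a r) t.
  by apply: eq_bigr => n _; rewrite (proj2 (zpow_polar _ _ _)) /dil mulrA.
by [].
Qed.

Lemma unif_cont (F : nat -> R -> R) (f : R -> R) (B q : R) : 0 <= q < 1 -> (forall n, continuous (F n)) ->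
  (forall n t, `|f t - F n t| <= B * q ^+ n) -> continuous f.
Proof.
move=> /andP[q0 q1] cF hF t; apply/cvgrPdist_le => e e0.
have lim0 : B * q ^+ n @[n --> \oo] --> 0.
  by rewrite -(mulr0 B); apply: cvgM; [exact: cvg_cst|apply: cvg_expr; rewrite ger0_norm].
have e3 : 0 < e / 3 by rewrite divr_gt0.
have [n hn] : exists n, B * q ^+ n <= e / 3.
  by have [n _ hn] := @cvgr_le _ _ _ _ _ _ lim0 _ e3; exists n; apply: hn => /=.
near=> s; have h : `|F n t - F n s| <= e / 3.
  by near: s; move/cvgrPdist_le: (cF n t) => /(_ _ e3).
have h1 := le_trans (hF n t) hn; have h2 := le_trans (hF n s) hn; rewrite distrC in h2.
have k1 := ler_distD (F n t) (f t) (f s); have k2 := ler_distD (F n s) (F n t) (f s).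
by lra.
Unshelve. all: by end_near. Qed.

Lemma uf_cont a rho : rregular a -> 0 <= rho < 1 -> continuous (uf a rho) /\ continuous (vf a rho).
Proof.
move=> ha r01; have [B [q [B0 q01 hB]]] := uf_tail ha r01.
have rr : 0 <= rho <= rho by case/andP: r01 => ->; rewrite lexx.
split; [apply: (@unif_cont (fun N => pc N (dil a rho)) _ B q q01) => N|apply: (@unif_cont (fun N => ps N (dil a rho)) _ B q q01) => N].
- exact: pc_cont.
- by move=> t; have [] := hB rho t N rr.
- exact: ps_cont.
- by move=> t; have [] := hB rho t N rr.
Qed.

Definition fpoly a rho N : {poly C} := \poly_(n < N) ((dil a rho n)%:C)%C.

Lemma fpoly_ci a rho N t : (fpoly a rho N).[ci t] = Complex (pc N (dil a rho) t) (ps N (dil a rho) t).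
Proof.
have [h1 h2] := horner_ci t (size_poly N (fun n => ((dil a rho n)%:C)%C)).
apply/eqP; rewrite eq_complex /=; apply/andP; split; apply/eqP; [rewrite h1|rewrite h2]; apply: eq_bigr => j _;
  by rewrite coef_poly ltn_ord /= mul0r ?subr0 ?addr0.
Qed.

Lemma nc_le_abs (x y : R) : nc (Complex x y) <= `|x| + `|y|.
Proof.
rewrite /ComplexField.Normc.normc; rewrite -[leRHS]ger0_norm ?addr_ge0// -sqrtr_sqr ler_wsqrtr//.
rewrite sqrrD !real_normK ?num_real// -addrA lerD2l addrC lerDl mulrn_wge0// mulr_ge0//.
Qed.

(** Limits along an ultrafilter exist for all coefficients simultaneously and take the place of a
    diagonal extraction. *)
Lemma ultra_lim (U : set_system nat) (x : nat -> R) B : UltraFilter U -> (forall m, `|x m| <= B) ->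
  exists l : R, x m @[m --> U] --> l.
Proof.
move=> UU hx; have cs := @segment_compact R (- B) B.
have UA : (x @ U) `[(- B), B]%classic.
  by apply: (@filterS _ U _ setT) => [m _|]; [rewrite /= in_itv /= -ler_norml; exact: hx|exact: filterT].
have [l [_ hl]] := cs (x @ U) _ UA.
exists l => V /= Vl; have [//|hV] := in_ultra_setVsetC (x @^-1` V) UU.
have [y [h1 h2]] := hl (~` V) V hV Vl.
by [].
Qed.

(** The dilate of radius 1 - 1/(m+2) is approximated by a polynomial and factored up to 1/(m+1). As
    |g|^2 and |h|^2 are close to the modulus of the polynomial, its L1 norm bounds their square
    sums. Each convolution identity involves finitely many coefficients and survives the limit. *)
Lemma H1_factor a M : rregular a -> 0 <= M ->
  (forall rho, 0 < rho < 1 -> circ (fun t => nc (Complex (uf a rho t) (vf a rho t))) <= M) ->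
  exists g h, [/\ forall n, \sum_(k < n) nc (g k) ^+ 2 <= M + 3, forall n, \sum_(k < n) nc (h k) ^+ 2 <= M + 3 &
    forall n, (a n)%:C%C = \sum_(k < n.+1) g k * h (n - k)%N].
Proof.
move=> ha M0 hM; have pi0 := pi_gt0 R; have pi2 := @pi_ge2 R; have pp : - pi <= pi by lra.
pose rho (m : nat) : R := 1 - m.+2%:R^-1.
have k01 m : 0 < (m.+2%:R : R)^-1 < 1 by rewrite invr_gt0 ltr0Sn invf_lt1 ?ltr1n.
have r01 m : 0 < rho m < 1 by have /andP[h1 h2] := k01 m; rewrite /rho subr_gt0 gtrBl h1 h2.
have d0 m : 0 < (m.+1%:R : R)^-1 <= 1 by rewrite invr_gt0 ltr0Sn invf_le1 ?ler1n.
have step m : exists g h : {poly C}, [/\ forall n, \sum_(k < n) nc g`_k ^+ 2 <= M + 3,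
   forall n, \sum_(k < n) nc h`_k ^+ 2 <= M + 3 &
   forall n, (n <= m)%N -> nc ((g * h)`_n - (dil a (rho m) n)%:C%C) <= m.+1%:R^-1].
  have /andP[e0 e1] := d0 m; set e := m.+1%:R^-1 in e0 e1 *.
  have r01' : 0 <= rho m < 1 by case/andP: (r01 m) => /ltW -> ->.
  have [B [q [B0 /andP[q0 q1] hB]]] := uf_tail ha r01'.
  have rr : 0 <= rho m <= rho m by case/andP: r01' => ->; rewrite lexx.
  have [N [Nm hN]] : exists N, (m < N)%N /\ B * q ^+ N <= e.
    have lim0 : B * q ^+ n @[n --> \oo] --> 0.
      by rewrite -(mulr0 B); apply: cvgM; [exact: cvg_cst|apply: cvg_expr; rewrite ger0_norm].
    have [n _ hn] := @cvgr_le _ _ _ _ _ _ lim0 _ e0.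
    by exists (maxn n m.+1); split; [rewrite leq_max ltnSn orbT|apply: hn; rewrite /= leq_max leqnn].
  pose p := fpoly a (rho m) N.
  have [g [h hgh]] := poly_factorable p e0; exists g, h.
  have [cu cv] := uf_cont ha r01'.
  have cF : continuous (fun t => nc (Complex (uf a (rho m) t) (vf a (rho m) t))).
    by apply: (@cont_comp _ (fun x => Num.sqrt x)); [exact: sqrt_continuous|cont].
  have hp : circ (fun t => nc p.[ci t]) <= M + 4 * pi.
    apply: (@le_trans _ _ (circ (fun t => nc (Complex (uf a (rho m) t) (vf a (rho m) t)) + 2))).
      apply: le_rint => [||t _]; [exact: nc_cont|by apply: contD => //; exact: contC|].
      rewrite fpoly_ci; have [b1 b2] := hB (rho m) t N rr.
      set z := Complex _ _; set z' := Complex (uf _ _ _) _.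
      have -> : z = z' + (z - z') by rewrite addrC subrK.
      apply: le_trans (ncD _ _) _; rewrite lerD2l; apply: le_trans (nc_le_abs _ _) _ => /=.
      by rewrite distrC [X in _ + X]distrC; lra.
    rewrite rintD//; last exact: contC.
    by rewrite rint_cst//; have := hM _ (r01 m); lra.
  have hk (k : {poly C}) : (forall t, nc k.[ci t] ^+ 2 <= nc p.[ci t] + e) -> forall n, \sum_(j < n) nc k`_j ^+ 2 <= M + 3.
    move=> kp n; have hs : \sum_(j < n) nc k`_j ^+ 2 <= \sum_(j < maxn n (size k)) nc k`_j ^+ 2.
      rewrite -(subnKC (leq_maxl n (size k))) big_split_ord /= lerDl; apply: sumr_ge0 => j _; exact: sqr_ge0.
    apply: le_trans hs _; have := parsevalC (leq_maxr n (size k)); set S := \sum_(j < _) _ => hS.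
    (* An approximation error of 2 and a factorization error of at most 1, over a circle of length 2
       pi. *)
    have : 2 * pi * S <= M + 6 * pi.
      rewrite -hS; apply: (@le_trans _ _ (circ (fun t => nc p.[ci t] + e))).
        apply: le_rint => [||t _]; [by apply: contX; exact: nc_cont|by apply: contD; [exact: nc_cont|exact: contC]|exact: kp].
      rewrite rintD; [|exact: nc_cont|exact: contC]; rewrite rint_cst//.
      have : e * (pi - - pi) <= 1 * (pi - - pi) by rewrite ler_wpM2r//; lra.
      by lra.
    move=> h3; rewrite -(ler_pM2l (mulr_gt0 (ltr0Sn R 1) pi0)); apply: le_trans h3 _.
    have h4 : M <= 2 * pi * M by apply: ler_peMl => //; lra.
    have h5 : M + 6 * pi <= 2 * pi * (M + 3) by rewrite (_ : 2 * pi * (M + 3) = 2 * pi * M + 6 * pi); [rewrite lerD2r|ring].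
    exact: h5.
  have hcoef n : (n <= m)%N -> nc ((g * h)`_n - (dil a (rho m) n)%:C%C) <= e.
    move=> nm; have -> : (dil a (rho m) n)%:C%C = p`_n by rewrite coef_poly (leq_ltn_trans nm).
    rewrite -coefB; apply: coef_le_sup (ltW e0) _ => t.
    by rewrite hornerD hornerN hornerM; have [] := hgh _ (ci_unimodular t).
  split => //; apply: hk => t; have [_ b1 b2] := hgh _ (ci_unimodular t).
    by move: b1; rewrite ler_norml => /andP[_]; lra.
  by move: b2; rewrite ler_norml => /andP[_]; lra.
have /choice[g /choice[h hgh]] := step.
have [U [UU sU]] := @ultraFilterLemma nat (nbhs \oo) _.
have bnd (k : nat -> {poly C}) : (forall m n, \sum_(j < n) nc (k m)`_j ^+ 2 <= M + 3) -> forall n m,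
   `|Rp (k m)`_n| <= M + 4 /\ `|Ip (k m)`_n| <= M + 4.
  move=> hk n m; have : nc (k m)`_n ^+ 2 <= M + 3.
    by apply: le_trans (hk m n.+1); rewrite big_ord_recr /= lerDr; apply: sumr_ge0 => j _; exact: sqr_ge0.
  rewrite nc_sqr -(real_normK (num_real (Rp _))) -(real_normK (num_real (Ip _))).
  have := normr_ge0 (Rp (k m)`_n); have := normr_ge0 (Ip (k m)`_n).
  by move: `|_| `|_| => x y *; split; nra.
have hg m n : \sum_(j < n) nc (g m)`_j ^+ 2 <= M + 3 by have [] := hgh m.
have hh m n : \sum_(j < n) nc (h m)`_j ^+ 2 <= M + 3 by have [] := hgh m.
have lim (k : nat -> {poly C}) : (forall m n, \sum_(j < n) nc (k m)`_j ^+ 2 <= M + 3) ->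
  exists l : nat -> C, forall n, Rp (k m)`_n @[m --> U] --> Rp (l n) /\ Ip (k m)`_n @[m --> U] --> Ip (l n).
  move=> hk; have hb := bnd k hk.
  have /choice[x hx] n : exists l : R, Rp (k m)`_n @[m --> U] --> l.
    by apply: (@ultra_lim U _ (M + 4)) => // m; have [] := hb n m.
  have /choice[y hy] n : exists l : R, Ip (k m)`_n @[m --> U] --> l.
    by apply: (@ultra_lim U _ (M + 4)) => // m; have [] := hb n m.
  by exists (fun n => Complex (x n) (y n)) => n.
have [G hG] := lim g hg; have [K hK] := lim h hh.
have bl (k : nat -> {poly C}) (l : nat -> C) : (forall m n, \sum_(j < n) nc (k m)`_j ^+ 2 <= M + 3) ->
  (forall n, Rp (k m)`_n @[m --> U] --> Rp (l n) /\ Ip (k m)`_n @[m --> U] --> Ip (l n)) ->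
  forall n, \sum_(j < n) nc (l j) ^+ 2 <= M + 3.
  move=> hk hl n; have c : \sum_(j < n) nc (k m)`_j ^+ 2 @[m --> U] --> \sum_(j < n) nc (l j) ^+ 2.
    apply: cvg_sumr => j _; rewrite nc_sqr; under eq_fun do rewrite nc_sqr.
    by have [h1 h2] := hl j; rewrite !expr2; under eq_fun do rewrite !expr2; apply: cvgD; apply: cvgM.
  by apply: (cvgr_to_le c); apply: (@filterS _ U _ setT) => //; exact: filterT.
exists G, K; split; [exact: bl hg hG|exact: bl hh hK|move=> n].
have c1 : Rp ((g m * h m)`_n) @[m --> U] --> Rp (\sum_(k < n.+1) G k * K (n - k)%N).
  have [-> _] := Re_sum n.+1 (fun k => G k * K (n - k)%N).
  rewrite (_ : (fun m => _) = fun m => \sum_(k < n.+1) (Rp (g m)`_k * Rp (h m)`_(n - k) - Ip (g m)`_k * Ip (h m)`_(n - k))).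
    apply: cvg_sumr => k _; rewrite (proj1 (Re_mul _ _)).
    by have [a1 a2] := hG k; have [b1 b2] := hK (n - k)%N; apply: cvgB; apply: cvgM.
  apply/funext => m; rewrite coefM; have [-> _] := Re_sum n.+1 (fun k => (g m)`_k * (h m)`_(n - k)).
  by apply: eq_bigr => k _; rewrite (proj1 (Re_mul _ _)).
have c2 : Ip ((g m * h m)`_n) @[m --> U] --> Ip (\sum_(k < n.+1) G k * K (n - k)%N).
  have [_ ->] := Re_sum n.+1 (fun k => G k * K (n - k)%N).
  rewrite (_ : (fun m => _) = fun m => \sum_(k < n.+1) (Rp (g m)`_k * Ip (h m)`_(n - k) + Ip (g m)`_k * Rp (h m)`_(n - k))).
    apply: cvg_sumr => k _; rewrite (proj2 (Re_mul _ _)).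
    by have [a1 a2] := hG k; have [b1 b2] := hK (n - k)%N; apply: cvgD; apply: cvgM.
  apply/funext => m; rewrite coefM; have [_ ->] := Re_sum n.+1 (fun k => (g m)`_k * (h m)`_(n - k)).
  by apply: eq_bigr => k _; rewrite (proj2 (Re_mul _ _)).
have small : (m.+1%:R : R)^-1 @[m --> U] --> 0 by apply: (cvg_trans _ (@cvg_harmonic R)) => A /=; exact: sU.
have rl : dil a (rho m) n @[m --> U] --> a n.
  rewrite -[X in _ --> X]mulr1 /dil; apply: cvgM; first exact: cvg_cst.
  suff rc : rho m @[m --> U] --> (1 : R).
    have rX k : rho m ^+ k @[m --> U] --> (1 : R).
      elim: k => [|k IH]; first by under eq_cvg do rewrite expr0; exact: cvg_cst.
      have hk := cvgM rc IH; rewrite mulr1 in hk.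
      have -> : (fun m => rho m ^+ k.+1) = (fun m => rho m * rho m ^+ k) by apply/funext => m; rewrite exprS.
      exact: hk.
    exact: rX.
  rewrite -[X in _ --> X]subr0; apply: cvgB; first exact: cvg_cst.
  have : (m.+2%:R : R)^-1 @[m --> \oo] --> 0 by rewrite (cvg_shiftS (fun k => (k.+1%:R : R)^-1)); exact: cvg_harmonic.
  by move=> hl; apply: (cvg_trans _ hl) => A /=; exact: sU.
have close : \forall m \near U, nc ((g m * h m)`_n - (dil a (rho m) n)%:C%C) <= m.+1%:R^-1.
  by apply: sU; exists n => // m /= nm; have [_ _] := hgh m; apply.
have ReD (x y : C) : Rp (x - y) = Rp x - Rp y /\ Ip (x - y) = Ip x - Ip y by case: x => ? ?; case: y.
have parts (x : C) : `|Rp x| <= nc x /\ `|Ip x| <= nc x.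
  by case: x => x y; rewrite /ComplexField.Normc.normc /= -!sqrtr_sqr; split; rewrite ler_wsqrtr// ?lerDl ?lerDr sqr_ge0.
have z1 : Rp ((g m * h m)`_n) - dil a (rho m) n @[m --> U] --> 0.
  apply/cvgrPdist_le => e e0; have hs := @cvgr_le _ _ _ _ _ _ small _ e0.
  near=> m; rewrite sub0r normrN.
  apply: (@le_trans _ _ (nc ((g m * h m)`_n - (dil a (rho m) n)%:C%C))).
    by have [p1 _] := parts ((g m * h m)`_n - (dil a (rho m) n)%:C%C); rewrite (proj1 (ReD _ _)) in p1.
  apply: (@le_trans _ _ (m.+1%:R^-1)); near: m; [exact: close|exact: hs].
have z2 : Ip ((g m * h m)`_n) @[m --> U] --> 0.
  apply/cvgrPdist_le => e e0; have hs := @cvgr_le _ _ _ _ _ _ small _ e0.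
  near=> m; rewrite sub0r normrN.
  apply: (@le_trans _ _ (nc ((g m * h m)`_n - (dil a (rho m) n)%:C%C))).
    by have [_ p1] := parts ((g m * h m)`_n - (dil a (rho m) n)%:C%C); rewrite (proj2 (ReD _ _)) subr0 in p1.
  apply: (@le_trans _ _ (m.+1%:R^-1)); near: m; [exact: close|exact: hs].
have PU : ProperFilter U by apply: ultra_proper.
have FU : Filter U by apply: filter_filter.
have hd : hausdorff_space R by exact: norm_hausdorff.
have e1 : a n = Rp (\sum_(k < n.+1) G k * K (n - k)%N).
  have c3 := cvgB c1 z1; have {}c3 := c3 FU; rewrite subr0 in c3.
  have E : (fun m => dil a (rho m) n) = (fun m => Rp ((g m * h m)`_n) - (Rp ((g m * h m)`_n) - dil a (rho m) n)).
    by apply/funext => m; rewrite subKr.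
  rewrite E in rl; have l1 := cvg_lim hd rl; have l2 := cvg_lim hd c3.
  exact: etrans (esym (l1 PU)) (l2 PU).
have e2 : 0 = Ip (\sum_(k < n.+1) G k * K (n - k)%N).
  by have l1 := cvg_lim hd z2; have l2 := cvg_lim hd c2; exact: etrans (esym (l1 PU)) (l2 PU).
by move: e1 e2; case: (\sum_(k < n.+1) G k * K (n - k)%N) => u v /= -> <-.
Unshelve. all: by end_near. Qed.

End HardyFactor.

(** * Mean oscillation of Poisson averages *)

Section OscAverage.
Variable R : realType.
Local Notation mu := (@lebesgue_measure R).
Local Notation pi := (@pi R).
Local Notation circ := (rint (- pi) pi).
Implicit Types (f g u w P : R -> R) (c s t x y r rho phi : R).

Lemma mean_shift_cont u s t : continuous u -> s < t -> continuous (fun th => mean u (s + th) (t + th)).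
Proof.
move=> cu st; have [F hF] := continuous_antiderivative cu.
have cF : continuous F by move=> x; apply: differentiable_continuous; apply/derivable1_diffP; have := hF x; case.
have -> : (fun th => mean u (s + th) (t + th)) = fun th => (F (t + th) - F (s + th)) * (t - s)^-1.
  apply/funext => th; rewrite /mean; congr (_ * _^-1); last by ring.
  by apply: (@rint_FTC _ u F) => //; rewrite lerD2r ltW.
have c1 : continuous (fun th => F (t + th)) by apply: (@cont_comp _ F (fun th => t + th) cF); cont.
have c2 : continuous (fun th => F (s + th)) by apply: (@cont_comp _ F (fun th => s + th) cF); cont.
by cont.
Qed.

(** The order of integration is exchanged so that a bound uniform in the translation [th] can be
    integrated against [P]. *)
Lemma rint_tonelli (h : R * R -> R) s t (K : R) P : measurable_fun setT h -> (forall z, 0 <= h z) ->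
  continuous P -> (forall y, 0 <= P y) ->
  (forall th, (\int[mu]_(x in `[s, t]) (h (x, th))%:E <= K%:E)%E) ->
  (\int[mu]_(x in `[s, t]) \int[mu]_(th in `[(- pi)%R, pi]) (h (x, th) * P th)%:E <= (K * circ P)%:E)%E.
Proof.
move=> mh h0 cP P0 hK.
pose g (z : R * R) : \bar R := (h z * P z.2 * (\1_(`[s, t]%classic) z.1 * \1_(`[- pi, pi]%classic) z.2))%:E.
have mg : measurable_fun setT g.
  apply/measurable_EFinP; apply: measurable_funM.
    apply: measurable_funM => //; apply: measurableT_comp; last exact: measurable_snd.
    exact: cont_meas.
  by apply: measurable_funM; (apply: measurableT_comp; [exact: measurable_indic|]);
    [exact: measurable_fst|exact: measurable_snd].
have g0 z : (0 <= g z)%E by rewrite lee_fin !mulr_ge0.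
have pt (D : set R) (F : R -> R) : (\int[mu]_(x in D) (F x)%:E = \int[mu]_x (F x * \1_D x)%:E)%E.
  rewrite integral_mkcond; apply: eq_integral => x _.
  by rewrite patchE indicE; case: ifP => _; rewrite ?mulr1 ?mulr0.
have -> : (\int[mu]_(x in `[s, t]) \int[mu]_(th in `[(- pi)%R, pi]) (h (x, th) * P th)%:E =
  \int[mu]_x \int[mu]_th g (x, th))%E.
  rewrite integral_mkcond; apply: eq_integral => x _; rewrite patchE /g /= indicE; case: ifP => _.
    by rewrite pt; apply: eq_integral => th _; rewrite mul1r.
  by rewrite integral0_eq// => th _; rewrite mul0r mulr0.
rewrite (@fubini_tonelli _ _ _ _ _ mu mu g mg g0).
have -> : (\int[mu]_y \int[mu]_x g (x, y) = \int[mu]_(y in `[(- pi)%R, pi]) ((P y)%:E * \int[mu]_(x in `[s, t]) (h (x, y))%:E))%E.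
  rewrite [RHS]integral_mkcond; apply: eq_integral => y _; rewrite patchE /g /= [in LHS]indicE; case: ifP => _.
    rewrite -ge0_integralZl//; last 3 first.
    - apply/measurable_EFinP; apply: measurable_funTS; apply: measurableT_comp => //; exact: measurable_pair2.
    - by move=> x _; rewrite lee_fin.
    - by rewrite lee_fin.
    under [RHS]eq_integral do rewrite -EFinM.
    by rewrite [RHS]pt; apply: eq_integral => x _; congr EFin => /=; ring.
  by rewrite integral0_eq// => x _; rewrite !mulr0.
apply: (@le_trans _ _ (\int[mu]_(y in `[(- pi)%R, pi]) (K * P y)%:E)%E).
  apply: integral_mono => // y _.
  - by rewrite mule_ge0 ?lee_fin// integral_ge0// => x _; rewrite lee_fin.
  - rewrite lee_fin mulr_ge0// -lee_fin; apply: le_trans (hK y); apply: integral_ge0 => x _; by rewrite lee_fin.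
  by rewrite mulrC EFinM lee_wpmul2l// lee_fin.
have c1 : continuous (fun y => K * P y) by cont.
by rewrite (rint_EFin _ _ c1) rintZ.
Qed.

(** Convolution is an average of translates. The constant is the same average of the means of u over
    the translated intervals. *)
Lemma osc_average u w P s t K : continuous u -> continuous w -> continuous P -> (forall y, 0 <= P y) ->
  circ P = 2 * pi -> s < t ->
  (forall x, circ (fun th => u (x + th) * P th) = 2 * pi * w x) ->
  (forall th, rint (s + th) (t + th) (fun x => `|u x - mean u (s + th) (t + th)|) <= K) ->
  exists c, rint s t (fun x => `|w x - c|) <= K.
Proof.
move=> cu cw cP P0 P1 st hw hK; have pi0 := pi_gt0 R.
pose m th := mean u (s + th) (t + th); have cm : continuous m by exact: mean_shift_cont.
pose c := (2 * pi)^-1 * circ (fun th => m th * P th).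
exists c; have p2 : 0 < 2 * pi by rewrite mulr_gt0.
have cux x : continuous (fun th => u (x + th)) by apply: (@cont_comp _ u (fun th => x + th) cu); cont.
have cmP : continuous (fun th => m th * P th) by cont.
pose h (z : R * R) := `|u (z.1 + z.2) - m z.2|.
have mh : measurable_fun setT h.
  apply: measurableT_comp => //; apply: measurable_funB.
    apply: measurableT_comp; first exact: cont_meas.
    by apply: measurable_funD; [exact: measurable_fst|exact: measurable_snd].
  by apply: measurableT_comp; [exact: cont_meas|exact: measurable_snd].
have hP x : continuous (fun th => h (x, th) * P th).
  by rewrite /h /=; have := cux x => cx; cont.
have pw x : 2 * pi * `|w x - c| <= circ (fun th => h (x, th) * P th).
  have cx := cux x; have c1 : continuous (fun th => u (x + th) * P th) by cont.
  have c2 : continuous (fun th => (u (x + th) - m th) * P th) by cont.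
  have -> : 2 * pi * `|w x - c| = `|circ (fun th => (u (x + th) - m th) * P th)|.
    rewrite (@rint_ext _ _ (fun th => u (x + th) * P th - m th * P th)) => [|th]; last by rewrite mulrBl.
    rewrite (rintB _ _ c1 cmP) hw -[2 * pi in LHS](ger0_norm (ltW p2)) -normrM; congr `|_|.
    by rewrite mulrBr /c mulrA mulfV ?mul1r// gt_eqF.
  apply: le_trans (rint_norm _ _ c2) _; rewrite le_eqVlt; apply/orP; left; apply/eqP; apply: rint_ext => th.
  by rewrite normrM [`|P th|]ger0_norm.
have cwc : continuous (fun x => `|w x - c|) by cont.
rewrite -(ler_pM2l p2) -rintZ// -lee_fin [2 * pi * K]mulrC -P1.
have cwc' : continuous (fun x => circ P * `|w x - c|) by cont.
rewrite -(rint_EFin _ _ cwc') .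
apply: le_trans (@rint_tonelli h s t K P mh (fun z => normr_ge0 _) cP P0 _).
  apply: integral_mono => // x _.
  - by rewrite lee_fin P1 mulr_ge0// ltW.
  - by apply: integral_ge0 => th _; rewrite lee_fin; apply: mulr_ge0; rewrite // /h.
  by rewrite (rint_EFin _ _ (hP x)) lee_fin P1.
move=> th; have cx : continuous (fun x => u (x + th)) by apply: (@cont_comp _ u (fun x => x + th) cu); cont.
have c1 : continuous (fun x => h (x, th)) by rewrite /h /=; cont.
rewrite (rint_EFin _ _ c1) lee_fin; apply: le_trans (hK th).
have c2 : continuous (fun x => `|u x - m th|) by cont.
by rewrite (@rint_shift _ (fun x => `|u x - m th|) th s t (ltW st) c2).
Qed.

Lemma osc_mean u s t c : continuous u -> s < t ->
  rint s t (fun x => `|u x - mean u s t|) <= 2 * rint s t (fun x => `|u x - c|).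
Proof.
move=> cu st; have h := mean_le c cu st.
have c1 : continuous (fun x => `|u x - c|) by cont.
apply: (@le_trans _ _ (rint s t (fun x => `|u x - c| + `|mean u s t - c|))).
  apply: le_rint => [||x _]; [by cont|by cont|].
  by have := ler_distD c (u x) (mean u s t); rewrite [`|c - _|]distrC.
rewrite rintD//; last by cont.
by rewrite (rint_cst _ (ltW st)); lra.
Qed.

Section Dilates.
Variable v : R -> R -> R.
Hypothesis vc : forall rho, 0 < rho < 1 -> continuous (v rho).
Hypothesis vp : forall rho x, 0 < rho < 1 -> v rho (x + 2 * pi) = v rho x.
Hypothesis vP : forall rho r phi, 0 < rho < 1 -> 0 < r < 1 ->
  circ (fun t => v rho t * poisson r (t - phi)) = 2 * pi * v (r * rho) phi.
Hypothesis vu : forall r e, 0 < r < 1 -> 0 < e ->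
  \forall rho \near (1 : R)^'-, forall phi, `|v (r * rho) phi - v r phi| <= e.
Variables (rk : nat -> R) (f : R -> R) (beta : R).
Hypothesis rk01' : forall k, 0 < rk k < 1.
Hypothesis rk1 : rk k @[k --> \oo] --> (1 : R).
Hypothesis mf : measurable_fun setT f.
Hypothesis hf : forall k s, (\int[mu]_(t in `[s, (s + 2 * pi)%R]) `|v (rk k) t - f t|%:E <= (2 * 2^-1 ^+ k)%:E)%E.
Hypothesis fosc : forall s t, s < t -> t <= s + 2 * pi -> exists c,
  (\int[mu]_(x in `[s, t]) `|f x - c|%:E <= (beta * (t - s))%:E)%E.

(** [v (r * rk k)] is a Poisson average of [v (rk k)], which is close to [f] in mean, so it inherits
    the oscillation of [f]; then k tends to infinity. Passing from a constant to the mean doubles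
    the bound twice, whence 4. *)
Lemma osc_dilate r s t : 0 < r < 1 -> s < t -> t <= s + 2 * pi ->
  rint s t (fun x => `|v r x - mean (v r) s t|) <= 4 * beta * (t - s).
Proof.
move=> r01 st ts; have r01' : 0 <= r < 1 by case/andP: r01 => /ltW -> ->.
have cP := poisson_cont r01'.
have P0 y : 0 <= poisson r y by rewrite ltW// poisson_gt0.
have cvr := vc r01.
have P1 : circ (poisson r) = 2 * pi.
  by rewrite -(poisson_one r01' 0); apply: rint_ext => x; rewrite subr0.
have osck k : exists c, rint s t (fun x => `|v (r * rk k) x - c|) <= 2 * (beta * (t - s) + 2 * 2^-1 ^+ k).
  have cv := vc (rk01' k).
  have rr : 0 < r * rk k < 1.
    have /andP[a1 a2] := rk01' k; case/andP: r01 => b1 b2; rewrite mulr_gt0//=.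
    by rewrite -[ltRHS]mulr1 ltr_pM// ltW.
  apply: (@osc_average (v (rk k)) _ (poisson r)) => // [|x|th]; first exact: vc.
    rewrite -(vP x (rk01' k) r01).
    have cF : continuous (fun th => v (rk k) (x + th) * poisson r th).
      by have := (@cont_comp _ (v (rk k)) (fun th => x + th) cv (ltac:(cont))) => cx; cont.
    rewrite -[LHS](circ_shift x cF); first by apply: rint_ext => th; rewrite addrC subrK.
    by move=> th; rewrite addrA vp// poisson_period.
  have st' : s + th < t + th by rewrite ltrD2r.
  have [c hc] := fosc st' (ltac:(lra) : t + th <= s + th + 2 * pi).
  apply: le_trans (osc_mean c cv st') _; rewrite ler_pM2l//.
  have c1 : continuous (fun x => `|v (rk k) x - c|) by cont.
  rewrite -lee_fin -(rint_EFin _ _ c1).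
  have mv : measurable_fun `[(s + th)%R, (t + th)%R] (fun x => `|v (rk k) x - f x|%:E).
    apply/measurable_EFinP; apply: measurableT_comp => //; apply: measurable_funB; first exact: cont_meas.
    exact: measurable_funTS.
  have mfc' : measurable_fun `[(s + th)%R, (t + th)%R] (fun x => `|f x - c|%:E).
    by apply/measurable_EFinP; exact: mfc.
  apply: (@le_trans _ _ (\int[mu]_(x in `[(s + th)%R, (t + th)%R]) (`|f x - c|%:E + `|v (rk k) x - f x|%:E))%E).
    apply: integral_mono => // x _; rewrite ?adde_ge0 ?lee_fin//= addrC.
    exact: ler_distD.
  rewrite ge0_integralD// EFinD; apply: leeD.
    by apply: le_trans hc _; rewrite lee_fin (_ : t + th - (s + th) = t - s)//; ring.
  apply: le_trans (hf k (s + th)); apply: integral_mono => // x.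
  by rewrite /= !in_itv /= => /andP[-> h]; apply: le_trans h _; lra.
apply/ler_addgt0Pr => e e0.
have ts0 : 0 < t - s by rewrite subr_gt0.
have d0 : 0 < e / (8 * (t - s)) by rewrite divr_gt0 ?mulr_gt0.
have h1 : \forall k \near \oo, forall phi, `|v (r * rk k) phi - v r phi| <= e / (8 * (t - s)).
  have := vu r01 d0; rewrite near_withinE => h.
  have [k0 _ hk0] := @rk1 _ h; exists k0 => // k kk; apply: hk0 => //=.
  by case/andP: (rk01' k).
have h2 : \forall k \near \oo, 8 * 2^-1 ^+ k <= e / 4 :> R.
  have c0 : 8 * 2^-1 ^+ k @[k --> \oo] --> (8 * 0 : R).
    apply: cvgM; first exact: cvg_cst.
    by apply: cvg_expr; rewrite ger0_norm ?invr_ge0// invf_lt1// ltr1n.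
  rewrite mulr0 in c0; have e4 : 0 < e / 4 by rewrite divr_gt0.
  by have [n _ hn] := @cvgr_le _ _ _ _ _ _ c0 _ e4; exists n => // k hk; exact: hn.
have [k [k1 k2]] : exists k, (forall phi, `|v (r * rk k) phi - v r phi| <= e / (8 * (t - s))) /\ 8 * 2^-1 ^+ k <= e / 4 :> R.
  by have [k [q1 q2]] := filter_ex (filterI h1 h2); exists k.
have [c hc] := osck k.
have rr : 0 < r * rk k < 1.
  have /andP[a1 a2] := rk01' k; case/andP: r01 => b1 b2; rewrite mulr_gt0//=.
  by rewrite -[ltRHS]mulr1 ltr_pM// ltW.
have crk := vc rr.
have h3 : rint s t (fun x => `|v r x - c|) <= rint s t (fun x => `|v (r * rk k) x - c|) + e / 8.
  have c1 : continuous (fun x => `|v (r * rk k) x - c|) by cont.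
  apply: (@le_trans _ _ (rint s t (fun x => `|v (r * rk k) x - c| + e / (8 * (t - s))))).
    apply: le_rint => [||x _]; [by cont|by cont|].
    have q1 := ler_distD (v (r * rk k) x) (v r x) c; have q2 := k1 x.
    by rewrite [`|v r x - v _ x|]distrC in q1; apply: (le_trans q1); rewrite addrC lerD2l.
  rewrite rintD//; last by cont.
  rewrite (rint_cst _ (ltW st)) lerD2l le_eqVlt; apply/orP; left; apply/eqP; field.
  by rewrite gt_eqF.
by have := osc_mean c cvr st; lra.
Qed.

End Dilates.
End OscAverage.

(** * Real and imaginary parts on circles *)

Section BoundaryFamilies.
Variable R : realType.
Local Notation C := R[i].
Local Notation nc := (@ComplexField.Normc.normc R).
Local Notation pi := (@pi R).
Local Notation circ := (rint (- pi) pi).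
Local Notation Rp := (@complex.Re R).
Local Notation Ip := (@complex.Im R).
Implicit Types (a c : nat -> R) (g h : nat -> C) (t r rho phi : R) (s : bool).

(** The boolean selects the imaginary part, so that both parts of the analytic function are treated
    by the same statements. *)
Definition wf s a := if s then vf a else uf a.
Definition tp s N a := if s then ps N a else pc N a.

Lemma wf_tail a rho : rregular a -> 0 <= rho < 1 -> exists B q : R, [/\ 0 <= B, 0 <= q < 1 &
  forall s r t N, 0 <= r <= rho -> `|wf s a r t - tp s N (dil a r) t| <= B * q ^+ N].
Proof.
move=> ha r01; have [B [q [B0 q01 hB]]] := uf_tail ha r01; exists B, q; split => // s r t N hr.
by case: s => /=; have [] := hB r t N hr.
Qed.

Lemma wf_cont s a rho : rregular a -> 0 <= rho < 1 -> continuous (wf s a rho).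
Proof. by move=> ha hr; have [] := uf_cont ha hr; case: s. Qed.

Lemma wf_period s a rho x : wf s a rho (x + 2 * pi) = wf s a rho x.
Proof.
have -> : x + 2 * pi = x + pi *+ 2 by rewrite mulr_natl.
by case: s; rewrite /wf /uf /vf cosD2pi sinD2pi.
Qed.

Lemma tp_cont s N a : continuous (tp s N a).
Proof. by case: s; [exact: ps_cont|exact: pc_cont]. Qed.

Lemma poisson_tp s N a r phi : 0 <= r < 1 ->
  circ (fun t => tp s N a t * poisson r (t - phi)) = 2 * pi * tp s N (dil a r) phi.
Proof.
move=> r01; case: s => /=; [rewrite poisson_ps// ev_im|rewrite poisson_pc// ev_re]; congr (_ * _);
  apply: eq_bigr => n _; rewrite ?(proj1 (zpow_polar _ _ _)) ?(proj2 (zpow_polar _ _ _)) /dil; ring.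
Qed.

Lemma tp_dist s N a c t : `|tp s N a t - tp s N c t| <= \sum_(n < N) `|a n - c n|.
Proof.
by case: s; rewrite /tp /ps /pc -sumrB; apply: le_trans (ler_norm_sum _ _ _) _; apply: ler_sum => n _;
  rewrite -mulrBl normrM ler_piMr// ?sin_max ?cos_max.
Qed.

Lemma geo0 (B q : R) : 0 <= q < 1 -> B * q ^+ N @[N --> \oo] --> 0.
Proof.
move=> /andP[q0 q1]; rewrite -(mulr0 B); apply: cvgM; first exact: cvg_cst.
by apply: cvg_expr; rewrite ger0_norm.
Qed.

Lemma le0_geo (x B q : R) : 0 <= q < 1 -> (forall N, x <= B * q ^+ N) -> x <= 0.
Proof.
by move=> q01 hx; apply: (cvgr_to_ge (geo0 B q01)); apply: nearW.
Qed.

Lemma wf_poisson s a rho r phi : rregular a -> 0 < rho < 1 -> 0 < r < 1 ->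
  circ (fun t => wf s a rho t * poisson r (t - phi)) = 2 * pi * wf s a (r * rho) phi.
Proof.
move=> ha rho01 r01; have r01' : 0 <= r < 1 by case/andP: r01 => /ltW -> ->.
have rho01' : 0 <= rho < 1 by case/andP: rho01 => /ltW -> ->.
have pi0 := pi_gt0 R; have p2 : 0 <= 2 * pi by rewrite mulr_ge0// ltW.
have [B [q [B0 q01 hB]]] := wf_tail ha rho01'.
have cP := @poisson_shift_cont _ _ r01' phi; have cw := @wf_cont s a rho ha rho01'.
apply/eqP; rewrite -subr_eq0 -normr_le0; apply: (@le0_geo _ (2 * (2 * pi * B)) q q01) => N.
have cT := @tp_cont s N (dil a rho).
have e1 : `|circ (fun t => wf s a rho t * poisson r (t - phi)) - circ (fun t => tp s N (dil a rho) t * poisson r (t - phi))| <= 2 * pi * (B * q ^+ N).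
  rewrite -rintB; [|by cont..].
  apply: le_trans (rint_norm _ _ _) _; first by cont.
  rewrite -(poisson_one r01' phi) [X in _ <= X]mulrC -rintZ//.
  apply: le_rint => [||t _]; [by cont|by cont|].
  rewrite -mulrBl normrM [`|poisson _ _|]ger0_norm; last by rewrite ltW// poisson_gt0.
  by rewrite ler_wpM2r ?hB ?(ltW (poisson_gt0 r01' _))//; case/andP: rho01' => ->; rewrite lexx.
rewrite poisson_tp// in e1.
have dd : dil (dil a rho) r = dil a (r * rho).
  by apply/funext => n; rewrite /dil exprMn -mulrA [r ^+ n * _]mulrC.
rewrite dd in e1; have hr : 0 <= r * rho <= rho.
  by case/andP: r01' => r0 r1; case/andP: rho01' => q0 q1; rewrite mulr_ge0//= ler_piMl// ltW.
have e2 := hB s (r * rho) phi N hr.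
have e3 : `|2 * pi * tp s N (dil a (r * rho)) phi - 2 * pi * wf s a (r * rho) phi| <= 2 * pi * (B * q ^+ N).
  by rewrite -mulrBr normrM (ger0_norm p2) ler_wpM2l// distrC.
have := ler_distD (2 * pi * tp s N (dil a (r * rho)) phi) (circ (fun t => wf s a rho t * poisson r (t - phi))) (2 * pi * wf s a (r * rho) phi).
by lra.
Qed.

Lemma wf_uniform s a r e : rregular a -> 0 < r < 1 -> 0 < e ->
  \forall rho \near (1 : R)^'-, forall phi, `|wf s a (r * rho) phi - wf s a r phi| <= e.
Proof.
move=> ha r01 e0; have r01' : 0 <= r < 1 by case/andP: r01 => /ltW -> ->.
have [B [q [B0 q01 hB]]] := wf_tail ha r01'.
have e3 : 0 < e / 3 by rewrite divr_gt0.
have [N _ hN] := @cvgr_le _ _ _ _ _ _ (geo0 B q01) _ e3.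
have {hN}hN : B * q ^+ N <= e / 3 by apply: hN => /=.
have lim0 : \sum_(n < N) `|dil a (r * rho) n - dil a r n| @[rho --> (1 : R)^'-] --> 0.
  have e0' : \sum_(n < N) `|dil a (r * 1) n - dil a r n| = 0.
    by rewrite big1// => n _; rewrite mulr1 subrr normr0.
  rewrite -[X in _ --> X]e0'.
  apply: cvg_at_left_filter.
  have cS : continuous (fun x : R => \sum_(n < N) `|dil a (r * x) n - dil a r n|).
    by apply: (@cont_sum R N (fun n x => `|dil a (r * x) n - dil a r n|)) => n; rewrite /dil; cont.
  exact: (cS 1).
near=> rho => phi; have h1 : \sum_(n < N) `|dil a (r * rho) n - dil a r n| <= e / 3.
  by near: rho; exact: (@cvgr_le _ _ _ _ _ _ lim0 _ e3).
have rho0 : 0 < rho by near: rho; exact: nbhs_left_gt.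
have rho1 : rho < 1 by near: rho; exact: nbhs_left_lt.
case/andP: r01' => r0 r1.
have hr : 0 <= r * rho <= r by rewrite mulr_ge0 ?(ltW rho0)//= ler_piMr// ltW.
have k1 := le_trans (hB s (r * rho) phi N hr) hN.
have k2 := le_trans (hB s r phi N (ltac:(by rewrite r0 lexx))) hN; rewrite distrC in k2.
have k3 := le_trans (tp_dist s N (dil a (r * rho)) (dil a r) phi) h1.
have m1 := ler_distD (tp s N (dil a (r * rho)) phi) (wf s a (r * rho) phi) (wf s a r phi).
have m2 := ler_distD (tp s N (dil a r) phi) (tp s N (dil a (r * rho)) phi) (wf s a r phi).
by lra.
Unshelve. all: by end_near. Qed.

Section Cauchy.
Variables (a : nat -> R) (g h : nat -> C) (B : R).
Hypothesis ha : rregular a.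
Hypothesis hg : forall n, \sum_(k < n) nc (g k) ^+ 2 <= B.
Hypothesis hh : forall n, \sum_(k < n) nc (h k) ^+ 2 <= B.
Hypothesis agh : forall n, (a n)%:C%C = \sum_(k < n.+1) g k * h (n - k)%N.

Definition gpoly (k : nat -> C) rho N : {poly C} := \poly_(n < N) (k n * ((rho ^+ n)%:C)%C).

Lemma B_ge0 : 0 <= B. Proof. by have := hg 0; rewrite big_ord0. Qed.

Lemma nc_sum n (F : 'I_n -> C) : nc (\sum_(k < n) F k) <= \sum_(k < n) nc (F k).
Proof.
elim: n F => [|n IH] F; first by rewrite !big_ord0 nc0.
by rewrite !big_ord_recr /=; apply: le_trans (ncD _ _) _; rewrite lerD2r.
Qed.

Lemma coef_sq (k : nat -> C) n : (forall n, \sum_(j < n) nc (k j) ^+ 2 <= B) -> nc (k n) ^+ 2 <= B.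
Proof.
move=> hk; apply: le_trans (hk n.+1); rewrite big_ord_recr /= lerDr.
by apply: sumr_ge0 => j _; exact: sqr_ge0.
Qed.

(** The product of the truncated factors has the right coefficients below N. Each of the N remaining
    ones is a sum of at most 2 N terms bounded by B rho^N. *)
Lemma prod_close rho N x : 0 <= rho < 1 -> unimodular x ->
  nc ((fpoly a rho N).[x] - (gpoly g rho N).[x] * (gpoly h rho N).[x]) <= (N * (N + N))%:R * B * rho ^+ N.
Proof.
move=> /andP[r0 r1] x1; set G := gpoly g rho N; set K := gpoly h rho N.
have sz : (size (G * K)%R <= N + N)%N.
  apply: leq_trans (size_polyMleq _ _) _; apply: leq_trans (leq_pred _) _.
  by apply: leq_add; exact: size_poly.
have sF : (size (fpoly a rho N) <= N)%N by exact: size_poly.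
rewrite -hornerM (horner_coef_wide _ sz) (horner_coef_wide _ sF) big_split_ord /=.
have -> : \sum_(i < N) (fpoly a rho N)`_i * x ^+ i = \sum_(i < N) (G * K)`_i * x ^+ i.
  apply: eq_bigr => i _; congr (_ * _); rewrite coef_poly ltn_ord /dil rmorphM /= agh mulr_suml coefM.
  apply: eq_bigr => k _; rewrite !coef_poly.
  have kN : (k < N)%N by apply: leq_ltn_trans (ltn_ord i); rewrite -ltnS.
  have ikN : (i - k < N)%N by apply: leq_ltn_trans (ltn_ord i); rewrite leq_subr.
  rewrite kN ikN; have -> : rho ^+ i = rho ^+ k * rho ^+ (i - k) by rewrite -exprD subnKC// -ltnS.
  by rewrite rmorphM /=; ring.
rewrite opprD addrA subrr sub0r ncN; apply: le_trans (nc_sum _) _.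
apply: (@le_trans _ _ (\sum_(i < N) (N + N)%:R * B * rho ^+ N)); last first.
  by rewrite sumr_const card_ord -[_ *+ N]mulr_natl natrM -!mulrA.
apply: ler_sum => i _; rewrite ncM ncX x1 expr1n mulr1 coefM; apply: le_trans (nc_sum _) _.
apply: (@le_trans _ _ (\sum_(k < (N + i).+1) B * rho ^+ N)); last first.
  rewrite sumr_const card_ord -[_ *+ (N + i).+1]mulr_natl -mulrA; apply: ler_wpM2r.
    by apply: mulr_ge0; [exact: B_ge0|exact: exprn_ge0].
  by rewrite ler_nat -addnS leq_add2l.
apply: ler_sum => k _; rewrite !coef_poly.
have B0 := B_ge0; case: ifP => [kN|_]; last by rewrite mul0r nc0 mulr_ge0 ?exprn_ge0.
case: ifP => [ikN|_]; last by rewrite mulr0 nc0 mulr_ge0 ?exprn_ge0.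
have kNi : (k <= N + i)%N by rewrite -ltnS.
rewrite !ncM !nc_real !ger0_norm ?exprn_ge0//.
have -> : nc (g k) * rho ^+ k * (nc (h (N + i - k)%N) * rho ^+ (N + i - k)) = (nc (g k) * nc (h (N + i - k)%N)) * rho ^+ (N + i).
  have -> : rho ^+ (N + i) = rho ^+ k * rho ^+ (N + i - k) by rewrite -exprD subnKC.
  by ring.
apply: ler_pM; rewrite ?mulr_ge0 ?nc_ge0 ?exprn_ge0//; last first.
  by rewrite exprD ler_piMr ?exprn_ge0// exprn_ile1// ltW.
have := coef_sq k hg; have := coef_sq (N + i - k)%N hh; have := sqr_ge0 (nc (g k) - nc (h (N + i - k)%N)).
by move: (nc (g k)) (nc (h _)) => X Y *; nra.
Qed.

Lemma quad_geo rho : 0 <= rho < 1 -> exists K q : R, 0 <= q < 1 /\ forall N, (N * (N + N))%:R * B * rho ^+ N <= K * q ^+ N.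
Proof.
(* With the fourth root w of rho, rho^N = (w^N)^2 w^(2N); the first factor absorbs N^2 and the
   second keeps a geometric decay. *)
move=> /andP[r0 r1]; pose w := Num.sqrt (Num.sqrt rho).
have w0 : 0 <= w by exact: sqrtr_ge0.
have w4 : w ^+ 4 = rho by rewrite (exprM w 2 2) !sqr_sqrtr ?sqrtr_ge0.
have w1 : w < 1 by rewrite -(@ltr_pXn2r _ 4) ?nnegrE// expr1n w4.
exists (2 * B * (1 - w)^-1 ^+ 2), (w ^+ 2); split.
  by rewrite exprn_ge0//= expr_lt1.
move=> N; have hx := natr_expr_le N (ltac:(by rewrite w0 w1) : 0 <= w < 1).
have hN : N%:R * w ^+ N <= (1 - w)^-1.
  by apply: le_trans hx; rewrite ler_wpM2r ?exprn_ge0// ler_nat.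
have B0 := B_ge0; have n0 : 0 <= N%:R * w ^+ N by rewrite mulr_ge0 ?exprn_ge0.
have -> : (N * (N + N))%:R * B * rho ^+ N = 2 * B * (N%:R * w ^+ N) ^+ 2 * w ^+ 2 ^+ N.
  rewrite natrM natrD -w4 -!exprM.
  have -> : w ^+ (4 * N) = w ^+ N ^+ 2 * w ^+ (2 * N) by rewrite -exprM -exprD; congr (_ ^+ _); rewrite (mulnC N 2) -mulnDl.
  by ring.
rewrite ler_wpM2r ?exprn_ge0// ler_wpM2l ?mulr_ge0// lerXn2r ?nnegrE ?invr_ge0 ?subr_ge0 ?(ltW w1)//.
Qed.

(** Complex sequences are viewed as quaternionic ones, so that the l2 continuity of dilation carries
    over. *)
Definition qof (k : nat -> C) n : quat R := Quat (Rp (k n)) (Ip (k n)) 0 0.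

Lemma sqs_qof (k : nat -> C) r rho N : sqs N (fun n => dilate r (qof k) n - dilate rho (qof k) n) =
  \sum_(n < N) nc (k n * ((r ^+ n)%:C)%C - k n * ((rho ^+ n)%:C)%C) ^+ 2.
Proof.
apply: eq_bigr => n _; rewrite normsqE sum4 !qcB !qcZ /qc /= -mulrBr -rmorphB ncM nc_real exprMn nc_sqr.
by rewrite real_normK ?num_real//; ring.
Qed.

Lemma circ_prod (p q : {poly C}) N (e D : R) : 0 <= e -> 0 <= D -> (size p <= N)%N -> (size q <= N)%N ->
  \sum_(n < N) nc p`_n ^+ 2 <= e ^+ 2 -> \sum_(n < N) nc q`_n ^+ 2 <= D ^+ 2 ->
  circ (fun t => nc p.[ci t] * nc q.[ci t]) <= 2 * pi * (e * D).
Proof.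
move=> e0 D0 sp sq hp hq; have pi0 := pi_gt0 R; have pp : - pi <= pi by have := ltW pi0; lra.
have hx := rint_CS (@nc_cont _ p) (@nc_cont _ q) pp.
rewrite (parsevalC sp) (parsevalC sq) in hx.
have J0 : 0 <= circ (fun t => nc p.[ci t] * nc q.[ci t]) by apply: rint_ge0 => t _; rewrite mulr_ge0 ?nc_ge0.
have p2 : 0 <= 2 * pi by rewrite mulr_ge0// ltW.
have J2 : circ (fun t => nc p.[ci t] * nc q.[ci t]) ^+ 2 <= (2 * pi * (e * D)) ^+ 2.
  apply: le_trans hx _.
  have -> : (2 * pi * (e * D)) ^+ 2 = (2 * pi * e ^+ 2) * (2 * pi * D ^+ 2) by ring.
  by apply: ler_pM; (try by apply: mulr_ge0 => //; apply: sumr_ge0 => n _; exact: sqr_ge0); rewrite ler_wpM2l.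
have K0 : 0 <= 2 * pi * (e * D) by apply: mulr_ge0 => //; exact: mulr_ge0.
by move: J2; rewrite ler_pXn2r ?nnegrE//.
Qed.

(** With a = g h, the difference of two dilates is (g - g') h + (h - h') g'. Cauchy-Schwarz on the
    circle reduces its L1 norm to the l2 continuity of the dilates of g and h. *)
Lemma wf_cauchy s e : 0 < e -> exists2 tau, 0 < tau < 1 & forall rho rho', tau < rho < 1 -> tau < rho' < 1 ->
  circ (fun t => `|wf s a rho t - wf s a rho' t|) <= e.
Proof.
move=> e0; have pi0 := pi_gt0 R; have B0 := B_ge0.
pose D := Num.sqrt B; have D0 : 0 <= D by exact: sqrtr_ge0.
have DB : D ^+ 2 = B by rewrite sqr_sqrtr.
(* Two products, each bounded by 2 pi e' D. *)
pose e' := e / (4 * pi * (D + 1)); have K0 : 0 < 4 * pi * (D + 1) by rewrite !mulr_gt0// ltr_wpDl.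
have e'0 : 0 < e' by rewrite divr_gt0.
have qb (k : nat -> C) : (forall n, \sum_(j < n) nc (k j) ^+ 2 <= B) -> forall m, sqs m (qof k) <= D ^+ 2.
  move=> hk m; rewrite DB; apply: le_trans (hk m); apply: ler_sum => n _.
  by rewrite normsqE sum4 /qc /= nc_sqr; lra.
have [d1 /andP[d10 d11] h1] := dilate_cauchy D0 e'0 (qb g hg).
have [d2 /andP[d20 d21] h2] := dilate_cauchy D0 e'0 (qb h hh).
pose d := Num.min (Num.min d1 d2) 2^-1; have d0 : 0 < d by rewrite !lt_min d10 d20 invr_gt0 ltr0n.
have dh : d <= 2^-1 by rewrite ge_min lexx orbT.
exists (1 - d); first by apply/andP; split; lra.
have dd1 : d <= d1 by rewrite !ge_min lexx.
have dd2 : d <= d2 by rewrite !ge_min lexx orbT.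
move=> rho rho' /andP[r0 r1] /andP[q0 q1].
have r01 : 0 <= rho < 1 by apply/andP; split; lra.
have q01 : 0 <= rho' < 1 by apply/andP; split; lra.
have [B1 [w1 [_ w101 hB1]]] := wf_tail ha r01; have [B2 [w2 [_ w201 hB2]]] := wf_tail ha q01.
have [K1 [z1 [z101 hK1]]] := quad_geo r01; have [K2 [z2 [z201 hK2]]] := quad_geo q01.
have c1 := @wf_cont s a rho ha r01; have c2 := @wf_cont s a rho' ha q01.
have lim : (B1 * w1 ^+ N + B2 * w2 ^+ N + K1 * z1 ^+ N + K2 * z2 ^+ N) * (2 * pi) + 4 * pi * (e' * D) @[N --> \oo] --> 4 * pi * (e' * D).
  rewrite -[X in _ --> X]add0r; apply: cvgD; last exact: cvg_cst.
  rewrite -[X in _ --> X](mul0r (2 * pi)); apply: cvgM; last exact: cvg_cst.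
  have hl := cvgD (cvgD (cvgD (geo0 B1 w101) (geo0 B2 w201)) (geo0 K1 z101)) (geo0 K2 z201).
  by rewrite !addr0 in hl; exact: hl.
apply: (@le_trans _ _ (4 * pi * (e' * D))); last first.
  have -> : e = 4 * pi * (e' * (D + 1)) by rewrite -[LHS](divfK (lt0r_neq0 K0)) -/e'; ring.
  by rewrite ler_wpM2l ?mulr_ge0 ?(ltW pi0)// ler_wpM2l ?(ltW e'0)// lerDl.
apply: (cvgr_to_ge lim); apply: nearW => N.
pose G r := gpoly g r N; pose K r := gpoly h r N.
have sG r : (size (G r) <= N)%N by exact: size_poly.
have sK r : (size (K r) <= N)%N by exact: size_poly.
have coefs (k : nat -> C) r : 0 <= r < 1 -> (forall n, \sum_(j < n) nc (k j) ^+ 2 <= B) ->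
  \sum_(n < N) nc (gpoly k r N)`_n ^+ 2 <= D ^+ 2.
  move=> /andP[a0 a1] hk; rewrite DB; apply: le_trans (hk N); apply: ler_sum => n _.
  rewrite coef_poly ltn_ord ncM nc_real ger0_norm ?exprn_ge0// exprMn ler_piMr ?sqr_ge0//.
  by rewrite exprn_ile1 ?exprn_ge0// exprn_ile1// ltW.
have diff (k : nat -> C) dk : (forall r s0 : R, 1 - dk < r < 1 -> 1 - dk < s0 < 1 -> forall N0,
     sqs N0 (fun n => dilate r (qof k) n - dilate s0 (qof k) n) <= e' ^+ 2) -> d <= dk ->
   \sum_(n < N) nc (gpoly k rho N - gpoly k rho' N)`_n ^+ 2 <= e' ^+ 2.
  move=> hk ddk; have := hk rho rho' (ltac:(by apply/andP; split; lra)) (ltac:(by apply/andP; split; lra)) N.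
  rewrite sqs_qof; apply: le_trans; apply: ler_sum => n _.
  by rewrite coefB !coef_poly ltn_ord.
have sD (p q : {poly C}) : (size p <= N)%N -> (size q <= N)%N -> (size (p - q)%R <= N)%N.
  by move=> h3 h4; apply: leq_trans (size_polyD _ _) _; rewrite size_polyN geq_max h3.
have I1 := circ_prod (ltW e'0) D0 (sD _ _ (sG rho) (sG rho')) (sK rho) (diff g d1 h1 dd1) (coefs h rho r01 hh).
have I2 := circ_prod (ltW e'0) D0 (sD _ _ (sK rho) (sK rho')) (sG rho') (diff h d2 h2 dd2) (coefs g rho' q01 hg).
pose F1 t := nc (G rho - G rho').[ci t] * nc (K rho).[ci t].
pose F2 t := nc (K rho - K rho').[ci t] * nc (G rho').[ci t].
have cF1 : continuous F1 by apply: contM; exact: nc_cont.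
have cF2 : continuous F2 by apply: contM; exact: nc_cont.
pose E := B1 * w1 ^+ N + B2 * w2 ^+ N + K1 * z1 ^+ N + K2 * z2 ^+ N.
apply: (@le_trans _ _ (circ (fun t => E + (F1 t + F2 t)))).
  apply: le_rint => [||t _]; [by cont|by apply: contD; [exact: contC|exact: contD]|].
  have u := ci_unimodular t.
  have k1 := hB1 s rho t N (ltac:(by case/andP: r01 => ->; rewrite lexx)).
  have k2 := hB2 s rho' t N (ltac:(by case/andP: q01 => ->; rewrite lexx)); rewrite distrC in k2.
  have k3 := le_trans (prod_close N r01 u) (hK1 N); have k4 := le_trans (prod_close N q01 u) (hK2 N).
  have k5 : `|tp s N (dil a rho) t - tp s N (dil a rho') t| <= nc ((fpoly a rho N).[ci t] - (fpoly a rho' N).[ci t]).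
    rewrite !fpoly_ci /ComplexField.Normc.normc /=; case: s {c1 c2 k1 k2} => /=; rewrite -sqrtr_sqr ler_wsqrtr// ?lerDl ?lerDr sqr_ge0//.
  have k6 : nc ((fpoly a rho N).[ci t] - (fpoly a rho' N).[ci t]) <= K1 * z1 ^+ N + K2 * z2 ^+ N + (F1 t + F2 t).
    set p := (fpoly a rho N).[ci t] in k3 *; set q := (fpoly a rho' N).[ci t] in k4 *.
    have -> : p - q = (p - (G rho).[ci t] * (K rho).[ci t]) + (- (q - (G rho').[ci t] * (K rho').[ci t])) +
      ((G rho - G rho').[ci t] * (K rho).[ci t] + (K rho - K rho').[ci t] * (G rho').[ci t]).
      by rewrite !hornerD !hornerN; ring.
    apply: le_trans (ncD _ _) _; apply: lerD.
      by apply: le_trans (ncD _ _) _; rewrite ncN; apply: lerD.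
    by apply: le_trans (ncD _ _) _; rewrite !ncM.
  have m1 := ler_distD (tp s N (dil a rho) t) (wf s a rho t) (wf s a rho' t).
  have m2 := ler_distD (tp s N (dil a rho') t) (tp s N (dil a rho) t) (wf s a rho' t).
  by rewrite /E /=; lra.
have cFF := contD cF1 cF2.
rewrite (rintD _ _ (@contC _ E) cFF) (rintD _ _ cF1 cF2) rint_cst; last by have := ltW pi0; lra.
have -> : E * (pi - - pi) = E * (2 * pi) by ring.
rewrite lerD2l; apply: le_trans (lerD I1 I2) _.
by rewrite le_eqVlt; apply/orP; left; apply/eqP; ring.
Qed.

End Cauchy.

Section HankelOsc.
Variables (a : nat -> R) (M : R).
Hypothesis ha : HB (seq_shift a) M.

Lemma M_ge0 : 0 <= M. Proof. by case: ha. Qed.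

Lemma HB_coef n : `|a n.+1| <= M.
Proof.
have := proj2 ha n.+1 (fun j => if j == 0%N then 1 else 0) (fun k => if k == n then 1 else 0).
have d k0 (k1 : 'I_n.+1) : (k1 = k0 :> nat) -> rs n.+1 (fun k => if k == k0 then 1 else 0) = 1 :> R.
  move=> e; rewrite /rs (bigD1 k1)//= e eqxx expr1n big1 ?addr0// => k kk.
  by rewrite (_ : (nat_of_ord k == k0) = false) ?expr0n//; apply/negbTE; rewrite -e; exact: kk.
rewrite (d 0%N ord0)// (d n ord_max)// sqrtr1 !mulr1; apply: le_trans.
rewrite big_ord_recl /= [X in _ <= `|_ + X|]big1 ?addr0; last first.
  by move=> j _; rewrite big1// => k _; rewrite !mul0r.
rewrite (bigD1 ord_max)//= eqxx !mul1r add0n [X in _ <= `|_ + X|]big1 ?addr0// => k kk.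
by rewrite (_ : (nat_of_ord k == n) = false) ?mulr0 ?mul0r//; apply/negbTE; exact: kk.
Qed.

Lemma HB_rregular : rregular a.
Proof.
move=> rho /andP[r0 r1]; exists (`|a 0%N| + M) => n; have M0 := M_ge0.
apply: (@le_trans _ _ `|a n|); first by rewrite ler_piMr// exprn_ile1// ltW.
by case: n => [|n]; [rewrite lerDl|apply: le_trans (HB_coef n) _; rewrite lerDr].
Qed.

(** The powers of r can be moved onto the test sequences, so dilation keeps the bound M. Cutting the
    dilated sequence at N changes entries by at most M r^N, and (N+1) r^N <= 1 bounds this change by
    M as well: hence 2 M. *)
Lemma garsia_HB r N z : 0 <= r < 1 -> N.+1%:R * r ^+ N <= 1 -> disc 1 z ->
  ev (wt 1 * Sb N (trunc N (dil a r))) z <= (2 * M) ^+ 2.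
Proof.
move=> /andP[r0 r1] hN hz; have M0 := M_ge0; set c := trunc N (dil a r).
have form (f g : nat -> R) : `|\sum_(j < N) \sum_(k < N.+1) f j * g k * c (j + k).+1| <= 2 * M * (Num.sqrt (rs N f) * Num.sqrt (rs N.+1 g)).
  pose f' j := trunc N f j.
  have e1 : rs N.+1 (fun j => f' j * r ^+ j) <= rs N f.
    rewrite /rs big_ord_recr /= /f' /trunc ltnn mul0r expr0n addr0; apply: ler_sum => j _.
    by rewrite ltn_ord exprMn ler_piMr ?sqr_ge0// exprn_ile1 ?exprn_ge0// exprn_ile1// ltW.
  have e2 : rs N.+1 (fun k => g k * r ^+ k.+1) <= rs N.+1 g.
    apply: ler_sum => j _; rewrite exprMn -[leRHS]mulr1 ler_wpM2l ?sqr_ge0//.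
    by apply: exprn_ile1; [exact: exprn_ge0|apply: exprn_ile1 => //; exact: ltW].
  have h1 := proj2 ha N.+1 (fun j => f' j * r ^+ j) (fun k => g k * r ^+ k.+1).
  pose T := \sum_(j < N) \sum_(k < N.+1) f j * g k * (dil a r (j + k).+1 - c (j + k).+1).
  have h2 : `|T| <= M * (Num.sqrt (rs N f) * Num.sqrt (rs N.+1 g)).
    have A1 : `|T| <= \sum_(j < N) \sum_(k < N.+1) `|f j| * `|g k| * (M * r ^+ N).
      apply: le_trans (ler_norm_sum _ _ _) _; apply: ler_sum => j _.
      apply: le_trans (ler_norm_sum _ _ _) _; apply: ler_sum => k _.
      rewrite !normrM ler_wpM2l ?mulr_ge0// /c /trunc; case: ifP => [_|/negbT].
        by rewrite subrr normr0 mulr_ge0 ?exprn_ge0.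
      rewrite -leqNgt subr0 /dil normrM => Njk; apply: ler_pM => //; first exact: HB_coef.
      by rewrite ger0_norm ?exprn_ge0// ler_wiXn2l// ltW.
    apply: le_trans A1 _.
    have -> : \sum_(j < N) \sum_(k < N.+1) `|f j| * `|g k| * (M * r ^+ N) =
      M * r ^+ N * ((\sum_(j < N) `|f j| * 1) * (\sum_(k < N.+1) `|g k| * 1)).
      rewrite mulr_suml mulr_sumr; apply: eq_bigr => j _; rewrite !mulr_sumr; apply: eq_bigr => k _.
      by rewrite !mulr1; ring.
    have S n (w : nat -> R) : (\sum_(k < n) `|w k| * 1) <= Num.sqrt n%:R * Num.sqrt (rs n w).
      have := @sum_sqr_le R n (fun k => `|w k|) (fun=> 1) (fun _ => (ltac:(by rewrite normr1))).
      have -> : \sum_(k < n) `|w k| ^+ 2 = rs n w by apply: eq_bigr => k _; rewrite real_normK ?num_real.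
      move=> h; rewrite -(@ler_pXn2r _ 2) ?nnegrE ?mulr_ge0 ?sqrtr_ge0//; last by apply: sumr_ge0 => k _; rewrite mulr1.
      by rewrite exprMn !sqr_sqrtr ?rs_ge0.
    have p0 n (w : nat -> R) : 0 <= \sum_(k < n) `|w k| * 1 :> R by apply: sumr_ge0 => k _; rewrite mulr1.
    have SS := ler_pM (p0 N f) (p0 N.+1 g) (S N f) (S N.+1 g).
    rewrite -mulrA ler_wpM2l//.
    apply: le_trans (ler_wpM2l (exprn_ge0 N r0) SS) _.
    have sN : Num.sqrt N%:R <= Num.sqrt N.+1%:R :> R by rewrite ler_wsqrtr// ler_nat.
    have s2 : Num.sqrt N.+1%:R * Num.sqrt N.+1%:R = N.+1%:R :> R by rewrite -expr2 sqr_sqrtr.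
    have rN0 : 0 <= r ^+ N by rewrite exprn_ge0.
    move: (Num.sqrt (rs N f)) (Num.sqrt (rs N.+1 g)) (sqrtr_ge0 (rs N f)) (sqrtr_ge0 (rs N.+1 g)) => X Y X0 Y0.
    have XY : 0 <= X * Y by rewrite mulr_ge0.
    have -> : r ^+ N * (Num.sqrt N%:R * X * (Num.sqrt N.+1%:R * Y)) = (Num.sqrt N%:R * Num.sqrt N.+1%:R * r ^+ N) * (X * Y) by ring.
    rewrite -[leRHS]mul1r ler_wpM2r//; apply: le_trans hN.
    apply: ler_wpM2r => //; rewrite -[leRHS]s2; apply: ler_wpM2r => //; exact: sqrtr_ge0.
  have -> : \sum_(j < N) \sum_(k < N.+1) f j * g k * c (j + k).+1 =
    \sum_(j < N.+1) \sum_(k < N.+1) f' j * r ^+ j * (g k * r ^+ k.+1) * seq_shift a (j + k)%N - T.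
    rewrite [X in X - _]big_ord_recr /= [X in _ + X - _]big1 ?addr0; last first.
      by move=> k _; rewrite /f' /trunc ltnn !mul0r.
    rewrite /T -sumrB; apply: eq_bigr => j _; rewrite -sumrB; apply: eq_bigr => k _.
    by rewrite /f' /trunc ltn_ord /seq_shift /dil -addnS exprD; ring.
  apply: le_trans (ler_normB _ _) _; rewrite -mulrA mulr_natl mulr2n; apply: lerD => //.
  apply: le_trans h1 _; rewrite ler_wpM2l//; apply: ler_pM; rewrite ?sqrtr_ge0 ?ler_wsqrtr//.
(* Choosing for [f] the image [T] of [w] turns the form bound into a bound for the square sum of
   that image. *)
have half (w : nat -> R) : \sum_(j < N) (\sum_(k < N.+1) w k * c (j + k).+1) ^+ 2 <= (2 * M) ^+ 2 * rs N.+1 w.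
  pose T j := \sum_(k < N.+1) w k * c (j + k).+1.
  have := form T w; have -> : \sum_(j < N) \sum_(k < N.+1) T j * w k * c (j + k).+1 = rs N T.
    by apply: eq_bigr => j _; rewrite expr2 {2}/T mulr_sumr; apply: eq_bigr => k _; rewrite mulrA.
  rewrite ger0_norm ?rs_ge0// => hT; change (rs N T <= (2 * M) ^+ 2 * rs N.+1 w).
  rewrite -{1}(sqr_sqrtr (rs_ge0 N T)) in hT; rewrite -(sqr_sqrtr (rs_ge0 N T)) -[X in _ * X](sqr_sqrtr (rs_ge0 N.+1 w)) -exprMn.
  move: (Num.sqrt (rs N T)) (Num.sqrt (rs N.+1 w)) (sqrtr_ge0 (rs N T)) (sqrtr_ge0 (rs N.+1 w)) hT => X Y X0 Y0 hT.
  rewrite lerXn2r ?nnegrE ?mulr_ge0//; have [X00|X00] := eqVneq X 0; first by rewrite X00 !mulr_ge0.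
  have Xp : 0 < X by rewrite lt_def X00.
  by rewrite -(ler_pM2l Xp) -expr2; apply: le_trans hT _; rewrite le_eqVlt; apply/orP; left; apply/eqP; ring.
have h1 := half (fun k => ev (zc R k) z); have h2 := half (fun k => ev (zs R k) z).
rewrite evM ev_wt expr1n /Sb ev_sum.
have w0 : 0 <= 1 - z.1 ^+ 2 - z.2 ^+ 2 by rewrite -addrA -opprD subr_ge0 ltW//; move: hz; rewrite /disc /= expr1n.
have -> : \sum_(j < N) ev (re N.+1 (sh j.+1 c) * re N.+1 (sh j.+1 c) + im N.+1 (sh j.+1 c) * im N.+1 (sh j.+1 c)) z =
  \sum_(j < N) (\sum_(k < N.+1) ev (zc R k) z * c (j + k).+1) ^+ 2 + \sum_(j < N) (\sum_(k < N.+1) ev (zs R k) z * c (j + k).+1) ^+ 2.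
  rewrite -big_split; apply: eq_bigr => j _ /=; rewrite evD !evM -!expr2 ev_re ev_im; congr (_ ^+ 2 + _ ^+ 2);
    by apply: eq_bigr => k _; rewrite /sh addSn mulrC.
apply: le_trans (ler_wpM2l w0 (lerD h1 h2)) _; rewrite -mulrDr.
have -> : rs N.+1 (fun k => ev (zc R k) z) + rs N.+1 (fun k => ev (zs R k) z) = \sum_(k < N.+1) (z.1 ^+ 2 + z.2 ^+ 2) ^+ k.
  by rewrite /rs -big_split; apply: eq_bigr => k _ /=; rewrite zpow_norm.
rewrite mulrCA -[leRHS]mulr1 ler_wpM2l ?sqr_ge0//.
(* A geometric sum: (1 - |z|^2) sum_(k<=N) |z|^(2k) = 1 - |z|^(2N+2). *)
have -> : 1 - z.1 ^+ 2 - z.2 ^+ 2 = - ((z.1 ^+ 2 + z.2 ^+ 2) - 1) by ring.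
by rewrite mulNr -subrX1 opprB gerBl exprn_ge0// addr_ge0 ?sqr_ge0.
Qed.

Lemma tp_trunc s N c t : tp s N (trunc N c) t = tp s N c t.
Proof. by case: s; apply: eq_bigr => n _; rewrite /trunc ltn_ord. Qed.

(** The Garsia bound (2 M)^2 gives 2 pi * 2 M for the truncated dilate. [N] is taken so large that
    both the truncation error is at most e and (N+1) r^N <= 1; the square root of r absorbs the
    factor N + 1. *)
Lemma HB_osc sb r e (s t : R) : 0 < r < 1 -> 0 < e -> s < t -> t <= s + 2 * pi ->
  exists c : R, rint s t (fun x => `|wf sb a r x - c|) <= (4 * pi * M + e) * (t - s).
Proof.
move=> /andP[r0 r1] e0 st ts; have r01 : 0 <= r < 1 by rewrite (ltW r0).
have M0 := M_ge0; have reg := HB_rregular.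
have [B [q [B0 q01 hB]]] := wf_tail reg r01.
have lim1 := geo0 B q01.
have [N [N1 N2]] : exists N, B * q ^+ N <= e /\ N.+1%:R * r ^+ N <= 1.
  have h1 : \forall N \near \oo, B * q ^+ N <= e.
    by have [n _ hn] := @cvgr_le _ _ _ _ _ _ lim1 _ e0; exists n => // k hk; exact: hn.
  pose w := Num.sqrt r; have w0 : 0 <= w by exact: sqrtr_ge0.
  have w2 : w ^+ 2 = r by rewrite sqr_sqrtr// ltW.
  have w1 : w < 1 by rewrite -(@ltr_pXn2r _ 2) ?nnegrE// expr1n w2.
  have w01 : 0 <= w < 1 by rewrite w0.
  have h2 : \forall N \near \oo, (1 - w)^-1 * w ^+ N <= 1.
    have lim2 := geo0 (1 - w)^-1 w01.
    by have [n _ hn] := @cvgr_le _ _ _ _ _ _ lim2 _ (@ltr01 R); exists n => // k hk; exact: hn.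
  have [N [k1 k2]] := filter_ex (filterI h1 h2); exists N; split => //.
  apply: le_trans k2; rewrite -w2 -exprM mulnC exprM expr2 mulrA ler_wpM2r ?exprn_ge0//.
  exact: natr_expr_le.
have c0 n : (N <= n)%N -> trunc N (dil a r) n = 0 by move=> Nn; rewrite /trunc ltnNge Nn.
have [c [d [hc hd]]] := garsia_lower c0 (fun z hz => garsia_HB r01 N2 hz) st ts.
have pi0 := pi_gt0 R.
have sqM : Num.sqrt ((2 * M) ^+ 2) = 2 * M by rewrite sqrtr_sqr ger0_norm ?mulr_ge0.
rewrite sqM in hc hd.
have [c' hc'] : exists c' : R, rint s t (fun x => `|tp sb N (trunc N (dil a r)) x - c'|) <= 2 * pi * (2 * M) * (t - s).
  by case: sb; [exists d|exists c].
exists c'; have cw := @wf_cont sb a r reg r01; have ct := @tp_cont sb N (trunc N (dil a r)).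
apply: (@le_trans _ _ (rint s t (fun x => `|tp sb N (trunc N (dil a r)) x - c'| + e))).
  apply: le_rint => [||x _]; [by cont|by cont|].
  have rr : 0 <= r <= r by rewrite (ltW r0) lexx.
  have k1 := le_trans (hB sb r x N rr) N1.
  have := ler_distD (tp sb N (dil a r) x) (wf sb a r x) c'.
  by rewrite tp_trunc; lra.
rewrite rintD; [|by cont..]; rewrite (rint_cst _ (ltW st)).
by move: (rint _ _ _) hc' => J hJ; lra.
Qed.

End HankelOsc.
End BoundaryFamilies.

(** * Boundary values on slices and BMO *)

Section BoundaryValues.
Variable R : realType.
Local Notation mu := (@lebesgue_measure R).
Local Notation H := (quat R).
Local Notation C := R[i].
Local Notation nc := (@ComplexField.Normc.normc R).
Local Notation pi := (@pi R).
Local Notation circ := (rint (- pi) pi).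
Local Notation J := (bool * 'I_4)%type.
Implicit Types (a : nat -> R) (b : nat -> H) (I q : H).

Import HBNNSimple.

(** [radial_lim] is identified only off a null set. The comparison runs over the simple functions
    below the integrand, which are measurable and can be restricted to the complement of [N]. *)
Lemma integral_ae_le (D N : set R) (F G : R -> \bar R) : measurable N -> mu N = 0%E ->
  (forall x, D x -> (0 <= F x)%E) -> (forall x, D x -> (0 <= G x)%E) ->
  (forall x, D x -> ~ N x -> (F x <= G x)%E) ->
  (\int[mu]_(x in D) F x <= \int[mu]_(x in D) G x)%E.
Proof.
move=> mN N0 f0 g0 fg; rewrite integral_mkcond [leRHS]integral_mkcond.
have F0 x : (0 <= (F \_ D) x)%E by rewrite patchE; case: ifPn => // /set_mem /f0.
have G0 x : (0 <= (G \_ D) x)%E by rewrite patchE; case: ifPn => // /set_mem /g0.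
rewrite ge0_integralTE//; apply: ge_ereal_sup => _ [h hf <-].
rewrite -integralT_nnsfun (@ge0_negligible_integral _ _ _ mu setT N)//; try (by apply/measurable_EFinP; exact: measurable_funPT); try (by move=> x _; rewrite lee_fin).
have h0 (x : R) : (0 <= (h x)%:E)%E by rewrite lee_fin; exact: fun_ge0.
apply: integral_mono => //; try (by move=> x _; exact: h0).
move=> x [_ Nx]; apply: le_trans (hf x) _; rewrite !patchE.
by case: ifPn => // /set_mem Dx; exact: fg.
Qed.

Lemma Rintegral_ae_eq (D N : set R) (f g : R -> R) : measurable N -> mu N = 0%E ->
  (forall x, ~ N x -> f x = g x) -> \int[mu]_(x in D) f x = \int[mu]_(x in D) g x.
Proof.
move=> mN N0 fg; rewrite /Rintegral integralE [in RHS]integralE; congr (fine (_ - _)%E);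
  by apply/eqP; rewrite eq_le; apply/andP; split; apply: (integral_ae_le mN N0);
    move=> x Dx //; move=> /fg E; rewrite ?funeposE ?funenegE E.
Qed.

Lemma osc_lincomb (T : finType) (k : T -> R) (F : T -> R -> R) (c : T -> R) (s t m : R) :
  (forall j, measurable_fun setT (F j)) -> (forall j, `|k j| <= 1) ->
  (forall j, (\int[mu]_(x in `[s, t]) `|F j x - c j|%:E <= m%:E)%E) ->
  (\int[mu]_(x in `[s, t]) `|\sum_j k j * F j x - \sum_j k j * c j|%:E <= (#|T|%:R * m)%:E)%E.
Proof.
move=> mF hk hF; have mI : measurable (`[s, t]%classic : set R) by exact: measurable_itv.
apply: (@le_trans _ _ (\int[mu]_(x in `[s, t]) \sum_j `|F j x - c j|%:E)%E).
  apply: integral_mono; [by []|by move=> x _; rewrite lee_fin|by move=> x _; apply: sume_ge0 => j _; rewrite lee_fin|move=> x _].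
  rewrite sumEFin lee_fin -sumrB; apply: le_trans (ler_norm_sum _ _ _) _; apply: ler_sum => j _.
  by rewrite -mulrBr normrM ler_piMl.
rewrite ge0_integral_sum//; last first.
  move=> j; apply/measurable_EFinP; apply: measurableT_comp => //.
  by apply: measurable_funB; [apply: measurable_funTS; exact: mF|exact: measurable_cst].
apply: (@le_trans _ _ (\sum_(j : T) m%:E)%E); first by apply: lee_sum => j _.
by rewrite sumEFin sumr_const mulr_natl.
Qed.

(** The mean differs from c by at most the average oscillation about c, which doubles the bound. *)
Lemma mean_osc (f : R -> R) (c m s t : R) : measurable_fun setT f -> s < t ->
  (\int[mu]_(x in `[s, t]) `|f x - c|%:E <= (m * (t - s))%:E)%E ->
  (\int[mu]_(x in `[s, t]) `|f x - (t - s)^-1 * \int[mu]_(x in `[s, t]) f x|%:E <= (2 * m * (t - s))%:E)%E.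
Proof.
move=> mf st hm; have mI : measurable (`[s, t]%classic : set (measurableTypeR R)) by exact: measurable_itv.
have ts0 : 0 < t - s by rewrite subr_gt0.
have mu_I : mu `[s, t]%classic = (t - s)%:E by rewrite lebesgue_measure_itv /= lte_fin st -EFinB.
pose d x := f x - c.
have md : measurable_fun `[s, t]%classic d.
  by apply: measurable_funB; [exact: measurable_funTS|exact: measurable_cst].
have mnd : measurable_fun `[s, t]%classic (fun x => `|d x|) by exact: measurableT_comp.
have id : mu.-integrable `[s, t]%classic (EFin \o d).
  apply/integrableP; split; first by apply/measurable_EFinP.
  by apply: (@le_lt_trans _ _ (m * (t - s))%:E); [exact: hm|rewrite ltry].
have ic : mu.-integrable `[s, t]%classic (EFin \o (fun _ : R => c)).
  exact: (@continuous_integrable R (fun=> c) s t (@contC R c)).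
have E : \int[mu]_(x in `[s, t]) f x = \int[mu]_(x in `[s, t]) d x + c * (t - s).
  rewrite -(rint_cst c (ltW st)) /rint -(RintegralD mI id ic); apply: eq_Rintegral => x _.
  by rewrite /d subrK.
have dm : `|\int[mu]_(x in `[s, t]) d x| <= m * (t - s).
  apply: le_trans (le_normr_Rintegral mI id) _; rewrite -lee_fin /Rintegral fineK//.
  by rewrite ge0_fin_numE ?(le_lt_trans hm) ?ltry//; apply: integral_ge0 => x _; rewrite lee_fin.
have ac : `|(t - s)^-1 * \int[mu]_(x in `[s, t]) f x - c| <= m.
  rewrite E mulrDr [c * _]mulrC mulKf ?gt_eqF// addrK normrM gtr0_norm ?invr_gt0//.
  by rewrite ler_pdivrMl// mulrC.
apply: (@le_trans _ _ (\int[mu]_(x in `[s, t]) (`|d x|%:E + m%:E))%E).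
  have m0 : 0 <= m by apply: le_trans ac.
  apply: integral_mono; [by []|by move=> x _; rewrite lee_fin|by move=> x _; rewrite -EFinD lee_fin addr_ge0|move=> x _].
  rewrite -EFinD lee_fin; move: ac; set A := _ * _ => ac; have -> : f x - A = d x - (A - c) by rewrite /d; ring.
  by apply: le_trans (ler_normB _ _) _; rewrite lerD2l.
have m0 : 0 <= m by apply: le_trans ac.
rewrite ge0_integralD//; try (by apply/measurable_EFinP); try (by move=> x _; rewrite lee_fin); try exact: measurable_cst.
rewrite integral_cst// [X in (_ + _ * X)%E]mu_I -EFinM.
have -> : (2 * m * (t - s))%:E = ((m * (t - s))%:E + (m * (t - s))%:E)%E by rewrite -EFinD; congr EFin; ring.
by rewrite leeD2r.
Qed.

(** Two senses of convergence are recorded: the radial one identifies [radial_lim], and the one in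
    mean along the radii [rk] transfers oscillation between the dilates and the boundary
    function. *)
Definition bdry (v : R -> R -> R) (f : R -> R) := [/\ measurable_fun setT f,
  {ae mu, forall t, v r t @[r --> (1 : R)^'-] --> f t} & exists rk : nat -> R,
  [/\ forall k, 0 < rk k < 1, rk k @[k --> \oo] --> (1 : R) &
   forall k s, (\int[mu]_(t in `[s, (s + 2 * pi)%R]) `|v (rk k) t - f t|%:E <= (2 * 2^-1 ^+ k)%:E)%E]].

Lemma wf_vr (sb : bool) a (r phi : R) : rregular a -> 0 < r < 1 ->
  wf sb a (r * rho) phi @[rho --> (1 : R)^'-] --> wf sb a r phi.
Proof.
move=> ha r01; apply/cvgrPdist_le => e e0; have := wf_uniform sb ha r01 e0.
by apply: filterS => rho /(_ phi); rewrite distrC.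
Qed.

Lemma boundary_exists a (g h : nat -> C) (B : R) (sb : bool) : rregular a ->
  (forall n, \sum_(k < n) nc (g k) ^+ 2 <= B) -> (forall n, \sum_(k < n) nc (h k) ^+ 2 <= B) ->
  (forall n, (a n)%:C%C = \sum_(k < n.+1) g k * h (n - k)%N) -> exists f, bdry (wf sb a) f.
Proof.
move=> ha hg hh agh.
have vc rho : 0 < rho < 1 -> continuous (wf sb a rho).
  by move=> /andP[r0 r1]; apply: wf_cont => //; rewrite (ltW r0).
have vp rho x : 0 < rho < 1 -> wf sb a rho (x + 2 * pi) = wf sb a rho x by move=> _; exact: wf_period.
have vP rho r phi : 0 < rho < 1 -> 0 < r < 1 ->
  circ (fun t => wf sb a rho t * poisson r (t - phi)) = 2 * pi * wf sb a (r * rho) phi by move=> *; exact: wf_poisson.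
have vr r phi : 0 < r < 1 -> wf sb a (r * rho) phi @[rho --> (1 : R)^'-] --> wf sb a r phi by exact: wf_vr.
have vL := @wf_cauchy R a g h B ha hg hh agh sb.
have [rk [tk [f [hrk mf fp hf hr]]]] : exists (rk tk : nat -> R) (f : R -> R), [/\ forall k, [/\ 0 < tk k < 1, 1 - k.+2%:R^-1 <= tk k & tk k < rk k < 1],
    measurable_fun setT f, forall x, f (x + 2 * pi) = f x,
    forall k s, (\int[mu]_(t in `[s, (s + 2 * pi)%R]) `|wf sb a (rk k) t - f t|%:E <= (2 * 2^-1 ^+ k)%:E)%E &
    forall k s rho, tk k < rho < 1 ->
      (\int[mu]_(t in `[s, (s + 2 * pi)%R]) `|wf sb a rho t - f t|%:E <= (3 * 2^-1 ^+ k)%:E)%E].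
  by eapply boundary_function; eassumption.
exists f; split => //; first by eapply radial_limit_ae; eassumption.
exists rk; split => //.
  by move=> k; have [/andP[t0 _] _ /andP[tr r1]] := hrk k; rewrite (lt_trans t0 tr).
apply: (@squeeze_cvgr _ _ _ _ (fun k => 1 - k.+2%:R^-1) (fun=> 1)); last exact: cvg_cst.
  by apply: nearW => k; have [_ h1 /andP[h2 h3]] := hrk k; rewrite (le_trans h1 (ltW h2)) ltW.
rewrite -[X in _ --> X]subr0; apply: cvgB; first exact: cvg_cst.
by rewrite (cvg_shiftS (fun k => (k.+1%:R : R)^-1)); exact: cvg_harmonic.
Qed.

(** A square summable series is the product of itself and the constant 1, so the boundary theory for
    products covers it. *)
Lemma factor_l2 a (B : R) : (forall n, rs n a <= B) -> exists g h : nat -> C,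
  [/\ forall n, \sum_(k < n) nc (g k) ^+ 2 <= B + 1, forall n, \sum_(k < n) nc (h k) ^+ 2 <= B + 1 &
   forall n, (a n)%:C%C = \sum_(k < n.+1) g k * h (n - k)%N].
Proof.
move=> hB; have B0 : 0 <= B by have := hB 0; rewrite /rs big_ord0.
exists (fun k => (a k)%:C%C), (fun k => (((k == 0%N)%:R : R)%:C)%C); split.
- move=> n; apply: le_trans (_ : B <= _); last by rewrite lerDl.
  apply: le_trans (hB n); apply: ler_sum => k _.
  by rewrite nc_real real_normK ?num_real.
- case=> [|n]; first by rewrite big_ord0 addr_ge0.
  rewrite big_ord_recl big1 => [|i _]; rewrite nc_real /=; last by rewrite normr0 expr0n.
  by rewrite normr1 expr1n addr0 lerDr.
- have k1 : ((true%:R : R)%:C)%C = 1 :> C by [].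
  have k0 : ((false%:R : R)%:C)%C = 0 :> C by [].
  move=> n; rewrite big_ord_recr /= subnn eqxx k1 mulr1 big1 ?add0r// => i _.
  by rewrite subn_eq0 leqNgt ltn_ord k0 mulr0.
Qed.

Definition Q4 I (u w : 'I_4 -> R) : H := \sum_e u e *: qb R e + I * \sum_e w e *: qb R e.

Lemma qc_mul_lin I q e : qc e (I * q) = \sum_e' qc e' q * qc e (I * qb R e').
Proof.
rewrite {1}(qsum_basis q) mulr_sumr qc_sum; apply: eq_bigr => e' _.
by rewrite -scalerAr qcZ.
Qed.

Lemma qc_Q4 I u w e : qc e (Q4 I u w) = u e + \sum_e' w e' * qc e (I * qb R e').
Proof.
rewrite /Q4 qcD qc_sum_qb qc_mul_lin; congr (_ + _); apply: eq_bigr => e' _.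
by rewrite qc_sum_qb.
Qed.

(** The coefficients expressing the coordinate e of P + I Q through the eight real functions u and
    v. *)
Definition kap I (e : 'I_4) (j : J) : R := if j.1 then qc e (I * qb R j.2) else (j.2 == e)%:R.

Lemma sum_J (F : J -> R) : \sum_j F j = \sum_e F (false, e) + \sum_e F (true, e).
Proof.
rewrite (eq_bigr (fun p => F (p.1, p.2))) => [|[]//].
by rewrite -(pair_bigA _ (fun s e => F (s, e))) big_bool addrC.
Qed.

Lemma qc_Q4_sum I (F : bool -> 'I_4 -> R) e : qc e (Q4 I (F false) (F true)) = \sum_j kap I e j * F j.1 j.2.
Proof.
rewrite qc_Q4 sum_J /kap /=; congr (_ + _); last by apply: eq_bigr => e' _; rewrite mulrC.
rewrite (bigD1 e)//= eqxx mul1r big1 ?addr0// => i /negbTE ->.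
by rewrite mul0r.
Qed.

Lemma kap_le I e j : qsphere I -> `|kap I e j| <= 1.
Proof.
move=> hI; rewrite /kap; case: ifP => _; last by case: (_ == _); rewrite ?normr1 ?normr0.
by apply: le_trans (qc_le _ _) _; rewrite normqM (proj2 (qsphereP hI)) norm_qb mulr1.
Qed.

Lemma reg_eval_circle b I (r t : R) : (forall e, rregular (cq b e)) -> qsphere I -> 0 <= r < 1 ->
  reg_eval b (r *: qexp I t) = Q4 I (fun e => wf false (cq b e) r t) (fun e => wf true (cq b e) r t).
Proof.
move=> hb hI /andP[r0 r1].
have -> : r *: qexp I t = slice_pt I (r * cos t) (r * sin t) by rewrite /qexp /slice_pt scalerDr !scalerA.
rewrite reg_eval_slice// !exprMn -mulrDr cos2Dsin2 mulr1.
by rewrite -(expr1n _ 2) ltr_pXn2r ?nnegrE.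
Qed.

Section Link.
Variables (b : nat -> H) (F : bool -> 'I_4 -> R -> R).
Hypothesis rb : forall e, rregular (cq b e).
Hypothesis hF : forall sb e, bdry (wf sb (cq b e)) (F sb e).
Local Notation PQ I t := (Q4 I (fun e => F false e t) (fun e => F true e t)).

Lemma mF sb e : measurable_fun setT (F sb e). Proof. by case: (hF sb e). Qed.

Lemma measurable_PQ I e : measurable_fun setT (fun t => qc e (PQ I t)).
Proof.
rewrite (_ : (fun t => _) = fun t => \sum_j kap I e j * F j.1 j.2 t); last first.
  by apply/funext => t; rewrite (qc_Q4_sum I (fun sb e => F sb e t)).
apply: measurable_sum => j; apply: measurable_funM; [exact: measurable_cst|exact: mF].
Qed.

(** The exceptional set comes from the eight real boundary functions, so one null set serves all
    imaginary units. *)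
Lemma radial_lim_link : exists N, [/\ measurable N, mu N = 0%E &
  forall t, ~ N t -> forall I, qsphere I -> radial_lim b I t = PQ I t].
Proof.
have h (j : J) : {ae mu, forall t, wf j.1 (cq b j.2) r t @[r --> (1 : R)^'-] --> F j.1 j.2 t} by case: (hF j.1 j.2).
have [N [mN N0 hN]] := filter_forall _ h; exists N; split => // t Nt I hI.
have ht (j : J) : wf j.1 (cq b j.2) r t @[r --> (1 : R)^'-] --> F j.1 j.2 t.
  by move: j; apply: contrapT => nh; apply: Nt; exact: hN.
apply: cvg_lim; first exact: norm_hausdorff.
apply: (@cvg_trans _ (Q4 I (fun e => wf false (cq b e) r t) (fun e => wf true (cq b e) r t) @[r --> (1 : R)^'-])).
  apply: near_eq_cvg.
  have n0 : \forall r \near (1 : R)^'-, 0 < r by apply: nbhs_left_gt.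
  have n1 : \forall r \near (1 : R)^'-, r < 1 by exact: nbhs_left_lt.
  near=> r; rewrite reg_eval_circle//; apply/andP; split; last by near: r; exact: n1.
  by apply: ltW; near: r; exact: n0.
apply/cvg_quatP => e; rewrite /comp /=.
rewrite (_ : (fun r => _) = fun r => \sum_j kap I e j * wf j.1 (cq b j.2) r t); last first.
  by apply/funext => r; rewrite (qc_Q4_sum I (fun sb e => wf sb (cq b e) r t)).
rewrite (qc_Q4_sum I (fun sb e => F sb e t)).
by apply: cvg_sumr => j _; apply: cvgM; [exact: cvg_cst|exact: ht].
Unshelve. all: by end_near.
Qed.

(** 64 = 2 * 8 * 4: eight real functions enter each coordinate, centring at the mean doubles the
    bound, and four coordinates are added. *)
Lemma BMO_slice_le (m : R) I : qsphere I ->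
  (forall sb e s t, s < t -> t <= s + 2 * pi -> exists c,
    (\int[mu]_(x in `[s, t]) `|F sb e x - c|%:E <= (m * (t - s))%:E)%E) ->
  (BMO_slice b I <= (64 * m)%:E)%E.
Proof.
move=> hI osc; apply: ge_ereal_sup => _ [s [t [st ts ->]]].
have [N [mN N0 hN]] := radial_lim_link; have ts0 : 0 < t - s by rewrite subr_gt0.
have mI : measurable (`[s, t]%classic : set R) by exact: measurable_itv.
rewrite lee_pdivrMl// -EFinM.
pose av e := (t - s)^-1 * \int[mu]_(x in `[s, t]) qc e (PQ I x).
have avE e : qc e (Defs.mean b I s t) = av e.
  rewrite /Defs.mean qcZ /av; congr (_ * _).
  have -> : qc e (qintegral `[s, t]%classic (radial_lim b I)) = \int[mu]_(x in `[s, t]) qc e (radial_lim b I x).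
    by move: e; apply: forall4.
  by apply: (@Rintegral_ae_eq _ N (fun x => qc e (radial_lim b I x)) (fun x => qc e (PQ I x)) mN N0) => x Nx; rewrite hN.
have oe e : (\int[mu]_(x in `[s, t]) `|qc e (PQ I x) - av e|%:E <= (2 * (8 * m) * (t - s))%:E)%E.
  have /choice[c hc] : forall j : J, exists c, (\int[mu]_(x in `[s, t]) `|F j.1 j.2 x - c|%:E <= (m * (t - s))%:E)%E.
    by move=> j; exact: osc.
  apply: (@mean_osc _ (\sum_j kap I e j * c j)) => //; first exact: measurable_PQ.
  have := @osc_lincomb J (kap I e) (fun j => F j.1 j.2) c s t (m * (t - s)) (fun j => mF j.1 j.2)
    (fun j => kap_le e j hI) hc.
  rewrite card_prod card_bool card_ord -[(2 * 4)%N]/8%N mulrA.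
  by under eq_integral do rewrite -(qc_Q4_sum I (fun sb e => F sb e _)).
apply: (@le_trans _ _ (\int[mu]_(x in `[s, t]) \sum_e `|qc e (PQ I x) - av e|%:E)%E).
  apply: (integral_ae_le mN N0) => x _; first by rewrite lee_fin.
    by apply: sume_ge0 => e _; rewrite lee_fin.
  move=> Nx; rewrite hN// sumEFin lee_fin; apply: le_trans (norm_le_qc _) _.
  by apply: ler_sum => e _; rewrite qcB avE.
rewrite ge0_integral_sum//; last first.
  move=> e; apply/measurable_EFinP; apply: measurableT_comp => //.
  by apply: measurable_funB; [apply: measurable_funTS; exact: measurable_PQ|exact: measurable_cst].
apply: (@le_trans _ _ (\sum_(e : 'I_4) (2 * (8 * m) * (t - s))%:E)%E); first by apply: lee_sum => e _.
rewrite sumEFin sumr_const card_ord lee_fin -[_ *+ 4]mulr_natl le_eqVlt; apply/orP; left; apply/eqP; ring.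
Qed.

(** P is half the sum of the values on the slices of I and -I, and Q is -I times half their
    difference. *)
Lemma PQ_components I e t : qsphere I ->
  F false e t = \sum_(j : J) (if j.1 then 2^-1 else 2^-1) * (j.2 == e)%:R * qc j.2 (PQ (if j.1 then - I else I) t) /\
  F true e t = \sum_(j : J) (if j.1 then - 2^-1 else 2^-1) * qc e (- I * qb R j.2) * qc j.2 (PQ (if j.1 then - I else I) t).
Proof.
move=> hI; pose P : H := \sum_e F false e t *: qb R e; pose Q : H := \sum_e F true e t *: qb R e.
have E1 e' : qc e' (PQ I t) = qc e' P + qc e' (I * Q) by rewrite /Q4 qcD.
have E2 e' : qc e' (PQ (- I) t) = qc e' P - qc e' (I * Q) by rewrite /Q4 qcD mulNr qcN.
split; rewrite sum_J /=.
  rewrite (bigD1 e)//= [X in _ + X](bigD1 e)//= eqxx.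
  rewrite [X in _ + X + _]big1 => [|i /negbTE ->]; last by rewrite mulr0 mul0r.
  rewrite [X in _ + (_ + X)]big1 => [|i /negbTE ->]; last by rewrite mulr0 mul0r.
  change (nat_of_bool true) with 1%N; rewrite E1 E2 ?mulr1n /P !qc_sum_qb; move: (qc e (I * Q)) (F false e t) => X Y; lra.
have -> : F true e t = \sum_e' qc e' (I * Q) * qc e (- I * qb R e').
  by rewrite -qc_mul_lin mulNr mulrA (qsphere_sqr hI) mulN1r opprK /Q qc_sum_qb.
by rewrite !sum4 !E1 !E2; field; rewrite ?pnatr_eq0.
Qed.

(** The 8 counts the summands, two slices with four coordinates each, from which one component is
    recovered. *)
Lemma osc_of_BMO (m : R) I : qsphere I -> (BMO_slice b I <= m%:E)%E -> (BMO_slice b (- I)%R <= m%:E)%E ->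
  forall sb e s t, s < t -> t <= s + 2 * pi -> exists c,
    (\int[mu]_(x in `[s, t]) `|F sb e x - c|%:E <= (8 * m * (t - s))%:E)%E.
Proof.
move=> hI h1 h2 sb e s t st ts.
pose K (s' : bool) : H := if s' then - I else I.
have hI' : qsphere (- I) by rewrite /qsphere /= sqrrN.
have [N [mN N0 hN]] := radial_lim_link; have ts0 : 0 < t - s by rewrite subr_gt0.
have hJ (s' : bool) : qsphere (K s') by case: s'.
have o (j : J) : (\int[mu]_(x in `[s, t]) `|qc j.2 (PQ (K j.1) x) - qc j.2 (Defs.mean b (K j.1) s t)|%:E
    <= (m * (t - s))%:E)%E.
  apply: (@le_trans _ _ (\int[mu]_(x in `[s, t]) `|radial_lim b (K j.1) x - Defs.mean b (K j.1) s t|%:E)%E).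
    apply: (integral_ae_le mN N0) => x _; rewrite ?lee_fin // => Nx.
    by rewrite hN// -qcB qc_le.
  have hs : (BMO_slice b (K j.1) <= m%:E)%E by rewrite /K; case: j.1.
  have : ((t - s)^-1%:E * \int[mu]_(x in `[s, t]) `|radial_lim b (K j.1) x - Defs.mean b (K j.1) s t|%:E <= m%:E)%E.
    by apply: le_trans hs; apply: ereal_sup_ubound; exists s, t.
  by rewrite lee_pdivrMl// -EFinM mulrC.
have half1 : `|2^-1 : R| <= 1 by rewrite ger0_norm ?invr_ge0// invf_le1// ler1n.
have card8 : #|{: J}|%:R = 8 :> R by rewrite card_prod card_bool card_ord.
have mG (j : J) : measurable_fun setT (fun x => qc j.2 (PQ (K j.1) x)) by exact: measurable_PQ.
case: sb.
- pose k (j : J) : R := (if j.1 then - 2^-1 else 2^-1) * qc e (- I * qb R j.2).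
  have hk j : `|k j| <= 1.
    rewrite /k normrM; have -> : `|if j.1 then - 2^-1 else 2^-1 : R| = `|2^-1| by case: j.1; rewrite ?normrN.
    apply: le_trans (_ : `|2^-1| * 1 <= 1); last by rewrite mulr1.
    rewrite ler_wpM2l//; apply: le_trans (qc_le _ _) _.
    by rewrite normqM (proj2 (qsphereP hI')) norm_qb mulr1.
  have := osc_lincomb mG hk o; rewrite card8 mulrA => oc; eexists; apply: le_trans oc.
  by under eq_integral do rewrite (proj2 (PQ_components e _ hI)); exact: lexx.
- pose k (j : J) : R := (if j.1 then 2^-1 else 2^-1) * (j.2 == e)%:R.
  have hk j : `|k j| <= 1.
    rewrite /k normrM; have -> : (if j.1 then 2^-1 else 2^-1 : R) = 2^-1 by case: j.1.
    apply: le_trans (_ : `|2^-1| * 1 <= 1); last by rewrite mulr1.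
    by rewrite ler_wpM2l//; case: (_ == _); rewrite ?normr1 ?normr0.
  have := osc_lincomb mG hk o; rewrite card8 mulrA => oc; eexists; apply: le_trans oc.
  by under eq_integral do rewrite (proj1 (PQ_components e _ hI)); exact: lexx.
Qed.
End Link.

(** |x| <= 1 + x^2 reduces the L1 norm to Parseval's identity; the second 1 in [2 + B] is the
    truncation error. *)
Lemma wf_L1 a (B : R) (sb : bool) (r : R) : rregular a -> (forall n, rs n a <= B) -> 0 <= r < 1 ->
  circ (fun t => `|wf sb a r t|) <= 2 * pi * (2 + B).
Proof.
move=> ha hB r01; have /andP[r0 r1] := r01; have [B1 [q [B0 q01 hw]]] := wf_tail ha r01.
have [N _ hN] := @cvgr_le _ _ _ _ _ _ (geo0 B1 q01) _ (@ltr01 R).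
have hq : B1 * q ^+ N <= 1 := hN N (leqnn N).
have rr : 0 <= r <= r by rewrite r0 lexx.
pose U t := pc N (dil a r) t ^+ 2 + ps N (dil a r) t ^+ 2.
have cU : continuous U by apply: contD; apply: contX; [exact: pc_cont|exact: ps_cont].
have pi0 := pi_gt0 R.
have pp : - pi <= pi by lra.
apply: (@le_trans _ _ (circ (fun t => 2 + U t))).
  apply: le_rint; [by apply: cont_norm; exact: wf_cont|by apply: contD; [exact: contC|]|move=> t _].
  have h1 := le_trans (hw sb r t N rr) hq.
  have h2 : `|wf sb a r t| <= 1 + `|tp sb N (dil a r) t|.
    by rewrite -(subrK (tp sb N (dil a r) t) (wf sb a r t)); apply: le_trans (ler_normD _ _) _; rewrite lerD2r.
  have h3 : `|tp sb N (dil a r) t| <= 1 + U t.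
    have h4 : tp sb N (dil a r) t ^+ 2 <= U t by rewrite /U; case: (sb); rewrite ?lerDl ?lerDr sqr_ge0.
    apply: le_trans (_ : 1 + `|tp sb N (dil a r) t| ^+ 2 <= _); last by rewrite real_normK ?num_real// lerD2l.
    by have := sqr_ge0 (`|tp sb N (dil a r) t| - 1); have := normr_ge0 (tp sb N (dil a r) t); nra.
  lra.
rewrite rintD//; last exact: contC.
rewrite rint_cst//.
have -> : circ U = 2 * pi * \sum_(j < N) ((dil a r j) ^+ 2 + 0 ^+ 2).
  rewrite -(parseval N (dil a r) (fun=> 0)); apply: rint_ext => t; rewrite /U /pc /ps.
  by congr (_ ^+ 2 + _ ^+ 2); apply: eq_bigr => j _; rewrite mul0r ?subr0 ?addr0.
have -> : 2 * (pi - - pi) = 2 * pi * 2 by ring.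
rewrite -mulrDr ler_wpM2l ?mulr_ge0 ?(ltW pi0)// lerD2l; apply: le_trans (hB N).
apply: ler_sum => j _; rewrite expr0n addr0 /dil exprMn -[leRHS]mulr1 ler_wpM2l ?sqr_ge0//.
by apply: exprn_ile1; [exact: exprn_ge0|apply: exprn_ile1 => //; exact: ltW].
Qed.

Lemma Q4_cont b I (r : R) : (forall e, rregular (cq b e)) -> 0 <= r < 1 ->
  continuous (fun t => `|Q4 I (fun e => wf false (cq b e) r t) (fun e => wf true (cq b e) r t)|).
Proof.
move=> hb r01.
rewrite (_ : (fun t => _) = fun t => Num.sqrt (\sum_e (\sum_j kap I e j * wf j.1 (cq b j.2) r t) ^+ 2)); last first.
  apply/funext => t; rewrite -[LHS]normr_id -sqrtr_sqr normsqE; congr Num.sqrt; apply: eq_bigr => e _.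
  by rewrite (qc_Q4_sum I (fun sb e => wf sb (cq b e) r t)).
apply: (@cont_comp R Num.sqrt); first exact: sqrt_continuous.
move=> x; apply: cvg_sumr => e _; move: x; apply: contX => x.
by apply: cvg_sumr => j _; apply: cvgM; [exact: cvg_cst|exact: wf_cont].
Qed.

Lemma H1_of_l2 b (B : R) : regular b -> (forall e n, rs n (cq b e) <= B) -> H1 b.
Proof.
move=> rb hB; have reg e : rregular (cq b e) := regular_rregular e rb.
split => //; have pi0 := pi_gt0 R.
apply: (@le_lt_trans _ _ (8 * (2 + B))%:E); last by rewrite ltry.
apply: ge_ereal_sup => _ [I [r [hI /andP[r0 r1] ->]]].
have r01 : 0 <= r < 1 by rewrite (ltW r0).
rewrite lee_pdivrMl ?mulr_gt0// -EFinM.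
have cw sb e : continuous (fun t => `|wf sb (cq b e) r t|) by apply: cont_norm; exact: wf_cont.
apply: (@le_trans _ _ (\int[mu]_(t in `[(- pi)%R, pi]) \sum_(j : J) `|wf j.1 (cq b j.2) r t|%:E)%E).
  apply: integral_mono; [by []|by move=> t _; rewrite lee_fin|by move=> t _; apply: sume_ge0 => j _; rewrite lee_fin|move=> t _].
  rewrite reg_eval_circle// sumEFin lee_fin sum_J /= /Q4; apply: le_trans (ler_normD _ _) _; apply: lerD.
    by apply: le_trans (ler_norm_sum _ _ _) _; apply: ler_sum => e _; rewrite normrZ norm_qb mulr1.
  rewrite normqM (proj2 (qsphereP hI)) mul1r.
  by apply: le_trans (ler_norm_sum _ _ _) _; apply: ler_sum => e _; rewrite normrZ norm_qb mulr1.
rewrite ge0_integral_sum//; try (by move=> j; apply/measurable_EFinP; apply: cont_meas).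
apply: (@le_trans _ _ (\sum_(j : J) (2 * pi * (2 + B))%:E)%E).
  by apply: lee_sum => j _; rewrite rint_EFin// lee_fin; apply: wf_L1.
rewrite sumEFin sumr_const card_prod card_bool card_ord lee_fin -mulr_natl.
by rewrite -[(2 * 4)%N]/8%N le_eqVlt; apply/orP; left; apply/eqP; ring.
Qed.

(** With W = I Q, both 2 |P| and 2 |W| are at most |P + W| + |P - W|. The H1 bound on the slices of
    I and -I thus controls u + i v for each coordinate, uniformly in the radius, with 2 pi M for
    each slice. *)
Lemma factor_of_H1 b e : H1 b -> exists (g h : nat -> C) (B : R),
  [/\ forall n, \sum_(k < n) nc (g k) ^+ 2 <= B, forall n, \sum_(k < n) nc (h k) ^+ 2 <= B &
   forall n, (cq b e n)%:C%C = \sum_(k < n.+1) g k * h (n - k)%N].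
Proof.
move=> [rb]; set S := ereal_sup _ => hS; have reg e' : rregular (cq b e') := regular_rregular e' rb.
have pi0 := pi_gt0 R; pose I : H := qb R 1.
have hI : qsphere I by rewrite /qsphere /= expr2; apply: quat_eqP; apply: forall4; rewrite /qc /= ; ring.
have hI' : qsphere (- I) by rewrite /qsphere /= sqrrN.
have hle K r : qsphere K -> 0 < r < 1 ->
  ((((2 * pi)^-1)%R%:E * \int[mu]_(t in `[(- pi)%R, pi]) `|reg_eval b (r *: qexp K t)|%:E) <= S)%E.
  by move=> hK r01; apply: ereal_sup_ubound; exists K, r.
have S0 : (0 <= S)%E.
  have h := hle I 2^-1 hI; apply: le_trans (h _); last by rewrite invr_gt0 ltr0n/= invf_lt1// ltr1n.
  by apply: mule_ge0; rewrite ?lee_fin ?invr_ge0 ?mulr_ge0 ?(ltW pi0)//; apply: integral_ge0 => t _; rewrite lee_fin.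
have Sf : S \is a fin_num by rewrite ge0_fin_numE.
pose M : R := fine S; have SM : S = M%:E by rewrite fineK.
have M0 : 0 <= M by rewrite -lee_fin -SM.
have h4 : 0 <= 4 * pi * M by rewrite !mulr_ge0// ltW.
have [rho h|g [h [hg hh hc]]] := @H1_factor R (cq b e) (4 * pi * M) (reg e) h4; last by exists g, h, (4 * pi * M + 3).
have /andP[r0 r1] := h; have r01 : 0 <= rho < 1 by rewrite (ltW r0).
pose N K t := `|Q4 K (fun e => wf false (cq b e) rho t) (fun e => wf true (cq b e) rho t)|.
have cN K : continuous (N K) by exact: Q4_cont.
have hN K : qsphere K -> circ (N K) <= 2 * pi * M.
  move=> hK; have := hle K rho hK h; rewrite SM lee_pdivrMl ?mulr_gt0// -EFinM -lee_fin -rint_EFin//.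
  by under eq_integral do rewrite reg_eval_circle//.
have -> : 4 * pi * M = 2 * pi * M + 2 * pi * M by ring.
apply: le_trans (lerD (hN I hI) (hN (- I) hI')); rewrite -rintD//.
have [cu cv] := @uf_cont R (cq b e) rho (reg e) r01.
have cnc : continuous (fun t => nc (Complex (uf (cq b e) rho t) (vf (cq b e) rho t))).
  rewrite (_ : (fun t => _) = fun t => Num.sqrt (uf (cq b e) rho t ^+ 2 + vf (cq b e) rho t ^+ 2)); last first.
    by apply/funext => t; rewrite nc_sqrt.
  by apply: (@cont_comp R Num.sqrt); [exact: sqrt_continuous|apply: contD; apply: contX].
apply: le_rint => //; first by apply: contD.
move=> t _; apply: le_trans (nc_le_abs _ _) _; rewrite /N.
set P : H := \sum_e wf false (cq b e) rho t *: qb R e; set Q : H := \sum_e wf true (cq b e) rho t *: qb R e.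
have nI : `|I| = 1 := proj2 (qsphereP hI).
have h1 : `|uf (cq b e) rho t| <= `|P|.
  by have := qc_le e P; rewrite /P qc_sum_qb.
have h2 : `|vf (cq b e) rho t| <= `|I * Q|.
  by rewrite normqM nI mul1r; have := qc_le e Q; rewrite /Q qc_sum_qb.
have E1 : Q4 I (fun e => wf false (cq b e) rho t) (fun e => wf true (cq b e) rho t) = P + I * Q by [].
have E2 : Q4 (- I) (fun e => wf false (cq b e) rho t) (fun e => wf true (cq b e) rho t) = P - I * Q by rewrite /Q4 mulNr.
rewrite E1 E2; move: (I * Q) h2 => W h2.
have t1 : 2 * `|P| <= `|P + W| + `|P - W|.
  apply: le_trans (ler_normD (P + W) (P - W)); rewrite addrACA subrr addr0 -mulr2n.
  by rewrite normrMn mulr_natl.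
have t2 : 2 * `|W| <= `|P + W| + `|P - W|.
  apply: le_trans (ler_normB (P + W) (P - W)).
  have -> : P + W - (P - W) = W *+ 2 by rewrite opprB [W - P]addrC addrACA subrr add0r mulr2n.
  by rewrite normrMn mulr_natl.
lra.
Qed.
End BoundaryValues.

(** * From mean oscillation to the Carleson inequality *)

Section CarlesonUpper.
Variable R : realType.
Local Notation H := (quat R).
Local Notation A := {poly {poly R}}.
Local Notation pi := (@pi R).
Implicit Types (a c : nat -> R) (b : nat -> H) (z : R * R).

(** 40 = 2 (16 + 4): the oscillation of the dilate plus 4 beta for the truncation, doubled by
    recentring at the mean of the polynomial. *)
Lemma dil_garsia a (beta r : R) : rregular a -> 0 < beta -> 0 < r < 1 ->
  (forall (sb : bool) (s t : R), s < t -> t <= s + 2 * pi ->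
    rint s t (fun x => `|wf sb a r x - mean (wf sb a r) s t|) <= 16 * beta * (t - s)) ->
  exists N1, forall N, (N1 <= N)%N -> forall z, disc 1 z ->
    ev (wt 1 * Sb N (trunc N (dil a r))) z <= 2 ^+ 18 * (40 * beta) ^+ 2.
Proof.
move=> ha b0 r01 osc; have r01' : 0 <= r < 1 by case/andP: r01 => r0 r1; rewrite (ltW r0).
have [B [q [B0 q01 hB]]] := wf_tail ha r01'.
have b4 : 0 < 4 * beta by rewrite mulr_gt0.
have [N1 _ hN] := @cvgr_le _ _ _ _ _ _ (geo0 B q01) _ b4; exists N1 => N nN z hz.
have hq : B * q ^+ N <= 4 * beta := hN N nN.
have rr : 0 <= r <= r by rewrite lexx; case/andP: r01' => ->.
have tosc (sb : bool) (s t : R) : s < t -> t <= s + 2 * pi ->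
  rint s t (fun x => `|tp sb N (trunc N (dil a r)) x - mean (tp sb N (trunc N (dil a r))) s t|) <= 40 * beta * (t - s).
  move=> st ts; apply: le_trans (osc_mean (mean (wf sb a r) s t) (@tp_cont R sb N _) st) _.
  have cw : continuous (fun x => `|wf sb a r x - mean (wf sb a r) s t|).
    by apply: cont_norm; apply: contB; [exact: wf_cont|exact: contC].
  have -> : 40 * beta * (t - s) = 2 * (16 * beta * (t - s) + 4 * beta * (t - s)) by ring.
  rewrite ler_wpM2l//; apply: le_trans (lerD (osc sb s t st ts) (lexx _)).
  rewrite -(rint_cst (4 * beta) (ltW st)) -(rintD _ _ cw (@contC R _)).
  apply: le_rint; first by apply: cont_norm; apply: contB; [exact: tp_cont|exact: contC].
    by apply: contD; [exact: cw|exact: contC].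
  move=> x _; rewrite tp_trunc; have h1 := le_trans (hB sb r x N rr) hq.
  have -> : tp sb N (dil a r) x - mean (wf sb a r) s t = (wf sb a r x - mean (wf sb a r) s t) - (wf sb a r x - tp sb N (dil a r) x) by ring.
  by apply: le_trans (ler_normB _ _) _; rewrite lerD2l.
apply: (@garsia_upper R N (trunc N (dil a r)) (40 * beta)) => //.
- by move=> n Nn; rewrite /trunc ltnNge Nn.
- by rewrite mulr_gt0.
- exact: (tosc false).
- exact: (tosc true).
Qed.

Lemma weighted_geo_sum (q : R) : 0 <= q < 1 -> exists S : R, 0 <= S /\ forall N, \sum_(k < N) k.+1%:R * q ^+ k <= S.
Proof.
move=> /andP[q0 q1]; pose w := Num.sqrt q; have w0 : 0 <= w by exact: sqrtr_ge0.
have w2 : w ^+ 2 = q by rewrite sqr_sqrtr.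
have w1 : w < 1 by rewrite -(@ltr_pXn2r _ 2) ?nnegrE// expr1n w2.
have w01 : 0 <= w < 1 by rewrite w0.
have i0 : 0 <= (1 - w)^-1 by rewrite invr_ge0 subr_ge0 ltW.
exists ((1 - w)^-1 * (w ^+ 0 / (1 - w))); split; first by rewrite mulr_ge0// expr0 mul1r.
move=> N; apply: le_trans (ler_wpM2l i0 (@geo_sum_le R w 0 N w01)).
rewrite big_mkord mulr_sumr; apply: ler_sum => k _.
by rewrite -w2 -exprM mul2n -addnn exprD mulrA ler_wpM2r ?exprn_ge0// natr_expr_le.
Qed.

(** Since 1 - r^(k+1) <= (k+1) (1 - r), dilation changes the partial sums by at most 1 - r times a
    convergent weighted geometric sum, uniformly in the truncation index. *)
Lemma dilated_series_cvg c (w : nat -> R) (B q l : R) (r : nat -> R) (m : nat -> nat) : 0 <= q < 1 -> 0 <= B ->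
  (forall k, `|c k * w k| <= B * q ^+ k) -> (fun N => \sum_(k < N) c k * w k) @ \oo --> l ->
  (forall n, 0 <= r n <= 1) -> r n @[n --> \oo] --> (1 : R) -> (forall n, (n <= m n)%N) ->
  \sum_(k < m n) c k * r n ^+ k.+1 * w k @[n --> \oo] --> l.
Proof.
move=> q01 B0 hc cl r01 r1 hm; have [S [S0 hS]] := weighted_geo_sum q01.
have my : m @ \oo --> \oo by apply/cvgnyPge => K; exists K => // n /= Kn; exact: leq_trans (hm n).
have yl : \sum_(k < m n) c k * w k @[n --> \oo] --> l := cvg_comp _ _ my cl.
have d0 : \sum_(k < m n) c k * r n ^+ k.+1 * w k - \sum_(k < m n) c k * w k @[n --> \oo] --> (0 : R).
  have e0 : B * S * (1 - r n) @[n --> \oo] --> (0 : R).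
    have h : B * S * (1 - r n) @[n --> \oo] --> B * S * (1 - 1).
      by apply: cvgM; [exact: cvg_cst|apply: cvgB; [exact: cvg_cst|exact: r1]].
    by rewrite subrr mulr0 in h.
  have e1 : - (B * S * (1 - r n)) @[n --> \oo] --> (0 : R) by rewrite -[X in _ --> X]oppr0; exact: cvgN.
  apply: (@squeeze_cvgr _ _ _ _ (fun n => - (B * S * (1 - r n))) (fun n => B * S * (1 - r n))) => //.
  apply: nearW => n; rewrite -ler_norml -sumrB; have /andP[rn0 rn1] := r01 n.
  apply: le_trans (ler_norm_sum _ _ _) _.
  apply: (@le_trans _ _ (\sum_(k < m n) B * (1 - r n) * (k.+1%:R * q ^+ k))); last first.
    have -> : B * S * (1 - r n) = B * (1 - r n) * S by ring.
    by rewrite -mulr_sumr ler_wpM2l ?mulr_ge0 ?subr_ge0.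
  apply: ler_sum => k _.
  have -> : c k * r n ^+ k.+1 * w k - c k * w k = (c k * w k) * (r n ^+ k.+1 - 1 ^+ k.+1) by rewrite expr1n; ring.
  have h1 := @expr_lip R k.+1 (r n) 1 (r01 n) (ltac:(by rewrite ler01 lexx)).
  have -> : B * (1 - r n) * (k.+1%:R * q ^+ k) = (B * q ^+ k) * (k.+1%:R * (1 - r n)) by ring.
  rewrite normrM; apply: ler_pM => //.
  by apply: le_trans h1 _; rewrite distrC ger0_norm ?subr_ge0.
have yl' := cvgD d0 yl; rewrite add0r in yl'.
have -> : (fun n => \sum_(k < m n) c k * r n ^+ k.+1 * w k) =
  (fun n => (\sum_(k < m n) c k * r n ^+ k.+1 * w k - \sum_(k < m n) c k * w k) + \sum_(k < m n) c k * w k).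
  by apply/funext => n; rewrite subrK.
exact: yl'.
Qed.

Lemma disc_radius z : disc 1 z -> exists rho : R, [/\ 0 <= rho < 1 & z.1 ^+ 2 + z.2 ^+ 2 <= rho ^+ 2].
Proof.
rewrite /disc /= expr1n => hz; have z0 : 0 <= z.1 ^+ 2 + z.2 ^+ 2 by rewrite addr_ge0 ?sqr_ge0.
exists (Num.sqrt (z.1 ^+ 2 + z.2 ^+ 2)); rewrite sqr_sqrtr// lexx sqrtr_ge0; split => //=.
by rewrite -(@ltr_pXn2r _ 2) ?nnegrE ?sqrtr_ge0// expr1n sqr_sqrtr.
Qed.

Lemma da_trunc m c k : da (trunc m.+1 c) k = if (k < m)%N then da c k else 0.
Proof. by rewrite /da /trunc ltnS; case: ifP => //; rewrite mul0rn. Qed.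

Lemma mod2_trunc_cvg a (m : nat -> nat) z : rregular a -> disc 1 z -> (forall n, (n <= m n)%N) ->
  ev (mod2 (m n).+1 (trunc (m n).+1 a)) z @[n --> \oo] --> Ufun a z ^+ 2 + Vfun a z ^+ 2.
Proof.
move=> ha /disc_radius[rho [r01 hz]] hm; have [B [q [B0 q01 hU]]] := UV_tail ha r01.
have [c1 c2 _] := hU z hz.
have my : (fun n => (m n).+1) @ \oo --> \oo.
  by apply/cvgnyPge => K; exists K => // n /= Kn; apply: leq_trans (leqnSn _); exact: leq_trans (hm n).
have e1 n : ev (re n (trunc n a)) z = ev (re n a) z.
  by rewrite !ev_re; apply: eq_bigr => k _; rewrite /trunc ltn_ord.
have e2 n : ev (im n (trunc n a)) z = ev (im n a) z.
  by rewrite !ev_im; apply: eq_bigr => k _; rewrite /trunc ltn_ord.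
have d1 := cvg_comp _ _ my c1; have d2 := cvg_comp _ _ my c2.
rewrite (_ : (fun n => _) = fun n => ev (re (m n).+1 a) z * ev (re (m n).+1 a) z + ev (im (m n).+1 a) z * ev (im (m n).+1 a) z).
  by rewrite !expr2; apply: cvgD; apply: cvgM.
by apply/funext => n; rewrite ev_mod2 e1 e2 !expr2.
Qed.

Lemma mod2_dilate_cvg a (r : nat -> R) (m : nat -> nat) z : rregular a -> disc 1 z ->
  (forall n, 0 <= r n <= 1) -> r n @[n --> \oo] --> (1 : R) -> (forall n, (n <= m n)%N) ->
  ev (mod2 (m n).+1 (da (trunc (m n).+1 (dil a (r n))))) z @[n --> \oo] --> Ufun (da a) z ^+ 2 + Vfun (da a) z ^+ 2.
Proof.
move=> ha /disc_radius[rho [r01 hz]] r1 rl hm; have hda := rregular_da ha.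
have [B [q [B0 q01 hU]]] := UV_tail hda r01; have [c1 c2 _] := hU z hz.
have [B' [r' [B0' /andP[rr r'1] hB']]] := rregular_le hda r01.
have /andP[rho0 _] := r01; have r'0 : 0 < r' := le_lt_trans rho0 rr.
have q'01 : 0 <= rho / r' < 1 by rewrite divr_ge0 ?(ltW r'0)//= ltr_pdivrMr// mul1r.
have bz k : `|da a k * ev (zc R k) z| <= B' * (rho / r') ^+ k.
  by apply: le_trans (hB' k); rewrite normrM ler_wpM2l//; have [] := zc_le k rho0 hz.
have bs k : `|da a k * ev (zs R k) z| <= B' * (rho / r') ^+ k.
  by apply: le_trans (hB' k); rewrite normrM ler_wpM2l//; have [] := zc_le k rho0 hz.
have c1' : (fun N => \sum_(k < N) da a k * ev (zc R k) z) @ \oo --> Ufun (da a) z.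
  by rewrite (_ : (fun N => _) = fun N => ev (re N (da a)) z) //; apply/funext => N; rewrite ev_re.
have c2' : (fun N => \sum_(k < N) da a k * ev (zs R k) z) @ \oo --> Vfun (da a) z.
  by rewrite (_ : (fun N => _) = fun N => ev (im N (da a)) z) //; apply/funext => N; rewrite ev_im.
have d1 := dilated_series_cvg q'01 B0' bz c1' r1 rl hm.
have d2 := dilated_series_cvg q'01 B0' bs c2' r1 rl hm.
have e n (w : nat -> R) : \sum_(k < (m n).+1) da (trunc (m n).+1 (dil a (r n))) k * w k = \sum_(k < m n) da a k * r n ^+ k.+1 * w k.
  rewrite big_ord_recr /= da_trunc ltnn mul0r addr0; apply: eq_bigr => k _.
  by rewrite da_trunc ltn_ord /da /dil -mulrnAl.
rewrite (_ : (fun n => _) = fun n => (\sum_(k < m n) da a k * r n ^+ k.+1 * ev (zc R k) z) * (\sum_(k < m n) da a k * r n ^+ k.+1 * ev (zc R k) z)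
  + (\sum_(k < m n) da a k * r n ^+ k.+1 * ev (zs R k) z) * (\sum_(k < m n) da a k * r n ^+ k.+1 * ev (zs R k) z)).
  by rewrite !expr2; apply: cvgD; apply: cvgM.
by apply/funext => n; rewrite ev_mod2 ev_re ev_im (e n (fun k => ev (zc R k) z)) (e n (fun k => ev (zs R k) z)) !expr2.
Qed.

Lemma pi_le_four : pi <= 4.
Proof. by have := @pi_ge2 R; have /andP[] := @pihalf_02 R; lra. Qed.

(** The disc inequality needs finitely supported sequences. For each n a truncation index is chosen,
    common to the four coordinates of [b], beyond which the dilate of radius 1 - 1/(n+2) satisfies
    the Garsia bound. *)
Lemma carleson_of_osc b (beta : R) : regular b -> 0 < beta ->
  (forall e (r : R) (sb : bool) (s t : R), 0 < r < 1 -> s < t -> t <= s + 2 * pi ->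
    rint s t (fun x => `|wf sb (cq b e) r x - mean (wf sb (cq b e) r) s t|) <= 16 * beta * (t - s)) ->
  carleson_bound (mu_density b) (2 ^+ 40 * beta ^+ 2).
Proof.
move=> rb b0 osc; split; first by rewrite mulr_ge0 ?exprn_ge0// ltW.
move=> f [rf lf]; have [x [x0 fx hx]] := l2P lf; rewrite fx -EFin_expe -EFinM.
have reg e : rregular (cq b e) := regular_rregular e rb.
have regf e : rregular (cq f e) := regular_rregular e rf.
pose G : R := 2 ^+ 18 * (40 * beta) ^+ 2.
have G0 : 0 < G by rewrite mulr_gt0 ?exprn_gt0// mulr_gt0.
pose rn n : R := 1 - n.+2%:R^-1.
have rn01 n : 0 < rn n < 1.
  rewrite /rn subr_gt0 ltrBlDr ltrDl invr_gt0 ltr0n andbT invf_lt1 ?ltr0n//.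
  by rewrite ltr1n.
have rn1 : rn n @[n --> \oo] --> (1 : R).
  rewrite -[X in _ --> X]subr0; apply: cvgB; first exact: cvg_cst.
  by rewrite (cvg_shiftS (fun k => (k.+1%:R : R)^-1)); exact: cvg_harmonic.
have /choice[m hm] : forall n, exists m, (n <= m)%N /\ forall e z, disc 1 z ->
  ev (wt 1 * Sb m.+1 (trunc m.+1 (dil (cq b e) (rn n)))) z <= G.
  move=> n; have /choice[N1 hN1] : forall e, exists N1, forall N, (N1 <= N)%N -> forall z, disc 1 z ->
    ev (wt 1 * Sb N (trunc N (dil (cq b e) (rn n)))) z <= G.
    by move=> e; apply: dil_garsia => // sb s t; exact: osc.
  exists (n + \sum_e N1 e)%N; split; first exact: leq_addr.
  move=> e; apply: hN1; rewrite (bigD1 e)//=; apply: leq_trans (leqnSn _).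
  by apply: leq_trans (leq_addl _ _); exact: leq_addr.
have hm1 n : (n <= m n)%N by case: (hm n).
(* [f] is truncated, [b] dilated and truncated; the limit in n is taken afterwards by Fatou's lemma
   inside [ball_upper]. *)
pose p n : A := wt 1 * ((\sum_e mod2 (m n).+1 (trunc (m n).+1 (cq f e))) *
  (\sum_e mod2 (m n).+1 (da (trunc (m n).+1 (dil (cq b e) (rn n)))))).
have r01 : 0 < (1 : R) <= 1 by rewrite ltr01 lexx.
have K0 : 0 <= 64 * G * x ^+ 2 by rewrite mulr_ge0 ?sqr_ge0// mulr_ge0// ltW.
apply: le_trans (@ball_upper R b f p (64 * G * x ^+ 2) K0 reg regf _ _ _) _.
- move=> n z hz; rewrite /p !evM mulr_ge0 ?disc_wt_ge0//.
  by rewrite !ev_sum mulr_ge0//; apply: sumr_ge0 => e _; rewrite ev_mod2 addr_ge0 ?sqr_ge0.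
- move=> n; set M := (m n).+1.
  have -> : p n = \sum_e \sum_e' wt 1 * (mod2 M (trunc M (cq f e)) * mod2 M (da (trunc M (dil (cq b e') (rn n))))).
    rewrite /p mulr_suml mulr_sumr; apply: eq_bigr => e _.
    by rewrite mulr_sumr mulr_sumr.
  rewrite (J_sum r01).
  (* 4 counts the coordinates of [b], and 16 G bounds the disc constant 4 G times the area
     [J 1 <= 4]. *)
  have -> : 64 * G * x ^+ 2 = 4 * (16 * G) * x ^+ 2 by ring.
  apply: (@le_trans _ _ (\sum_e 4 * (16 * G) * \sum_(k < M) cq f e k ^+ 2)); last first.
    rewrite -mulr_sumr; apply: ler_wpM2l; first by rewrite !mulr_ge0// ltW.
    rewrite exchange_big /=; apply: le_trans (hx M); rewrite le_eqVlt; apply/orP; left; apply/eqP.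
    by apply: eq_bigr => k _; rewrite normsqE.
  apply: ler_sum => e _; rewrite (J_sum r01).
  have -> : 4 * (16 * G) * \sum_(k < M) cq f e k ^+ 2 = \sum_(e' : 'I_4) 16 * G * \sum_(k < M) cq f e k ^+ 2.
    by rewrite sumr_const card_ord -[_ *+ 4]mulr_natl; ring.
  apply: ler_sum => e' _.
  have tr c k : (M <= k)%N -> trunc M c k = 0 :> R by move=> Mk; rewrite /trunc ltnNge Mk.
  apply: le_trans (@disc_carleson R M _ _ G (tr _) (tr _) G0 _) _.
    by move=> z hz; have [_ h] := hm n; exact: h.
  have -> : \sum_(k < M) trunc M (cq f e) k ^+ 2 = \sum_(k < M) cq f e k ^+ 2.
    by apply: eq_bigr => k _; rewrite /trunc ltn_ord.
  rewrite ler_wpM2r//; first by apply: sumr_ge0 => k _; exact: sqr_ge0.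
  have := J1_le r01; have := ltW G0; move: (Jd 1 1) => J ? ?; nra.
- move=> z hz; rewrite (_ : (fun n => _) = fun n => ev (wt 1) z * ((\sum_e ev (mod2 (m n).+1 (trunc (m n).+1 (cq f e))) z) *
    (\sum_e ev (mod2 (m n).+1 (da (trunc (m n).+1 (dil (cq b e) (rn n))))) z))); last first.
    by apply/funext => n; rewrite /p !evM !ev_sum.
  apply: cvgM; first exact: cvg_cst.
  apply: cvgM; apply: cvg_sumr => e _; first exact: mod2_trunc_cvg.
  rewrite (_ : cq (cderiv b) e = da (cq b e)); last exact: cseq_cderiv.
  by apply: mod2_dilate_cvg => // n; have /andP[h1 h2] := rn01 n; rewrite !ltW.
rewrite lee_fin /G; have p0 := @pi_ge0 R; have p4 := pi_le_four.
have p16 : pi ^+ 2 <= 16 by rewrite (_ : 16 = 4 ^+ 2 :> R) ?lerXn2r ?nnegrE//; ring.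
(* 40 = 18 + 4 + 7 + 11: besides the given 2^18, pi^2 <= 2^4, 2 * 64 = 2^7 and 40^2 = 1600 <=
   2^11. *)
have -> : 2 * pi ^+ 2 * (64 * (2 ^+ 18 * (40 * beta) ^+ 2) * x ^+ 2) = (pi ^+ 2 * (128 * 1600)) * (2 ^+ 18 * (beta ^+ 2 * x ^+ 2)) by ring.
have -> : 2 ^+ 40 * beta ^+ 2 * x ^+ 2 = 2 ^+ 22 * (2 ^+ 18 * (beta ^+ 2 * x ^+ 2)).
  by rewrite (_ : 40 = 22 + 18)%N// exprD; ring.
apply: ler_wpM2r; first by apply: mulr_ge0; [exact: exprn_ge0|apply: mulr_ge0; exact: sqr_ge0].
have h11 : 1600 <= 2 ^+ 11 :> R by rewrite -natrX ler_nat.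
have e7 : 128 = 2 ^+ 7 :> R by rewrite -natrX.
have q16 : pi ^+ 2 <= 2 ^+ 4 by apply: le_trans p16 _; rewrite -natrX; exact: lexx.
rewrite e7 (_ : 22 = 4 + (7 + 11))%N // exprD exprD.
apply: ler_pM; [exact: sqr_ge0|by apply: mulr_ge0; [exact: exprn_ge0|exact: ler0n]|exact: q16|].
by apply: ler_wpM2l; [exact: exprn_ge0|exact: h11].
Qed.
End CarlesonUpper.

(** * BMO against the Hankel form and the Carleson measure *)

Section BMOBounds.
Variable R : realType.
Local Notation mu := (@lebesgue_measure R).
Local Notation H := (quat R).
Local Notation pi := (@pi R).
Local Notation J := (bool * 'I_4)%type.
Implicit Types (b : nat -> H).

Lemma rs_cq b (N : R) n e : QB b N -> rs n (cq b e) <= N ^+ 2.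
Proof.
move=> hb; apply: le_trans (l2_coef_tail hb n); apply: ler_sum => k _.
by rewrite normsqE (bigD1 e)//= lerDl; apply: sumr_ge0 => i _; exact: sqr_ge0.
Qed.

(** 1152 = 64 * 18. The dilate oscillates by at most (4 pi + 1) M <= 17 M, and replacing it by the
    boundary function costs another M on the given interval. [N] only ensures square summability. *)
Lemma BMO_of_hankel b (N M : R) : regular b -> QB b N -> 0 < M -> (forall e, HB (seq_shift (cq b e)) M) ->
  (BMO_seminorm b <= (1152 * M)%:E)%E.
Proof.
move=> rb hN M0 hM; have reg e : rregular (cq b e) := regular_rregular e rb.
have hrs e n : rs n (cq b e) <= N ^+ 2 by exact: rs_cq.
have /choice[F hF] : forall j : J, exists f, bdry (wf j.1 (cq b j.2)) f.
  move=> j; have [g [h [hg hh hc]]] := factor_l2 (hrs j.2).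
  exact: boundary_exists (reg j.2) hg hh hc.
have hF' sb e : bdry (wf sb (cq b e)) (F (sb, e)) by exact: hF (sb, e).
rewrite /BMO_seminorm asboolT; last exact: H1_of_l2 hrs.
apply: ge_ereal_sup => _ [I hI <-].
have -> : 1152 * M = 64 * (18 * M) by ring.
apply: (BMO_slice_le reg hF' hI) => sb e s t st ts.
have [mf _ [rk [rk01 _ hf]]] := hF' sb e; have ts0 : 0 < t - s by rewrite subr_gt0.
have q01 : 0 <= (2^-1 : R) < 1 by rewrite invr_ge0 ler0n/= invf_lt1// ltr1n.
have Mt : 0 < M * (t - s) by rewrite mulr_gt0.
have [k _ hk] := @cvgr_le _ _ _ _ _ _ (geo0 2 q01) _ Mt.
have k1 : 2 * 2^-1 ^+ k <= M * (t - s) := hk k (leqnn k).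
have [c hc] := HB_osc (hM e) sb (rk01 k) M0 st ts; exists c.
have cw : continuous (wf sb (cq b e) (rk k)).
  by apply: wf_cont => //; have /andP[r0 r1] := rk01 k; rewrite (ltW r0).
have cwc : continuous (fun x => `|wf sb (cq b e) (rk k) x - c|) by apply: cont_norm; apply: contB => //; exact: contC.
apply: (@le_trans _ _ (\int[mu]_(x in `[s, t]) (`|wf sb (cq b e) (rk k) x - F (sb, e) x|%:E + `|wf sb (cq b e) (rk k) x - c|%:E))%E).
  apply: integral_mono; [by []|by move=> x _; rewrite lee_fin|by move=> x _; rewrite -EFinD lee_fin addr_ge0|move=> x _].
  rewrite -EFinD lee_fin; set W := wf _ _ _ _; set f := F _ _.
  have -> : f - c = (W - c) - (W - f) by ring.
  by apply: le_trans (ler_normB _ _) _; rewrite addrC.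
have mI : measurable (`[s, t]%classic : set R) by exact: measurable_itv.
rewrite ge0_integralD//; try (by apply/measurable_EFinP; exact: cont_meas);
  try (by apply/measurable_EFinP; apply: measurableT_comp => //; apply: measurable_funB; [exact: cont_meas|exact: measurable_funTS]).
have h1 : (\int[mu]_(x in `[s, t]) `|wf sb (cq b e) (rk k) x - F (sb, e) x|%:E <= (M * (t - s))%:E)%E.
  apply: (@le_trans _ _ (2 * 2^-1 ^+ k)%:E); last by rewrite lee_fin.
  apply: le_trans (hf k s); apply: integral_mono; [|by move=> x _; rewrite lee_fin|by move=> x _; rewrite lee_fin|by []].
  by move=> x /=; rewrite !in_itv /= => /andP[-> /le_trans ->].
have h2 : (\int[mu]_(x in `[s, t]) `|wf sb (cq b e) (rk k) x - c|%:E <= (17 * M * (t - s))%:E)%E.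
  rewrite rint_EFin// lee_fin; apply: le_trans hc _; rewrite ler_wpM2r ?(ltW ts0)//.
  by have := pi_le_four R; nra.
have -> : 18 * M * (t - s) = M * (t - s) + 17 * M * (t - s) by ring.
by rewrite EFinD; exact: leeD.
Qed.

(** Two opposite slices determine all components, with oscillation 8 beta; the dilates have 4 * 8
    beta = 16 (2 beta), and squaring the 2 raises 2^40 to 2^42. *)
Lemma carleson_of_BMO b (beta : R) : regular b -> 0 < beta -> (BMO_seminorm b <= beta%:E)%E ->
  carleson_bound (mu_density b) (2 ^+ 42 * beta ^+ 2).
Proof.
move=> rb b0; rewrite /BMO_seminorm; case: asboolP => // hH1 hB.
have reg e : rregular (cq b e) := regular_rregular e rb.
have /choice[F hF] : forall j : J, exists f, bdry (wf j.1 (cq b j.2)) f.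
  move=> j; have [g [h [B [hg hh hc]]]] := factor_of_H1 j.2 hH1.
  exact: boundary_exists (reg j.2) hg hh hc.
have hF' sb e : bdry (wf sb (cq b e)) (F (sb, e)) by exact: hF (sb, e).
pose I : H := qb R 1.
have hI : qsphere I by rewrite /qsphere /= expr2; apply: quat_eqP; apply: forall4; rewrite /qc /= ; ring.
have hI' : qsphere (- I) by rewrite /qsphere /= sqrrN.
have s1 : (BMO_slice b I <= beta%:E)%E by apply: le_trans hB; apply: ereal_sup_ubound; exists I.
have s2 : (BMO_slice b (- I)%R <= beta%:E)%E by apply: le_trans hB; apply: ereal_sup_ubound; exists (- I).
have osc := osc_of_BMO reg hF' hI s1 s2.
have -> : 2 ^+ 42 * beta ^+ 2 = 2 ^+ 40 * (2 * beta) ^+ 2.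
  by rewrite (_ : 42 = 40 + 2)%N// exprD; ring.
apply: carleson_of_osc => //; first by rewrite mulr_gt0.
move=> e r sb s t r01 st ts; have [mf _ [rk [rk01 rk1 hf]]] := hF' sb e.
have -> : 16 * (2 * beta) * (t - s) = 4 * (8 * beta) * (t - s) by ring.
have vc rho : 0 < rho < 1 -> continuous (wf sb (cq b e) rho).
  by move=> /andP[r0 r1]; apply: wf_cont => //; rewrite (ltW r0).
have vp rho x : 0 < rho < 1 -> wf sb (cq b e) rho (x + 2 * pi) = wf sb (cq b e) rho x by move=> _; exact: wf_period.
have vP rho r' phi : 0 < rho < 1 -> 0 < r' < 1 ->
  rint (- pi) pi (fun t => wf sb (cq b e) rho t * poisson r' (t - phi)) = 2 * pi * wf sb (cq b e) (r' * rho) phi by move=> *; exact: wf_poisson.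
have vu r' e' : 0 < r' < 1 -> 0 < e' ->
  \forall rho \near (1 : R)^'-, forall phi, `|wf sb (cq b e) (r' * rho) phi - wf sb (cq b e) r' phi| <= e' by exact: wf_uniform.
have fosc s' t' : s' < t' -> t' <= s' + 2 * pi -> exists c,
  (\int[mu]_(x in `[s', t']) `|F (sb, e) x - c|%:E <= (8 * beta * (t' - s'))%:E)%E by exact: osc.
by eapply osc_dilate; eassumption.
Qed.
End BMOBounds.

(** * Assembly of the equivalences and of the constants *)

Section Equivalences.
Variable R : realType.
Local Notation H := (quat R).
Local Notation pi := (@pi R).
Implicit Types (b : nat -> H) (x y : \bar R).

(** Reduces a comparison of extended norms to implications between real bounds. Only positive N are
    asked for, so a vanishing norm is reached by approximation from above. *)
Lemma le_of_real x y (C : R) : 0 < C -> (0 <= y)%E ->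
  (forall N : R, 0 < N -> (y <= N%:E)%E -> (x <= (C * N)%:E)%E) -> (x <= C%:E * y)%E.
Proof.
move=> C0; case: y => [r| |] //= y0 h; last by rewrite gt0_muley ?lte_fin// leey.
rewrite lee_fin in y0; rewrite -EFinM; apply/lee_addgt0Pr => e e0; rewrite -EFinD.
have eC : 0 < e / C by rewrite divr_gt0.
have -> : C * r + e = C * (r + e / C) by rewrite mulrDr mulrCA divff ?mulr1// gt_eqF.
by apply: h; [rewrite ltr_wpDl|rewrite lee_fin lerDl ltW].
Qed.

Lemma approx_of x y (C : R) : 0 < C -> (x <= C%:E * y)%E -> (y <= C%:E * x)%E -> approx_const C x y.
Proof. by move=> C0 h1 h2; split => //; rewrite lee_pdivrMl. Qed.

(** The constant function 1. It shows that the suprema defining the norms run over nonempty sets, so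
    they are nonnegative rather than -oo. *)
Definition unit_seq (n : nat) : H := if n is 0 then 1 else 0.

Lemma unit_seq_neq0 : unit_seq != (fun=> 0).
Proof. by apply/eqP => /(congr1 (@^~ 0%N)) /eqP; rewrite /unit_seq oner_eq0. Qed.

Lemma l2_unit_seq : l2 unit_seq.
Proof.
apply: (@l2_leP R unit_seq 1) => //; case=> [|n]; first by rewrite /sqs big_ord0 expr1n.
rewrite /sqs big_ord_recl big1 => [|i _]; last by rewrite /unit_seq /= normr0 expr0n.
by rewrite /unit_seq /= -[1 : H]scale1r norm_real normr1 addr0.
Qed.

Lemma star_unit_seq : star unit_seq unit_seq != (fun=> 0).
Proof.
apply/eqP => /(congr1 (@^~ 0%N)) /eqP.
by rewrite /star big_ord_recl big_ord0 /unit_seq /= mulr1 addr0 oner_eq0.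
Qed.

Lemma hankel_norm_ge0 (alpha : nat -> H) : (0 <= hankel_norm alpha)%E.
Proof.
apply: (@le_trans _ _ (hankel_image_norm alpha unit_seq / l2norm unit_seq)%E); last first.
  by apply: ereal_sup_ubound; exists unit_seq => //; split; [exact: l2_unit_seq|exact: unit_seq_neq0].
apply: mule_ge0; last by rewrite inve_ge0 l2norm_ge0.
by rewrite /hankel_image_norm; case: asboolP => _; [exact: l2norm_ge0|exact: leey].
Qed.

Lemma form_norm_ge0 b : (0 <= form_norm b)%E.
Proof.
have hd := H2_l2 l2_unit_seq; have nd := unit_seq_neq0.
apply: (@le_trans _ _ (Lambda_abs b (star unit_seq unit_seq) / (l2norm unit_seq * l2norm unit_seq))%E); last first.
  by apply: ereal_sup_ubound; exists unit_seq, unit_seq.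
apply: mule_ge0; first exact: Lambda_abs_ge0.
by rewrite inve_ge0 mule_ge0 ?l2norm_ge0.
Qed.

Lemma weak_dual_norm_ge0 b : (0 <= weak_dual_norm b)%E.
Proof.
have hd := H2_l2 l2_unit_seq; have [wp _] := weak_norm_star hd hd.
apply: (@le_trans _ _ (Lambda_abs b (star unit_seq unit_seq) / weak_norm (star unit_seq unit_seq))%E); last first.
  by apply: ereal_sup_ubound; exists (star unit_seq unit_seq) => //; split => //; exact: star_unit_seq.
by apply: mule_ge0; [exact: Lambda_abs_ge0|rewrite inve_ge0 weak_norm_ge0].
Qed.

Lemma BMO_seminorm_ge0 b : (0 <= BMO_seminorm b)%E.
Proof.
rewrite /BMO_seminorm; case: asboolP => _; last exact: leey.
pose I : H := qb R 1.
have hI : qsphere I by rewrite /qsphere /= expr2; apply: quat_eqP; apply: forall4; rewrite /qc /= ; ring.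
apply: (@le_trans _ _ (BMO_slice b I)); last by apply: ereal_sup_ubound; exists I.
have p0 := pi_ge2 R.
apply: (le_trans _ (ereal_sup_ubound _)); last by exists 0, 1; split => //; lra.
apply: mule_ge0; first by rewrite lee_fin invr_ge0 subr_ge0.
by apply: integral_ge0 => t _; rewrite lee_fin.
Qed.

Lemma carleson_const_ge0 w : (0 <= carleson_const w :> \bar R)%E.
Proof. by apply: le_ereal_inf_tmp => _ [K [K0 _] <-]; rewrite lee_fin. Qed.

Lemma carleson_HB b (K A : R) e : regular b -> 0 <= A -> 2 * K <= A ^+ 2 ->
  carleson_bound (mu_density b) K -> HB (seq_shift (cq b e)) (32 * A).
Proof.
move=> rb A0 KA hK; have p2 := pi_ge2 R.
have hA : Num.sqrt (2 * K / pi) <= A.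
  rewrite -[leRHS]ger0_norm// -sqrtr_sqr ler_wsqrtr//; apply: le_trans KA.
  have K0 : 0 <= K by case: hK.
  by rewrite ler_pdivrMr ?(lt_le_trans _ p2)// ler_peMr ?mulr_ge0//; lra.
split; first by rewrite mulr_ge0.
move=> n f g; apply: le_trans (carleson_hankel e n f g rb hK) _.
by rewrite ler_wpM2r ?mulr_ge0 ?sqrtr_ge0// ler_wpM2l.
Qed.

(** Origin of 2^35: the Carleson constant 2^42 N^2 gives the shifted form the bound 32 * 2^22 N =
    2^27 N; restoring the constant term gives N + 2^28 N <= 2^29 N, and the 64 triples of
    coordinates give 2^35 N. *)
Lemma QB_of_BMO b (N : R) : regular b -> 0 < N -> `|b 0%N| <= N -> (BMO_seminorm b <= N%:E)%E ->
  QB b (2 ^+ 35 * N).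
Proof.
move=> rb N0 b0 hN; have hK := carleson_of_BMO rb N0 hN.
have A0 : 0 <= 2 ^+ 22 * N by rewrite mulr_ge0 ?exprn_ge0// ltW.
have KA : 2 * (2 ^+ 42 * N ^+ 2) <= (2 ^+ 22 * N) ^+ 2.
  rewrite exprMn -exprM mulrA -exprS ler_wpM2r ?sqr_ge0// ler_weXn2l//; lra.
have hH e : HB (seq_shift (cq b e)) (32 * (2 ^+ 22 * N)) := carleson_HB e rb A0 KA hK.
have [q0 hq] := QB_of_shift hH; split; first by rewrite mulr_ge0 ?exprn_ge0// ltW.
move=> n f g; apply: le_trans (hq n f g) _; rewrite -[leLHS]mulrA -[leRHS]mulrA; apply: ler_wpM2r; first by rewrite mulr_ge0 ?sqrtr_ge0.
have -> : 2 ^+ 35 * N = 64 * (2 ^+ 29 * N) by rewrite (_ : 64 = 2 ^+ 6 :> R) ?mulrA -?exprD//; ring.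
have -> : 2 * (32 * (2 ^+ 22 * N)) = 2 ^+ 28 * N by rewrite (_ : 32 = 2 ^+ 5 :> R) ?mulrA -?exprD -?exprS//; ring.
rewrite ler_wpM2l//; have -> : 2 ^+ 29 * N = 2 ^+ 28 * N + 2 ^+ 28 * N by rewrite exprS; ring.
rewrite lerD2r; apply: le_trans b0 _; rewrite ler_peMl ?(ltW N0)// exprn_ege1//; lra.
Qed.

Lemma BMO_of_QB b (N : R) : regular b -> 0 < N -> QB b N -> (BMO_seminorm b <= (1152 * N)%:E)%E.
Proof. by move=> rb N0 hb; apply: (BMO_of_hankel rb hb N0) => e; apply: HB_shift; exact: QB_HB. Qed.

(** The product of all factors here is 1152 * 64, so the constant 2^35 imposed by the opposite chain
    of implications is ample. *)
Lemma BMO_of_carleson b (N : R) : regular b -> 0 < N -> carleson_bound (mu_density b) (2 * N ^+ 2) ->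
  (BMO_seminorm b <= (2 ^+ 35 * N)%:E)%E.
Proof.
move=> rb N0 hK; have A0 : 0 <= 2 * N by rewrite mulr_ge0// ltW.
have KA : 2 * (2 * N ^+ 2) <= (2 * N) ^+ 2 by rewrite le_eqVlt; apply/orP; left; apply/eqP; ring.
have hH e : HB (seq_shift (cq b e)) (32 * (2 * N)) := carleson_HB e rb A0 KA hK.
have M0 : 0 < 32 * (2 * N) by rewrite !mulr_gt0.
apply: le_trans (BMO_of_hankel rb (QB_of_shift hH) M0 hH) _; rewrite lee_fin.
have -> : 1152 * (32 * (2 * N)) = (1152 * 64) * N by ring.
rewrite ler_wpM2r ?(ltW N0)//.
have -> : 2 ^+ 35 = 2 ^+ 11 * (2 ^+ 6 * 2 ^+ 18) :> R by rewrite -!exprD.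
apply: ler_pM; [exact: ler0n|exact: ler0n|by rewrite -natrX ler_nat|].
have -> : 64 = 2 ^+ 6 :> R by rewrite -natrX.
by rewrite ler_peMr; [|exact: exprn_ge0|apply: exprn_ege1; rewrite ler1n].
Qed.

Lemma carleson_mono (w : H -> R) (K K' : R) : K <= K' -> carleson_bound w K -> carleson_bound w K'.
Proof.
move=> KK [K0 h]; split; first exact: le_trans KK.
move=> f hf; apply: le_trans (h f hf) _; apply: lee_wpmul2r; last by rewrite lee_fin.
by have [_ lf] := hf; have [x [x0 -> _]] := l2P lf; rewrite -EFin_expe lee_fin sqr_ge0.
Qed.

Lemma sqrte_le x (N : R) : 0 <= N -> (0 <= x)%E -> (sqrte x <= N%:E)%E = (x <= (N ^+ 2)%:E)%E.
Proof.
move=> N0; case: x => [r| |] //= x0; rewrite !lee_fin in x0 *.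
by rewrite -[in LHS](ger0_norm N0) -sqrtr_sqr ler_sqrt// sqr_ge0.
Qed.

Lemma fin_bound x : (0 <= x)%E -> (x < +oo)%E -> exists2 N : R, 0 < N & (x <= N%:E)%E.
Proof.
case: x => [r| |] //=; rewrite lee_fin => r0 _; exists (r + 1); first by rewrite ltr_wpDl.
by rewrite lee_fin lerDl.
Qed.

End Equivalences.

Theorem theorem1p1 (R : realType) :
  exists C : R, 0 < C /\
    forall alpha b : nat -> quat R,
      regular b -> (forall n, alpha n = qconj (b n)) ->
      [<-> (hankel_norm alpha < +oo)%E;
           (form_norm b < +oo)%E;
           (BMO_seminorm b < +oo)%E;
           carleson (mu_density b);
           Lambda_in_weak_dual b]
      /\
      [/\ hankel_norm alpha = form_norm b,
          approx_const C (form_norm b) (weak_dual_norm b),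
          (* BMO_seminorm b and carleson_const ignore the constant term of b *)
          approx_const C (weak_dual_norm b) (`|b 0%N|%:E + BMO_seminorm b)%E
        & approx_const C (BMO_seminorm b)
            (sqrte (carleson_const (mu_density b)))].
Proof.
have C0 : 0 < 2 ^+ 35 :> R by rewrite exprn_gt0.
have C1 : 1 <= 2 ^+ 35 :> R by rewrite exprn_ege1// ler1n.
exists (2 ^+ 35); split => // alpha b rb ab.
have {alpha ab}-> : alpha = fun n => qconj (b n) by apply/funext.
have form_of_QB (N : R) : QB b N -> (form_norm b <= N%:E)%E.
  by move=> h; have [N0 _] := h; apply: form_norm_le_weak => //; exact: weak_dual_le.
have QB_of_weak (N : R) : 0 <= N -> (weak_dual_norm b <= N%:E)%E -> QB b N.
  by move=> N0 h; apply: QB_of_form => //; exact: form_norm_le_weak.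
have le1 (x y : \bar R) : (x <= 1%:E * y)%E -> (x <= y)%E by rewrite mul1e.
have hform : hankel_norm (fun n => qconj (b n)) = form_norm b.
  apply/eqP; rewrite eq_le; apply/andP; split; apply: le1; apply: le_of_real => //.
  - exact: form_norm_ge0.
  - by move=> N N0 h; rewrite mul1r; apply: hankel_of_QB; apply: QB_of_form => //; exact: ltW.
  - exact: hankel_norm_ge0.
  - by move=> N N0 h; rewrite mul1r; apply: form_of_QB; apply: QB_of_hankel => //; exact: ltW.
have leC (x : \bar R) : (0 <= x)%E -> (x <= (2 ^+ 35)%:E * x)%E.
  by move=> x0; apply: lee_pemull => //; rewrite lee_fin.
(* Each side is at most a positive N exactly when [QB b N] holds, so the comparability with the weak
   dual norm is in fact an equality. *)
have hweak : form_norm b = weak_dual_norm b.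
  apply/eqP; rewrite eq_le; apply/andP; split; apply: le1; apply: le_of_real => //.
  - exact: weak_dual_norm_ge0.
  - by move=> N N0 h; rewrite mul1r; apply: form_of_QB; apply: QB_of_weak => //; exact: ltW.
  - exact: form_norm_ge0.
  - by move=> N N0 h; rewrite mul1r; apply: weak_dual_le; apply: QB_of_form => //; exact: ltW.
split; last split => //.
- tfae.
  + by rewrite hform.
  + move=> h; have [N N0 hN] := fin_bound (form_norm_ge0 b) h.
    apply: le_lt_trans (BMO_of_QB rb N0 _) (ltry _); apply: QB_of_form => //; exact: ltW.
  + move=> h; have [N N0 hN] := fin_bound (BMO_seminorm_ge0 b) h.
    by exists (2 ^+ 42 * N ^+ 2); exact: carleson_of_BMO.
  + move=> [K hK]; have K0 : 0 <= K by case: hK.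
    have KA : 2 * K <= (Num.sqrt (2 * K)) ^+ 2 by rewrite sqr_sqrtr// mulr_ge0.
    have hH e := carleson_HB e rb (sqrtr_ge0 _) KA hK.
    (* The form bound obtained here contains |b 0|, which is finite for the given [b] although [K]
       does not control it. *)
    exact: Lambda_in_weak_dual_of_QB (QB_of_shift hH).
  + move=> [_ _ _ h]; have [N N0 hN] := fin_bound (weak_dual_norm_ge0 b) h.
    apply: le_lt_trans (ltry N); apply: hankel_of_QB; apply: QB_of_weak => //; exact: ltW.
- by rewrite -hweak; apply: approx_of => //; apply: leC; exact: form_norm_ge0.
- have S0 : (0 <= `|b 0%N|%:E + BMO_seminorm b)%E by rewrite adde_ge0 ?lee_fin// BMO_seminorm_ge0.
  apply: approx_of => //; apply: le_of_real => //; last first.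
  + move=> N N0 h; have hb := QB_of_weak N (ltW N0) h.
    have h1 := QB_coef 0 hb; have h2 := BMO_of_QB rb N0 hb.
    apply: (@le_trans _ _ (N%:E + (1152 * N)%:E)%E); first by rewrite leeD// lee_fin.
    rewrite -EFinD lee_fin -[X in X + _]mul1r -mulrDl ler_wpM2r ?(ltW N0)//.
    have -> : 2 ^+ 35 = 2 ^+ 11 * 2 ^+ 24 :> R by rewrite -exprD.
    apply: (@le_trans _ _ (2 ^+ 11)); last by rewrite ler_peMr ?exprn_ge0// exprn_ege1// ler1n.
    by rewrite -(natrD _ 1 1152) -natrX ler_nat.
  + exact: weak_dual_norm_ge0.
  + move=> N N0 h; apply: weak_dual_le; apply: QB_of_BMO => //.
      by rewrite -lee_fin; apply: le_trans h; rewrite leeDl// BMO_seminorm_ge0.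
    by apply: le_trans h; rewrite leeDr// lee_fin.
- have cc0 := carleson_const_ge0 (mu_density b).
  apply: approx_of => //; apply: le_of_real => //.
  + exact: sqrte_ge0.
  + move=> N N0; rewrite sqrte_le ?(ltW N0)// => h; apply: BMO_of_carleson => //.
    have N2 : 0 < N ^+ 2 by rewrite exprn_gt0.
    (* The infimum defining [carleson_const] need not be attained; the factor 2 leaves room for an
       actual Carleson constant. *)
    have lt2 : (carleson_const (mu_density b) < (2 * N ^+ 2)%:E)%E.
      by apply: le_lt_trans h _; rewrite lte_fin ltr_pMl// ltr1n.
    have [_ [K hK <-] KN] := ereal_inf_lt lt2.
    by apply: carleson_mono hK; rewrite -lee_fin ltW.
  + exact: BMO_seminorm_ge0.
  + move=> N N0 h; rewrite sqrte_le ?mulr_ge0 ?(ltW N0) ?(ltW C0)//.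
    have hK := carleson_of_BMO rb N0 h.
    apply: (@le_trans _ _ (2 ^+ 42 * N ^+ 2)%:E); first by apply: ereal_inf_lbound; exists (2 ^+ 42 * N ^+ 2).
    rewrite lee_fin [leRHS]exprMn -exprM ler_wpM2r ?sqr_ge0// ler_weXn2l// ler1n//.
Qed.
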